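(* Let $S\in\Omega_p$ be a price path with market portfolio $\mu$, and fix $\alpha\in(0,1]$ and $K>0$. Let $m$ be a probability measure on $C^{2+\alpha,K}=C^{2+\alpha,K}(\overline{\Delta}^d_+;\mathbb{R}^d)$ with full support. Let $\nu$ be the pushforward of $m$ under $F\mapsto(\pi^F,\pi^{F,\prime})$, let $$\pi^\nu_t:=\frac{\int_{\mathcal{F}^{2+\alpha,K}}\pi_tV^\pi_t\,\mathrm{d}\nu(\pi)}{\int_{\mathcal{F}^{2+\alpha,K}}V^\pi_t\,\mathrm{d}\nu(\pi)},\quad t\in[0,\infty),\qquad V^{\ast,K,\alpha}_T:=\sup_{F\in C^{2+\alpha,K}}V^{\pi^F}_T .$$ (i) With $\xi_T:=\|\mu\|_{p,[0,T]}+\|A^\mu\|_{\frac p2,[0,T]}+\sum_{i=1}^d[\mu]^{ii}_T$, if $\lim_{T\to\infty}(1+\|\mu\|^2_{p,[0,T]})\xi_T=\infty$, then $$\lim_{T\to\infty}\frac{1}{(1+\|\mu\|^2_{p,[0,T]})\xi_T}\Big(\log V^{\ast,K,\alpha}_T-\log V^{\pi^\nu}_T\Big)=0.$$ (ii) With $\xi_{k,k+1}:=\|\mu\|_{p,[k,k+1]}+\|A^\mu\|_{\frac p2,[k,k+1]}+\sum_{i=1}^d[\mu]^{ii}_{k,k+1}$ for each integer $k\ge0$, if $\lim_{T\to\infty}\sum_{k=0}^{\lceil T\rceil-1}(1+\|\mu\|^2_{p,[k,k+1]})\xi_{k,k+1}=\infty$, then $$\lim_{T\to\infty}\frac{1}{\sum_{k=0}^{\lceil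 T\rceil-1}(1+\|\mu\|^2_{p,[k,k+1]})\xi_{k,k+1}}\Big(\log V^{\ast,K,\alpha}_T-\log V^{\pi^\nu}_T\Big)=0.$$
   Context: Parameters: $p\in(2,3)$, $q\ge p$, $r>1$ with $2/p+1/q>1$, $1/r=1/p+1/q$ (for the portfolios $\pi^F$ one may take $q=p$, $r=p/2$). Notation: $\Delta_{[0,T]}=\{(s,t)\in[0,T]^2:s\le t\}$; $S_{s,t}:=S_t-S_s$; for a path or two-parameter function $A$ and $a\ge1$, $\|A\|_{a,[s,t]}:=\sup_{\mathcal{P}}(\sum_{[u,v]\in\mathcal{P}}|A_{u,v}|^a)^{1/a}$ over finite partitions of $[s,t]$. A control function is $c\colon\Delta_{[0,T]}\to[0,\infty)$ with $c(s,u)+c(u,t)\le c(s,t)$. Convention $0/0:=0$. Products and quotients of vectors are componentwise; $F_sS_{s,t}$ inside integrals is the Euclidean inner product. $\mathbb{R}_+=(0,\infty)$; $\Delta^d=\{x\in\mathbb{R}^d:\sum_ix^i=1\}$; $\overline{\Delta}^d_+=\{x\in\Delta^d:x^i\ge0\ \forall i\}$. Property (RIE): $S\in C([0,T];\mathbb{R}^d)$ satisfies (RIE) with respect to $p$ and partitions $\mathcal{P}^n=\{0=t^n_0<\cdots<t^n_{N_n}=T\}$ with $|\mathcal{P}^n|\to0$ if, with $S^n_t:=S_T\mathbf{1}_{\{T\}}(t)+\sum_kS_{t^n_k}\mathbf{1}_{[t^n_k,t^n_{k+1})}(t)$, (1) $\int_0^tS^n_u\otimes\mathrm{d}S_u:=\sum_kS_{t^n_k}\otimes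 S_{t^n_k\wedge t,t^n_{k+1}\wedge t}$ converge uniformly in $t$ to a limit $\int_0^tS_u\otimes\mathrm{d}S_u$, and (2) there is a control function $c$ with $\sup_{(s,t)}\frac{|S_{s,t}|^p}{c(s,t)}+\sup_n\sup_{0\le k<\ell\le N_n}\frac{|\int_{t^n_k}^{t^n_\ell}S^n_u\otimes\mathrm{d}S_u-S_{t^n_k}\otimes S_{t^n_k,t^n_\ell}|^{p/2}}{c(t^n_k,t^n_\ell)}\le1$. The associated $p$-rough path is $\mathbf{S}=(S,\mathbb{S})$, $\mathbb{S}_{s,t}:=\int_s^tS_u\otimes\mathrm{d}S_u-S_s\otimes S_{s,t}$, with bracket $[\mathbf{S}]_t:=S_{0,t}\otimes S_{0,t}-2\,\mathrm{Sym}(\mathbb{S}_{0,t})$, of finite variation. Price paths: a partition of $[0,\infty)$ is a strictly increasing sequence $0=t_0<t_1<\dots\to\infty$; $\mathcal{P}([0,T]):=(\mathcal{P}\cup\{T\})\cap[0,T]$. $\Omega_p$ is the set of $S\in C([0,\infty);\mathbb{R}^d_+)$ for which there are partitions $(\mathcal{P}^n_S)_n$ of $[0,\infty)$ with vanishing mesh on compacts such that, for all $T>0$, $S|_{[0,T]}$ satisfies (RIE) with respect to $p$ and $(\mathcal{P}^n_S([0,T]))_n$. The market portfolio is $\mu^i:=S^i/(S^1+\cdots+S^d)$. Controlled paths: for $X$ continuous of finite $p$-variation, $(F,F')\in\mathcal{V}^q_X$ on $[0,T]$ if $F\colon[0,T]\to\mathbb{R}^d$, $F'\colon[0,T]\to\mathcal{L}(\mathbb{R}^d;\mathbb{R}^d)$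 are continuous, $\|F'\|_{q,[0,T]}<\infty$ and $R^F_{s,t}:=F_{s,t}-F'_sX_{s,t}$ has $\|R^F\|_{r,[0,T]}<\infty$. Smooth functions $f(X)$ are controlled with derivative $\mathrm{D}f(X)$; componentwise products are controlled with $((FG)')^{ij}=(F')^{ij}G^i+F^i(G')^{ij}$. A $\mu$-controlled path is also $S$-controlled. Integrals: $\int_0^tF_u\,\mathrm{d}\mathbf{S}_u:=\lim_{|\mathcal{P}|\to0}\sum_{[s,v]\in\mathcal{P}}(F_sS_{s,v}+\sum_{i,j}(F'_s)^{ij}\mathbb{S}^{ji}_{s,v})$; for real-valued $S$-controlled paths $f,g$ (derivatives $f',g'$ with values in $\mathcal{L}(\mathbb{R}^d;\mathbb{R})$), $\int f\,\mathrm{d}g:=\lim\sum(f_sg_{s,v}+\sum_{j,k}(f'_s)^j(g'_s)^k\mathbb{S}^{jk}_{s,v})$. Lift and bracket of $\mu$: $A^{\mu}_{s,t}:=\int_s^t\mu_u\otimes\mathrm{d}\mu_u-\mu_s\otimes\mu_{s,t}$ (integrals of $S$-controlled paths, componentwise), $[\mu]_t:=\mu_{0,t}\otimes\mu_{0,t}-2\,\mathrm{Sym}(A^\mu_{0,t})$, $[\mu]_{s,t}=[\mu]_t-[\mu]_s$. Wealth: a portfolio is an $S$-controlled path $\pi$ (on each $[0,T]$) with values in $\Delta^d$; its wealth is $W^\pi_t:=\exp\big(\int_0^t\frac{\pi_s}{S_s}\mathrm{d}\mathbf{S}_s-\frac12\sum_{i,j}\int_0^t\frac{\pi^i_s\pi^j_s}{S^i_sS^j_s}\mathrm{d}[\mathbf{S}]^{ij}_s\big)$,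 and its relative wealth is $V^\pi:=W^\pi/W^\mu$. Functionally controlled portfolios: $C^{2+\alpha,K}(\overline{\Delta}^d_+;\mathbb{R}^d):=\{F\in C^{2+\alpha}(\overline{\Delta}^d_+;\mathbb{R}^d):\|F\|_{C^{2+\alpha}}\le K\}$, where $C^{2+\alpha}$ denotes twice continuously differentiable functions (on the closed simplex: restrictions of such functions on $\mathbb{R}^d$) with $\alpha$-Hölder second derivative, $\|F\|_{C^2}:=\max_{0\le n\le2}\|\mathrm{D}^nF\|_\infty$ and $\|F\|_{C^{2+\alpha}}:=\|F\|_{C^2}+\|\mathrm{D}^2F\|_{\alpha\text{-Höl}}$; it is endowed with the $C^2$-distance, with respect to which it is compact. For such $F$, $(\pi^F_t)^i:=\mu^i_t\big(F^i(\mu_t)+1-\sum_{j=1}^d\mu^j_tF^j(\mu_t)\big)$, a $\mu$-controlled path with its natural Gubinelli derivative $\pi^{F,\prime}$ (derivative with respect to $\mu$), and $\mathcal{F}^{2+\alpha,K}:=\{(\pi^F,\pi^{F,\prime}):F\in C^{2+\alpha,K}\}$. *)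

(* Defs.v *)
From HB Require Import structures.
From mathcomp Require Import all_boot all_order all_algebra finmap.
From mathcomp Require Import all_classical all_reals all_analysis.

Set Implicit Arguments.
Unset Strict Implicit.
Unset Printing Implicit Defensive.
Import Order.TTheory GRing.Theory Num.Theory.
Import numFieldNormedType.Exports.
Local Open Scope classical_set_scope.
Local Open Scope ring_scope.

(* Vectors of R^d are row vectors.  A derivative of a path with values in R^n
   along a driver with values in R^d is an n x d matrix A acting by
   x |-> x *m A^T, and x ⊗ y is x^T *m y.  Paths are total functions of a real
   time, of which only the restriction to [0, +oo) matters. *)

Section Norms.
Context {R : realType}.

Definition l2 {I : finType} (u : I -> R) : R := Num.sqrt (\sum_i u i ^+ 2).

(* Euclidean norm of vectors, Frobenius norm of matrices; the instance norm
   `| _ | of the library on matrices is the maximum norm. *)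
Definition enorm {m n : nat} (A : 'M[R]_(m, n)) : R :=
  l2 (fun ij : 'I_m * 'I_n => A ij.1 ij.2).

Definition tensor {m n : nat} (x : 'rV[R]_m) (y : 'rV[R]_n) : 'M[R]_(m, n) :=
  x^T *m y.

Definition sym {n : nat} (A : 'M[R]_n) : 'M[R]_n := 2^-1 *: (A + A^T).

End Norms.

Section Partitions.
Context {R : realType}.

(* As in [itv_partition a b s], a partition a < s_0 < ... < s_(n-1) = b is the
   list s of its points other than a; the trivial interval has the empty list. *)

Definition psum {V : zmodType} (a : R) (s : seq R) (A : R -> R -> V) : V :=
  \sum_(k < size s) A (nth 0 (a :: s) k) (nth 0 s k).

Definition mesh (a : R) (s : seq R) : R :=
  \big[Num.max/0]_(k < size s) (nth 0 s k - nth 0 (a :: s) k).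

(* The filter "|P| -> 0" on the partitions P of [a, b]. *)
Definition mesh_to0 (a b : R) : set_system (seq R) :=
  filter_from [set delta : R | 0 < delta]
    (fun delta => [set s | itv_partition a b s /\ mesh a s < delta]).

Definition mesh_lim (a b : R) (A : R -> R -> R) : R :=
  lim (psum a s A @[s --> mesh_to0 a b]).

Definition incr {V : zmodType} (X : R -> V) (s t : R) : V := X t - X s.

(* The (possibly infinite) seminorm ‖A‖_{a,[s,t]}. *)
Definition pvar {m n : nat} (a : R) (A : R -> R -> 'M[R]_(m, n)) (s t : R)
    : \bar R :=
  ereal_sup [set (psum s P (fun u v => enorm (A u v) `^ a) `^ a^-1)%:E
            | P in itv_partition s t].

Definition control (T : R) (c : R -> R -> R) : Prop :=
  (forall s t, 0 <= s <= t -> t <= T -> 0 <= c s t) /\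
  (forall s u t, 0 <= s <= u -> u <= t <= T -> c s u + c u t <= c s t).

Definition time_partition (u : nat -> R) : Prop :=
  [/\ u 0%N = 0,
      {homo u : k l / (k < l)%N >-> k < l} &
      u k @[k --> \oo] --> +oo].

(* (P ∪ {T}) ∩ [0, T], without the point 0. *)
Definition restrict_partition (u : nat -> R) (T : R) : seq R :=
  sort <=%R (fset_set ((range u `|` [set T]) `&` `]0, T]%classic)).

End Partitions.

Section RoughPaths.
Context {R : realType} {d : nat}.
Implicit Types (S : R -> 'rV[R]_d) (P : nat -> nat -> R).

(* ∫_0^t S^n ⊗ dS, for S^n the discretisation of S along 0 :: s. *)
Definition disc_int S (s : seq R) (t : R) : 'M[R]_d :=
  psum 0 s (fun u v =>
    tensor (S u) (S (Num.min v t) - S (Num.min u t))).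

(* In \bar R, 0 / 0 = 0 and x / 0 = +oo for x > 0. *)
Definition quotient0 (x c : R) : \bar R := (x%:E / c%:E)%E.

Definition RIE_path (p T : R) S (c : R -> R -> R) : \bar R :=
  ereal_sup [set quotient0 (enorm (incr S st.1 st.2) `^ p) (c st.1 st.2)
            | st in [set st : R * R | 0 <= st.1 <= st.2 /\ st.2 <= T]].

Definition RIE_area (p : R) S (P : nat -> seq R) (c : R -> R -> R) : \bar R :=
  ereal_sup [set x | exists n k l : nat,
    let t := nth 0 (0 :: P n) in
    (k < l <= size (P n))%N /\
    x = quotient0 (enorm (incr (disc_int S (P n)) (t k) (t l)
                          - tensor (S (t k)) (incr S (t k) (t l))) `^ (p / 2))
                  (c (t k) (t l))].

Definition RIE (p T : R) S (P : nat -> seq R) : Prop :=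
  [/\ {within `[0, T], continuous S},
      (forall n, itv_partition 0 T (P n)),
      mesh 0 (P n) @[n --> \oo] --> 0,
      (exists I : R -> 'M[R]_d,
         {uniform `[0, T], (fun n => disc_int S (P n)) @ \oo --> I}) &
      exists2 c : R -> R -> R, control T c &
        (RIE_path p T S c + RIE_area p S P c <= 1)%E].

(* S belongs to Omega_p, as witnessed by the sequence of partitions P. *)
Definition price_path (p : R) S P : Prop :=
  [/\ {within `[0, +oo[, continuous S},
      (forall t i, 0 <= t -> 0 < S t 0 i),
      (forall n, time_partition (P n)) &
      forall T, 0 < T -> RIE p T S (fun n => restrict_partition (P n) T)].

(* The discrete integrals up to time t do not depend on the horizon T >= t of
   the partitions, so that T = t is taken. *)
Definition ito_int S P (t : R) : 'M[R]_d :=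
  lim (disc_int S (restrict_partition (P n) t) t @[n --> \oo]).

Definition lift S P (s t : R) : 'M[R]_d :=
  incr (ito_int S P) s t - tensor (S s) (incr S s t).

Definition bracket (X : R -> 'rV[R]_d) (A : R -> R -> 'M[R]_d) (t : R)
    : 'M[R]_d :=
  tensor (incr X 0 t) (incr X 0 t) - 2 *: sym (A 0 t).

End RoughPaths.

(* A path with values in R^n together with its Gubinelli derivative with
   respect to a driver with values in R^d. *)
Definition cpath (R : realType) (d n : nat) : Type :=
  ((R -> 'rV[R]_n) * (R -> 'M[R]_(n, d)))%type.

Section ControlledPaths.
Context {R : realType} {d : nat}.

Definition remainder {n : nat} (X : R -> 'rV[R]_d) (F : cpath R d n)
    (s t : R) : 'rV[R]_n :=
  incr F.1 s t - incr X s t *m (F.2 s)^T.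

Definition controlled {n : nat} (q r T : R) (X : R -> 'rV[R]_d)
    (F : cpath R d n) : Prop :=
  [/\ {within `[0, T], continuous F.1},
      {within `[0, T], continuous F.2},
      (pvar q (incr F.2) 0 T < +oo)%E &
      (pvar r (remainder X F) 0 T < +oo)%E].

Definition basis (j : 'I_d) : 'rV[R]_d := delta_mx 0 j.

(* (D f x)_ij = d f^i / d x^j; note that 'J of the library is its transpose. *)
Definition D {n : nat} (f : 'rV[R]_d -> 'rV[R]_n) (x : 'rV[R]_d)
    : 'M[R]_(n, d) :=
  \matrix_(i, j) ('D_(basis j) f x) 0 i.

Definition csmooth {n : nat} (f : 'rV[R]_d -> 'rV[R]_n)
    (X : R -> 'rV[R]_d) : cpath R d n :=
  (fun t => f (X t), fun t => D f (X t)).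

Definition cmul {n : nat} (F G : cpath R d n) : cpath R d n :=
  (fun t => \row_i (F.1 t 0 i * G.1 t 0 i),
   fun t => \matrix_(i, j) (F.2 t i j * G.1 t 0 i + F.1 t 0 i * G.2 t i j)).

Definition ccoord {n : nat} (i : 'I_n) (F : cpath R d n) : cpath R d 1 :=
  (fun t => col i (F.1 t), fun t => row i (F.2 t)).

Section Integrals.
Variables (S : R -> 'rV[R]_d) (P : nat -> nat -> R).

Definition rough_int (F : cpath R d d) (s t : R) : R :=
  mesh_lim s t (fun u v =>
    \sum_i F.1 u 0 i * incr S u v 0 i
    + \sum_i \sum_j F.2 u i j * lift S P u v j i).

Definition ctrl_int (f g : cpath R d 1) (s t : R) : R :=
  mesh_lim s t (fun u v =>
    f.1 u 0 0 * incr g.1 u v 0 0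
    + \sum_j \sum_k f.2 u 0 j * g.2 u 0 k * lift S P u v j k).

End Integrals.

(* Riemann-Stieltjes integral ∫_s^t f dg. *)
Definition RS_int (f g : R -> R) (s t : R) : R :=
  mesh_lim s t (fun u v => f u * incr g u v).

End ControlledPaths.

Section Market.
Context {R : realType} {d : nat}.
Variables (S : R -> 'rV[R]_d) (P : nat -> nat -> R).

Definition normalize (x : 'rV[R]_d) : 'rV[R]_d := (\sum_i x 0 i)^-1 *: x.

Definition mu (t : R) : 'rV[R]_d := normalize (S t).

(* A mu-controlled path, seen as an S-controlled path. *)
Definition to_S {n : nat} (F : cpath R d n) : cpath R d n :=
  (F.1, fun t => F.2 t *m D normalize (S t)).

Definition cmu : cpath R d d := csmooth normalize S.

Definition Amu (s t : R) : 'M[R]_d :=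
  \matrix_(i, j) ctrl_int S P (ccoord i cmu) (ccoord j cmu) s t
  - tensor (mu s) (incr mu s t).

Definition mu_bracket (t : R) : 'M[R]_d := bracket mu Amu t.

Definition mu_norm (p s t : R) : R := fine (pvar p (incr mu) s t).

Definition xi (p s t : R) : R :=
  mu_norm p s t + fine (pvar (p / 2) Amu s t)
  + \sum_i incr mu_bracket s t i i.

Definition portfolio (q r : R) (pi : cpath R d d) : Prop :=
  (forall T, 0 < T -> controlled q r T S pi) /\
  (forall t, 0 <= t -> \sum_i pi.1 t 0 i = 1).

Definition wealth (pi : cpath R d d) (t : R) : R :=
  expR (rough_int S P (cmul pi (csmooth (map_mx GRing.inv) S)) 0 t
        - 2^-1 * \sum_i \sum_j
            RS_int (fun s => pi.1 s 0 i * pi.1 s 0 j / (S s 0 i * S s 0 j))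
                   (fun s => bracket S (lift S P) s i j) 0 t).

Definition rel_wealth (pi : cpath R d d) (t : R) : R :=
  wealth pi t / wealth cmu t.

(* The Gubinelli derivative of V^pi with respect to S: as V^pi is the
   exponential of ∫ (pi/S - mu/S) dS plus a path of finite variation, it is
   V^pi (pi/S - mu/S). *)
Definition rel_wealth' (pi : cpath R d d) (t : R) : 'rV[R]_d :=
  \row_j (rel_wealth pi t * ((pi.1 t 0 j - mu t 0 j) / S t 0 j)).

End Market.

Section FunctionSpaces.
Context {R : realType} {d : nat}.
Implicit Type F : 'rV[R]_d -> 'rV[R]_d.

Definition simplex : set 'rV[R]_d :=
  [set x | (forall i, 0 <= x 0 i) /\ \sum_i x 0 i = 1].

Definition C2 F : Prop :=
  (forall x, differentiable F x) /\
  (forall v, (forall x, differentiable ('D_v F) x) /\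
     forall w, continuous ('D_w ('D_v F))).

Definition D2 F (x : 'rV[R]_d) (ijk : 'I_d * 'I_d * 'I_d) : R :=
  ('D_(basis ijk.2) ('D_(basis ijk.1.2) F) x) 0 ijk.1.1.

Definition sup_simplex (f : 'rV[R]_d -> R) : \bar R :=
  ereal_sup [set (f x)%:E | x in simplex].

Definition C2_norm F : \bar R :=
  maxe (sup_simplex (fun x => enorm (F x)))
    (maxe (sup_simplex (fun x => enorm (D F x)))
          (sup_simplex (fun x => l2 (D2 F x)))).

(* The pairs x = y contribute 0 / 0 = 0. *)
Definition D2_holder (alpha : R) F : \bar R :=
  ereal_sup [set (l2 (D2 F xy.1 \- D2 F xy.2) / enorm (xy.1 - xy.2) `^ alpha)%:E
            | xy in simplex `*` simplex].

Definition C2a_norm (alpha : R) F : \bar R :=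
  (C2_norm F + D2_holder alpha F)%E.

(* A function of C^{2+alpha} on the closed simplex is represented by an
   extension to R^d.  The norms only see F, D F and D^2 F on the simplex, so
   that extensions which agree there to second order are at C^2-distance 0, and
   hence are not separated by the Borel sets below. *)
Definition C2a_ball (alpha : R) (K : {posnum R})
    : set ('rV[R]_d -> 'rV[R]_d) :=
  [set F | C2 F /\ (C2a_norm alpha F <= K%:num%:E)%E].

Lemma derive_0 (v x : 'rV[R]_d) :
  'D_v (cst 0 : 'rV[R]_d -> 'rV[R]_d) x = 0.
Proof. exact: derive_cst. Qed.

Lemma C2a_ball0 alpha K : C2a_ball alpha K (cst 0).
Proof.
have D0 v : 'D_v (cst 0 : 'rV[R]_d -> 'rV[R]_d) = cst 0.
  by apply/funext => x; exact: derive_0.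
have l20 (I : finType) : l2 (fun _ : I => (0 : R)) = 0.
  by rewrite /l2 big1 ?sqrtr0// => i _; rewrite expr0n.
have sup0 (f : 'rV[R]_d -> R) : (forall x, f x = 0) -> (sup_simplex f <= 0)%E.
  by move=> f0; apply: ge_ereal_sup => _ [x _ <-]; rewrite f0.
split.
  split=> [x|v]; first exact: differentiable_cst.
  rewrite D0; split=> [x|w]; first exact: differentiable_cst.
  by rewrite D0; exact: cst_continuous.
have D20 x ijk : D2 (cst 0) x ijk = 0.
  by rewrite /D2 D0 derive_0 mxE.
apply: (@le_trans _ _ (0 + 0)%E); last first.
  by rewrite adde0 lee_fin.
apply: leeD.
  rewrite /C2_norm !ge_max; apply/and3P; split; apply: sup0 => x.
  - rewrite /enorm -[RHS](l20 ('I_1 * 'I_d)%type); congr l2.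
    by apply/funext => ij; rewrite mxE.
  - rewrite /enorm -[RHS](l20 ('I_d * 'I_d)%type); congr l2.
    by apply/funext => ij; rewrite mxE derive_0 mxE.
  - by rewrite -[RHS](l20 ('I_d * 'I_d * 'I_d)%type); congr l2; apply/funext.
apply: ge_ereal_sup => _ [xy _ <-].
rewrite (_ : D2 _ _ \- _ = fun=> 0) ?l20 ?mul0r//.
by apply/funext => ijk /=; rewrite !D20 subrr.
Qed.

Definition C2aK (alpha : R) (K : {posnum R}) : Type :=
  set_type (C2a_ball alpha K).

HB.instance Definition _ alpha K := Choice.on (C2aK alpha K).
HB.instance Definition _ alpha K := isPointed.Build (C2aK alpha K)
  (SigSub (mem_set (C2a_ball0 alpha K))).

Definition C2_open (alpha : R) (K : {posnum R}) : set (set (C2aK alpha K)) :=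
  [set U | forall F : C2aK alpha K, U F -> exists2 e : R, 0 < e &
     forall G : C2aK alpha K, (C2_norm (\val F \- \val G)%R < e%:E)%E -> U G].

Definition C2aK_borel (alpha : R) (K : {posnum R}) :=
  g_sigma_algebraType (@C2_open alpha K).

HB.instance Definition _ alpha K := Measurable.on (C2aK_borel alpha K).

Definition full_support (alpha : R) (K : {posnum R})
    (m : set (C2aK_borel alpha K) -> \bar R) : Prop :=
  forall U, @C2_open alpha K U -> U !=set0 -> (0 < m U)%E.

End FunctionSpaces.
Arguments C2aK_borel {R} d alpha K.

Section ControlledPortfolios.
Context {R : realType} {d : nat}.
Variables (S : R -> 'rV[R]_d) (P : nat -> nat -> R).

Definition portfolio_map (F : 'rV[R]_d -> 'rV[R]_d) (x : 'rV[R]_d)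
    : 'rV[R]_d :=
  \row_i (x 0 i * (F x 0 i + 1 - \sum_j x 0 j * F x 0 j)).

Variables (alpha : R) (K : {posnum R}).

(* (pi^F, pi^F'), with the derivative taken with respect to mu. *)
Definition piF (F : C2aK_borel d alpha K) : cpath R d d :=
  csmooth (portfolio_map (\val F)) (mu S).

(* The portfolios F^{2+alpha,K}, in the type of all paths endowed with the
   largest sigma-algebra for which F |-> (pi^F, pi^F') is measurable. *)
Definition portfolios : Type :=
  g_sigma_algebraType (image_set_system setT piF measurable).

HB.instance Definition _ := Measurable.on portfolios.

Definition calF : set portfolios := range piF.

Variable m : probability (C2aK_borel d alpha K) R.

Definition nu : set portfolios -> \bar R :=
  pushforward m (piF : C2aK_borel d alpha K -> portfolios).

Definition nu_int (f : portfolios -> R) : R :=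
  fine (\int[nu]_(pi in calF) (f pi)%:E).

Definition V (pi : portfolios) : R -> R := rel_wealth S P (to_S S pi).

Definition V' (pi : portfolios) : R -> 'rV[R]_d := rel_wealth' S P (to_S S pi).

Definition pinu_num (t : R) : 'rV[R]_d :=
  \row_i nu_int (fun pi => pi.1 t 0 i * V pi t).

Definition pinu_den (t : R) : R := nu_int (fun pi => V pi t).

Definition pinu_num' (t : R) : 'M[R]_d :=
  \matrix_(i, j) nu_int (fun pi =>
    (to_S S pi).2 t i j * V pi t + pi.1 t 0 i * V' pi t 0 j).

Definition pinu_den' (t : R) : 'rV[R]_d :=
  \row_j nu_int (fun pi => V' pi t 0 j).

(* pi^nu as an S-controlled path: its derivative is given by the product rule
   under the integrals and the quotient rule. *)
Definition pinu : cpath R d d :=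
  (fun t => (pinu_den t)^-1 *: pinu_num t,
   fun t => (pinu_den t)^-1 *: pinu_num' t
            - (pinu_den t ^+ 2)^-1 *: tensor (pinu_num t) (pinu_den' t)).

Definition Vstar (t : R) : R :=
  sup (range (fun F : C2aK_borel d alpha K => V (piF F) t)).

End ControlledPortfolios.

(* Main.v *)
Require Import Defs.
From mathcomp Require Import all_boot all_order all_algebra finmap.
From mathcomp Require Import all_classical all_reals all_analysis.
From mathcomp Require Import measurable_realfun ring lra.

(** Write V^F for the relative wealth of the portfolio generated by F.  The proof
    is the argument of Cover for universal portfolios, and rests on three facts.

    The wealth of the mixed portfolio is the average of the wealths that it
    mixes, V^nu = int V^F dm ([rel_wealth_pinu]).  The logarithm of V^F is
    Lipschitz in F for the C2-distance, with a constant of the order of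
    (1 + |mu|_p^2) xi ([log_difference]).  Balls of radius e in the Hölder ball
    have masses bounded below by some k_e > 0, because the Hölder ball is
    totally bounded and m has full support ([ball_mass]).  Keeping in the
    average only the ball around a nearly optimal F gives
    0 <= log V^* - log V^nu <= C e (1 + |mu|_p^2) xi - log k_e
    ([regret_bounds]); one divides by the rate, lets T tend to infinity and then
    e to 0 ([sublinear_limit]).  Over unit intervals the Lipschitz estimates are
    added up.

    All the wealths are computed from local increments, up to errors [err] that
    add up to zero over fine partitions; by sewing, two paths with the same
    local increments up to such errors have the same increments.  In the
    numeraire of the whole market, a portfolio that is generated at each time by
    a field phi with derivative Psi along mu has a logarithmic relative wealth
    with local increments
    phi . mu_{s,t} + Psi : A_{s,t} - 1/2 (phi phi) : [mu]_{s,t},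
    where A is the lift of mu ([ito_local], which reduces to the algebraic
    [ito_identity]).  Exponentiating removes the bracket, so that the increments
    of V^F are V^F (F . mu_{s,t} + (D F + F F) : A_{s,t}), linear in quantities
    that can be averaged over F ([VF_expand], [Z_expand]).  Dividing by the
    average wealth and taking the logarithm again gives the increments of the
    portfolio that is generated by the wealth-weighted average of F, with the
    wealth-weighted average of D F + F F, minus the product of the averages, as
    its derivative ([log_Z_expand]).  This portfolio is pi^nu
    ([generated_pinu]).

    For the Lipschitz estimate, the logarithms of V^F and V^G differ by a rough
    integral of F - G along mu, which is bounded by a Young estimate for the
    variations of mu and of A ([two_control_bound]), and by a bracket integral,
    which is bounded by the trace of [mu] because the bracket is positive
    ([mu_br_ge0]).  That positivity comes from property (RIE): between points
    of a partition, the bracket of the prices is a limit of discrete quadratic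
    variations ([area_approx]). *)

Set Implicit Arguments.
Unset Strict Implicit.
Unset Printing Implicit Defensive.
Import Order.TTheory GRing.Theory Num.Theory.
Import numFieldNormedType.Exports.
Local Open Scope classical_set_scope.
Local Open Scope ring_scope.

(** * Partition sums and Young's maximal inequality *)

Section PartitionSums.
Context {R : realType}.
Implicit Types (a b x : R) (s : seq R).

Lemma psum_nil {V : zmodType} a (A : R -> R -> V) : psum a [::] A = 0.
Proof. by rewrite /psum big_ord0. Qed.

Lemma psum_cons {V : zmodType} a x s (A : R -> R -> V) :
  psum a (x :: s) A = A a x + psum x s A.
Proof. by rewrite /psum big_ord_recl. Qed.

Lemma psum_cat {V : zmodType} a s1 s2 (A : R -> R -> V) :
  psum a (s1 ++ s2) A = psum a s1 A + psum (last a s1) s2 A.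
Proof.
elim: s1 a => [|x s1 IH] a /=; first by rewrite psum_nil add0r.
by rewrite !psum_cons IH addrA.
Qed.

Lemma psumD {V : zmodType} a s (A B : R -> R -> V) :
  psum a s (fun u v => A u v + B u v) = psum a s A + psum a s B.
Proof. exact: big_split. Qed.

Lemma psumN {V : zmodType} a s (A : R -> R -> V) :
  psum a s (fun u v => - A u v) = - psum a s A.
Proof. by rewrite /psum sumrN. Qed.

Lemma psumZ a s (k : R) (A : R -> R -> R) :
  psum a s (fun u v => k * A u v) = k * psum a s A.
Proof. by rewrite /psum mulr_sumr. Qed.

Lemma psum_sum {I : finType} a s (A : I -> R -> R -> R) :
  psum a s (fun u v => \sum_i A i u v) = \sum_i psum a s (A i).
Proof. exact: exchange_big. Qed.

Lemma psum_incr {V : zmodType} a s (X : R -> V) :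
  psum a s (incr X) = X (last a s) - X a.
Proof.
elim: s a => [|x s IH] a /=; first by rewrite psum_nil subrr.
by rewrite psum_cons IH /incr addrC addrA subrK.
Qed.

Lemma mesh_nil a : mesh a [::] = 0.
Proof. by rewrite /mesh big_ord0. Qed.

Lemma mesh_cons a x s : mesh a (x :: s) = Num.max (x - a) (mesh x s).
Proof. by rewrite /mesh big_ord_recl. Qed.

Lemma mesh_ge0 a s : 0 <= mesh a s.
Proof.
elim: s a => [|x s IH] a; first by rewrite mesh_nil.
by rewrite mesh_cons le_max IH orbT.
Qed.

Lemma mesh_cat a s1 s2 :
  mesh a (s1 ++ s2) = Num.max (mesh a s1) (mesh (last a s1) s2).
Proof.
elim: s1 a => [|x s1 IH] a /=.
  by rewrite mesh_nil; apply/esym/max_idPr/mesh_ge0.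
by rewrite !mesh_cons IH maxA.
Qed.

Lemma itv_partition_consP a b x s :
  itv_partition a b (x :: s) <-> a < x /\ itv_partition x b s.
Proof.
rewrite /itv_partition /=; split.
  by move=> [/andP[ax ps] lb].
by move=> [ax [ps lb]]; rewrite ax.
Qed.

Lemma itv_partition_catP a b s1 s2 :
  itv_partition a b (s1 ++ s2) <->
  itv_partition a (last a s1) s1 /\ itv_partition (last a s1) b s2.
Proof.
rewrite /itv_partition cat_path last_cat eqxx; split.
  by move=> [/andP[p1 p2] l].
by move=> [[p1 _] [p2 l]]; rewrite p1.
Qed.

Lemma psum_le a b s (A B : R -> R -> R) : itv_partition a b s ->
  (forall u v, a <= u -> u < v -> v <= b -> v - u <= mesh a s ->
     A u v <= B u v) ->
  psum a s A <= psum a s B.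
Proof.
elim: s a => [|x s IH] a; first by rewrite !psum_nil.
move=> /itv_partition_consP[ax ps] H; rewrite !psum_cons lerD//.
  apply: H => //; first exact: itv_partition_le ps.
  by rewrite mesh_cons le_max lexx.
apply: IH => // u v xu uv vb m; apply: H => //; first exact: le_trans (ltW ax) xu.
by rewrite mesh_cons le_max m orbT.
Qed.

Lemma eq_psum {V : zmodType} a b s (A B : R -> R -> V) : itv_partition a b s ->
  (forall u v, a <= u -> u < v -> v <= b -> A u v = B u v) ->
  psum a s A = psum a s B.
Proof.
elim: s a => [|x s IH] a; first by rewrite !psum_nil.
move=> /itv_partition_consP[ax ps] H; rewrite !psum_cons; congr (_ + _).
  by apply: H => //; exact: itv_partition_le ps.
apply: IH => // u v xu uv vb; apply: H => //; exact: le_trans (ltW ax) xu.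
Qed.

Lemma norm_psum_le a b s (A B : R -> R -> R) : itv_partition a b s ->
  (forall u v, a <= u -> u < v -> v <= b -> `|A u v| <= B u v) ->
  `|psum a s A| <= psum a s B.
Proof.
move=> ps H; apply: (le_trans (ler_norm_sum _ _ _)).
by apply: (psum_le (A := fun u v => `|A u v|) ps) => u v au uv vb _; exact: H.
Qed.

Lemma psum_ge0 a b s (A : R -> R -> R) : itv_partition a b s ->
  (forall u v, a <= u -> u < v -> v <= b -> 0 <= A u v) ->
  0 <= psum a s A.
Proof.
move=> ps H; have := @psum_le a b s (fun _ _ => 0) A ps.
rewrite /psum sumr_const mul0rn; apply => u v *; exact: H.
Qed.

Lemma partition_exists a b (delta : R) : a <= b -> 0 < delta ->
  exists s, itv_partition a b s /\ mesh a s < delta.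
Proof.
move=> ab d0; have [n hn] : exists n : nat, b - a <= n%:R * (delta / 2).
  exists (Num.bound ((b - a) / (delta / 2))).
  rewrite -ler_pdivrMr ?divr_gt0//; apply/ltW/archi_boundP.
  by rewrite divr_ge0 ?subr_ge0// ltW// divr_gt0.
elim: n a ab hn => [|n IH] a ab.
  rewrite mul0r subr_le0 => ba; have -> : a = b by apply/le_anti; rewrite ab ba.
  by exists [::]; split; [split => /=|rewrite mesh_nil].
move=> hn; have [ba|ba] := leP (b - a) (delta / 2).
  move: ab; rewrite le_eqVlt => /predU1P[->|ab].
    by exists [::]; split; [split => /=|rewrite mesh_nil].
  exists [:: b]; split; first exact: itv_partition1.
  by rewrite mesh_cons mesh_nil gt_max d0 andbT; lra.
have [||s [ps ms]] := IH (a + delta / 2); first by lra.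
  by move: hn; rewrite -natr1; lra.
exists (a + delta / 2 :: s); split.
  by apply/itv_partition_consP; split => //; lra.
by rewrite mesh_cons gt_max ms andbT; lra.
Qed.

Lemma mesh_to0_filter a b : a <= b -> ProperFilter (mesh_to0 a b).
Proof.
move=> ab; apply: filter_from_proper; last first.
  by move=> e /= e0; have [s [ps ms]] := partition_exists ab e0; exists s.
apply: filter_from_filter; first by exists 1; rewrite /= ltr01.
move=> e f /= e0 f0; exists (Num.min e f); first by rewrite /= lt_min e0.
by move=> s /= [ps]; rewrite lt_min => /andP[]; split.
Qed.

Lemma mesh_to0_cvg a b (A : R -> R -> R) (l : R) : a <= b ->
  (forall e, 0 < e -> exists2 delta, 0 < delta & forall s,
     itv_partition a b s -> mesh a s < delta -> `|l - psum a s A| <= e) ->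
  psum a s A @[s --> mesh_to0 a b] --> l.
Proof.
move=> /mesh_to0_filter FF H; apply/cvgrPdist_le => e e0; have [delta d0 Hd] := H _ e0.
by exists delta => //= s [ps ms]; exact: Hd.
Qed.

End PartitionSums.

Section Controls.
Context {R : realType}.
Variables (T : R) (c : R -> R -> R).
Hypothesis hc : control T c.

Lemma control_ge0 s t : 0 <= s -> s <= t -> t <= T -> 0 <= c s t.
Proof. by move=> s0 st tT; apply: (proj1 hc) => //; rewrite s0. Qed.

Lemma control_add s u t : 0 <= s -> s <= u -> u <= t -> t <= T ->
  c s u + c u t <= c s t.
Proof. by move=> s0 su ut tT; apply: (proj2 hc); rewrite ?s0 ?ut. Qed.

Lemma control_xx s : 0 <= s -> s <= T -> c s s = 0.
Proof.
move=> s0 sT; have := control_add s0 (lexx s) (lexx s) sT.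
have := control_ge0 s0 (lexx s) sT; lra.
Qed.

Lemma control_mono s u v t : 0 <= s -> s <= u -> u <= v -> v <= t -> t <= T ->
  c u v <= c s t.
Proof.
move=> s0 su uv vt tT.
have u0 := le_trans s0 su; have vT := le_trans vt tT.
have h1 := control_add s0 su (le_trans uv vt) tT.
have h2 := control_add u0 uv vt tT.
have h3 := control_ge0 s0 su (le_trans uv vT).
have h4 := control_ge0 (le_trans u0 uv) vt tT.
lra.
Qed.

Lemma control_psum a b s : 0 <= a -> b <= T -> itv_partition a b s ->
  psum a s c <= c a b.
Proof.
move=> a0 bT; elim: s a a0 => [|x s IH] a a0.
  move=> ps; rewrite psum_nil; apply: control_ge0 => //.
  exact: itv_partition_le ps.
move=> /itv_partition_consP[ax ps]; rewrite psum_cons.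
have x0 := le_trans a0 (ltW ax).
have := IH _ x0 ps; have := control_add a0 (ltW ax) (itv_partition_le ps) bT.
lra.
Qed.

Variable theta : R.
Hypothesis theta1 : 1 < theta.

Let half : R := 2^-1 `^ theta.

Lemma young_half : 0 < half < 2^-1.
Proof.
rewrite /half powR_gt0 ?invr_gt0//=.
rewrite -mulr_powRB1 ?invr_ge0//; last by move: theta1; lra.
rewrite gtr_pMr ?invr_gt0//.
have := @gt0_ltr_powR R (theta - 1) _ 2^-1 1; rewrite powR1; apply.
- by rewrite subr_gt0.
- by rewrite nnegrE invr_ge0.
- by rewrite nnegrE.
- lra.
Qed.

(** The solution of the recursion [young_cstE] in the proof of [young_bound]: 2
    removals for the interval at the cut, and the two sides. *)
Definition young_cst : R := 2 / (1 - 2 * half).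

Lemma young_cstE : young_cst = 2 + 2 * half * young_cst.
Proof.
have /andP[h0 h1] := young_half; rewrite /young_cst; field.
by rewrite gt_eqF//; lra.
Qed.

Lemma young_cst_ge0 : 0 <= young_cst.
Proof. by have /andP[h0 h1] := young_half; rewrite divr_ge0//; lra. Qed.

(** [x] is the first point beyond which the control is at most half of the total;
    beyond the preceding point it is more than half, which by superadditivity
    leaves at most half before that point. *)
Lemma control_split a b s (h := c a b / 2) : 0 <= a -> b <= T ->
  itv_partition a b s -> s != [::] ->
  exists s1 x s2, [/\ s = s1 ++ x :: s2, c a (last a s1) <= h & c x b <= h].
Proof.
move=> a0 bT ps s0.
have ab : a <= b := itv_partition_le ps.
suff H : forall s' y, a <= y -> c a y <= h -> itv_partition y b s' -> s' != [::] ->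
    exists s1 x s2, [/\ s' = s1 ++ x :: s2, c a (last y s1) <= h & c x b <= h].
  apply: (H s a) => //; rewrite control_xx ?(le_trans ab)//.
  by rewrite /h divr_ge0// control_ge0.
elim=> [//|x s' IH] y ay cy /itv_partition_consP[yx ps'] _.
have [cx|cx] := leP (c x b) h; first by exists [::], x, s'.
have ax : a <= x := le_trans ay (ltW yx).
have cax : c a x <= h.
  have := control_add a0 ax (itv_partition_le ps') bT; move: cx; rewrite /h; lra.
case: s' ps' IH => [|z s'] ps' IH.
  move: cx; rewrite (itv_partition_nil ps') control_xx ?(le_trans a0)//.
  by rewrite ltNge /h divr_ge0// control_ge0.
have [//|s1 [w [s2 [-> h1 h2]]]] := IH _ ax cax ps'.
by exists (x :: s1), w, s2.
Qed.

(** Young's maximal inequality.  Removing all the points of a partition costs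
    at most [young_cst * c a b `^ theta]: cut as in [control_split], and note
    that the costs of the two sides add up to the fraction [2 * half < 1] of
    the total. *)
Lemma young_bound (Xi : R -> R -> R) (M : R) a b s : 0 <= M ->
  0 <= a -> b <= T ->
  (forall u v w, a <= u -> u <= v -> v <= w -> w <= b ->
     `|Xi u w - Xi u v - Xi v w| <= M * c u w `^ theta) ->
  itv_partition a b s -> s != [::] ->
  `|psum a s Xi - Xi a b| <= M * young_cst * c a b `^ theta.
Proof.
move=> M0 a0 bT; have [n] := ubnP (size s).
elim: n a b s a0 bT => // n IH a b s a0 bT; rewrite ltnS => sn H ps s0.
have ab : a <= b := itv_partition_le ps.
have [s1 [x [s2 [E h1 h2]]]] := control_split a0 bT ps s0.
set y := last a s1 in h1.
move: ps; rewrite E => /itv_partition_catP[p1 /itv_partition_consP[yx p2]].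
have ay : a <= y := itv_partition_le p1.
have xb : x <= b := itv_partition_le p2.
have ax := le_trans ay (ltW yx); have yb := le_trans (ltW yx) xb.
have y0 := le_trans a0 ay; have x0 := le_trans a0 ax.
set W := c a b `^ theta.
have th0 : 0 <= theta by move: theta1; lra.
have K0 := young_cst_ge0.
have B0 : 0 <= M * young_cst * (half * W).
  by apply: mulr_ge0; apply: mulr_ge0 => //; exact: powR_ge0.
have cab := control_ge0 a0 ab bT.
have cay := control_ge0 a0 ay (le_trans yb bT).
have cxb := control_ge0 x0 xb bT.
have halfW z : 0 <= z -> z <= c a b / 2 -> z `^ theta <= half * W.
  move=> z0 zh; rewrite mulrC /half /W -powRM//.
  by apply: ge0_ler_powR => //; rewrite nnegrE//; apply: le_trans zh.
have Wmon u w : a <= u -> u <= w -> w <= b -> c u w `^ theta <= W.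
  move=> au uw wb; apply: ge0_ler_powR => //; rewrite ?nnegrE//.
    by apply: control_ge0 => //; lra.
  exact: control_mono.
have diag u : a <= u -> u <= b -> Xi u u = 0.
  move=> au ub; have := H u u u au (lexx _) (lexx _) ub.
  rewrite control_xx; [|lra|lra].
  rewrite powR0 ?gt_eqF//; last by move: theta1; lra.
  by rewrite mulr0 subrr sub0r normrN normr_le0 => /eqP.
have e1 : `|psum a s1 Xi - Xi a y| <= M * young_cst * (half * W).
  have [s10|s10] := eqVneq s1 [::].
    by rewrite {1}s10 psum_nil /y s10 /= diag // subrr normr0.
  apply: (@le_trans _ _ (M * young_cst * c a y `^ theta)); last first.
    by apply: ler_wpM2l; [exact: mulr_ge0|exact: halfW].
  apply: IH => //.
  - exact: le_trans bT.
  - by rewrite E size_cat /= in sn; apply: leq_trans sn; rewrite addnS ltnS leq_addr.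
  - by move=> u v w au uv vw wy; apply: H => //; exact: le_trans yb.
have e2 : `|psum x s2 Xi - Xi x b| <= M * young_cst * (half * W).
  have [s20|s20] := eqVneq s2 [::].
    move: p2; rewrite s20 => /itv_partition_nil <-.
    by rewrite psum_nil diag // subrr normr0.
  apply: (@le_trans _ _ (M * young_cst * c x b `^ theta)); last first.
    by apply: ler_wpM2l; [exact: mulr_ge0|exact: halfW].
  apply: IH => //.
    by rewrite E size_cat /= in sn; apply: leq_trans sn; rewrite addnS ltnS leq_addl.
  by move=> u v w xu uv vw wb; apply: H => //; exact: le_trans xu.
have e3 : `|Xi a b - Xi a y - Xi y b| <= M * W.
  apply: le_trans (H _ _ _ _ _ _ _) _ => //.
have e4 : `|Xi y b - Xi y x - Xi x b| <= M * W.
  apply: le_trans (H _ _ _ _ _ _ _) _ => //; first exact: ltW.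
  by rewrite ler_wpM2l// Wmon.
have -> : M * young_cst * W = M * W + M * W + M * young_cst * (half * W)
    + M * young_cst * (half * W).
  by rewrite {1}young_cstE; ring.
rewrite psum_cat psum_cons -/y.
have -> : psum a s1 Xi + (Xi y x + psum x s2 Xi) - Xi a b =
  - (Xi a b - Xi a y - Xi y b) - (Xi y b - Xi y x - Xi x b)
  + (psum a s1 Xi - Xi a y) + (psum x s2 Xi - Xi x b) by ring.
apply: le_trans (ler_normD _ _) _; apply: lerD => //.
apply: le_trans (ler_normD _ _) _; apply: lerD => //.
apply: le_trans (ler_normB _ _) _; apply: lerD => //.
by rewrite normrN.
Qed.

End Controls.

(** * Sewing *)

Section Refinements.
Context {R : realType}.
Implicit Types (a b x : R) (s r : seq R).

Lemma mem_itv_partition a b s x : itv_partition a b s -> x \in s -> a < x <= b.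
Proof.
elim: s a => // y s IH a /itv_partition_consP[ay ps].
rewrite inE => /predU1P[->|/(IH _ ps)/andP[yx ->]].
  by rewrite ay (itv_partition_le ps).
by rewrite (lt_trans ay).
Qed.

Lemma common_refinement a b s t : itv_partition a b s -> itv_partition a b t ->
  exists r, [/\ itv_partition a b r, {subset s <= r} & {subset t <= r}].
Proof.
move=> ps pt; have [ab|ab] := eqVneq a b.
  move: ps pt; rewrite ab => /itv_partitionxx-> /itv_partitionxx->.
  by exists [::].
have bs : b \in s.
  case: s ps => [/itv_partition_nil/eqP|x s [_ /= /eqP <-]]; last exact: mem_last.
  by rewrite (negbTE ab).
pose r := sort <=%R (undup (s ++ t)).
have mr x : (x \in r) = (x \in s) || (x \in t).
  by rewrite mem_sort mem_undup mem_cat.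
have rlt : path <%R a r.
  rewrite lt_path_sortedE lt_sorted_uniq_le sort_uniq undup_uniq/=.
  rewrite (sort_sorted le_total)//= andbT; apply/allP => x; rewrite mr.
  by move=> /orP[/(mem_itv_partition ps)|/(mem_itv_partition pt)] /andP[].
have pr : itv_partition a (last a r) r by split => /=.
exists r; split; last 2 first.
- by move=> x xs; rewrite mr xs.
- by move=> x xs; rewrite mr xs orbT.
split => //; rewrite eq_le; apply/andP; split; last first.
  by have /(mem_itv_partition pr)/andP[] : b \in r by rewrite mr bs.
have : last a r \in a :: r by exact: mem_last.
rewrite inE => /predU1P[->|]; first exact: itv_partition_le ps.
by rewrite mr => /orP[/(mem_itv_partition ps)|/(mem_itv_partition pt)] /andP[].
Qed.

Lemma mesh_limP a b (A : R -> R -> R) (l : R) : a <= b ->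
  psum a s A @[s --> mesh_to0 a b] --> l ->
  forall e, 0 < e -> exists2 delta, 0 < delta & forall s,
     itv_partition a b s -> mesh a s < delta -> `|l - psum a s A| <= e.
Proof.
move=> /mesh_to0_filter FF /cvgrPdist_le H e e0.
by have [delta d0 Hd] := H _ e0; exists delta => // s ps ms; exact: Hd.
Qed.

Lemma mesh_limE a b (A : R -> R -> R) (l : R) : a <= b ->
  psum a s A @[s --> mesh_to0 a b] --> l -> mesh_lim a b A = l.
Proof. by move=> /mesh_to0_filter FF /cvg_lim; exact. Qed.

Lemma mesh_lim_le a b (A : R -> R -> R) (l B : R) : a <= b ->
  psum a s A @[s --> mesh_to0 a b] --> l ->
  (forall s, itv_partition a b s -> `|psum a s A| <= B) -> `|l| <= B.
Proof.
move=> ab cA H; apply/ler_addgt0Pr => e e0.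
have [delta d0 Hd] := mesh_limP ab cA e0.
have [s [ps ms]] := partition_exists ab d0.
have := Hd _ ps ms; have := H _ ps.
have := ler_normD (l - psum a s A) (psum a s A); rewrite subrK; lra.
Qed.

(** Concatenated partitions of the two halves are fine partitions of the whole. *)
Lemma mesh_lim_add a u b (A : R -> R -> R) (l1 l2 l : R) : a <= u -> u <= b ->
  psum a s A @[s --> mesh_to0 a u] --> l1 ->
  psum u s A @[s --> mesh_to0 u b] --> l2 ->
  psum a s A @[s --> mesh_to0 a b] --> l -> l = l1 + l2.
Proof.
move=> au ub c1 c2 c3; apply/eqP; rewrite -subr_eq0 -normr_le0.
apply/ler_addgt0Pr => e e0; rewrite add0r.
have e3 : 0 < e / 3 by rewrite divr_gt0.
have [d1 d10 H1] := mesh_limP au c1 e3.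
have [d2 d20 H2] := mesh_limP ub c2 e3.
have [d3 d30 H3] := mesh_limP (le_trans au ub) c3 e3.
have m1 : 0 < Num.min d1 d3 by rewrite lt_min d10.
have m2 : 0 < Num.min d2 d3 by rewrite lt_min d20.
have [s1 [p1]] := partition_exists au m1; rewrite lt_min => /andP[s11 s13].
have [s2 [p2]] := partition_exists ub m2; rewrite lt_min => /andP[s22 s23].
have l1E : last a s1 = u by case: p1 => _ /eqP.
have := H1 _ p1 s11; have := H2 _ p2 s22.
have := H3 _ (itv_partition_cat p1 p2); rewrite mesh_cat gt_max l1E s13 s23.
move=> /(_ isT); rewrite psum_cat l1E.
set P1 := psum _ _ _; set P2 := psum _ _ _ => h3 h2 h1.
have -> : l - (l1 + l2) = (l - (P1 + P2)) - (l1 - P1) - (l2 - P2) by ring.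
have := ler_normB (l - (P1 + P2) - (l1 - P1)) (l2 - P2).
have := ler_normB (l - (P1 + P2)) (l1 - P1); lra.
Qed.

End Refinements.

Section Sewing.
Context {R : realType}.

(** What the sewing lemma asks of an error term: errors of this size can be
    added up over the removal of all the points of a partition, and over all
    the intervals of a fine partition. *)
Definition sewing_error (T : R) (e : R -> R -> R) : Prop :=
  [/\ forall s t, 0 <= s -> s <= t -> t <= T -> 0 <= e s t,
      exists2 C, 0 <= C & forall (Xi : R -> R -> R) M a b s, 0 <= M ->
        0 <= a -> b <= T ->
        (forall u v w, a <= u -> u <= v -> v <= w -> w <= b ->
           `|Xi u w - Xi u v - Xi v w| <= M * e u w) ->
        itv_partition a b s -> s != [::] ->
        `|psum a s Xi - Xi a b| <= M * C * e a b &
      forall k, 0 < k -> exists2 delta, 0 < delta & forall a b s,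
        0 <= a -> b <= T -> itv_partition a b s -> mesh a s < delta ->
        psum a s e <= k].

Variables (T : R) (e : R -> R -> R).
Hypothesis he : sewing_error T e.

(** The increments of [L] telescope, and the errors add up to little over fine
    partitions. *)
Lemma approx_cvg (L : R -> R) (Xi : R -> R -> R) M : 0 <= M ->
  (forall s t, 0 <= s -> s <= t -> t <= T ->
     `|L t - L s - Xi s t| <= M * e s t) ->
  forall a b, 0 <= a -> a <= b -> b <= T ->
  psum a s Xi @[s --> mesh_to0 a b] --> L b - L a.
Proof.
move=> M0 H a b a0 ab bT; apply: mesh_to0_cvg => // k k0.
have [_ _ hv] := he.
have M1 : 0 < M + 1 by lra.
have [delta d0 Hd] := hv (k / (M + 1)) (divr_gt0 k0 M1).
exists delta => // s ps ms.
have lE : last a s = b by case: ps => _ /eqP.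
rewrite -{1}lE -psum_incr -psumN -psumD.
apply: le_trans (norm_psum_le (B := fun u v => M * e u v) ps _) _.
  by move=> u v au uv vb; apply: H; rewrite ?(ltW uv)//; lra.
rewrite psumZ; have h := Hd _ _ _ a0 bT ps ms.
apply: le_trans (ler_wpM2l M0 h) _.
by rewrite mulrA ler_pdivrMr// mulrC ler_wpM2l ?ltW//; lra.
Qed.

(** Refining a partition replaces each of its intervals by a partition of that
    interval, so that the costs of the removals add up along the coarse one. *)
Lemma refinement_bound (C : R) (Xi : R -> R -> R) a b s r :
  0 <= a -> b <= T ->
  (forall u v s, a <= u -> u < v -> v <= b ->
     itv_partition u v s -> s != [::] -> `|psum u s Xi - Xi u v| <= C * e u v) ->
  itv_partition a b s -> itv_partition a b r -> {subset s <= r} ->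
  `|psum a r Xi - psum a s Xi| <= C * psum a s e.
Proof.
move=> a0 bT; elim: s a r a0 => [|x s IH] a r a0 H.
  move=> /itv_partition_nil <- /itv_partitionxx-> _.
  by rewrite !psum_nil subrr normr0 mulr0.
move=> /itv_partition_consP[ax ps] pr sr.
have xr : x \in r by apply: sr; rewrite mem_head.
move: pr sr; case/splitPr: xr => r1 r2; rewrite -cat_rcons.
move=> /itv_partition_catP[]; rewrite !last_rcons => p1 p2 sr.
have xb : x <= b := itv_partition_le ps.
have h1 : `|psum a (rcons r1 x) Xi - Xi a x| <= C * e a x.
  by apply: H => //; rewrite -size_eq0 size_rcons.
have h2 : `|psum x r2 Xi - psum x s Xi| <= C * psum x s e.
  apply: IH => //; first exact: le_trans a0 (ltW ax).
    by move=> u v t xu; apply: H; exact: le_trans (ltW ax) xu.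
  move=> y ys; have := sr y; rewrite inE ys orbT mem_cat => /(_ isT).
  case/orP => // yr1; have /andP[_ yx] := mem_itv_partition p1 yr1.
  by have := mem_itv_partition ps ys; rewrite ltNge yx.
rewrite psum_cat !psum_cons last_rcons mulrDr.
apply: le_trans (lerD h1 h2); apply: le_trans (ler_normD _ _).
by rewrite le_eqVlt; apply/orP; left; apply/eqP; congr `|_|; ring.
Qed.

(** Sums over two fine partitions are compared through a common refinement by
    [refinement_bound], which makes them Cauchy. *)
Lemma sewing : exists2 C, 0 <= C & forall (Xi : R -> R -> R) M, 0 <= M ->
  (forall s u t, 0 <= s -> s <= u -> u <= t -> t <= T ->
     `|Xi s t - Xi s u - Xi u t| <= M * e s t) ->
  forall a b, 0 <= a -> a <= b -> b <= T ->
  [/\ psum a s Xi @[s --> mesh_to0 a b] --> mesh_lim a b Xi,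
      forall u, a <= u -> u <= b ->
        mesh_lim a b Xi = mesh_lim a u Xi + mesh_lim u b Xi &
      `|mesh_lim a b Xi - Xi a b| <= C * M * e a b].
Proof.
have [e0 [C C0 hC] hv] := he.
exists (C + 1) => [|Xi M M0 H]; first by rewrite addr_ge0.
have CM0 : 0 <= M * C by rewrite mulr_ge0.
have cv a b : 0 <= a -> a <= b -> b <= T ->
    psum a s Xi @[s --> mesh_to0 a b] --> mesh_lim a b Xi.
  move=> a0 ab bT; have FF := mesh_to0_filter ab.
  have ref s r : itv_partition a b s -> itv_partition a b r ->
      {subset s <= r} -> `|psum a r Xi - psum a s Xi| <= M * C * psum a s e.
    move=> ps pr; apply: (refinement_bound a0 bT _ ps pr).
    move=> u v t au uv vb pt t0; apply: hC => //.
    - exact: le_trans au.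
    - exact: le_trans bT.
    - move=> u' v' w' uu' u'v' v'w' w'v; apply: H => //.
        exact: le_trans a0 (le_trans au uu').
      exact: le_trans w'v (le_trans vb bT).
  apply: (@cauchy_cvg R^o).
  apply: cauchy_exP => eps eps0.
  have M1 : 0 < 2 * (M * C) + 1 by lra.
  have [delta d0 Hd] := hv (eps / (2 * (M * C) + 1)) (divr_gt0 eps0 M1).
  have [s [ps ms]] := partition_exists ab d0.
  exists (psum a s Xi); exists delta => //= t [pt mt].
  have [r [pr sr tr]] := common_refinement ps pt.
  have h1 := ref _ _ ps pr sr; have h2 := ref _ _ pt pr tr.
  have h3 := ler_wpM2l CM0 (Hd _ _ _ a0 bT ps ms).
  have h4 := ler_wpM2l CM0 (Hd _ _ _ a0 bT pt mt).
  have h5 : M * C * (eps / (2 * (M * C) + 1)) * 2 < eps.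
    have q0 : 0 < eps / (2 * (M * C) + 1) by rewrite divr_gt0.
    by rewrite -[ltRHS](divfK (lt0r_neq0 M1)); lra.
  rewrite /ball /= /ball_ /=.
  have -> : psum a s Xi - psum a t Xi = (psum a r Xi - psum a t Xi)
     - (psum a r Xi - psum a s Xi) by ring.
  have := ler_normB (psum a r Xi - psum a t Xi) (psum a r Xi - psum a s Xi).
  lra.
move=> a b a0 ab bT; split; first exact: cv.
  move=> u au ub; apply: (mesh_lim_add au ub); apply: cv => //.
  - exact: le_trans bT.
  - exact: le_trans au.
have [ab'|nab] := eqVneq a b.
  have -> : mesh_lim a b Xi = 0.
    apply: mesh_limE => //; apply: mesh_to0_cvg => // k k0; exists 1 => // s.
    by rewrite ab' => /itv_partitionxx-> _; rewrite psum_nil subrr normr0 ltW.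
  have := H a a a a0 (lexx _) (lexx _); rewrite ab' subrr sub0r => /(_ bT).
  move=> /le_trans; apply; apply: ler_wpM2r; first exact: e0 (le_trans a0 ab) _ _.
  by rewrite mulrDl mul1r lerDr mulrC.
have ebd : 0 <= e a b by exact: e0.
have h s : itv_partition a b s -> `|psum a s Xi - Xi a b| <= M * C * e a b.
  move=> ps; apply: hC => //.
    move=> u v w au uv vw wb; apply: H => //; [exact: le_trans au|exact: le_trans bT].
  by apply/eqP => s0; move: ps; rewrite s0 => /itv_partition_nil/eqP; rewrite (negbTE nab).
apply: (@le_trans _ _ (M * C * e a b)); last first.
  by rewrite ler_wpM2r// mulrDl mul1r [C * M]mulrC lerDl.
apply/ler_addgt0Pr => k k0.
have [delta d0 Hd] := mesh_limP ab (cv _ _ a0 ab bT) k0.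
have [s [ps ms]] := partition_exists ab d0.
have := Hd _ ps ms; have := h _ ps.
have := ler_normD (mesh_lim a b Xi - psum a s Xi) (psum a s Xi - Xi a b).
have -> : mesh_lim a b Xi - psum a s Xi + (psum a s Xi - Xi a b)
  = mesh_lim a b Xi - Xi a b by ring.
lra.
Qed.

End Sewing.

Section ErrorTerm.
Context {R : realType}.
Variables (T p : R) (c eta : R -> R -> R).
Hypothesis hc : control T c.
Hypothesis hp : 2 < p < 3.
Let hp2 : 2 < p. Proof. by case/andP: hp. Qed.
Let hp3 : p < 3. Proof. by case/andP: hp. Qed.

Definition tau (s t : R) : R := c s t `^ p^-1.

(** The control may jump, so that smallness over short intervals has to be
    carried by a separate quantity. *)
Definition modulus : Prop :=
  [/\ forall s t, 0 <= s -> s <= t -> t <= T -> 0 <= eta s t <= tau s t,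
      forall s u v t, 0 <= s -> s <= u -> u <= v -> v <= t -> t <= T ->
        eta u v <= eta s t &
      forall k, 0 < k -> exists2 delta, 0 < delta & forall s t,
        0 <= s -> s <= t -> t <= T -> t - s < delta -> eta s t <= k].

Hypothesis heta : modulus.

(** Errors of order three have size [tau ^+ 3].  As the control need not be
    continuous, a small power of the modulus is kept, so that the errors add up
    to little over fine partitions; [2^-1 * (3 - p)] leaves [c] with an exponent
    larger than 1. *)
Definition err (s t : R) : R :=
  eta s t `^ ((3 - p) / 2) * c s t `^ ((3 + p) / (2 * p)).

Lemma err_theta : 1 < (3 + p) / (2 * p).
Proof. by rewrite ltr_pdivlMr; (move: hp2 hp3; lra). Qed.

Lemma tau_ge0 s t : 0 <= tau s t.
Proof. exact: powR_ge0. Qed.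

Lemma err_ge0 s t : 0 <= err s t.
Proof. by rewrite mulr_ge0// powR_ge0. Qed.

Lemma tau_powE s t : 0 <= s -> s <= t -> t <= T ->
  c s t `^ ((3 + p) / (2 * p)) = tau s t `^ ((3 + p) / 2).
Proof.
by move=> *; rewrite /tau -powRrM; congr (_ `^ _); field; rewrite gt_eqF//; (move: hp2 hp3; lra).
Qed.

Lemma eta_tau2_err s t : 0 <= s -> s <= t -> t <= T ->
  tau s t ^+ 2 * eta s t <= err s t.
Proof.
move=> s0 st tT; have [h1 _ _] := heta; have /andP[g0 gt] := h1 _ _ s0 st tT.
rewrite /err tau_powE//; move: g0; rewrite le_eqVlt => /predU1P[<-|g0].
  by rewrite mulr0 mulr_ge0// powR_ge0.
have t0 : 0 < tau s t := lt_le_trans g0 gt.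
have eE : eta s t = eta s t `^ ((3 - p) / 2) * eta s t `^ ((p - 1) / 2).
  rewrite -powRD ?(gt_eqF g0) ?implybT//.
  by rewrite (_ : _ + _ = 1) ?powRr1 ?ltW//; lra.
have tE : tau s t `^ ((3 + p) / 2) = tau s t ^+ 2 * tau s t `^ ((p - 1) / 2).
  rewrite -(powR_mulrn 2 (ltW t0)) -powRD ?(gt_eqF t0) ?implybT//.
  by congr (_ `^ _); lra.
rewrite {1}eE tE mulrCA !ler_wpM2l ?powR_ge0 ?sqr_ge0//.
apply: ge0_ler_powR; rewrite ?nnegrE ?(ltW g0) ?(ltW t0)//; (move: hp2; lra).
Qed.

Lemma err_tau3 s t : 0 <= s -> s <= t -> t <= T -> err s t <= tau s t ^+ 3.
Proof.
move=> s0 st tT; have [h1 _ _] := heta; have /andP[g0 gt] := h1 _ _ s0 st tT.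
have tE : tau s t ^+ 3 = tau s t `^ ((3 - p) / 2) * tau s t `^ ((3 + p) / 2).
  rewrite -(powR_mulrn 3 (tau_ge0 _ _)) -powRD.
    by congr (_ `^ _); lra.
  by apply/implyP => /eqP; lra.
rewrite /err tau_powE// tE.
rewrite ler_wpM2r ?powR_ge0//; apply: ge0_ler_powR; rewrite ?nnegrE ?tau_ge0//; (move: hp2 hp3; lra).
Qed.

Lemma err_sewing : sewing_error T err.
Proof.
have [h1 h2 h3] := heta; have th1 := err_theta.
split => [s t *||k k0]; first exact: err_ge0.
  exists (young_cst ((3 + p) / (2 * p))) => [|Xi M a b s M0 a0 bT H ps s0].
    exact: young_cst_ge0.
  have ab := itv_partition_le ps.
  have -> : M * young_cst ((3 + p) / (2 * p)) * err a b =
      M * eta a b `^ ((3 - p) / 2) * young_cst ((3 + p) / (2 * p)) *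
      c a b `^ ((3 + p) / (2 * p)) by rewrite /err; ring.
  apply: (young_bound hc) => //; first by rewrite mulr_ge0// powR_ge0.
  move=> u v w au uv vw wb; apply: le_trans (H _ _ _ au uv vw wb) _.
  rewrite /err mulrA ler_wpM2r ?powR_ge0// ler_wpM2l//.
  have uw := le_trans uv vw; have u0 := le_trans a0 au; have wT := le_trans wb bT.
  have /andP[g1 _] := h1 _ _ u0 uw wT; have /andP[g2 _] := h1 _ _ a0 ab bT.
  by apply: ge0_ler_powR; rewrite ?nnegrE//; [(move: hp2 hp3; lra)|exact: h2].
set th := (3 + p) / (2 * p); set B := c 0 T `^ th + 1.
have B0 : 0 < B by rewrite ltr_wpDl// powR_ge0.
set q := (3 - p) / 2; have q0 : 0 < q by rewrite /q; (move: hp2 hp3; lra).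
have kB : 0 < k / B by rewrite divr_gt0.
have [|delta d0 Hd] := h3 ((k / B) `^ q^-1); first exact: powR_gt0.
exists delta => // a b s a0 bT ps ms.
have ab := itv_partition_le ps.
apply: (@le_trans _ _ (psum a s (fun u v => (k / B * c 0 T `^ (th - 1)) * c u v))).
  apply: (psum_le ps) => u v au uv vb m.
  have u0 := le_trans a0 au; have vT := le_trans vb bT.
  have cuv := control_ge0 hc u0 (ltW uv) vT.
  have th0 : 0 < th by apply: lt_trans th1.
  rewrite /err -/q -/th -mulrA; apply: ler_pM; rewrite ?powR_ge0//.
    have : eta u v <= (k / B) `^ q^-1.
      by apply: Hd; rewrite ?(ltW uv)//; exact: le_lt_trans ms.
    have /andP[g1 _] := h1 _ _ u0 (ltW uv) vT.
    move=> /(ge0_ler_powR (ltW q0)); rewrite !nnegrE g1 powR_ge0 => /(_ isT isT).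
    by rewrite -powRrM mulVf ?gt_eqF// powRr1// ltW.
  rewrite -mulr_powRB1// mulrC ler_wpM2r//.
  have c0 := control_mono hc (lexx 0) u0 (ltW uv) vT (lexx T).
  by apply: ge0_ler_powR => //; rewrite ?nnegrE//; [rewrite subr_ge0 ltW|exact: le_trans cuv c0].
rewrite psumZ.
apply: (@le_trans _ _ (k / B * c 0 T `^ (th - 1) * c 0 T)).
  apply: ler_wpM2l; first by apply: mulr_ge0; [exact: ltW|exact: powR_ge0].
  apply: le_trans (control_psum hc a0 bT ps) _.
  by have := control_mono hc (lexx 0) a0 ab bT (lexx T).
have cT : 0 <= c 0 T by apply: (control_ge0 hc) => //; exact: le_trans a0 (le_trans ab bT).
rewrite -mulrA [X in _ * X]mulrC mulr_powRB1//; last exact: lt_trans th1.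
by rewrite mulrAC ler_pdivrMr// ler_wpM2l ?(ltW k0)// /B lerDl.
Qed.

End ErrorTerm.

(** * Uniform order bounds *)

Section BigO.
Context {R : realType} {I : Type}.
Implicit Types (D : set I) (x y z : I -> R).

(** [x] is O([y]) with a constant that is uniform over [D].  Indices consist of
    times, and possibly of a function, so that estimates that are uniform over
    times and over functions have the same form. *)
Definition bO D x y : Prop :=
  exists2 C : R, 0 <= C & forall i, D i -> `|x i| <= C * y i.

Lemma bO_le D x y : (forall i, D i -> `|x i| <= y i) -> bO D x y.
Proof. by move=> H; exists 1 => // i Di; rewrite mul1r H. Qed.

Lemma eq_bO D x x' y : (forall i, D i -> x i = x' i) -> bO D x' y -> bO D x y.
Proof. by move=> E [C C0 H]; exists C => // i Di; rewrite E ?H. Qed.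

Lemma bO_trans D y x z : bO D x y -> bO D y z -> bO D x z.
Proof.
move=> [C C0 H] [C' C'0 H']; exists (C * C') => [|i Di]; first exact: mulr_ge0.
apply: le_trans (H _ Di) _; rewrite -mulrA ler_wpM2l//.
exact: le_trans (ler_norm _) (H' _ Di).
Qed.

Lemma bO_leT D y x z : bO D x y -> (forall i, D i -> y i <= z i) -> bO D x z.
Proof.
move=> [C C0 H] H'; exists C => // i Di; apply: le_trans (H _ Di) _.
by rewrite ler_wpM2l// H'.
Qed.

Lemma bO_D D x x' y : bO D x y -> bO D x' y -> bO D (fun i => x i + x' i) y.
Proof.
move=> [C C0 H] [C' C'0 H']; exists (C + C') => [|i Di]; first exact: addr_ge0.
by rewrite mulrDl; apply: le_trans (ler_normD _ _) (lerD (H _ Di) (H' _ Di)).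
Qed.

Lemma bO_N D x y : bO D x y -> bO D (fun i => - x i) y.
Proof. by move=> [C C0 H]; exists C => // i Di; rewrite normrN H. Qed.

Lemma bO_B D x x' y : bO D x y -> bO D x' y -> bO D (fun i => x i - x' i) y.
Proof. by move=> h h'; apply: bO_D h _; exact: bO_N. Qed.

Lemma bO_M D x y x' y' : bO D x y -> bO D x' y' ->
  bO D (fun i => x i * x' i) (fun i => y i * y' i).
Proof.
move=> [C C0 H] [C' C'0 H']; exists (C * C') => [|i Di]; first exact: mulr_ge0.
by rewrite normrM mulrACA ler_pM ?H ?H'.
Qed.

Lemma bO_Ml D x x' y : bO D x (fun=> 1) -> bO D x' y ->
  bO D (fun i => x i * x' i) y.
Proof.
by move=> h h'; apply: bO_leT (bO_M h h') _ => i _; rewrite mul1r.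
Qed.

Lemma bO_Mr D x x' y : bO D x y -> bO D x' (fun=> 1) ->
  bO D (fun i => x i * x' i) y.
Proof.
by move=> h h'; apply: bO_leT (bO_M h h') _ => i _; rewrite mulr1.
Qed.

Lemma bO_sum {J : Type} (r : seq J) (P : pred J) D (x : J -> I -> R) y :
  (forall i, D i -> 0 <= y i) -> (forall j, bO D (x j) y) ->
  bO D (fun i => \sum_(j <- r | P j) x j i) y.
Proof.
move=> y0 H; elim: r => [|j r IH].
  by exists 0 => // i Di; rewrite big_nil normr0 mul0r.
apply: (@eq_bO _ _ (fun i => (if P j then x j i else 0) + \sum_(j <- r | P j) x j i)).
  by move=> i _; rewrite big_cons; case: ifP => //; rewrite add0r.
by apply: bO_D => //; case: (P j) => //; exists 0 => // i Di; rewrite normr0 mul0r.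
Qed.

Lemma bO_cst D (k : R) : bO D (fun=> k) (fun=> 1).
Proof. by exists `|k| => // i _; rewrite mulr1. Qed.

Lemma bO_X D x y n : bO D x y -> bO D (fun i => x i ^+ n) (fun i => y i ^+ n).
Proof.
move=> h; elim: n => [|n IH]; first exact: (eq_bO _ (bO_cst D 1)).
apply: (eq_bO (x' := fun i => x i * x i ^+ n)); first by move=> i _; rewrite exprS.
by apply: bO_leT (bO_M h IH) _ => i _; rewrite exprS.
Qed.

Lemma bO_norm D x y : bO D x y -> bO D (fun i => `|x i|) y.
Proof. by move=> [C C0 H]; exists C => // i Di; rewrite normr_id H. Qed.

End BigO.

Lemma bO_comp {R : realType} {I J : Type} (f : J -> I) (D : set I) (E : set J)
    (x y : I -> R) :
  (forall j, E j -> D (f j)) -> bO D x y -> bO E (x \o f) (y \o f).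
Proof. by move=> ED [C C0 H]; exists C => // j /ED/H. Qed.

Section ExpLog.
Context {R : realType}.

Lemma mvt_bound (f df : R -> R) (B C : R) n :
  (forall x : R, is_derive x (1 : R) f (df x)) -> f 0 = 0 -> 0 <= C ->
  (forall x, `|x| <= B -> `|df x| <= C * `|x| ^+ n) ->
  forall x, `|x| <= B -> `|f x| <= C * `|x| ^+ n.+1.
Proof.
move=> dfE f0 C0 H x xB.
have cf (y z : R) : {within `[y, z], continuous f}.
  apply: continuous_subspaceT => w.
  by apply: differentiable_continuous; apply/derivable1_diffP; case: (dfE w).
have [x0|x0] := leP 0 x.
  have [c] := @MVT_segment R f df 0 x x0 (fun y _ => dfE y) (cf _ _).
  rewrite in_itv /= => /andP[c0 cx]; rewrite f0 !subr0 => ->.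
  rewrite normrM exprSr mulrA ler_wpM2r//.
  have cx' : `|c| <= `|x| by rewrite !ger0_norm.
  apply: le_trans (H _ (le_trans cx' xB)) _.
  by rewrite ler_wpM2l// lerXn2r// nnegrE.
have [c] := @MVT_segment R f df x 0 (ltW x0) (fun y _ => dfE y) (cf _ _).
rewrite in_itv /= => /andP[c0 cx].
rewrite f0 !sub0r => /eqP; rewrite eqr_oppLR => /eqP->.
rewrite normrN normrM normrN exprSr mulrA ler_wpM2r//.
have cx' : `|c| <= `|x| by rewrite (ler0_norm (ltW x0)) ler0_norm// lerN2.
apply: le_trans (H _ (le_trans cx' xB)) _.
by rewrite ler_wpM2l// lerXn2r// nnegrE.
Qed.

Lemma expR_taylor0 (B x : R) : `|x| <= B -> `|expR x - 1| <= expR B * `|x|.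
Proof.
move=> xB; rewrite -[in leRHS](expr1 `|x|).
apply: (@mvt_bound (expR - cst 1) expR B) xB => //.
- by move=> y; apply: is_derive_eq; rewrite subr0.
- by rewrite !fctE expR0 subrr.
move=> y yB; rewrite expr0 mulr1 ger0_norm ?expR_ge0// ler_expR.
exact: le_trans (ler_norm _) yB.
Qed.

Lemma expR_taylor1 (B x : R) : `|x| <= B ->
  `|expR x - 1 - x| <= expR B * `|x| ^+ 2.
Proof.
move=> xB; apply: (@mvt_bound (expR - cst 1 - id) (fun x => expR x - 1) B) xB => //.
- by move=> y; apply: is_derive_eq; rewrite subr0.
- by rewrite !fctE expR0 !subr0 subrr.
by move=> y yB; rewrite expr1; exact: expR_taylor0.
Qed.

Lemma expR_taylor2 (B x : R) : `|x| <= B ->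
  `|expR x - 1 - x - x ^+ 2 / 2| <= expR B * `|x| ^+ 3.
Proof.
pose f : R -> R := expR - cst 1 - id - 2^-1 *: (id ^+ 2 : R -> R).
have fE y : f y = expR y - 1 - y - y ^+ 2 / 2.
  by rewrite /f !fctE /GRing.scale /= [2^-1 * _]mulrC.
move=> xB; rewrite -fE.
apply: (@mvt_bound f (fun x => expR x - 1 - x) B) xB => //.
- move=> y; apply: is_derive_eq; rewrite subr0 /GRing.scale /=.
  by congr (_ - _); rewrite expr1 mulr1 -mulr_natl mulrA mulVf// mul1r.
- by rewrite fE expR0 !subr0 subrr expr0n mul0r subrr.
by move=> y; exact: expR_taylor1.
Qed.

(** The logarithm inverts the exponential, so that its expansion is the inverse
    of that of the exponential. *)
Lemma ln_taylor2 (a b : R) : 0 < a ->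
  exists2 C, 0 <= C & forall z, a <= 1 + z -> 1 + z <= b ->
    `|ln (1 + z) - z + z ^+ 2 / 2| <= C * `|z| ^+ 3.
Proof.
move=> a0.
pose k := Num.max 1 a^-1.
have k1 : 1 <= k by rewrite le_max lexx.
have k0 : 0 <= k by exact: le_trans k1.
have ka : a^-1 <= k by rewrite le_max lexx orbT.
pose E := expR (k * (1 + `|b|)).
have E0 : 0 <= E by exact: expR_ge0.
exists (2 * E * k ^+ 3) => [|z az zb]; first by rewrite !mulr_ge0 ?exprn_ge0.
set x := ln (1 + z).
have z1 : 0 < 1 + z by exact: lt_le_trans az.
have xz : `|x| <= k * `|z|.
  rewrite ler_norml; apply/andP; split.
    have : ln (1 + (- z / (1 + z))) <= - z / (1 + z).
      by apply: le_ln1Dx; rewrite ltr_pdivlMr//; lra.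
    rewrite (_ : 1 + - z / (1 + z) = (1 + z)^-1); last by field; rewrite gt_eqF.
    rewrite lnV ?posrE// -/x => h.
    have h2 : - z / (1 + z) <= `|z| * k.
      apply: le_trans (ler_norm _) _; rewrite normrM normrN ler_wpM2l//.
      rewrite ger0_norm ?invr_ge0 ?(ltW z1)//; apply: le_trans ka.
      by rewrite lef_pV2 ?posrE.
    by rewrite mulrC; lra.
  have : x <= z by apply: le_ln1Dx; lra.
  move=> h; apply: le_trans h _; apply: le_trans (ler_norm _) _.
  by rewrite ler_peMl.
have zb' : `|z| <= 1 + `|b|.
  have := ler_norm b; rewrite ler_norml => h; apply/andP; split; lra.
have xB : `|x| <= k * (1 + `|b|) by apply: le_trans xz _; rewrite ler_wpM2l.
have xe : expR x = 1 + z by rewrite lnK// posrE.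
have h1 := expR_taylor1 xB; have h2 := expR_taylor2 xB.
rewrite xe in h1 h2.
have -> : x - z + z ^+ 2 / 2 = - (1 + z - 1 - x - x ^+ 2 / 2)
   + (1 + z - 1 - x) * (z + x) / 2 by field.
apply: le_trans (ler_normD _ _) _; rewrite normrN !normrM.
have x3 : `|x| ^+ 3 <= k ^+ 3 * `|z| ^+ 3.
  by rewrite -exprMn lerXn2r// nnegrE// mulr_ge0.
have x2 : `|x| ^+ 2 <= k ^+ 2 * `|z| ^+ 2.
  by rewrite -exprMn lerXn2r// nnegrE// mulr_ge0.
have h3 : `|1 + z - 1 - x - x ^+ 2 / 2| <= E * (k ^+ 3 * `|z| ^+ 3).
  by apply: le_trans h2 _; rewrite ler_wpM2l.
have h4 : `|1 + z - 1 - x| <= E * (k ^+ 2 * `|z| ^+ 2).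
  by apply: le_trans h1 _; rewrite ler_wpM2l.
have h5 : `|z + x| <= 2 * k * `|z|.
  apply: le_trans (ler_normD _ _) _.
  have : `|z| <= k * `|z| by rewrite ler_peMl.
  lra.
have h6 := ler_pM (normr_ge0 _) (normr_ge0 _) h4 h5.
have -> : `|2^-1 : R| = 2^-1 by rewrite ger0_norm// invr_ge0.
have -> : 2 * E * k ^+ 3 * `|z| ^+ 3 = E * (k ^+ 3 * `|z| ^+ 3)
  + (E * (k ^+ 2 * `|z| ^+ 2) * (2 * k * `|z|)) / 2 by field.
by rewrite lerD// ler_wpM2r// invr_ge0.
Qed.

Lemma bO_exp {I : Type} (D : set I) (x : I -> R) : bO D x (fun=> 1) ->
  bO D (fun i => expR (x i) - 1 - x i - x i ^+ 2 / 2) (fun i => `|x i| ^+ 3).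
Proof.
move=> [C C0 H]; exists (expR C) => [|i Di]; first exact: expR_ge0.
by apply: expR_taylor2; have := H i Di; rewrite mulr1.
Qed.

Lemma bO_ln {I : Type} (D : set I) (x : I -> R) (a b : R) : 0 < a ->
  (forall i, D i -> a <= 1 + x i <= b) ->
  bO D (fun i => ln (1 + x i) - x i + x i ^+ 2 / 2) (fun i => `|x i| ^+ 3).
Proof.
move=> a0 H; have [C C0 h] := @ln_taylor2 a b a0.
by exists C => // i /H/andP[]; exact: h.
Qed.

End ExpLog.

(** * Norms and uniform continuity *)

Section Norms.
Context {R : realType}.

Lemma l2_coord {I : finType} (u : I -> R) i : `|u i| <= l2 u.
Proof.
rewrite -sqrtr_sqr ler_wsqrtr// (bigD1 i)//= lerDl.
by apply: sumr_ge0 => j _; exact: sqr_ge0.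
Qed.

Lemma l2_ge0 {I : finType} (u : I -> R) : 0 <= l2 u.
Proof. exact: sqrtr_ge0. Qed.

Lemma l2_le {I : finType} (u : I -> R) (M : R) : 0 <= M ->
  (forall i, `|u i| <= M) -> l2 u <= #|I|%:R * M.
Proof.
move=> M0 H; rewrite -[leRHS]ger0_norm ?mulr_ge0// -sqrtr_sqr ler_wsqrtr//.
apply: (@le_trans _ _ (\sum_(i : I) M ^+ 2)).
  by apply: ler_sum => i _; rewrite -real_normK ?num_real// lerXn2r// nnegrE.
rewrite sumr_const -[leLHS]mulr_natl exprMn; apply: ler_wpM2r; first exact: sqr_ge0.
by rewrite -natrX ler_nat; case: #|I| => // n; rewrite expnS expn1 leq_pmulr.
Qed.

Lemma enorm_ge0 {m n} (A : 'M[R]_(m, n)) : 0 <= enorm A.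
Proof. exact: l2_ge0. Qed.

Lemma enorm_coord {m n} (A : 'M[R]_(m, n)) i j : `|A i j| <= enorm A.
Proof. exact: (l2_coord (fun ij : 'I_m * 'I_n => A ij.1 ij.2) (i, j)). Qed.

Lemma enorm_le {m n} (A : 'M[R]_(m, n)) (M : R) : 0 <= M ->
  (forall i j, `|A i j| <= M) -> enorm A <= (m * n)%:R * M.
Proof.
move=> M0 H; have := @l2_le ('I_m * 'I_n)%type (fun ij => A ij.1 ij.2) M M0.
by rewrite card_prod !card_ord; apply => -[i j].
Qed.

Lemma mx_entry_le {m n} (A : 'M[R]_(m, n)) i j : `|A i j| <= `|A|.
Proof.
rewrite [leRHS]/Num.Def.normr/= mx_normrE.
exact: (le_bigmax _ (fun ij : 'I_m * 'I_n => `|A ij.1 ij.2|) (i, j)).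
Qed.

Lemma mx_norm_le {m n} (A : 'M[R]_(m, n)) (M : R) : 0 <= M ->
  (forall i j, `|A i j| <= M) -> `|A| <= M.
Proof.
move=> M0 H; rewrite [leLHS]/Num.Def.normr/= mx_normrE.
by apply: bigmax_le => // ij _; exact: H.
Qed.

Lemma sumr_le_const {d : nat} (x : 'I_d -> R) (M : R) :
  (forall i, `|x i| <= M) -> `|\sum_i x i| <= d%:R * M.
Proof.
move=> H; apply: le_trans (ler_norm_sum _ _ _) _.
apply: le_trans (ler_sum _ (fun i _ => H i)) _.
by rewrite sumr_const card_ord mulr_natl.
Qed.

End Norms.

Section Continuity.
Context {R : realType} {V : normedModType R}.
Variable T : R.

Lemma within_itv_continuousP (f : R -> V) :
  {within `[0, T], continuous f} <->
  forall x : R, 0 <= x -> x <= T -> forall e : R, 0 < e ->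
  exists2 delta : R, 0 < delta & forall y : R, 0 <= y -> y <= T -> `|y - x| < delta -> `|f y - f x| <= e.
Proof.
rewrite subspace_continuousP; split=> [H x x0 xT e e0|H x /=].
  have /H : `[0, T]%classic x by rewrite /= in_itv/= x0.
  move=> /cvgrPdist_le/(_ _ e0).
  rewrite /prop_near1 /within /= => /nbhs_ballP[delta /= d0 Hd].
  exists delta => // y y0 yT yx; rewrite distrC; apply: Hd.
    by rewrite /ball/= /ball_/= distrC.
  by rewrite /= in_itv/= y0.
rewrite in_itv/= => /andP[x0 xT]; apply/cvgrPdist_le => e e0.
have [delta d0 Hd] := H x x0 xT e e0.
rewrite /prop_near1 /within /=; apply/nbhs_ballP; exists delta => //= y.
rewrite /ball/= /ball_/= distrC => yx.
by rewrite in_itv/= => /andP[y0 yT]; rewrite distrC Hd.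
Qed.

Lemma within_itv_unif_continuous (f : R -> V) :
  {within `[0, T], continuous f} -> forall e : R, 0 < e ->
  exists2 delta : R, 0 < delta & forall s t : R, 0 <= s -> s <= T -> 0 <= t -> t <= T ->
    `|t - s| < delta -> `|f t - f s| <= e.
Proof.
move=> /within_itv_continuousP H e e0.
have /compact_near_coveringP/near_covering_withinP cov := @segment_compact R 0 T.
have := cov R 0^'+ (fun delta x => forall y, 0 <= y -> y <= T ->
  `|y - x| < delta -> `|f y - f x| <= e) _.
case=> [x /=|delta /= d0 Hd].
  rewrite in_itv/= => /andP[x0 xT].
  have e2 : 0 < e / 2 by rewrite divr_gt0.
  have [delta d0 Hd] := H x x0 xT (e / 2) e2.
  exists (ball x (delta / 2), [set t | 0 < t < delta / 2]) => /=.
    split; first by apply: nbhsx_ballx; rewrite divr_gt0.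
    by exists (delta / 2) => /=; [rewrite divr_gt0|move=> t /=; rewrite sub0r normrN => th t0; rewrite t0 (le_lt_trans (ler_norm _) th)].
  move=> [x' t] /= [xx' /andP[t0 td]]; rewrite in_itv/= => /andP[x'0 x'T] y y0 yT yx'.
  rewrite /ball/= /ball_/= in xx'.
  have h1 : `|f y - f x| <= e / 2.
    apply: Hd => //; have -> : y - x = (y - x') - (x - x') by ring.
    by apply: le_lt_trans (ler_normB _ _) _; lra.
  have h2 : `|f x' - f x| <= e / 2 by apply: Hd => //; rewrite distrC; lra.
  have -> : f y - f x' = (f y - f x) - (f x' - f x) by rewrite opprB addrA subrK.
  by apply: le_trans (ler_normB _ _) _; lra.
exists (delta / 2); first by rewrite divr_gt0.
move=> s t s0 sT t0 tT st; apply: (Hd (delta / 2)) => //=.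
- by rewrite sub0r normrN gtr0_norm ?divr_gt0//; lra.
- by rewrite divr_gt0.
- by rewrite in_itv/= s0.
Qed.

End Continuity.

(** * Moduli of continuity and discrete integrals *)

Section Modulus.
Context {R : realType}.

Lemma tau_mono (T p : R) c (s u v t : R) : control T c -> 0 <= p ->
  0 <= s -> s <= u -> u <= v -> v <= t -> t <= T -> tau p c u v <= tau p c s t.
Proof.
move=> hc p0 s0 su uv vt tT; have cm := control_mono hc s0 su uv vt tT.
have c0 := control_ge0 hc (le_trans s0 su) uv (le_trans vt tT).
apply: ge0_ler_powR; rewrite ?nnegrE ?invr_ge0//; exact: le_trans cm.
Qed.

(** The modulus is the supremum of all the [g] over all subintervals. *)
Lemma modulus_exists (J : Type) (T p : R) c (g : J -> R -> R -> R) :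
  inhabited J -> control T c -> 0 <= p ->
  (forall j u v, 0 <= u -> u <= v -> v <= T -> 0 <= g j u v <= tau p c u v) ->
  (forall k, 0 < k -> exists2 delta, 0 < delta & forall j u v,
     0 <= u -> u <= v -> v <= T -> v - u < delta -> g j u v <= k) ->
  exists2 eta, modulus T p c eta &
    forall j u v, 0 <= u -> u <= v -> v <= T -> g j u v <= eta u v.
Proof.
move=> [j0] hc p0 gb gc.
pose E s t := [set x | exists j u v, [/\ s <= u, u <= v, v <= t & x = g j u v]].
have Eub s t x : 0 <= s -> t <= T -> E s t x -> x <= tau p c s t.
  move=> s0 tT [j [u [v [su uv vt ->]]]].
  have /andP[_ h] := gb j _ _ (le_trans s0 su) uv (le_trans vt tT).
  exact: le_trans h (tau_mono hc p0 s0 su uv vt tT).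
have Eg s t j : s <= t -> E s t (g j s t) by move=> st; exists j, s, t; split.
have Esup s t x : 0 <= s -> t <= T -> E s t x -> x <= sup (E s t).
  by move=> s0 tT; apply: ub_le_sup; exists (tau p c s t) => y; exact: Eub.
have E0 s t : s <= t -> E s t !=set0.
  by move=> st; exists (g j0 s t); exact: Eg.
exists (fun s t => sup (E s t)); last first.
  by move=> j u v u0 uv vT; apply: Esup => //; exact: Eg.
split.
- move=> s t s0 st tT; apply/andP; split.
    have /andP[h _] := gb j0 _ _ s0 st tT.
    by apply: le_trans h _; apply: Esup => //; exact: Eg.
  by apply: ge_sup; [exact: E0|move=> x; exact: Eub].
- move=> s u v t s0 su uv vt tT; apply: ge_sup; first exact: E0.
  move=> x [j [u' [v' [uu' u'v' v'v ->]]]]; apply: Esup => //.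
  by exists j, u', v'; split => //; [exact: le_trans uu'|exact: le_trans vt].
move=> k k0; have [delta d0 Hd] := gc k k0; exists delta => // s t s0 st tT std.
apply: ge_sup; first exact: E0.
move=> x [j [u [v [su uv vt ->]]]]; apply: Hd => //.
- exact: le_trans su.
- exact: le_trans tT.
- lra.
Qed.

End Modulus.

Section SplitPartition.
Context {R : realType}.
Implicit Types (a b x k : R) (s : seq R).

Lemma split_ge a b s x k : itv_partition a b s -> a <= x -> x <= b ->
  mesh a s < k -> exists s1 s2, s = s1 ++ s2 /\ x <= last a s1 < x + k.
Proof.
elim: s a => [|y s IH] a.
  move=> /itv_partition_nil ab ax xb; rewrite mesh_nil => k0.
  exists [::], [::]; split => //=; rewrite ab xb; lra.
move=> /itv_partition_consP[ay ps] ax xb; rewrite mesh_cons gt_max => /andP[m1 m2].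
have [yx|xy] := leP y x.
  have [s1 [s2 [-> h]]] := IH _ ps yx xb m2.
  by exists (y :: s1), s2.
move: ax; rewrite le_eqVlt => /predU1P[ax|ax].
  by exists [::], (y :: s); split => //=; rewrite ax lexx ltrDl; have := mesh_ge0 y s; lra.
by exists [:: y], s; split => //=; lra.
Qed.

Lemma split_le a b s x k : itv_partition a b s -> a <= x -> x <= b ->
  mesh a s < k -> exists s1 s2, s = s1 ++ s2 /\ x - k < last a s1 <= x.
Proof.
elim: s a => [|y s IH] a.
  move=> /itv_partition_nil ab ax xb; rewrite mesh_nil => k0.
  by exists [::], [::]; split => //=; rewrite ax andbT; lra.
move=> /itv_partition_consP[ay ps] ax xb; rewrite mesh_cons gt_max => /andP[m1 m2].
have [yx|xy] := leP y x.
  have [s1 [s2 [-> h]]] := IH _ ps yx xb m2.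
  by exists (y :: s1), s2.
by exists [::], (y :: s); split => //=; lra.
Qed.

Lemma psum0 {V : zmodType} a s : psum a s (fun _ _ => 0 : V) = 0.
Proof. by rewrite /psum big1. Qed.

End SplitPartition.

Section DiscreteIntegrals.
Context {R : realType} {d : nat}.
Implicit Types (S : R -> 'rV[R]_d).

Lemma tensorE {m n} (x : 'rV[R]_m) (y : 'rV[R]_n) i j :
  tensor x y i j = x 0 i * y 0 j.
Proof. by rewrite /tensor mxE big_ord1 mxE. Qed.

Lemma tensor0r {m n} (x : 'rV[R]_m) : tensor x (0 : 'rV[R]_n) = 0.
Proof. by rewrite /tensor mulmx0. Qed.

Let F S (t u v : R) := tensor (S u) (S (Num.min v t) - S (Num.min u t)).

Lemma disc_int_tail S a b s t : itv_partition a b s -> t <= a ->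
  psum a s (F S t) = 0.
Proof.
move=> ps ta; rewrite -(psum0 (V := 'M[R]_d) a s).
apply: (eq_psum ps) => u v au uv vb.
rewrite /F !min_r ?subrr ?tensor0r//; first exact: le_trans au.
exact: le_trans (le_trans ta au) (ltW uv).
Qed.

Lemma disc_int_prefix S T s1 s2 : itv_partition 0 T (s1 ++ s2) ->
  disc_int S (s1 ++ s2) (last 0 s1)
  = psum 0 s1 (fun u v => tensor (S u) (incr S u v)).
Proof.
move=> /itv_partition_catP[p1 p2].
rewrite /disc_int psum_cat (disc_int_tail _ p2)// addr0.
by apply: (eq_psum p1) => u v u0 uv vb; rewrite !min_l// (le_trans (ltW uv)).
Qed.

(** The intervals beyond [t] contribute nothing, and the interval that contains
    [t] is cut at [t]; this is why the discrete integrals do not depend on the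
    horizon. *)
Lemma disc_int_truncate S a b s t : itv_partition a b s -> a < t -> t <= b ->
  psum a s (F S t) = psum a (rcons [seq x <- s | x < t] t) (F S t).
Proof.
elim: s a => [|x s IH] a.
  by move=> /itv_partition_nil-> h1 h2; move: (lt_le_trans h1 h2); rewrite ltxx.
move=> /itv_partition_consP[ax ps] at_ tb /=.
have [xt|tx] := ltP x t; first by rewrite /= !psum_cons IH.
have -> : [seq y <- s | y < t] = [::].
  apply/eqP; rewrite -[_ == _]negbK -has_filter; apply/hasPn => y ys.
  have /andP[xy _] := mem_itv_partition ps ys.
  by rewrite -leNgt (le_trans tx)// ltW.
rewrite /= !psum_cons psum_nil (disc_int_tail _ ps)//; congr (_ + _).
by rewrite /F minxx (min_r tx).
Qed.

Lemma finite_restrict (u : nat -> R) T : 0 < T ->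
  itv_partition 0 T (restrict_partition u T) ->
  finite_set ((range u `|` [set T]) `&` `]0, T]%classic).
Proof.
move=> T0 ps; apply: contrapT => nf; move: ps; rewrite /restrict_partition.
rewrite /fset_set; case: pselect => // _; rewrite /= => -[_ /eqP/= T0'].
by move: T0; rewrite -T0' ltxx.
Qed.

Lemma mem_restrict (u : nat -> R) T x : 0 < T ->
  itv_partition 0 T (restrict_partition u T) ->
  (x \in restrict_partition u T) = ((x \in range u) || (x == T)) && (0 < x <= T).
Proof.
move=> T0 ps; rewrite mem_sort in_fset_set; last exact: finite_restrict.
rewrite in_setI in_setU; congr ((_ || _) && _).
  by apply/idP/eqP => [/set_mem//|->]; exact/mem_set.
by apply/idP/idP => [/set_mem|h]; [|apply: mem_set]; rewrite /= in_itv.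
Qed.

Lemma restrict_truncate (u : nat -> R) T t : 0 < t -> t <= T ->
  itv_partition 0 T (restrict_partition u T) ->
  itv_partition 0 t (restrict_partition u t) ->
  restrict_partition u t = rcons [seq x <- restrict_partition u T | x < t] t.
Proof.
move=> t0 tT pT pt; have T0 := lt_le_trans t0 tT.
apply: lt_sorted_eq.
- by case: pt => /path_sorted.
- rewrite (sorted_pairwise lt_trans) pairwise_rcons filter_all /=.
  rewrite -(sorted_pairwise lt_trans); apply: sorted_filter; first exact: lt_trans.
  by case: pT => /path_sorted.
move=> x; rewrite mem_rcons inE mem_filter !mem_restrict//.
have [->|xt] := eqVneq x t; first by rewrite orbT t0 lexx.
rewrite orbF /=; have [xlt|xge] := ltP x t.
  by rewrite (ltW xlt) (le_trans (ltW xlt) tT) (lt_eqF (lt_le_trans xlt tT)) orbF.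
by rewrite [x <= t]le_eqVlt (negbTE xt) (ltNge x t) xge /= !andbF.
Qed.

End DiscreteIntegrals.

(** * Prices with property (RIE) *)

Section RIEFacts.
Context {R : realType} {d : nat}.
Variables (p : R) (S : R -> 'rV[R]_d) (P : nat -> nat -> R).
Hypothesis hp : 2 < p < 3.
Hypothesis hS : price_path p S P.

Lemma quotient0_le1 (x c : R) : 0 <= x -> (quotient0 x c <= 1)%E -> 0 <= c ->
  x <= c.
Proof.
rewrite /quotient0 => x0 + c0; rewrite inver; case: eqP => [c00|/eqP c00].
  move: x0; rewrite c00 le_eqVlt => /predU1P[<-//|x0].
  by rewrite gt0_muley ?lte_fin// leye_eq.
have c1 : 0 < c by rewrite lt_neqAle eq_sym c00.
by rewrite -EFinM lee_fin ler_pdivrMr// mul1r.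
Qed.

Lemma quotient0_ge0 (x c : R) : 0 <= x -> 0 <= c -> (0 <= quotient0 x c)%E.
Proof.
move=> x0 c0; rewrite /quotient0 mule_ge0 ?lee_fin//.
by rewrite inver; case: ifP => // _; rewrite lee_fin invr_ge0.
Qed.

Lemma powR_le_root (x c a : R) : 0 < a -> 0 <= x -> 0 <= c ->
  x `^ a <= c -> x <= c `^ a^-1.
Proof.
move=> a0 x0 c0 h; have a1 : 0 <= a^-1 by rewrite invr_ge0 ltW.
have := ge0_ler_powR a1 _ _ h; rewrite !nnegrE powR_ge0 c0 => /(_ isT isT).
by rewrite -powRrM mulfV ?gt_eqF// powRr1.
Qed.

Let Pn T n := restrict_partition (P n) T.

Lemma RIE_exists T : 0 < T -> RIE p T S (Pn T).
Proof. by case: hS => _ _ _; apply. Qed.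

Lemma restrict_itv_partition T n : 0 < T -> itv_partition 0 T (Pn T n).
Proof. by move=> /RIE_exists[_]. Qed.

Lemma disc_int_horizon T t n : 0 < T -> 0 <= t -> t <= T ->
  disc_int S (Pn T n) t = disc_int S (Pn t n) t.
Proof.
move=> T0; rewrite le_eqVlt => /predU1P[<- _|t0 tT]; last first.
  rewrite /Pn (@restrict_truncate _ (P n) T t)//; last 2 first.
    exact: restrict_itv_partition.
    exact: restrict_itv_partition.
  exact: disc_int_truncate (restrict_itv_partition n T0) t0 tT.
rewrite [LHS](disc_int_tail S (restrict_itv_partition n T0) (lexx 0)).
rewrite /Pn /restrict_partition set_itv_ge; last by rewrite bnd_simp ltxx.
by rewrite setI0 fset_set0 [sort _ _](_ : _ = [::])// /disc_int psum_nil.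
Qed.

(** At each time the discrete integrals along the partitions of [0, T] are those
    of the definition of [ito_int], so that their uniform limit is [ito_int]. *)
Lemma ito_int_unif T : 0 < T -> forall e : R, 0 < e ->
  \forall n \near \oo, forall t i j, 0 <= t -> t <= T ->
    `|ito_int S P t i j - disc_int S (Pn T n) t i j| <= e.
Proof.
move=> T0; have [_ _ _ [I cI] _] := RIE_exists T0.
have uI (e : R) : 0 < e -> \forall n \near \oo, forall t, 0 <= t -> t <= T ->
    `|I t - disc_int S (Pn T n) t| <= e.
  move=> e0.
  have : nbhs (I : {uniform` `[0, T]%classic -> 'M[R]_d})
      [set h | forall y : R, `[0, T]%classic y -> `|I y - h y| < e].
    apply/uniform_nbhs; exists [set xy | ball xy.1 e xy.2]; split.
      exact: (entourage_ball _ (PosNum e0)).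
    move=> h /= H y /H; rewrite -ball_normE; exact.
  move=> /cI h.
  have {}h : \forall n \near \oo, forall y : R, `[0, T]%classic y ->
      `|I y - disc_int S (Pn T n) y| < e by exact: h.
  apply: filterS h => n H t t0 tT.
  by apply/ltW/H; rewrite /= in_itv/= t0.
have ptI t : 0 <= t -> t <= T -> ito_int S P t = I t.
  move=> t0 tT; apply/cvg_lim => //; apply/cvgrPdist_le => e e0.
  near=> n; rewrite -(disc_int_horizon n T0)//.
  by move: t t0 tT; near: n; exact: uI.
move=> e /uI; apply: filterS => n H t i j t0 tT; rewrite ptI//.
by apply: le_trans (H t t0 tT); have := mx_entry_le (I t - disc_int S (Pn T n) t) i j; rewrite !mxE.
Unshelve. all: by end_near. Qed.

Lemma price_within T : {within `[0, T], continuous S}.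
Proof.
have [cS _ _ _] := hS; apply: continuous_subspaceW cS => x /=.
by rewrite !in_itv/= andbT => /andP[].
Qed.

Lemma price_unif T (e : R) : 0 < e ->
  exists2 delta : R, 0 < delta & forall s t i, 0 <= s -> s <= T -> 0 <= t -> t <= T ->
    `|t - s| < delta -> `|S t 0 i - S s 0 i| <= e.
Proof.
move=> e0; have [delta d0 H] := within_itv_unif_continuous (@price_within T) e0.
exists delta => // s t i s0 sT t0 tT st; have := H s t s0 sT t0 tT st.
by apply: le_trans; have := mx_entry_le (S t - S s) 0 i; rewrite !mxE.
Qed.

Lemma price_within_coord T i : {within `[0, T], continuous (fun t => S t 0 i)}.
Proof.
apply/within_itv_continuousP => x x0 xT e e0.
have [delta d0 H] := price_unif T e0.
by exists delta => // y y0 yT yx; exact: H.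
Qed.

Lemma price_pos t i : 0 <= t -> 0 < S t 0 i.
Proof. by case: hS => _ + _ _; exact. Qed.

Lemma price_bounds T : 0 <= T -> exists2 B : R, 0 < B &
  forall t i, 0 <= t -> t <= T -> B^-1 <= S t 0 i <= B.
Proof.
move=> T0.
have /choice[f Hf] : forall i : 'I_d, exists B : R, 0 < B /\
    forall t, 0 <= t -> t <= T -> B^-1 <= S t 0 i <= B.
  move=> i.
  have [a a1 Ha] := EVT_max T0 (@price_within_coord T i).
  have [b b1 Hb] := EVT_min T0 (@price_within_coord T i).
  move: a1 b1; rewrite !in_itv/= => /andP[a0 aT] /andP[b0 bT].
  have pa := price_pos i a0; have pb := price_pos i b0.
  exists (S a 0 i + (S b 0 i)^-1); split; first by rewrite addr_gt0// invr_gt0.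
  move=> t t0 tT; have tI : t \in `[0, T]%R by rewrite in_itv/= t0.
  apply/andP; split.
    apply: le_trans (Hb t tI); rewrite invf_ple ?posrE ?addr_gt0 ?invr_gt0//.
    by rewrite lerDr ltW.
  by apply: le_trans (Ha t tI) _; rewrite lerDl invr_ge0 ltW.
exists (1 + \sum_i f i) => [|t i t0 tT].
  by rewrite ltr_pwDl// sumr_ge0// => i _; case: (Hf i) => /ltW.
have fS : f i <= 1 + \sum_i f i.
  rewrite (bigD1 i)//= addrCA lerDl addr_ge0// sumr_ge0// => j _.
  by case: (Hf j) => /ltW.
have [fi0 /(_ t t0 tT)/andP[h1 h2]] := Hf i.
rewrite (le_trans h2 fS) andbT; apply: le_trans h1.
by rewrite lef_pV2// posrE//; exact: lt_le_trans fS.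
Qed.

Lemma disc_int_entry (s : seq R) t i j : disc_int S s t i j =
  psum 0 s (fun u v => S u 0 i * (S (Num.min v t) 0 j - S (Num.min u t) 0 j)).
Proof.
rewrite /disc_int /psum summxE; apply: eq_bigr => k _.
by rewrite tensorE !mxE.
Qed.

Lemma ito_int_unif_continuous T : 0 < T -> forall e : R, 0 < e ->
  exists2 delta : R, 0 < delta & forall s t i j, 0 <= s -> s <= T ->
    0 <= t -> t <= T -> `|t - s| < delta ->
    `|ito_int S P t i j - ito_int S P s i j| <= e.
Proof.
move=> T0 e e0.
have e3 : 0 < e / 3 by rewrite divr_gt0.
have [N _ HN] := ito_int_unif T0 e3.
have {}HN := HN N (leqnn N).
have [B B0 HB] := price_bounds (ltW T0).
set s0 := Pn T N in HN.
have ps : itv_partition 0 T s0 := restrict_itv_partition N T0.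
pose K := (size s0)%:R * (B * 2) + 1 : R.
have K0 : 0 < K by rewrite ltr_pwDr// !mulr_ge0// ltW.
have eK : 0 < e / 3 / K by rewrite divr_gt0.
have [delta d0 Hd] := price_unif T eK.
exists delta => // s t i j s00 sT t0 tT st.
have h : `|disc_int S s0 t i j - disc_int S s0 s i j| <= e / 3.
  rewrite !disc_int_entry -psumN -psumD.
  apply: le_trans (norm_psum_le (B := fun _ _ => B * 2 * (e / 3 / K)) ps _) _.
    move=> u v u0 uv vT.
    have -> x y z w : S u 0 i * (x - y) - S u 0 i * (z - w)
        = S u 0 i * ((x - z) - (y - w)) by ring.
    rewrite normrM -mulrA; apply: ler_pM => //.
      have /andP[h1 h2] := HB u i u0 (le_trans (ltW uv) vT).
      by rewrite ger0_norm// ltW// price_pos.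
    have v0 := le_trans u0 (ltW uv); have uT := le_trans (ltW uv) vT.
    have mm w : 0 <= w -> w <= T -> `|S (Num.min w t) 0 j - S (Num.min w s) 0 j| <= e / 3 / K.
      move=> w0 wT; apply: Hd; rewrite ?le_min ?w0 ?ge_min ?wT//.
      apply: le_lt_trans st; have [wt|tw] := leP w t; have [ws|sw] := leP w s.
      - by rewrite subrr normr0.
      - by rewrite !ger0_norm ?subr_ge0; [lra|lra|exact: ltW].
      - rewrite ler0_norm ?subr_le0//; last exact: ltW.
        by rewrite ler0_norm; lra.
      - by [].
    apply: le_trans (ler_normB _ _) _.
    by have := mm u u0 uT; have := mm v v0 vT; lra.
  rewrite /psum sumr_const card_ord -[leLHS]mulr_natl.
  rewrite -[leRHS](divfK (lt0r_neq0 K0)) {3}/K; lra.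
have h1 := HN s i j s00 sT; have h2 := HN t i j t0 tT.
have -> : ito_int S P t i j - ito_int S P s i j =
   (ito_int S P t i j - disc_int S s0 t i j)
   - (ito_int S P s i j - disc_int S s0 s i j)
   + (disc_int S s0 t i j - disc_int S s0 s i j) by ring.
apply: le_trans (ler_normD _ _) _.
by have := ler_normB (ito_int S P t i j - disc_int S s0 t i j)
   (ito_int S P s i j - disc_int S s0 s i j); lra.
Qed.

End RIEFacts.

(** * The rough path of the prices *)

(** A p-rough path in coordinates, with a modulus [eta] that bounds it and whose
    p-th power is controlled, and with nonnegative bracket increments. *)
Record rough_driver {R : realType} {d : nat} (T p : R) (S : R -> 'rV[R]_d)
    (A : R -> R -> 'M[R]_d) (c eta : R -> R -> R) : Prop := RoughDriver {
  driver_control : control T c;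
  driver_modulus : modulus T p c eta;
  driver_path : forall s t i, 0 <= s -> s <= t -> t <= T ->
    `|S t 0 i - S s 0 i| <= eta s t;
  driver_area : forall s t i j, 0 <= s -> s <= t -> t <= T ->
    `|A s t i j| <= eta s t ^+ 2;
  driver_chen : forall s u t i j, A s t i j =
    A s u i j + A u t i j + (S u 0 i - S s 0 i) * (S t 0 j - S u 0 j);
  driver_bracket_ge0 : forall s t (v : 'I_d -> R), 0 <= s -> s <= t -> t <= T ->
    0 <= \sum_i \sum_j v i * v j *
      ((S t 0 i - S s 0 i) * (S t 0 j - S s 0 j) - 2 * A s t i j) }.

Section PriceRoughPath.
Context {R : realType} {d : nat}.
Variables (p : R) (S : R -> 'rV[R]_d) (P : nat -> nat -> R).
Hypothesis hp : 2 < p < 3.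
Hypothesis hS : price_path p S P.

Let hp0 : 0 < p. Proof. by case/andP: hp => h _; exact: lt_trans h. Qed.

Let Pn T n := restrict_partition (P n) T.

Lemma nth_size_cat (a : R) s1 s2 : nth 0 (a :: s1 ++ s2) (size s1) = last a s1.
Proof. by elim: s1 a => //= x s1 IH a; rewrite IH. Qed.

Lemma liftE s t i j : Defs.lift S P s t i j =
  ito_int S P t i j - ito_int S P s i j - S s 0 i * (S t 0 j - S s 0 j).
Proof. by rewrite /Defs.lift /incr mxE [X in _ + X]mxE tensorE !mxE. Qed.

(** The left-point sums of [y dy] are at most half the increment of [y ^+ 2];
    the defect is the discrete quadratic variation. *)
Lemma psum_sq_le (y : R -> R) a s :
  2 * psum a s (fun u v => y u * (y v - y u)) <= y (last a s) ^+ 2 - y a ^+ 2.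
Proof.
elim: s a => [|x s IH] a /=; first by rewrite psum_nil mulr0 subrr.
rewrite psum_cons mulrDr; have := IH x; have := sqr_ge0 (y x - y a).
lra.
Qed.

Lemma RIE_bounds T : 0 < T -> exists2 c, control T c &
  (forall s t, 0 <= s -> s <= t -> t <= T ->
     enorm (incr S s t) `^ p <= c s t) /\
  (forall n k l, let t := nth 0 (0 :: Pn T n) in
     (k < l <= size (Pn T n))%N -> 0 <= t k -> t k <= t l -> t l <= T ->
     enorm (incr (disc_int S (Pn T n)) (t k) (t l)
            - tensor (S (t k)) (incr S (t k) (t l))) `^ (p / 2)
     <= c (t k) (t l)).
Proof.
move=> T0; have [_ pT _ _ [c hc H]] := RIE_exists hS T0.
have q1 (x y : \bar R) : (0 <= x -> 0 <= y -> x + y <= 1 -> x <= 1 /\ y <= 1)%E.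
  move=> x0 y0 xy; split; apply: le_trans xy; first exact: leeDl.
  exact: leeDr.
have path0 : (0 <= RIE_path p T S c)%E.
  apply: le_ereal_sup_tmp; exists (quotient0 (enorm (incr S 0 T) `^ p) (c 0 T)).
    by exists (0, T) => //; split; rewrite /= ?lexx ?ltW.
  by apply: quotient0_ge0; [exact: powR_ge0|apply: (control_ge0 hc) => //; exact: ltW].
have tn n : 0 <= nth 0 (0 :: Pn T n) 0 <= T by rewrite /= lexx ltW.
have area0 : (0 <= RIE_area p S (Pn T) c)%E.
  have [s Es] : exists s, Pn T 0 = s by exists (Pn T 0).
  have ps := pT 0%N; rewrite -/(Pn T 0) Es in ps.
  case: s ps Es => [/itv_partition_nil T00|x s /itv_partition_consP[x0 ps] Es].
    by move: T0; rewrite -T00 ltxx.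
  have xT := itv_partition_le ps.
  apply: le_ereal_sup_tmp; exists (quotient0 (enorm (incr (disc_int S (Pn T 0)) 0 x
     - tensor (S 0) (incr S 0 x)) `^ (p / 2)) (c 0 x)).
    by exists 0%N, 0%N, 1%N => /=; rewrite Es.
  by apply: quotient0_ge0; [exact: powR_ge0|apply: (control_ge0 hc) => //; exact: ltW].
have [h1 h2] := q1 _ _ path0 area0 H.
exists c => //; split=> [s t s0 st tT|n k l t kl tk0 tkl tlT].
  apply: quotient0_le1; [exact: powR_ge0| |exact: (control_ge0 hc)].
  apply: le_trans h1; apply: ereal_sup_ubound.
  by exists (s, t) => //; split; rewrite /= ?s0.
apply: quotient0_le1; [exact: powR_ge0| |exact: (control_ge0 hc)].
by apply: le_trans h2; apply: ereal_sup_ubound; exists n, k, l.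
Qed.

(** Property (RIE) only controls the area between partition points of the same
    level.  Points of a fine partition close to [s] and [t] give increments [x]
    and areas [A] close to those between [s] and [t]; the areas are discrete, so
    that [psum_sq_le] applies to the price of any fixed combination of assets,
    whence the positivity of the bracket. *)
Lemma area_approx T c s t e : 0 < T -> control T c ->
  (forall n k l, let t := nth 0 (0 :: Pn T n) in
     (k < l <= size (Pn T n))%N -> 0 <= t k -> t k <= t l -> t l <= T ->
     enorm (incr (disc_int S (Pn T n)) (t k) (t l)
            - tensor (S (t k)) (incr S (t k) (t l))) `^ (p / 2)
     <= c (t k) (t l)) ->
  0 <= s -> s < t -> t <= T -> 0 < e ->
  exists (x : 'I_d -> R) (A : 'I_d -> 'I_d -> R),
  [/\ forall i, `|x i - (S t 0 i - S s 0 i)| <= e,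
      forall i j, `|A i j - Defs.lift S P s t i j| <= e,
      forall i j, `|A i j| <= tau p c s t ^+ 2 &
      forall v : 'I_d -> R,
        0 <= \sum_i \sum_j v i * v j * (x i * x j - 2 * A i j)].
Proof.
move=> T0 hc H s0 st tT e0.
have [B B0 HB] := price_bounds hS (ltW T0).
(* [4 + 3 * B] collects the errors from moving the end points, weighted by the
   size of the prices, and from the discrete integrals. *)
pose e1 := e / (4 + 3 * B).
have D0 : 0 < 4 + 3 * B by lra.
have e10 : 0 < e1 by rewrite divr_gt0.
have eE : e = e1 * (4 + 3 * B) by rewrite /e1 divfK// gt_eqF.
have [dS dS0 HdS] := price_unif hS T e10.
have [dI dI0 HdI] := ito_int_unif_continuous hS T0 e10.
(* The last bound makes room for an interval between the points chosen near [s]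
   and near [t]. *)
pose k := Num.min (Num.min dS dI) ((t - s) / 2).
have k0 : 0 < k by rewrite !lt_min dS0 dI0 divr_gt0// subr_gt0.
have kS : k <= dS by rewrite !ge_min lexx.
have kI : k <= dI by rewrite !ge_min lexx orbT.
have kst : k <= (t - s) / 2 by rewrite ge_min lexx orbT.
have [_ pT cm _ _] := RIE_exists hS T0.
have near1 := ito_int_unif hS T0 e10.
have near2 : \forall n \near \oo, mesh 0 (Pn T n) < k.
  move/cvgrPdist_lt : cm => /(_ _ k0); apply: filterS => n.
  by rewrite sub0r normrN; apply: le_lt_trans; exact: ler_norm.
have [n [Hn mn]] := filter_ex (filterI near1 near2).
have tT' : s <= T := le_trans (ltW st) tT.
have ps := pT n; rewrite -/(Pn T n) in ps.
have [s1 [r [E1 /andP[sa ak]]]] := split_ge ps s0 tT' mn.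
set a := last 0 s1 in sa ak.
move: (ps) (mn); rewrite E1 mesh_cat gt_max.
move=> /itv_partition_catP[p1 pr] /andP[_ mr]; rewrite -/a in p1 pr mr.
have at_ : a <= t by lra.
have [s2 [s3 [E2 /andP[kb bt]]]] := split_le pr at_ tT mr.
set b := last a s2 in kb bt.
have ab : a < b by lra.
have a0 : 0 <= a by exact: le_trans sa.
have b0 : 0 <= b by exact: le_trans (ltW ab).
have bT : b <= T by exact: le_trans tT.
have aT : a <= T := le_trans (ltW ab) bT.
have EP : Pn T n = s1 ++ s2 ++ s3 by rewrite E1 E2.
have EP' : Pn T n = (s1 ++ s2) ++ s3 by rewrite EP catA.
have tk : nth 0 (0 :: Pn T n) (size s1) = a by rewrite EP nth_size_cat.
have tl : nth 0 (0 :: Pn T n) (size (s1 ++ s2)) = b.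
  by rewrite EP' nth_size_cat last_cat.
pose M := incr (disc_int S (Pn T n)) a b - tensor (S a) (incr S a b).
have hM : enorm M `^ (p / 2) <= c a b.
  have := H n (size s1) (size (s1 ++ s2)); rewrite /= tk tl; apply => //.
    rewrite EP' !size_cat leq_addr andbT -[ltnLHS]addn0 ltn_add2l.
    by move: ab; rewrite /b; case: (s2) => //=; rewrite ltxx.
  exact: ltW.
have ME i j : M i j = psum a s2 (fun u v => S u 0 i * (S v 0 j - S u 0 j))
    - S a 0 i * (S b 0 j - S a 0 j).
  rewrite /M mxE [X in _ + X]mxE tensorE /incr; congr (_ - _); last by rewrite !mxE.
  have pb : disc_int S (Pn T n) b = psum 0 (s1 ++ s2) (fun u v => tensor (S u) (incr S u v)).
    have -> : b = last 0 (s1 ++ s2) by rewrite last_cat.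
    by rewrite EP' (@disc_int_prefix _ _ _ T)// -EP'.
  have pa : disc_int S (Pn T n) a = psum 0 s1 (fun u v => tensor (S u) (incr S u v)).
    by rewrite EP /a (@disc_int_prefix _ _ _ T)// -EP.
  rewrite pa pb psum_cat -/a addrAC subrr add0r /psum summxE.
  by apply: eq_bigr => l _; rewrite tensorE !mxE.
have MD i j : M i j = disc_int S (Pn T n) b i j - disc_int S (Pn T n) a i j
    - S a 0 i * (S b 0 j - S a 0 j).
  by rewrite /M mxE [X in _ + X]mxE tensorE !mxE.
have Sa i : `|S a 0 i - S s 0 i| <= e1.
  apply: HdS => //; rewrite ger0_norm; lra.
have Sb i : `|S b 0 i - S t 0 i| <= e1.
  apply: HdS => //; [lra|rewrite ler0_norm; lra].
exists (fun i => S b 0 i - S a 0 i), M; split.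
- move=> i; have -> : S b 0 i - S a 0 i - (S t 0 i - S s 0 i)
    = (S b 0 i - S t 0 i) - (S a 0 i - S s 0 i) by ring.
  apply: le_trans (ler_normB _ _) _; have := Sa i; have := Sb i.
  by rewrite eE; nra.
- move=> i j; rewrite MD liftE.
  have -> : disc_int S (Pn T n) b i j - disc_int S (Pn T n) a i j
    - S a 0 i * (S b 0 j - S a 0 j)
    - (ito_int S P t i j - ito_int S P s i j - S s 0 i * (S t 0 j - S s 0 j))
    = (ito_int S P a i j - disc_int S (Pn T n) a i j)
      - (ito_int S P b i j - disc_int S (Pn T n) b i j)
      + ((ito_int S P b i j - ito_int S P t i j)
      - (ito_int S P a i j - ito_int S P s i j))
      - ((S a 0 i - S s 0 i) * (S b 0 j - S a 0 j)
         + S s 0 i * ((S b 0 j - S t 0 j) - (S a 0 j - S s 0 j))) by ring.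
  have h1 := Hn a i j a0 aT; have h2 := Hn b i j b0 bT.
  have h3 : `|ito_int S P b i j - ito_int S P t i j| <= e1.
    by apply: HdI => //; [lra|rewrite ler0_norm; lra].
  have h4 : `|ito_int S P a i j - ito_int S P s i j| <= e1.
    by apply: HdI => //; rewrite ger0_norm; lra.
  have h5 : `|S b 0 j - S a 0 j| <= B.
    have /andP[g1 g2] := HB a j a0 aT; have /andP[g3 g4] := HB b j b0 bT.
    have i0 : 0 < B^-1 by rewrite invr_gt0.
    by rewrite ler_norml; apply/andP; split; lra.
  have h6 : `|S s 0 i| <= B.
    have /andP[g1 g2] := HB s i s0 tT'.
    by rewrite ger0_norm// ltW// (price_pos hS).
  have h7 : `|(S a 0 i - S s 0 i) * (S b 0 j - S a 0 j)| <= e1 * B.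
    by rewrite normrM ler_pM.
  have h8 : `|S s 0 i * ((S b 0 j - S t 0 j) - (S a 0 j - S s 0 j))| <= B * (2 * e1).
    rewrite normrM ler_pM//; apply: le_trans (ler_normB _ _) _.
    by have := Sa j; have := Sb j; lra.
  apply: le_trans (ler_normB _ _) _.
  apply: le_trans (lerD (ler_normD _ _) (ler_normD _ _)) _.
  apply: le_trans (lerD (lerD (ler_normB _ _) (ler_normB _ _)) (lexx _)) _.
  rewrite eE; lra.
- move=> i j; apply: le_trans (enorm_coord M i j) _.
  have p2 : 0 < p / 2 by rewrite divr_gt0.
  have cab := control_ge0 hc a0 (ltW ab) bT.
  apply: le_trans (powR_le_root p2 (enorm_ge0 _) cab hM) _.
  have -> : c a b `^ (p / 2)^-1 = tau p c a b ^+ 2.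
    rewrite /tau -powR_mulrn ?powR_ge0// -powRrM; congr (_ `^ _).
    by field; rewrite gt_eqF.
  rewrite lerXn2r ?nnegrE ?tau_ge0//.
  by apply: (tau_mono hc) => //; exact: ltW.
move=> v.
pose y u := \sum_i v i * S u 0 i.
have yI u w : y w - y u = \sum_i v i * (S w 0 i - S u 0 i).
  by rewrite /y -sumrB; apply: eq_bigr => i _; rewrite mulrBr.
have sq (f g : 'I_d -> R) : (\sum_i v i * f i) * (\sum_i v i * g i) =
    \sum_i \sum_j v i * v j * (f i * g j).
  rewrite mulr_suml; apply: eq_bigr => i _; rewrite mulr_sumr.
  by apply: eq_bigr => j _; ring.
have -> : \sum_i \sum_j v i * v j * ((S b 0 i - S a 0 i) * (S b 0 j - S a 0 j)
    - 2 * M i j) = (y b - y a) ^+ 2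
    - 2 * (psum a s2 (fun u w => y u * (y w - y u)) - y a * (y b - y a)).
  have -> : psum a s2 (fun u w => y u * (y w - y u)) = \sum_i \sum_j v i * v j *
      psum a s2 (fun u w => S u 0 i * (S w 0 j - S u 0 j)).
    transitivity (psum a s2 (fun u w => \sum_i \sum_j
        v i * v j * (S u 0 i * (S w 0 j - S u 0 j)))).
      by apply: eq_bigr => l _; rewrite yI {1}/y sq.
    rewrite psum_sum; apply: eq_bigr => i _; rewrite psum_sum.
    by apply: eq_bigr => j _; rewrite psumZ.
  rewrite expr2 !yI /y !sq -sumrB mulr_sumr -sumrB; apply: eq_bigr => i _.
  rewrite -sumrB mulr_sumr -sumrB; apply: eq_bigr => j _.
  by rewrite ME; ring.
have := psum_sq_le y a s2; rewrite -/b; nra.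
Qed.

Lemma area_unif T e : 0 < T -> 0 < e ->
  exists2 delta : R, 0 < delta & forall s t i j, 0 <= s -> s <= t -> t <= T ->
    t - s < delta -> `|Defs.lift S P s t i j| <= e.
Proof.
move=> T0 e0.
have [B B0 HB] := price_bounds hS (ltW T0).
pose e1 := e / (1 + B).
have D0 : 0 < 1 + B by lra.
have e10 : 0 < e1 by rewrite divr_gt0.
have eE : e = e1 * (1 + B) by rewrite /e1 divfK// gt_eqF.
have [dS dS0 HdS] := price_unif hS T e10.
have [dI dI0 HdI] := ito_int_unif_continuous hS T0 e10.
exists (Num.min dS dI) => [|s t i j s0 st tT]; first by rewrite lt_min dS0.
rewrite lt_min => /andP[h1 h2]; rewrite liftE.
have sT := le_trans st tT; have t0 := le_trans s0 st.
apply: le_trans (ler_normB _ _) _; rewrite normrM eE mulrDr mulr1.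
have ts : `|t - s| = t - s by rewrite ger0_norm ?subr_ge0.
apply: lerD; first by apply: HdI; rewrite ?ts.
rewrite mulrC; apply: ler_pM => //; first by apply: HdS; rewrite ?ts.
have /andP[g1 g2] := HB s i s0 sT.
by rewrite ger0_norm// ltW// (price_pos hS).
Qed.

(** All the bounds between arbitrary times are limits of those of
    [area_approx].  The square root of the area enters the modulus, so that
    [eta] scales like the path. *)
Lemma price_rough_driver T : (0 < d)%N -> 0 < T ->
  exists c eta, rough_driver T p S (Defs.lift S P) c eta.
Proof.
move=> d0 T0; have [c hc [Hp Ha]] := RIE_bounds T0.
have hS_tau s t i : 0 <= s -> s <= t -> t <= T -> `|S t 0 i - S s 0 i| <= tau p c s t.
  move=> s0 st tT; apply: (@le_trans _ _ (enorm (incr S s t))).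
    by have := enorm_coord (incr S s t) 0 i; rewrite !mxE.
  by apply: powR_le_root (Hp _ _ s0 st tT); rewrite ?enorm_ge0//; exact: (control_ge0 hc).
have chen s u t i j : Defs.lift S P s t i j = Defs.lift S P s u i j
    + Defs.lift S P u t i j + (S u 0 i - S s 0 i) * (S t 0 j - S u 0 j).
  by rewrite !liftE; ring.
have lift0 s i j : Defs.lift S P s s i j = 0 by rewrite liftE !subrr mulr0 subrr.
have hA_tau s t i j : 0 <= s -> s <= t -> t <= T ->
    `|Defs.lift S P s t i j| <= tau p c s t ^+ 2.
  move=> s0; rewrite le_eqVlt => /predU1P[<- _|st tT].
    by rewrite lift0 normr0 sqr_ge0.
  apply/ler_addgt0Pr => e e0.
  have [x [A [_ hA hAt _]]] := area_approx T0 hc Ha s0 st tT e0.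
  have := hA i j; have := hAt i j.
  have := ler_normB (A i j) (A i j - Defs.lift S P s t i j).
  by rewrite opprB addrC subrK; lra.
pose g (J : 'I_d + 'I_d * 'I_d) s t := match J with
  | inl i => `|S t 0 i - S s 0 i|
  | inr ij => Num.sqrt `|Defs.lift S P s t ij.1 ij.2| end.
have [||eta heta hg] := @modulus_exists R _ T p c g
  (inhabits (inl (Ordinal d0))) hc (ltW hp0).
- case=> [i|[i j]] u v u0 uv vT /=; first by rewrite normr_ge0 hS_tau.
  rewrite sqrtr_ge0 /= -[leRHS]ger0_norm ?tau_ge0// -[leRHS]sqrtr_sqr ler_wsqrtr//.
  exact: hA_tau.
- move=> k k0; have [dS dS0 HdS] := price_unif hS T k0.
  have k2 : 0 < k ^+ 2 by rewrite exprn_gt0.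
  have [dA dA0 HdA] := area_unif T0 k2.
  exists (Num.min dS dA) => [|J u v u0 uv vT]; first by rewrite lt_min dS0.
  rewrite lt_min => /andP[h1 h2].
  have vu : `|v - u| = v - u by rewrite ger0_norm ?subr_ge0.
  case: J => [i|[i j]] /=.
    by apply: HdS; rewrite ?vu//; [exact: le_trans vT|exact: le_trans uv].
  rewrite -[leRHS]ger0_norm ?(ltW k0)// -[leRHS]sqrtr_sqr ler_wsqrtr//.
  exact: HdA.
exists c, eta; split => //.
- by move=> s t i s0 st tT; exact: (hg (inl i)).
- move=> s t i j s0 st tT; rewrite -[leLHS]sqr_sqrtr//.
  rewrite lerXn2r ?nnegrE ?sqrtr_ge0//; first exact: le_trans (sqrtr_ge0 _) (hg (inr (i, j)) _ _ s0 st tT).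
  exact: (hg (inr (i, j))).
move=> s t v s0; rewrite le_eqVlt => /predU1P[<- _|st tT].
  by rewrite big1// => i _; rewrite big1// => j _; rewrite lift0 subrr; ring.
set Q := \sum_i _.
rewrite -oppr_le0; apply/ler_addgt0Pr => e e0; rewrite add0r.
pose W := \sum_i \sum_j `|v i * v j|.
have W0 : 0 <= W by apply: sumr_ge0 => i _; apply: sumr_ge0.
pose tt := tau p c s t.
have tt0 : 0 <= tt by exact: tau_ge0.
pose K := W * (2 * tt + 3) + 1.
have K0 : 0 < K by rewrite ltr_pwDr// mulr_ge0//; lra.
pose k := Num.min 1 (e / K).
have k0 : 0 < k by rewrite lt_min ltr01 divr_gt0.
have k1 : k <= 1 by rewrite ge_min lexx.
have ke : k * K <= e by rewrite -ler_pdivlMr// ge_min lexx orbT.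
have [x [A [hx hA hAt hv]]] := area_approx T0 hc Ha s0 st tT k0.
have h0 := hv v.
have : `|\sum_i \sum_j v i * v j * (x i * x j - 2 * A i j) - Q| <= W * (k * (2 * tt + 3)).
  rewrite /Q -sumrB /W mulr_suml; apply: le_trans (ler_norm_sum _ _ _) _.
  apply: ler_sum => i _; rewrite -sumrB mulr_suml.
  apply: le_trans (ler_norm_sum _ _ _) _; apply: ler_sum => j _.
  rewrite -mulrBr normrM ler_wpM2l//.
  have -> : x i * x j - 2 * A i j - ((S t 0 i - S s 0 i) * (S t 0 j - S s 0 j)
      - 2 * Defs.lift S P s t i j) = (x i - (S t 0 i - S s 0 i)) * (x j - (S t 0 j - S s 0 j))
      + (x i - (S t 0 i - S s 0 i)) * (S t 0 j - S s 0 j)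
      + (S t 0 i - S s 0 i) * (x j - (S t 0 j - S s 0 j))
      - 2 * (A i j - Defs.lift S P s t i j) by ring.
  have b1 : `|(x i - (S t 0 i - S s 0 i)) * (x j - (S t 0 j - S s 0 j))| <= k * 1.
    by rewrite normrM ler_pM// (le_trans (hx j)).
  have b2 : `|(x i - (S t 0 i - S s 0 i)) * (S t 0 j - S s 0 j)| <= k * tt.
    by rewrite normrM ler_pM// hS_tau// ltW.
  have b3 : `|(S t 0 i - S s 0 i) * (x j - (S t 0 j - S s 0 j))| <= tt * k.
    by rewrite normrM ler_pM// hS_tau// ltW.
  have b4 : `|2 * (A i j - Defs.lift S P s t i j)| <= 2 * k.
    by rewrite normrM (ger0_norm (x := 2))// ler_pM.
  apply: le_trans (ler_normB _ _) _.
  apply: le_trans (lerD (ler_normD _ _) (lexx _)) _.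
  apply: le_trans (lerD (lerD (ler_normD _ _) (lexx _)) (lexx _)) _.
  lra.
set Q' := \sum_i _ in h0 *; rewrite ler_norml => /andP[_ h].
have : W * (k * (2 * tt + 3)) <= k * K by rewrite /K; lra.
lra.
Qed.

End PriceRoughPath.

(** * Derivatives on the simplex *)

Local Notation basis := Defs.basis.

Section Derivatives.
Context {R : realType} {d : nat}.
Implicit Types (x y v : 'rV[R]_d).

Lemma is_derive_coord x v i : is_derive x v (fun y : 'rV[R]_d => y 0 i) (v 0 i).
Proof.
have di : derivable (id : 'rV[R]_d -> 'rV[R]_d) x v by exact: derivable_id.
apply: DeriveDef; first by move/derivable_mxP : di; exact.
by have := derive_mx di; rewrite derive_id => /matrixP/(_ 0 i); rewrite mxE => ->.
Qed.

Lemma is_derive_mulf (f g : 'rV[R]_d -> R) x v df dg :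
  is_derive x v f df -> is_derive x v g dg ->
  is_derive x v (fun y => f y * g y) (f x * dg + g x * df).
Proof. exact: is_deriveM. Qed.

Lemma is_derive_sumf n (h : 'I_n -> 'rV[R]_d -> R) x v dh :
  (forall i, is_derive x v (h i) (dh i)) ->
  is_derive x v (fun y => \sum_i h i y) (\sum_i dh i).
Proof.
move=> H; have -> : (fun y => \sum_i h i y) = \sum_i h i.
  by apply/funext => y; rewrite fct_sumE.
exact: is_derive_sum.
Qed.

Lemma is_derive_invf (f : 'rV[R]_d -> R) x v df : f x != 0 ->
  is_derive x v f df -> is_derive x v (fun y => (f y)^-1) (- (f x) ^- 2 * df).
Proof.
move=> fx0 [h1 h2]; apply: DeriveDef; first exact: derivableV.
by rewrite deriveV// h2.
Qed.

Lemma is_derive_entry n (f : 'rV[R]_d -> 'rV[R]_n) x v i :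
  derivable f x v -> is_derive x v (fun y => f y 0 i) (('D_v f x) 0 i).
Proof.
move=> df; apply: DeriveDef; first by move/derivable_mxP : df; exact.
by rewrite derive_mx// mxE.
Qed.

Lemma D_entry n (f : 'rV[R]_d -> 'rV[R]_n) x j (df : 'I_n -> R) :
  (forall i, is_derive x (basis j) (fun y => f y 0 i) (df i)) ->
  forall i, D f x i j = df i.
Proof.
move=> H i; rewrite mxE derive_mx ?mxE; last first.
  by apply/derivable_mxP => k l; rewrite ord1; case: (H l).
by case: (H i).
Qed.

Lemma basisE (j i : 'I_d) : (basis j : 'rV[R]_d) 0 i = (i == j)%:R.
Proof. by rewrite mxE eqxx. Qed.

Definition dnorm x (i j : 'I_d) : R :=
  ((i == j)%:R - normalize x 0 i) / \sum_k x 0 k.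

Lemma normalizeE x i : normalize x 0 i = x 0 i / \sum_k x 0 k.
Proof. by rewrite mxE mulrC. Qed.

Lemma D_normalize x i j : \sum_k x 0 k != 0 -> D normalize x i j = dnorm x i j.
Proof.
move=> s0; pose s y := \sum_k (y : 'rV[R]_d) 0 k.
have ds : is_derive x (basis j) s 1.
  have -> : (1 : R) = \sum_(k < d) (basis j : 'rV[R]_d) 0 k.
    rewrite (bigD1 j)//= basisE eqxx big1 ?addr0// => k kj.
    by rewrite basisE (negbTE kj).
  by apply: is_derive_sumf => k; exact: is_derive_coord.
have H k : is_derive x (basis j) (fun y : 'rV[R]_d => normalize y 0 k)
    ((s x)^-1 * (k == j)%:R + x 0 k * (- (s x) ^- 2 * 1)).
  rewrite (_ : (fun y => _) = fun y : 'rV[R]_d => (s y)^-1 * y 0 k); last first.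
    by apply/funext => y; rewrite mxE.
  apply: is_derive_mulf; first exact: is_derive_invf.
  by rewrite -basisE; exact: is_derive_coord.
by rewrite (D_entry H) /dnorm normalizeE -/(s x); field.
Qed.

Lemma D_inv x i j : (forall k, x 0 k != 0) ->
  D (map_mx GRing.inv) x i j = - (i == j)%:R / x 0 i ^+ 2.
Proof.
move=> x0; have H k : is_derive x (basis j) (fun y : 'rV[R]_d => map_mx GRing.inv y 0 k)
    (- (x 0 k) ^- 2 * (k == j)%:R).
  rewrite (_ : (fun y => _) = fun y : 'rV[R]_d => (y 0 k)^-1); last first.
    by apply/funext => y; rewrite mxE.
  by apply: is_derive_invf => //; rewrite -basisE; exact: is_derive_coord.
by rewrite (D_entry H) /= !mulNr mulrC.
Qed.

Lemma D_portfolio_map (F : 'rV[R]_d -> 'rV[R]_d) x i j : differentiable F x ->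
  D (portfolio_map F) x i j =
  (i == j)%:R * (F x 0 i + 1 - \sum_k x 0 k * F x 0 k)
  + x 0 i * (D F x i j - F x 0 j - \sum_k x 0 k * D F x k j).
Proof.
move=> dF; pose w y := \sum_k (y : 'rV[R]_d) 0 k * F y 0 k.
have dFe k : is_derive x (basis j) (fun y => F y 0 k) (D F x k j).
  by rewrite mxE; apply: is_derive_entry; exact: diff_derivable.
have dw : is_derive x (basis j) w
    (\sum_k (x 0 k * D F x k j + F x 0 k * (k == j)%:R)).
  apply: is_derive_sumf => k; apply: is_derive_mulf => //.
  by rewrite -basisE; exact: is_derive_coord.
have H k : is_derive x (basis j) (fun y => portfolio_map F y 0 k)
    (x 0 k * (D F x k j + 0
       - \sum_k (x 0 k * D F x k j + F x 0 k * (k == j)%:R))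
     + (F x 0 k + 1 - w x) * (k == j)%:R).
  rewrite (_ : (fun y => _) =
      fun y : 'rV[R]_d => y 0 k * (F y 0 k + 1 - w y)); last first.
    by apply/funext => y; rewrite mxE.
  apply: is_derive_mulf; last by rewrite -basisE; exact: is_derive_coord.
rewrite (D_entry H) big_split/=.
have -> : \sum_k F x 0 k * (k == j)%:R = F x 0 j.
  rewrite (bigD1 j)//= eqxx mulr1 big1 ?addr0// => k kj.
  by rewrite (negbTE kj) mulr0.
by rewrite /w; ring.
Qed.

Lemma derive_basis n (G : 'rV[R]_d -> 'rV[R]_n) x v i : differentiable G x ->
  ('D_v G x) 0 i = \sum_k v 0 k * ('D_(basis k) G x) 0 i.
Proof.
move=> dG; rewrite deriveE// {1}(row_sum_delta v) linear_sum summxE.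
by apply: eq_bigr => k _; rewrite linearZ mxE deriveE.
Qed.

(** The intermediate point depends on the coordinate [i]: there is no mean value
    theorem for vector-valued maps. *)
Lemma MVT_line n (G : 'rV[R]_d -> 'rV[R]_n) x y i :
  (forall z, differentiable G z) ->
  exists2 t, 0 <= t <= 1 & G y 0 i - G x 0 i =
    \sum_k (y 0 k - x 0 k) * ('D_(basis k) G (x + t *: (y - x))) 0 i.
Proof.
move=> dG; set v := y - x.
pose f (t : R) := G (x + t *: v) 0 i.
have df (t : R) : is_derive t (1 : R) f ('D_v G (x + t *: v) 0 i).
  have [h1 h2] := is_derive_entry i (@diff_derivable _ _ _ _ _ v (dG (x + t *: v))).
  have E : (fun h : R => h^-1 *: ((f \o shift t) (h *: (1 : R)) - f t)) =
      (fun h : R => h^-1 *: (((fun y => G y 0 i) \o shift (x + t *: v)) (h *: v)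
         - G (x + t *: v) 0 i)).
    apply/funext => h /=; congr (_ *: (_ - _)).
    have -> : h *: (1 : R) = h by exact: mulr1.
    by rewrite /f scalerDl addrCA.
  apply: DeriveDef; first by rewrite /derivable E.
  by rewrite /derive E.
have cf : {within `[0, 1], continuous f}.
  apply: continuous_subspaceT => t.
  by apply: differentiable_continuous; apply/derivable1_diffP; case: (df t).
have [t + E] := @MVT_segment R f _ 0 1 ler01 (fun t _ => df t) cf.
rewrite in_itv/= => ht; exists t => //.
have <- : f 1 - f 0 = G y 0 i - G x 0 i.
  by rewrite /f scale1r scale0r addr0 /v (addrC x) subrK.
rewrite E subr0 mulr1 derive_basis//.
by apply: eq_bigr => k _; rewrite /v !mxE.
Qed.

End Derivatives.

Section SimplexTaylor.
Context {R : realType} {d : nat}.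
Implicit Types (x y : 'rV[R]_d) (F G H : 'rV[R]_d -> 'rV[R]_d).

Lemma simplex_convex x y (t : R) : simplex x -> simplex y -> 0 <= t <= 1 ->
  simplex (x + t *: (y - x)).
Proof.
move=> [x0 x1] [y0 y1] /andP[t0 t1]; split=> [i|].
  rewrite !mxE; have -> : x 0 i + t * (y 0 i - x 0 i) = (1 - t) * x 0 i + t * y 0 i by ring.
  by rewrite addr_ge0// mulr_ge0// subr_ge0.
under eq_bigr do rewrite !mxE.
by rewrite big_split/= -mulr_sumr sumrB x1 y1 subrr mulr0 addr0.
Qed.

Definition twice_diff F : Prop :=
  (forall x, differentiable F x) /\
  (forall v x, differentiable ('D_v F) x).

Lemma C2_twice_diff F : C2 F -> twice_diff F.
Proof. by move=> [h1 h2]; split=> // v x; case: (h2 v). Qed.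

Lemma derive_sub F G v : twice_diff F -> twice_diff G ->
  'D_v (F - G) = 'D_v F - 'D_v G.
Proof.
move=> [dF _] [dG _]; apply/funext => x.
by rewrite deriveB//; exact: diff_derivable.
Qed.

Lemma twice_diff_sub F G : twice_diff F -> twice_diff G -> twice_diff (F - G).
Proof.
move=> hF hG; have [hF1 hF2] := hF; have [hG1 hG2] := hG; split=> [x|v x].
  exact: differentiableB (hF1 x) (hG1 x).
rewrite (derive_sub v hF hG); exact: differentiableB (hF2 v x) (hG2 v x).
Qed.

Lemma D_sub F G x i j : twice_diff F -> twice_diff G ->
  D (F - G) x i j = D F x i j - D G x i j.
Proof.
move=> [hF _] [hG _]; rewrite !mxE deriveB; last 2 first.
- exact: diff_derivable (hF _).
- exact: diff_derivable (hG _).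
by rewrite !mxE.
Qed.

Lemma D2_sub F G x ijk : twice_diff F -> twice_diff G ->
  D2 (F - G) x ijk = D2 F x ijk - D2 G x ijk.
Proof.
move=> hF hG; have [_ hF2] := hF; have [_ hG2] := hG.
rewrite /D2 (derive_sub _ hF hG) deriveB; last 2 first.
- exact: diff_derivable (hF2 _ _).
- exact: diff_derivable (hG2 _ _).
by rewrite !mxE.
Qed.

(** The C2 norm, up to a dimensional constant. *)
Definition C2_le (M : R) H : Prop := forall x, simplex x -> forall i j k,
  [/\ `|H x 0 i| <= M, `|D H x i j| <= M & `|D2 H x (i, j, k)| <= M].

Definition dist1 x y : R := \sum_k `|y 0 k - x 0 k|.

Lemma dist1_ge0 x y : 0 <= dist1 x y.
Proof. exact: sumr_ge0. Qed.

(** Convexity of the simplex keeps the intermediate point where the derivative is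
    bounded. *)
Lemma MVT_simplex H (M : R) x y i : (forall z, differentiable H z) ->
  (forall z j, simplex z -> `|('D_(basis j) H z) 0 i| <= M) ->
  simplex x -> simplex y -> `|H y 0 i - H x 0 i| <= M * dist1 x y.
Proof.
move=> dH hM sx sy; have [t t01 ->] := MVT_line x y i dH.
rewrite /dist1 mulr_sumr; apply: le_trans (ler_norm_sum _ _ _) _.
apply: ler_sum => k _; rewrite normrM mulrC ler_wpM2r// hM//.
exact: simplex_convex.
Qed.

Variables (H : 'rV[R]_d -> 'rV[R]_d) (M : R).
Hypotheses (hH : twice_diff H) (hM : C2_le M H).

Lemma C2_lipschitz x y i : simplex x -> simplex y ->
  `|H y 0 i - H x 0 i| <= M * dist1 x y.
Proof.
apply: MVT_simplex; first by case: hH.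
by move=> z j sz; have [_ + _] := hM sz i j j; rewrite mxE.
Qed.

Lemma D_lipschitz x y i j : simplex x -> simplex y ->
  `|D H y i j - D H x i j| <= M * dist1 x y.
Proof.
have [_ dH2] := hH; rewrite !mxE.
apply: (@MVT_simplex ('D_(basis j) H) M x y i (dH2 (basis j))).
by move=> z k sz; have [_ _] := hM sz i j k.
Qed.

Lemma C2_taylor x y i : simplex x -> simplex y ->
  `|H y 0 i - H x 0 i - \sum_j D H x i j * (y 0 j - x 0 j)| <= M * dist1 x y ^+ 2.
Proof.
move=> sx sy; have [dH _] := hH; have [t t01 ->] := MVT_line x y i dH.
have sz := simplex_convex sx sy t01; set z := x + _ in sz *.
rewrite -sumrB expr2 mulrA {2}/dist1 mulr_sumr.
apply: le_trans (ler_norm_sum _ _ _) _; apply: ler_sum => k _.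
have -> : (y 0 k - x 0 k) * ('D_(basis k) H z) 0 i - D H x i k * (y 0 k - x 0 k)
   = (D H z i k - D H x i k) * (y 0 k - x 0 k) by rewrite !mxE; ring.
rewrite normrM ler_wpM2r//; apply: le_trans (D_lipschitz i k sx sz) _.
have [_ h _] := hM sx i k k; have M0 : 0 <= M := le_trans (normr_ge0 _) h.
rewrite ler_wpM2l// /dist1 ler_sum// => l _; rewrite /z !mxE addrAC subrr add0r.
rewrite normrM; case/andP: t01 => t0 t1.
by rewrite ger0_norm// ler_piMl.
Qed.

End SimplexTaylor.

(** * The algebra of the change of numeraire *)

Section ItoIdentity.
Context {R : realType} {d : nat}.
Variables (x : 'rV[R]_d) (phi : 'I_d -> R) (Psi : 'I_d -> 'I_d -> R).
Hypothesis x0 : forall k, x 0 k != 0.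

Let sigma := \sum_k x 0 k.
Hypothesis s0 : sigma != 0.
Let m k := normalize x 0 k.

(** The portfolio [mu (phi + 1 - <mu, phi>)] and its Gubinelli derivative, when
    [phi] has derivative [Psi] with respect to [mu]. *)
Definition gen_pi k : R :=
  normalize x 0 k * (phi k + 1 - \sum_l normalize x 0 l * phi l).

Definition gen_dpi k l : R :=
  (k == l)%:R * (phi k + 1 - \sum_j normalize x 0 j * phi j)
  + normalize x 0 k * (Psi k l - phi l - \sum_j normalize x 0 j * Psi j l).

Let f k := phi k - \sum_l m l * phi l.
Let g k l := Psi k l - \sum_j m j * Psi j l.

Lemma sum_delta_l (h : 'I_d -> R) k : \sum_l h l * (l == k)%:R = h k.
Proof.
rewrite (bigD1 k)//= eqxx mulr1 big1 ?addr0// => l lk.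
by rewrite (negbTE lk) mulr0.
Qed.

Lemma sum_dnorm (h : 'I_d -> R) k :
  \sum_l h l * dnorm x l k = (h k - \sum_l m l * h l) / sigma.
Proof.
rewrite -{1}(sum_delta_l h k) -sumrB mulr_suml; apply: eq_bigr => l _.
by rewrite /dnorm -/sigma -/(m l); ring.
Qed.

Lemma gen_piE k : gen_pi k / x 0 k = (1 + f k) / sigma.
Proof.
rewrite /gen_pi normalizeE -/sigma; under eq_bigr do rewrite -/(m _).
by rewrite /f; field; rewrite x0 s0.
Qed.

(** If [phi] is the gradient of the logarithm of G, then [gen_pi k / x 0 k] is that
    of the logarithm of f(x) = sigma G(x / sigma), and both sides are D^2 f / f:
    the terms in D G cancel as f is homogeneous. *)
Lemma dnorm_contract k l :
  \sum_j gen_dpi k j * dnorm x j l / x 0 k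
  - gen_pi k * (k == l)%:R / x 0 k ^+ 2 + gen_pi k / x 0 k * (gen_pi l / x 0 l)
  = \sum_i \sum_j (Psi i j + phi i * phi j) * dnorm x i k * dnorm x j l.
Proof.
have -> : \sum_i \sum_j (Psi i j + phi i * phi j) * dnorm x i k * dnorm x j l
    = (\sum_j g k j * dnorm x j l) / sigma + f k * f l / sigma ^+ 2.
  transitivity (\sum_j (\sum_i Psi i j * dnorm x i k) * dnorm x j l
     + (\sum_i phi i * dnorm x i k) * (\sum_j phi j * dnorm x j l)).
    have r1 : \sum_j (\sum_i Psi i j * dnorm x i k) * dnorm x j l
        = \sum_i \sum_j Psi i j * dnorm x i k * dnorm x j l.
      by rewrite exchange_big/=; apply: eq_bigr => j _; rewrite mulr_suml.
    rewrite r1 mulr_suml -big_split/=; apply: eq_bigr => i _.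
    rewrite mulr_sumr -big_split/=; apply: eq_bigr => j _; ring.
  rewrite (sum_dnorm phi k) (sum_dnorm phi l); congr (_ + _); last by rewrite /f; field.
  rewrite mulr_suml; apply: eq_bigr => j _.
  by rewrite (sum_dnorm (Psi^~ j) k) /g; ring.
have -> : \sum_j gen_dpi k j * dnorm x j l / x 0 k =
    (f k + 1) * dnorm x k l / x 0 k
    + (\sum_j g k j * dnorm x j l - f l / sigma) / sigma.
  transitivity ((\sum_j ((f k + 1) * (j == k)%:R + m k * (g k j - phi j)) * dnorm x j l) / x 0 k).
    rewrite mulr_suml; apply: eq_bigr => j _; rewrite /gen_dpi -/(m k) eq_sym /f /g.
    by under eq_bigr do rewrite -/(m _); ring.
  under eq_bigr do rewrite mulrDl.
  rewrite big_split/=.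
  have -> : \sum_j (f k + 1) * (j == k)%:R * dnorm x j l = (f k + 1) * dnorm x k l.
    rewrite -(sum_delta_l (fun j => (f k + 1) * dnorm x j l)).
    by apply: eq_bigr => j _; ring.
  have -> : \sum_j m k * (g k j - phi j) * dnorm x j l
      = m k * (\sum_j g k j * dnorm x j l - f l / sigma).
    rewrite /f -sum_dnorm -sumrB mulr_sumr; apply: eq_bigr => j _; ring.
  by rewrite /m normalizeE -/sigma; field; rewrite x0 s0.
have pE : gen_pi k = (1 + f k) / sigma * x 0 k by rewrite -gen_piE divfK.
rewrite !gen_piE pE.
rewrite /dnorm -/sigma normalizeE -/sigma; field.
by rewrite x0 s0.
Qed.

Variables (del : 'I_d -> R) (SS : 'I_d -> 'I_d -> R).

Let delta := \sum_k del k.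
Let y k := \sum_l dnorm x k l * del l.
Let B k l := \sum_i \sum_j dnorm x k i * dnorm x l j * SS i j.

(** To second order the logarithmic wealth of the portfolio generated by [phi] is
    that of the whole market plus the logarithmic relative wealth of [phi] in
    the coordinates [mu].  The terms in [del] agree because both sides have the
    form [w - w ^+ 2 / 2] with [w = delta / sigma + sum phi y], and the terms in
    [SS] agree coefficient by coefficient by [dnorm_contract]. *)
Lemma ito_identity :
  \sum_k gen_pi k / x 0 k * del k
  + \sum_k \sum_l (\sum_j gen_dpi k j * dnorm x j l / x 0 k
       - gen_pi k * (k == l)%:R / x 0 k ^+ 2) * SS l k
  - 2^-1 * \sum_k \sum_l gen_pi k / x 0 k * (gen_pi l / x 0 l)
       * (del k * del l - SS k l - SS l k)
  = delta / sigma - (delta / sigma) ^+ 2 / 2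
    + \sum_k phi k * (y k - y k * (delta / sigma))
    + \sum_k \sum_l Psi k l * B l k
    - 2^-1 * \sum_k \sum_l phi k * phi l * (y k * y l - B k l - B l k).
Proof.
set q := fun k l => gen_pi k / x 0 k * (gen_pi l / x 0 l).
set u := \sum_k phi k * y k.
have yE k : y k = (del k - m k * delta) / sigma.
  rewrite /y /delta mulr_sumr -{1}(sum_delta_l del k) -sumrB mulr_suml.
  by apply: eq_bigr => l _; rewrite /dnorm -/sigma -/(m k) eq_sym; ring.
have w1 : \sum_k gen_pi k / x 0 k * del k = delta / sigma + u.
  under eq_bigr do rewrite gen_piE.
  have -> : u = (\sum_k f k * del k) / sigma.
    rewrite /u; under eq_bigr do rewrite yE.
    transitivity ((\sum_k phi k * del k - (\sum_l m l * phi l) * delta) / sigma).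
      rewrite (mulr_suml _ _ _ delta) -sumrB mulr_suml; apply: eq_bigr => k _; ring.
    congr (_ / _); rewrite /delta mulr_sumr -sumrB.
    by apply: eq_bigr => k _; rewrite /f; ring.
  rewrite /delta -mulrDl -big_split/= mulr_suml; apply: eq_bigr => k _; ring.
have sq (h k : 'I_d -> R) :
    \sum_i \sum_j h i * h j * (k i * k j) = (\sum_i h i * k i) ^+ 2.
  rewrite expr2 mulr_suml; apply: eq_bigr => i _; rewrite mulr_sumr.
  by apply: eq_bigr => j _; ring.
have sym2 (h G : 'I_d -> 'I_d -> R) : (forall i j, h i j = h j i) ->
    \sum_i \sum_j h i j * (G i j + G j i) = 2 * \sum_i \sum_j h i j * G j i.
  move=> hs.
  have e : \sum_i \sum_j h i j * G i j = \sum_i \sum_j h i j * G j i.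
    rewrite exchange_big/=; apply: eq_bigr => i _; apply: eq_bigr => j _.
    by rewrite hs.
  transitivity (\sum_i \sum_j h i j * G i j + \sum_i \sum_j h i j * G j i).
    rewrite -big_split/=; apply: eq_bigr => i _; rewrite -big_split/=.
    by apply: eq_bigr => j _; rewrite mulrDr.
  by rewrite e; ring.
have e1 : \sum_k \sum_l q k l * (del k * del l - SS k l - SS l k)
   = (delta / sigma + u) ^+ 2 - 2 * \sum_k \sum_l q k l * SS l k.
  rewrite -w1 -sq -sym2; last by move=> i j; rewrite /q; ring.
  rewrite -sumrB; apply: eq_bigr => i _; rewrite -sumrB.
  by apply: eq_bigr => j _; rewrite /q; ring.
have e2 : \sum_k \sum_l phi k * phi l * (y k * y l - B k l - B l k)
   = u ^+ 2 - 2 * \sum_k \sum_l phi k * phi l * B l k.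
  rewrite -sq -sym2; last by move=> i j; ring.
  rewrite -sumrB; apply: eq_bigr => i _; rewrite -sumrB.
  by apply: eq_bigr => j _; ring.
have e3 : \sum_k phi k * (y k - y k * (delta / sigma)) = u - u * (delta / sigma).
  by rewrite /u mulr_suml -sumrB; apply: eq_bigr => k _; ring.
have e4 : \sum_k \sum_l (\sum_j gen_dpi k j * dnorm x j l / x 0 k
       - gen_pi k * (k == l)%:R / x 0 k ^+ 2) * SS l k
   + \sum_k \sum_l q k l * SS l k
   = \sum_k \sum_l Psi k l * B l k + \sum_k \sum_l phi k * phi l * B l k.
  transitivity (\sum_k \sum_l
      (\sum_i \sum_j (Psi i j + phi i * phi j) * dnorm x i k * dnorm x j l) * SS l k).
    rewrite -big_split/=; apply: eq_bigr => k _; rewrite -big_split/=.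
    by apply: eq_bigr => l _; rewrite -mulrDl -dnorm_contract.
  transitivity (\sum_i \sum_j (Psi i j + phi i * phi j) * B j i); last first.
    rewrite -big_split/=; apply: eq_bigr => i _; rewrite -big_split/=.
    by apply: eq_bigr => j _; ring.
  transitivity (\sum_k \sum_l \sum_i \sum_j
      (Psi i j + phi i * phi j) * (dnorm x j l * dnorm x i k * SS l k)).
    apply: eq_bigr => k _; apply: eq_bigr => l _; rewrite mulr_suml.
    apply: eq_bigr => i _; rewrite mulr_suml; apply: eq_bigr => j _; ring.
  under eq_bigr do rewrite exchange_big/=.
  rewrite exchange_big/=; apply: eq_bigr => i _.
  under eq_bigr do rewrite exchange_big/=.
  rewrite exchange_big/=; apply: eq_bigr => j _.
  rewrite /B mulr_sumr exchange_big/=; apply: eq_bigr => l _.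
  by rewrite mulr_sumr.
rewrite e1 e2 e3 w1.
transitivity (delta / sigma + u - (delta / sigma + u) ^+ 2 / 2
  + (\sum_k \sum_l Psi k l * B l k + \sum_k \sum_l phi k * phi l * B l k)).
  by rewrite -e4; field.
by field.
Qed.

End ItoIdentity.

(** * Local expansions of the market *)

Section Expansions.
Context {R : realType} {d : nat}.
Variables (p T B : R) (S : R -> 'rV[R]_d) (A : R -> R -> 'M[R]_d).
Variables (c eta : R -> R -> R).
Hypothesis hd : (0 < d)%N.
Hypothesis hp : 2 < p < 3.
Hypothesis hr : rough_driver T p S A c eta.
Hypothesis B0 : 0 < B.
Hypothesis hB : forall t i, 0 <= t -> t <= T -> B^-1 <= S t 0 i <= B.

Local Notation tau := (tau p c).
Local Notation E := (err p c eta).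
Let hc := driver_control hr.
Let hm := driver_modulus hr.

Definition total (t : R) : R := \sum_k S t 0 k.

Lemma price_gt0 t i : 0 <= t -> t <= T -> 0 < S t 0 i.
Proof.
by move=> t0 tT; have /andP[h _] := hB i t0 tT; apply: lt_le_trans h; rewrite invr_gt0.
Qed.

Lemma total_bounds t : 0 <= t -> t <= T -> d%:R * B^-1 <= total t <= d%:R * B.
Proof.
move=> t0 tT.
have e (x : R) : d%:R * x = \sum_(k < d) x by rewrite sumr_const card_ord mulr_natl.
by rewrite !e; apply/andP; split; apply: ler_sum => i _; case/andP: (hB i t0 tT).
Qed.

Lemma total_gt0 t : 0 <= t -> t <= T -> 0 < total t.
Proof.
move=> t0 tT; have /andP[h _] := total_bounds t0 tT; apply: lt_le_trans h.
by rewrite mulr_gt0 ?invr_gt0// ltr0n.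
Qed.

Lemma mu_simplex t : 0 <= t -> t <= T -> simplex (mu S t).
Proof.
move=> t0 tT; have s0 := total_gt0 t0 tT; split=> [i|].
  by rewrite normalizeE divr_ge0 ?ltW// price_gt0.
by under eq_bigr do rewrite normalizeE; rewrite -mulr_suml divff// gt_eqF.
Qed.

Lemma mu_le1 t i : 0 <= t -> t <= T -> `|mu S t 0 i| <= 1.
Proof.
move=> t0 tT; have [h0 h1] := mu_simplex t0 tT; rewrite ger0_norm//.
by rewrite -h1 (bigD1 i)//= lerDl sumr_ge0.
Qed.

Section Spans.
Context {I : Type}.
Variable D : set I.

Definition times (u : I -> R) : Prop := forall i, D i -> 0 <= u i /\ u i <= T.

Definition spans (s t : I -> R) : Prop :=
  forall i, D i -> [/\ 0 <= s i, s i <= t i & t i <= T].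

Lemma spans_l s t : spans s t -> times s.
Proof. by move=> h i /h[h1 h2 h3]; split=> //; exact: le_trans h3. Qed.

Lemma spans_r s t : spans s t -> times t.
Proof. by move=> h i /h[h1 h2 h3]; split=> //; exact: le_trans h2. Qed.

Section Times.
Variable u : I -> R.
Hypothesis hu : times u.

Lemma O_S k : bO D (fun i => S (u i) 0 k) (fun=> 1).
Proof.
exists B => [|i /hu[u0 uT]]; first exact: ltW.
have /andP[_ h] := hB k u0 uT.
by rewrite mulr1 ger0_norm// ltW// price_gt0.
Qed.

Lemma O_Sinv k : bO D (fun i => (S (u i) 0 k)^-1) (fun=> 1).
Proof.
exists B => [|i /hu[u0 uT]]; first exact: ltW.
have /andP[h _] := hB k u0 uT; have S0 := price_gt0 k u0 uT.
by rewrite mulr1 ger0_norm ?invr_ge0 ?(ltW S0)// invf_ple// posrE.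
Qed.

Lemma O_totalV : bO D (fun i => (total (u i))^-1) (fun=> 1).
Proof.
exists (d%:R * B^-1)^-1 => [|i /hu[u0 uT]].
  by rewrite invr_ge0 mulr_ge0// invr_ge0 ltW.
have /andP[h _] := total_bounds u0 uT; have S0 := total_gt0 u0 uT.
rewrite mulr1 ger0_norm ?invr_ge0 ?(ltW S0)// lef_pV2// posrE//.
by rewrite mulr_gt0 ?invr_gt0// ltr0n.
Qed.

Lemma O_mu k : bO D (fun i => mu S (u i) 0 k) (fun=> 1).
Proof. by exists 1 => // i /hu[u0 uT]; rewrite mulr1 mu_le1. Qed.

Lemma O_dnorm k l : bO D (fun i => dnorm (S (u i)) k l) (fun=> 1).
Proof.
apply: bO_Ml; last exact: O_totalV.
by apply: bO_B; [exact: bO_cst|exact: O_mu].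
Qed.

End Times.

Section Increments.
Variables s t : I -> R.
Hypothesis hst : spans s t.
Let hs := spans_l hst.
Let ht := spans_r hst.

Lemma eta_bounds i : D i -> 0 <= eta (s i) (t i) <= tau (s i) (t i).
Proof. by move=> /hst[s0 st tT]; have [h _ _] := hm; exact: h. Qed.

Lemma O_eta_tau : bO D (fun i => eta (s i) (t i)) (fun i => tau (s i) (t i)).
Proof. by apply: bO_le => i /eta_bounds/andP[h1 h2]; rewrite ger0_norm. Qed.

Lemma O_tau : bO D (fun i => tau (s i) (t i)) (fun=> 1).
Proof.
exists (tau 0 T) => [|i /hst[s0 st tT]]; first exact: tau_ge0.
rewrite mulr1 ger0_norm ?tau_ge0//.
have p0 : 0 <= p by case/andP: hp => h _; apply: ltW; exact: lt_trans h.
by have := tau_mono hc p0 (lexx 0) s0 st tT (lexx T).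
Qed.

Lemma O_eta : bO D (fun i => eta (s i) (t i)) (fun=> 1).
Proof. exact: bO_trans O_eta_tau O_tau. Qed.

Lemma O_eta_tau2 : bO D (fun i => tau (s i) (t i) ^+ 2 * eta (s i) (t i))
  (fun i => E (s i) (t i)).
Proof.
apply: bO_le => i Di; have /andP[h1 h2] := eta_bounds Di.
rewrite ger0_norm; last by rewrite mulr_ge0// sqr_ge0.
by have [s0 st tT] := hst Di; exact: (eta_tau2_err hp hm).
Qed.

Lemma O_eta2_tau2 : bO D (fun i => eta (s i) (t i) ^+ 2)
  (fun i => tau (s i) (t i) ^+ 2).
Proof. exact: bO_X O_eta_tau. Qed.

Lemma O_eta3 : bO D (fun i => eta (s i) (t i) ^+ 3) (fun i => E (s i) (t i)).
Proof.
apply: bO_trans O_eta_tau2.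
apply: (eq_bO (x' := fun i => eta (s i) (t i) ^+ 2 * eta (s i) (t i))).
  by move=> i _; rewrite exprSr.
apply: bO_M; first exact: O_eta2_tau2.
by apply: bO_le => i /eta_bounds/andP[h _]; rewrite ger0_norm.
Qed.

Lemma O_E_tau3 : bO D (fun i => E (s i) (t i)) (fun i => tau (s i) (t i) ^+ 3).
Proof.
apply: bO_le => i /hst[s0 st tT]; rewrite ger0_norm; last exact: err_ge0.
exact: (err_tau3 hp hm).
Qed.

Lemma O_E_tau2 : bO D (fun i => E (s i) (t i)) (fun i => tau (s i) (t i) ^+ 2).
Proof.
apply: bO_trans O_E_tau3 _.
apply: (eq_bO (x' := fun i => tau (s i) (t i) * tau (s i) (t i) ^+ 2)).
  by move=> i _; rewrite exprS.
apply: bO_Ml; first exact: O_tau.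
by apply: bO_le => i _; rewrite ger0_norm// sqr_ge0.
Qed.

Lemma O_tau2_tau : bO D (fun i => tau (s i) (t i) ^+ 2) (fun i => tau (s i) (t i)).
Proof.
apply: (eq_bO (x' := fun i => tau (s i) (t i) * tau (s i) (t i))).
  by move=> i _; rewrite expr2.
apply: bO_Ml; first exact: O_tau.
by apply: bO_le => i _; rewrite ger0_norm// tau_ge0.
Qed.

Lemma O_E : bO D (fun i => E (s i) (t i)) (fun=> 1).
Proof.
exact: bO_trans O_E_tau2 (bO_trans O_tau2_tau O_tau).
Qed.

Lemma O_dS k : bO D (fun i => S (t i) 0 k - S (s i) 0 k) (fun i => eta (s i) (t i)).
Proof. by apply: bO_le => i /hst[s0 st tT]; exact: (driver_path hr). Qed.

Lemma O_area k l : bO D (fun i => A (s i) (t i) k l) (fun i => eta (s i) (t i) ^+ 2).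
Proof. by apply: bO_le => i /hst[s0 st tT]; exact: (driver_area hr). Qed.

Let eta_ge0 i : D i -> 0 <= eta (s i) (t i).
Proof. by move=> /eta_bounds/andP[]. Qed.

Definition dtotal i : R := \sum_k (S (t i) 0 k - S (s i) 0 k).

Lemma dtotalE i : dtotal i = total (t i) - total (s i).
Proof. by rewrite /dtotal sumrB. Qed.

Lemma O_dtotal : bO D dtotal (fun i => eta (s i) (t i)).
Proof. by apply: bO_sum => // k; exact: O_dS. Qed.

Lemma O_dtotal_rel : bO D (fun i => dtotal i / total (s i)) (fun i => eta (s i) (t i)).
Proof. by apply: bO_Mr; [exact: O_dtotal|exact: O_totalV]. Qed.

Definition dmu1 k i : R := \sum_l dnorm (S (s i)) k l * (S (t i) 0 l - S (s i) 0 l).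

Lemma dmu1E k i : dmu1 k i =
  (S (t i) 0 k - S (s i) 0 k - mu S (s i) 0 k * dtotal i) / total (s i).
Proof.
rewrite /dmu1 /dtotal mulr_sumr -{1}(sum_delta_l (fun l => S (t i) 0 l - S (s i) 0 l) k).
rewrite -sumrB mulr_suml.
by apply: eq_bigr => l _; rewrite /dnorm -/(total _) -/(mu S _) eq_sym; ring.
Qed.

Lemma O_dmu1 k : bO D (dmu1 k) (fun i => eta (s i) (t i)).
Proof.
by apply: bO_sum => // l; apply: bO_Ml; [exact: O_dnorm|exact: O_dS].
Qed.

(** The quotient is expanded to second order: to first order the market portfolio
    moves by [dmu1], which is then divided by the new total rather than the old. *)
Lemma mu_expand k : bO D (fun i => mu S (t i) 0 k - mu S (s i) 0 k
    - (dmu1 k i - dmu1 k i * (dtotal i / total (s i))))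
  (fun i => eta (s i) (t i) ^+ 3).
Proof.
apply: (eq_bO (x' := fun i => dmu1 k i * (dtotal i / total (s i))
    * (dtotal i / total (t i)))).
  move=> i Di; have [u0 uT] := hs Di; have [v0 vT] := ht Di.
  have su := lt0r_neq0 (total_gt0 u0 uT); have sv := lt0r_neq0 (total_gt0 v0 vT).
  rewrite dmu1E dtotalE !normalizeE -!/(total _).
  by field; rewrite su sv.
apply: (@bO_leT _ _ _ (fun i => eta (s i) (t i) * eta (s i) (t i) * eta (s i) (t i))).
  apply: bO_M; last by apply: bO_Mr; [exact: O_dtotal|exact: O_totalV].
  by apply: bO_M; [exact: O_dmu1|exact: O_dtotal_rel].
by move=> i _; rewrite -expr2 -exprSr.
Qed.

Lemma mu_linear k : bO D (fun i => mu S (t i) 0 k - mu S (s i) 0 k - dmu1 k i)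
  (fun i => eta (s i) (t i) ^+ 2).
Proof.
apply: (eq_bO (x' := fun i => mu S (t i) 0 k - mu S (s i) 0 k
    - (dmu1 k i - dmu1 k i * (dtotal i / total (s i)))
    - dmu1 k i * (dtotal i / total (s i)))); first by move=> i _; ring.
apply: bO_B.
  apply: bO_trans (mu_expand k) _.
  apply: (eq_bO (x' := fun i => eta (s i) (t i) * eta (s i) (t i) ^+ 2)).
    by move=> i _; rewrite exprS.
  apply: bO_Ml; first exact: O_eta.
  by apply: bO_le => i _; rewrite ger0_norm// sqr_ge0.
apply: bO_leT (bO_M (O_dmu1 k) O_dtotal_rel) _ => i _.
by rewrite expr2.
Qed.

Lemma O_eta2 : bO D (fun i => eta (s i) (t i) ^+ 2) (fun i => eta (s i) (t i)).
Proof.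
apply: (eq_bO (x' := fun i => eta (s i) (t i) * eta (s i) (t i))).
  by move=> i _; rewrite expr2.
apply: bO_Ml; first exact: O_eta.
by apply: bO_le => i Di; rewrite ger0_norm// eta_ge0.
Qed.

Lemma O_dmu k : bO D (fun i => mu S (t i) 0 k - mu S (s i) 0 k)
  (fun i => eta (s i) (t i)).
Proof.
apply: (eq_bO (x' := fun i => mu S (t i) 0 k - mu S (s i) 0 k - dmu1 k i
   + dmu1 k i)); first by move=> i _; ring.
by apply: bO_D; [exact: bO_trans (mu_linear k) O_eta2|exact: O_dmu1].
Qed.

Lemma O_dtotalV : bO D (fun i => (total (t i))^-1 - (total (s i))^-1)
  (fun i => eta (s i) (t i)).
Proof.
apply: (eq_bO (x' := fun i => - (dtotal i / total (s i)) * (total (t i))^-1)).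
  move=> i Di; have [u0 uT] := hs Di; have [v0 vT] := ht Di.
  have su := lt0r_neq0 (total_gt0 u0 uT); have sv := lt0r_neq0 (total_gt0 v0 vT).
  by rewrite dtotalE; field; rewrite su sv.
by apply: bO_Mr; [apply: bO_N; exact: O_dtotal_rel|exact: O_totalV].
Qed.

Lemma O_ddnorm k l : bO D (fun i => dnorm (S (t i)) k l - dnorm (S (s i)) k l)
  (fun i => eta (s i) (t i)).
Proof.
apply: (eq_bO (x' := fun i => - (mu S (t i) 0 k - mu S (s i) 0 k) * (total (t i))^-1
   + ((k == l)%:R - mu S (s i) 0 k) * ((total (t i))^-1 - (total (s i))^-1))).
  by move=> i _; rewrite /dnorm -!/(total _) -!/(mu S _); ring.
apply: bO_D.
  by apply: bO_Mr; [apply: bO_N; exact: O_dmu|exact: O_totalV].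
apply: bO_Ml; last exact: O_dtotalV.
by apply: bO_B; [exact: bO_cst|exact: O_mu].
Qed.

Lemma log_total_expand : bO D (fun i => ln (total (t i)) - ln (total (s i))
    - (dtotal i / total (s i) - (dtotal i / total (s i)) ^+ 2 / 2))
  (fun i => eta (s i) (t i) ^+ 3).
Proof.
have d0 : (0 < d%:R :> R) by rewrite ltr0n.
have E1 i : D i -> 1 + dtotal i / total (s i) = total (t i) / total (s i).
  move=> Di; have [u0 uT] := hs Di.
  by rewrite dtotalE; field; exact: lt0r_neq0 (total_gt0 u0 uT).
have hx := @bO_ln R I D (fun i => dtotal i / total (s i)) (B^-1 * B^-1) (B * B) _.
apply: (eq_bO (x' := fun i => ln (1 + dtotal i / total (s i))
    - dtotal i / total (s i) + (dtotal i / total (s i)) ^+ 2 / 2)).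
  move=> i Di; have [u0 uT] := hs Di; have [v0 vT] := ht Di.
  by rewrite E1// ln_div ?posrE ?total_gt0//; ring.
apply: bO_trans (hx _ _) _.
- by rewrite mulr_gt0// invr_gt0.
- move=> i Di; have [u0 uT] := hs Di; have [v0 vT] := ht Di.
  have su := total_gt0 u0 uT; have sv := total_gt0 v0 vT.
  have /andP[g1 g2] := total_bounds u0 uT; have /andP[g3 g4] := total_bounds v0 vT.
  rewrite E1//; apply/andP; split.
    rewrite ler_pdivlMr//; apply: le_trans g3.
    apply: le_trans (ler_wpM2l _ g2) _; first by rewrite mulr_ge0// invr_ge0 ltW.
    by rewrite le_eqVlt; apply/orP; left; apply/eqP; field; rewrite gt_eqF.
  rewrite ler_pdivrMr//; apply: le_trans g4 _.
  have BB : 0 <= B * B by rewrite mulr_ge0 ?ltW.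
  apply: le_trans (ler_wpM2l BB g1).
  by rewrite le_eqVlt; apply/orP; left; apply/eqP; field; rewrite gt_eqF.
exact: bO_X (bO_norm O_dtotal_rel).
Qed.

End Increments.
End Spans.
End Expansions.

(** * Lift and bracket of the market portfolio *)

Section Families.
Context {R : realType} (J : Type) (T : R).

Definition pairs : set (J * R * R) :=
  [set i | [/\ 0 <= i.1.2, i.1.2 <= i.2 & i.2 <= T]].

Definition triples : set (J * R * R * R) :=
  [set i | [/\ 0 <= i.1.1.2, i.1.1.2 <= i.1.2, i.1.2 <= i.2 & i.2 <= T]].

(** Sewing for a family of germs with a common defect bound gives a remainder
    that is uniform over the family. *)
Lemma sewing_family (e : R -> R -> R) (Xi : J -> R -> R -> R) :
  sewing_error T e ->
  bO triples (fun i => Xi i.1.1.1 i.1.1.2 i.2 - Xi i.1.1.1 i.1.1.2 i.1.2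
      - Xi i.1.1.1 i.1.2 i.2) (fun i => e i.1.1.2 i.2) ->
  [/\ forall j a b, 0 <= a -> a <= b -> b <= T ->
        psum a s (Xi j) @[s --> mesh_to0 a b] --> mesh_lim a b (Xi j),
      forall j a u b, 0 <= a -> a <= u -> u <= b -> b <= T ->
        mesh_lim a b (Xi j) = mesh_lim a u (Xi j) + mesh_lim u b (Xi j) &
      bO pairs (fun i => mesh_lim i.1.2 i.2 (Xi i.1.1) - Xi i.1.1 i.1.2 i.2)
        (fun i => e i.1.2 i.2)].
Proof.
move=> he [M M0 H]; have [C C0 hC] := sewing he.
have {}H j s u t : 0 <= s -> s <= u -> u <= t -> t <= T ->
    `|Xi j s t - Xi j s u - Xi j u t| <= M * e s t.
  by move=> *; apply: (H (j, s, u, t)); split.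
split.
- by move=> j a b a0 ab bT; have [] := hC (Xi j) M M0 (H j) a b a0 ab bT.
- move=> j a u b a0 au ub bT.
  have [_ h _] := hC (Xi j) M M0 (H j) a b a0 (le_trans au ub) bT; exact: h.
exists (C * M) => [|[[j s] t] [/= s0 st tT]]; first exact: mulr_ge0.
by have [] := hC (Xi j) M M0 (H j) s t s0 st tT.
Qed.

End Families.

Section MarketPath.
Context {R : realType} {d : nat}.
Variables (p T B : R) (S : R -> 'rV[R]_d) (P : nat -> nat -> R).
Variables (c eta : R -> R -> R).
Hypothesis hd : (0 < d)%N.
Hypothesis hp : 2 < p < 3.
Local Notation A := (Defs.lift S P).
Hypothesis hr : rough_driver T p S A c eta.
Hypothesis B0 : 0 < B.
Hypothesis hB : forall t i, 0 <= t -> t <= T -> B^-1 <= S t 0 i <= B.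

Local Notation tau := (tau p c).
Local Notation E := (err p c eta).
Let hm := driver_modulus hr.
Let hE : sewing_error T E := err_sewing (driver_control hr) hp hm.

(** The lift of the market portfolio to first order. *)
Definition area1 k l s t : R :=
  \sum_i \sum_j dnorm (S s) k i * dnorm (S s) l j * A s t i j.

Definition ito_summand k l u v : R :=
  (ccoord k (cmu S)).1 u 0 0 * incr (ccoord l (cmu S)).1 u v 0 0
  + \sum_i \sum_j (ccoord k (cmu S)).2 u 0 i * (ccoord l (cmu S)).2 u 0 j
     * A u v i j.

Lemma ito_summandE k l u v : 0 <= u -> u <= T ->
  ito_summand k l u v = mu S u 0 k * (mu S v 0 l - mu S u 0 l) + area1 k l u v.
Proof.
move=> u0 uT; have su := lt0r_neq0 (total_gt0 hd B0 hB u0 uT).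
rewrite /ito_summand /incr !mxE; congr (_ + _).
apply: eq_bigr => i _; apply: eq_bigr => j _.
by rewrite !mxE -/(D normalize (S u)) -!D_normalize// !mxE.
Qed.

Section Triples.
Context {I : Type}.
Variables (D : set I) (s u t : I -> R).
Hypotheses (hsu : spans T D s u) (hut : spans T D u t).

Lemma spans_st : spans T D s t.
Proof.
move=> i Di; have [s0 su _] := hsu Di; have [_ ut tT] := hut Di.
by split => //; exact: le_trans ut.
Qed.

Let hst := spans_st.

Lemma eta_sub_l i : D i -> eta (s i) (u i) <= eta (s i) (t i).
Proof.
move=> Di; have [s0 su _] := hsu Di; have [_ ut tT] := hut Di.
by have [_ h _] := hm; exact: h.
Qed.

Lemma eta_sub_r i : D i -> eta (u i) (t i) <= eta (s i) (t i).
Proof.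
move=> Di; have [s0 su _] := hsu Di; have [_ ut tT] := hut Di.
by have [_ h _] := hm; exact: h.
Qed.

Lemma eta_sub_l_ge0 i : D i -> 0 <= eta (s i) (u i).
Proof. by move=> Di; have /andP[] := eta_bounds hr hsu Di. Qed.

Lemma eta_sub_r_ge0 i : D i -> 0 <= eta (u i) (t i).
Proof. by move=> Di; have /andP[] := eta_bounds hr hut Di. Qed.

Lemma bO_sub_l n x : bO D x (fun i => eta (s i) (u i) ^+ n) ->
  bO D x (fun i => eta (s i) (t i) ^+ n).
Proof.
move=> h; apply: bO_leT h _ => i Di; apply: lerXn2r.
- by rewrite nnegrE eta_sub_l_ge0.
- by rewrite nnegrE (le_trans (eta_sub_l_ge0 Di))// eta_sub_l.
- exact: eta_sub_l.
Qed.

Lemma bO_sub_r n x : bO D x (fun i => eta (u i) (t i) ^+ n) ->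
  bO D x (fun i => eta (s i) (t i) ^+ n).
Proof.
move=> h; apply: bO_leT h _ => i Di; apply: lerXn2r.
- by rewrite nnegrE eta_sub_r_ge0.
- by rewrite nnegrE (le_trans (eta_sub_r_ge0 Di))// eta_sub_r.
- exact: eta_sub_r.
Qed.

Lemma bO_sub_l1 x : bO D x (fun i => eta (s i) (u i)) ->
  bO D x (fun i => eta (s i) (t i)).
Proof. by move=> h; apply: bO_leT h _ => i; exact: eta_sub_l. Qed.

Lemma bO_sub_r1 x : bO D x (fun i => eta (u i) (t i)) ->
  bO D x (fun i => eta (s i) (t i)).
Proof. by move=> h; apply: bO_leT h _ => i; exact: eta_sub_r. Qed.

Lemma bO_cube x y z : bO D x (fun i => eta (s i) (t i)) ->
  bO D y (fun i => eta (s i) (t i)) -> bO D z (fun i => eta (s i) (t i)) ->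
  bO D (fun i => x i * y i * z i) (fun i => E (s i) (t i)).
Proof.
move=> hx hy hz; apply: bO_trans (O_eta3 hp hr hst).
by apply: bO_leT (bO_M (bO_M hx hy) hz) _ => i _; rewrite -expr2 -exprSr.
Qed.

Lemma bO_cube12 x y : bO D x (fun i => eta (s i) (t i)) ->
  bO D y (fun i => eta (s i) (t i) ^+ 2) ->
  bO D (fun i => x i * y i) (fun i => E (s i) (t i)).
Proof.
move=> hx hy; apply: bO_trans (O_eta3 hp hr hst).
by apply: bO_leT (bO_M hx hy) _ => i _; rewrite -exprS.
Qed.

Lemma err_ge0_D i : D i -> 0 <= E (s i) (t i).
Proof. by move=> _; exact: err_ge0. Qed.

(** To leading order the defect of the compensated germ cancels by Chen's relation
    for the area of the prices. *)
Lemma ito_summand_defect k l : bO D (fun i => ito_summand k l (s i) (t i)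
    - ito_summand k l (s i) (u i) - ito_summand k l (u i) (t i))
  (fun i => E (s i) (t i)).
Proof.
have hs := spans_l hst; have hu := spans_l hut; have ht := spans_r hst.
pose y k i := \sum_j dnorm (S (s i)) k j * (S (t i) 0 j - S (u i) 0 j).
have yO k' : bO D (y k') (fun i => eta (s i) (t i)).
  apply: bO_sum => [i Di|j]; first by have /andP[] := eta_bounds hr hst Di.
  apply: bO_Ml; first exact: (O_dnorm hd B0 hB hs).
  by apply: bO_sub_r1; exact: (O_dS hr hut).
apply: (eq_bO (x' := fun i =>
    - ((mu S (u i) 0 k - mu S (s i) 0 k - dmu1 S s u k i)
        * (mu S (t i) 0 l - mu S (u i) 0 l))
    - dmu1 S s u k i * (mu S (t i) 0 l - mu S (u i) 0 l - dmu1 S u t l i)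
    - dmu1 S s u k i * (\sum_b (dnorm (S (u i)) l b - dnorm (S (s i)) l b)
        * (S (t i) 0 b - S (u i) 0 b))
    - \sum_a \sum_b ((dnorm (S (u i)) k a - dnorm (S (s i)) k a)
          * (dnorm (S (u i)) l b * A (u i) (t i) a b)
        + (dnorm (S (u i)) l b - dnorm (S (s i)) l b)
          * (dnorm (S (s i)) k a * A (u i) (t i) a b)))).
  move=> i Di; have [s0 sT] := hs _ Di; have [u0 uT] := hu _ Di.
  rewrite !ito_summandE//.
  have a1 : area1 k l (s i) (t i) - area1 k l (s i) (u i) - area1 k l (u i) (t i)
      = dmu1 S s u k i * y l i
      - \sum_a \sum_b ((dnorm (S (u i)) k a - dnorm (S (s i)) k a)
          * (dnorm (S (u i)) l b * A (u i) (t i) a b)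
        + (dnorm (S (u i)) l b - dnorm (S (s i)) l b)
          * (dnorm (S (s i)) k a * A (u i) (t i) a b)).
    rewrite /area1 /dmu1 /y mulr_suml -!sumrB; apply: eq_bigr => a _.
    rewrite mulr_sumr -!sumrB; apply: eq_bigr => b _.
    by rewrite (driver_chen hr (s i) (u i) (t i)); ring.
  have a2 : y l i = dmu1 S u t l i - \sum_b (dnorm (S (u i)) l b - dnorm (S (s i)) l b)
        * (S (t i) 0 b - S (u i) 0 b).
    by rewrite /y /dmu1 -sumrB; apply: eq_bigr => b _; ring.
  rewrite [LHS](_ : _ = mu S (s i) 0 k * (mu S (t i) 0 l - mu S (s i) 0 l)
    - mu S (s i) 0 k * (mu S (u i) 0 l - mu S (s i) 0 l)
    - mu S (u i) 0 k * (mu S (t i) 0 l - mu S (u i) 0 l)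
    + (area1 k l (s i) (t i) - area1 k l (s i) (u i) - area1 k l (u i) (t i))); last by ring.
  by rewrite a1 a2; ring.
have dmuO k' : bO D (dmu1 S s u k') (fun i => eta (s i) (t i)).
  by apply: bO_sub_l1; exact: (O_dmu1 hd hr B0 hB hsu).
have dnO k' a : bO D (fun i => dnorm (S (u i)) k' a - dnorm (S (s i)) k' a)
    (fun i => eta (s i) (t i)).
  by apply: bO_sub_l1; exact: (O_ddnorm hd hp hr B0 hB hsu).
apply: bO_B; [apply: bO_B; [apply: bO_B; [apply: bO_N|]|]|].
- apply: (eq_bO (x' := fun i => (mu S (t i) 0 l - mu S (u i) 0 l) *
    (mu S (u i) 0 k - mu S (s i) 0 k - dmu1 S s u k i))); first by move=> i _; ring.
  apply: bO_cube12; first by apply: bO_sub_r1; exact: (O_dmu hd hp hr B0 hB hut).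
  by apply: bO_sub_l; exact: (mu_linear hd hp hr B0 hB hsu).
- apply: bO_cube12 => //.
  by apply: bO_sub_r; exact: (mu_linear hd hp hr B0 hB hut).
- apply: (eq_bO (x' := fun i => \sum_b dmu1 S s u k i *
      (dnorm (S (u i)) l b - dnorm (S (s i)) l b) * (S (t i) 0 b - S (u i) 0 b))).
    by move=> i _; rewrite mulr_sumr; apply: eq_bigr => b _; ring.
  apply: bO_sum => [i Di|b]; first exact: err_ge0_D.
  by apply: bO_cube => //; apply: bO_sub_r1; exact: (O_dS hr hut).
apply: bO_sum => [i Di|a]; first exact: err_ge0_D.
apply: bO_sum => [i Di|b]; first exact: err_ge0_D.
apply: bO_D; apply: bO_cube12 => //.
  apply: bO_Ml; first exact: (O_dnorm hd B0 hB hu).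
  by apply: bO_sub_r; exact: (O_area hr hut).
apply: bO_Ml; first exact: (O_dnorm hd B0 hB hs).
by apply: bO_sub_r; exact: (O_area hr hut).
Qed.

End Triples.

Lemma AmuE s t k l : Amu S P s t k l = mesh_lim s t (ito_summand k l)
  - mu S s 0 k * (mu S t 0 l - mu S s 0 l).
Proof. by rewrite /Amu mxE [X in X + _]mxE [X in _ + X]mxE tensorE !mxE. Qed.

Lemma ito_sewing k l :
  (forall a u b, 0 <= a -> a <= u -> u <= b -> b <= T ->
     mesh_lim a b (ito_summand k l) =
     mesh_lim a u (ito_summand k l) + mesh_lim u b (ito_summand k l)) /\
  bO (@pairs R unit T) (fun i => mesh_lim i.1.2 i.2 (ito_summand k l)
     - ito_summand k l i.1.2 i.2) (fun i => E i.1.2 i.2).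
Proof.
have [|_ h1 h2] := @sewing_family R unit T E (fun _ => ito_summand k l) hE.
  apply: (ito_summand_defect (s := fun i => i.1.1.2) (u := fun i => i.1.2) (t := fun i => i.2)).
    move=> i [h1 h2 h3 h4]; split => //; exact: le_trans h4.
  move=> i [h1 h2 h3 h4]; split => //; exact: le_trans h2.
by split => // a u b *; apply: h1 => //; exact: tt.
Qed.

(** Chen's relation is the additivity of the integral in disguise. *)
Lemma Amu_chen s u t k l : 0 <= s -> s <= u -> u <= t -> t <= T ->
  Amu S P s t k l = Amu S P s u k l + Amu S P u t k l
    + (mu S u 0 k - mu S s 0 k) * (mu S t 0 l - mu S u 0 l).
Proof.
by move=> s0 su ut tT; have [h _] := ito_sewing k l; rewrite !AmuE (h s u t)//; ring.
Qed.

Definition mu_br s t k l : R := incr (mu_bracket S P) s t k l.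

Lemma bracket_incrE (X : R -> 'rV[R]_d) (A0 : R -> R -> 'M[R]_d) s t k l :
  (forall k l, A0 0 t k l = A0 0 s k l + A0 s t k l
     + (X s 0 k - X 0 0 k) * (X t 0 l - X s 0 l)) ->
  incr (bracket X A0) s t k l =
    (X t 0 k - X s 0 k) * (X t 0 l - X s 0 l) - A0 s t k l - A0 s t l k.
Proof.
move=> h; have e u : bracket X A0 u k l = (X u 0 k - X 0 0 k) * (X u 0 l - X 0 0 l)
    - A0 0 u k l - A0 0 u l k.
  by rewrite /bracket /sym /incr !mxE big_ord1 !mxE; field.
have -> : incr (bracket X A0) s t k l = bracket X A0 t k l - bracket X A0 s k l.
  by rewrite /incr mxE [X in _ + X]mxE.
rewrite !e h (h l k); ring.
Qed.

Lemma mu_brE s t k l : 0 <= s -> s <= t -> t <= T -> mu_br s t k l =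
  (mu S t 0 k - mu S s 0 k) * (mu S t 0 l - mu S s 0 l)
  - Amu S P s t k l - Amu S P s t l k.
Proof.
by move=> s0 st tT; rewrite /mu_br bracket_incrE// => k' l'; exact: Amu_chen.
Qed.

Section Spans.
Context {I : Type}.
Variables (D : set I) (s t : I -> R).
Hypothesis hst : spans T D s t.
Let hs := spans_l hst.
Let ht := spans_r hst.

Lemma Amu_expand k l : bO D (fun i => Amu S P (s i) (t i) k l
    - area1 k l (s i) (t i)) (fun i => E (s i) (t i)).
Proof.
have [_ h] := ito_sewing k l.
have := bO_comp (E := D) (f := fun i => (tt, s i, t i)) _ h; move=> {}h.
apply: (eq_bO _ (h _)) => [i Di|i /hst[s0 st tT]] //.
have [s0 sT] := hs Di.
by rewrite AmuE /= ito_summandE//; ring.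
Qed.

Lemma O_area1 k l : bO D (fun i => area1 k l (s i) (t i)) (fun i => eta (s i) (t i) ^+ 2).
Proof.
apply: bO_sum => [i _|a]; first exact: sqr_ge0.
apply: bO_sum => [i _|b]; first exact: sqr_ge0.
by apply: bO_Ml; [apply: bO_Ml; exact: (O_dnorm hd B0 hB hs)|exact: (O_area hr hst)].
Qed.

Lemma O_Amu k l : bO D (fun i => Amu S P (s i) (t i) k l)
  (fun i => tau (s i) (t i) ^+ 2).
Proof.
apply: (eq_bO (x' := fun i => Amu S P (s i) (t i) k l - area1 k l (s i) (t i)
   + area1 k l (s i) (t i))); first by move=> i _; ring.
apply: bO_D.
  exact: bO_trans (Amu_expand k l) (O_E_tau2 hp hr hst).
exact: bO_trans (O_area1 k l) (O_eta2_tau2 hr hst).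
Qed.

Lemma bO_cubeE12 x y : bO D x (fun i => eta (s i) (t i)) ->
  bO D y (fun i => eta (s i) (t i) ^+ 2) ->
  bO D (fun i => x i * y i) (fun i => E (s i) (t i)).
Proof.
move=> hx hy; apply: bO_trans (O_eta3 hp hr hst).
by apply: bO_leT (bO_M hx hy) _ => i _; rewrite -exprS.
Qed.

Lemma mu_br_expand k l : bO D (fun i => mu_br (s i) (t i) k l
    - (dmu1 S s t k i * dmu1 S s t l i - area1 k l (s i) (t i) - area1 l k (s i) (t i)))
  (fun i => E (s i) (t i)).
Proof.
have y1 := O_dmu1 hd hr B0 hB hst; have m1 := O_dmu hd hp hr B0 hB hst.
have ml := mu_linear hd hp hr B0 hB hst.
apply: (eq_bO (x' := fun i =>
    (mu S (t i) 0 l - mu S (s i) 0 l) * (mu S (t i) 0 k - mu S (s i) 0 k - dmu1 S s t k i)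
    + dmu1 S s t k i * (mu S (t i) 0 l - mu S (s i) 0 l - dmu1 S s t l i)
    - (Amu S P (s i) (t i) k l - area1 k l (s i) (t i))
    - (Amu S P (s i) (t i) l k - area1 l k (s i) (t i)))).
  by move=> i /hst[s0 st tT]; rewrite mu_brE//; ring.
apply: bO_B; last exact: Amu_expand.
apply: bO_B; last exact: Amu_expand.
by apply: bO_D; apply: bO_cubeE12.
Qed.

Lemma O_mu_br k l : bO D (fun i => mu_br (s i) (t i) k l) (fun i => tau (s i) (t i) ^+ 2).
Proof.
apply: (eq_bO (x' := fun i => (mu S (t i) 0 k - mu S (s i) 0 k)
   * (mu S (t i) 0 l - mu S (s i) 0 l)
  - Amu S P (s i) (t i) k l - Amu S P (s i) (t i) l k)).
  by move=> i /hst[s0 st tT]; rewrite mu_brE.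
apply: bO_B; [apply: bO_B|]; try exact: O_Amu.
apply: bO_trans (O_eta2_tau2 hr hst).
by apply: bO_leT (bO_M (O_dmu hd hp hr B0 hB hst k) (O_dmu hd hp hr B0 hB hst l)) _ => i _;
  rewrite expr2.
Qed.

End Spans.
End MarketPath.

(** * Logarithmic wealth *)

Lemma cvg_sumR {R : realType} {I T : Type} (r : seq I) (F : set_system T)
    (f : I -> T -> R) (l : I -> R) : Filter F ->
  (forall i, f i x @[x --> F] --> l i) ->
  \sum_(i <- r) f i x @[x --> F] --> \sum_(i <- r) l i.
Proof.
move=> FF H; elim: r => [|i r IH].
  by rewrite big_nil; under eq_fun do rewrite big_nil; exact: cvg_cst.
by rewrite big_cons; under eq_fun do rewrite big_cons; exact: cvgD.
Qed.

Section LogWealth.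
Context {R : realType} {d : nat}.
Variables (p T B : R) (S : R -> 'rV[R]_d) (P : nat -> nat -> R).
Variables (c eta : R -> R -> R).
Hypothesis hd : (0 < d)%N.
Hypothesis hp : 2 < p < 3.
Local Notation A := (Defs.lift S P).
Hypothesis hr : rough_driver T p S A c eta.
Hypothesis B0 : 0 < B.
Hypothesis hB : forall t i, 0 <= t -> t <= T -> B^-1 <= S t 0 i <= B.

Local Notation tau := (tau p c).
Local Notation E := (err p c eta).
Let hm := driver_modulus hr.
Let hE : sewing_error T E := err_sewing (driver_control hr) hp hm.

Lemma incr_entry {m n} (X : R -> 'M[R]_(m, n)) u w k l :
  incr X u w k l = X w k l - X u k l.
Proof. by rewrite /incr mxE [X in _ + X]mxE. Qed.

Lemma incr_entry_add {m n} (X : R -> 'M[R]_(m, n)) s u t k l :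
  incr X s t k l = incr X s u k l + incr X u t k l.
Proof. by rewrite !incr_entry; ring. Qed.

Lemma left_sum_defect (f X : R -> R) s u t :
  f s * incr X s t - f s * incr X s u - f u * incr X u t
  = - ((f u - f s) * incr X u t).
Proof. by rewrite /incr; ring. Qed.

Lemma pairs_spans (J : Type) : spans T (@pairs R J T) (fun i => i.1.2) (fun i => i.2).
Proof. by move=> i. Qed.

(** Nonnegative germs have nonnegative sums, and the errors vanish along fine
    partitions. *)
Lemma incr_ge0_of_local (Q : R -> R) (N : R -> R -> R) :
  bO (@pairs R unit T) (fun i => Q i.2 - Q i.1.2 - N i.1.2 i.2) (fun i => E i.1.2 i.2) ->
  (forall s t, 0 <= s -> s <= t -> t <= T -> 0 <= N s t) ->
  forall s t, 0 <= s -> s <= t -> t <= T -> Q s <= Q t.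
Proof.
move=> [C C0 H] N0 s t s0 st tT; rewrite -subr_ge0 -oppr_le0.
apply/ler_addgt0Pr => k k0; rewrite add0r.
have [_ _ hv] := hE; have C1 : 0 < C + 1 by lra.
have [delta d0 Hd] := hv (k / (C + 1)) (divr_gt0 k0 C1).
have [r [pr mr]] := partition_exists st d0.
have h := Hd _ _ _ s0 tT pr mr.
have tE : last s r = t by case: pr => _ /eqP.
rewrite -{1}tE -psum_incr -psumN.
apply: (@le_trans _ _ (psum s r (fun u v => C * E u v))).
  apply: (psum_le pr) => u v su uv vt _.
  have u0 := le_trans s0 su; have vT := le_trans vt tT.
  have := H (tt, u, v) (And3 u0 (ltW uv) vT); rewrite /= ler_norml => /andP[h1 _].
  by have := N0 u v u0 (ltW uv) vT; rewrite /incr; lra.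
rewrite psumZ; apply: le_trans (ler_wpM2l C0 h) _.
by rewrite mulrA ler_pdivrMr// mulrC ler_wpM2l ?(ltW k0)//; lra.
Qed.

(** The bracket of the market portfolio inherits the positivity of that of the
    prices, of which it is locally the image. *)
Lemma mu_br_ge0 s t (v : 'I_d -> R) : 0 <= s -> s <= t -> t <= T ->
  0 <= \sum_k \sum_l v k * v l * mu_br S P s t k l.
Proof.
pose Q u := \sum_k \sum_l v k * v l * mu_bracket S P u k l.
have QE u w : \sum_k \sum_l v k * v l * mu_br S P u w k l = Q w - Q u.
  rewrite /Q -sumrB; apply: eq_bigr => k _; rewrite -sumrB; apply: eq_bigr => l _.
  by rewrite /mu_br incr_entry mulrBr.
move=> s0 st tT; rewrite QE subr_ge0; move: s t s0 st tT.
pose N u w := \sum_k \sum_l v k * v l * (dmu1 S (fun=> u) (fun=> w) k tt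
  * dmu1 S (fun=> u) (fun=> w) l tt - area1 S P k l u w - area1 S P l k u w).
apply: (@incr_ge0_of_local Q N).
  have hs := @pairs_spans unit.
  apply: (eq_bO (x' := fun i => \sum_k \sum_l v k * v l * (mu_br S P i.1.2 i.2 k l
    - (dmu1 S (fun i => i.1.2) (fun i => i.2) k i
       * dmu1 S (fun i => i.1.2) (fun i => i.2) l i
       - area1 S P k l i.1.2 i.2 - area1 S P l k i.1.2 i.2)))).
    move=> i _; rewrite -QE /N -sumrB; apply: eq_bigr => k _.
    by rewrite -sumrB; apply: eq_bigr => l _; rewrite [RHS]mulrBr.
  apply: bO_sum => [i _|k]; first exact: err_ge0.
  apply: bO_sum => [i _|l]; first exact: err_ge0.
  apply: bO_Ml; last exact: (mu_br_expand hd hp hr B0 hB hs).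
  by exists `|v k * v l| => // i _; rewrite mulr1.
(* The test vector for the prices is the pull-back of [v] by the differential of
   the normalisation. *)
move=> u w u0 uw wT; pose z i := \sum_k v k * dnorm (S u) k i.
have := driver_bracket_ge0 hr z u0 uw wT; congr (_ <= _).
pose del i := S w 0 i - S u 0 i.
transitivity ((\sum_i z i * del i) ^+ 2 - 2 * \sum_i \sum_j z i * z j * A u w i j).
  rewrite expr2 mulr_suml mulr_sumr -sumrB; apply: eq_bigr => i _.
  rewrite mulr_sumr mulr_sumr -sumrB; apply: eq_bigr => j _.
  by rewrite /del; ring.
have e1 : \sum_i z i * del i = \sum_k v k * dmu1 S (fun=> u) (fun=> w) k tt.
  under eq_bigr do rewrite mulr_suml.
  rewrite exchange_big/=; apply: eq_bigr => k _; rewrite /dmu1 mulr_sumr.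
  by apply: eq_bigr => i _; rewrite mulrA.
have e2 : \sum_i \sum_j z i * z j * A u w i j
    = \sum_k \sum_l v k * v l * area1 S P k l u w.
  transitivity (\sum_i \sum_j \sum_k \sum_l
      v k * v l * (dnorm (S u) k i * dnorm (S u) l j * A u w i j)).
    apply: eq_bigr => i _; apply: eq_bigr => j _; rewrite /z mulr_suml mulr_suml.
    apply: eq_bigr => k _; rewrite mulr_sumr mulr_suml; apply: eq_bigr => l _; ring.
  under eq_bigr do rewrite exchange_big/=.
  rewrite exchange_big/=; apply: eq_bigr => k _.
  under eq_bigr do rewrite exchange_big/=.
  rewrite exchange_big/=; apply: eq_bigr => l _.
  rewrite /area1 mulr_sumr; apply: eq_bigr => i _.
  by rewrite mulr_sumr.
have e3 : \sum_k \sum_l v k * v l * area1 S P k l u w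
    = \sum_k \sum_l v k * v l * area1 S P l k u w.
  rewrite exchange_big/=; apply: eq_bigr => k _; apply: eq_bigr => l _; ring.
rewrite e1 e2 /N.
have -> : \sum_k \sum_l v k * v l * (dmu1 S (fun=> u) (fun=> w) k tt
    * dmu1 S (fun=> u) (fun=> w) l tt - area1 S P k l u w - area1 S P l k u w)
  = (\sum_k v k * dmu1 S (fun=> u) (fun=> w) k tt) ^+ 2
    - \sum_k \sum_l v k * v l * area1 S P k l u w
    - \sum_k \sum_l v k * v l * area1 S P l k u w.
  rewrite expr2 mulr_suml -!sumrB; apply: eq_bigr => k _.
  by rewrite mulr_sumr -!sumrB; apply: eq_bigr => l _; ring.
by rewrite -e3; ring.
Qed.

Lemma mu_br_add s u t k l :
  mu_br S P s t k l = mu_br S P s u k l + mu_br S P u t k l.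
Proof.
exact: (incr_entry_add (mu_bracket S P)).
Qed.

Lemma mu_br_sym s t k l : 0 <= s -> s <= t -> t <= T ->
  mu_br S P s t k l = mu_br S P s t l k.
Proof.
by move=> s0 st tT; rewrite !(mu_brE hd hp hr B0 hB _ _ s0 st tT); ring.
Qed.

Lemma quad_delta (M : 'I_d -> 'I_d -> R) (e : R) k l :
  \sum_i \sum_j ((i == k)%:R + e * (i == l)%:R) * ((j == k)%:R + e * (j == l)%:R) * M i j
  = M k k + e * M k l + e * M l k + e ^+ 2 * M l l.
Proof.
have s1 i : \sum_j ((i == k)%:R + e * (i == l)%:R) * ((j == k)%:R + e * (j == l)%:R) * M i j
    = ((i == k)%:R + e * (i == l)%:R) * (M i k + e * M i l).
  rewrite -(sum_delta_l (M i) k) -(sum_delta_l (M i) l) mulr_sumr -big_split/= mulr_sumr.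
  by apply: eq_bigr => j _; ring.
under eq_bigr do rewrite s1.
transitivity (\sum_i (M i k + e * M i l) * (i == k)%:R
   + e * \sum_i (M i k + e * M i l) * (i == l)%:R).
  by rewrite mulr_sumr -big_split/=; apply: eq_bigr => i _; ring.
by rewrite !sum_delta_l; ring.
Qed.

Lemma mu_br_diag_ge0 s t k : 0 <= s -> s <= t -> t <= T -> 0 <= mu_br S P s t k k.
Proof.
move=> s0 st tT.
have := mu_br_ge0 (fun i => (i == k)%:R + 0 * (i == k)%:R) s0 st tT.
by rewrite quad_delta expr0n !mul0r !addr0.
Qed.

(** Test positivity on the two vectors that are supported by [k] and [l] with
    weights 1 and 1, respectively 1 and -1. *)
Lemma mu_br_le_trace s t k l : 0 <= s -> s <= t -> t <= T ->
  `|mu_br S P s t k l| <= \sum_i mu_br S P s t i i.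
Proof.
move=> s0 st tT.
have h1 := mu_br_ge0 (fun i => (i == k)%:R + 1 * (i == l)%:R) s0 st tT.
have h2 := mu_br_ge0 (fun i => (i == k)%:R + -1 * (i == l)%:R) s0 st tT.
rewrite quad_delta in h1; rewrite quad_delta in h2.
have sy := mu_br_sym k l s0 st tT.
have tr i : mu_br S P s t i i <= \sum_i mu_br S P s t i i.
  by rewrite (bigD1 i)//= lerDl sumr_ge0// => j _; exact: mu_br_diag_ge0.
have := tr k; have := tr l.
rewrite ler_norml => t1 t2; apply/andP; split; lra.
Qed.

(** The local increment of the logarithm of the relative wealth of the
    portfolio generated by [phi], in terms of the market portfolio only. *)
Definition dlogV (phi : 'I_d -> R) (Psi : 'I_d -> 'I_d -> R) s t : R :=
  \sum_k phi k * (mu S t 0 k - mu S s 0 k)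
  + \sum_k \sum_l Psi k l * Amu S P s t l k
  - 2^-1 * \sum_k \sum_l phi k * phi l * mu_br S P s t k l.

Definition int_summand (pi : cpath R d d) s t : R :=
  \sum_i (cmul pi (csmooth (map_mx GRing.inv) S)).1 s 0 i * incr S s t 0 i
  + \sum_i \sum_j (cmul pi (csmooth (map_mx GRing.inv) S)).2 s i j * A s t j i.

Definition br_summand (pi : cpath R d d) i j s t : R :=
  pi.1 s 0 i * pi.1 s 0 j / (S s 0 i * S s 0 j) * incr (fun t => bracket S A t i j) s t.

(** The local increment of the logarithmic wealth. *)
Definition log_summand (pi : cpath R d d) s t : R :=
  int_summand pi s t - 2^-1 * \sum_i \sum_j br_summand pi i j s t.

(** [pi] is, at time [s], the portfolio that would be generated by a function of
    the market portfolio with value [phi] and derivative [Psi]; such a function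
    need not exist for the mixed portfolio. *)
Definition generated (pi : cpath R d d) s phi Psi : Prop :=
  (forall k, pi.1 s 0 k = gen_pi (S s) phi k) /\
  (forall k l, pi.2 s k l = \sum_j gen_dpi (S s) phi Psi k j * dnorm (S s) j l).

Lemma S_bracketE s t k l : incr (fun t => bracket S A t k l) s t =
  (S t 0 k - S s 0 k) * (S t 0 l - S s 0 l) - A s t k l - A s t l k.
Proof.
rewrite -(@bracket_incrE _ _ S A s t k l).
  by rewrite incr_entry.
by move=> k' l'; rewrite (driver_chen hr 0 s t).
Qed.

Lemma log_summandE pi s t phi Psi : 0 <= s -> s <= t -> t <= T ->
  generated pi s phi Psi ->
  log_summand pi s t =
  let x := S s in
  \sum_k gen_pi x phi k / x 0 k * (S t 0 k - S s 0 k)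
  + \sum_k \sum_l (\sum_j gen_dpi x phi Psi k j * dnorm x j l / x 0 k
       - gen_pi x phi k * (k == l)%:R / x 0 k ^+ 2) * A s t l k
  - 2^-1 * \sum_k \sum_l gen_pi x phi k / x 0 k * (gen_pi x phi l / x 0 l)
       * ((S t 0 k - S s 0 k) * (S t 0 l - S s 0 l) - A s t k l - A s t l k).
Proof.
move=> s0 st tT [g1 g2] /=; have sT := le_trans st tT.
have x0 k : S s 0 k != 0 by rewrite gt_eqF// (price_gt0 B0 hB).
congr (_ + _ - _ * _).
- by apply: eq_bigr => k _; rewrite !mxE g1.
- apply: eq_bigr => k _; apply: eq_bigr => l _; congr (_ * _).
  rewrite [LHS]mxE /csmooth /= D_inv// g1 g2 [map_mx _ _ _ _]mxE mulr_suml.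
  by congr (_ + _); rewrite mulNr mulrN mulrA.
- apply: eq_bigr => k _; apply: eq_bigr => l _; rewrite /br_summand S_bracketE !g1.
  by congr (_ * _); field; rewrite !x0.
Qed.

(** Ito's formula for the logarithmic wealth in the numeraire of the whole
    market: [ito_identity] is applied to the second order expansions of the
    logarithm of the total, of [mu], of its lift and of its bracket. *)
Lemma ito_local (I : Type) (D : set I) (s t : I -> R) (pi : I -> cpath R d d)
    (phi : I -> 'I_d -> R) (Psi : I -> 'I_d -> 'I_d -> R) :
  spans T D s t ->
  (forall i, D i -> generated (pi i) (s i) (phi i) (Psi i)) ->
  (forall k, bO D (fun i => phi i k) (fun=> 1)) ->
  (forall k l, bO D (fun i => Psi i k l) (fun=> 1)) ->
  bO D (fun i => log_summand (pi i) (s i) (t i)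
     - (ln (total S (t i)) - ln (total S (s i))) - dlogV (phi i) (Psi i) (s i) (t i))
   (fun i => E (s i) (t i)).
Proof.
move=> hst hg hphi hPsi.
pose y k i := dmu1 S s t k i; pose z i := dtotal S s t i / total S (s i).
apply: (eq_bO (x' := fun i =>
   - (ln (total S (t i)) - ln (total S (s i)) - (z i - z i ^+ 2 / 2))
   - \sum_k phi i k * (mu S (t i) 0 k - mu S (s i) 0 k - (y k i - y k i * z i))
   - \sum_k \sum_l Psi i k l * (Amu S P (s i) (t i) l k - area1 S P l k (s i) (t i))
   + 2^-1 * \sum_k \sum_l phi i k * phi i l * (mu_br S P (s i) (t i) k l
       - (y k i * y l i - area1 S P k l (s i) (t i) - area1 S P l k (s i) (t i))))).
  move=> i Di; have [s0 st tT] := hst _ Di; have sT := le_trans st tT.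
  rewrite (log_summandE s0 st tT (hg _ Di)) /=.
  rewrite (@ito_identity _ _ (S (s i)) (phi i) (Psi i) _ _
     (fun k => S (t i) 0 k - S (s i) 0 k) (fun k l => A (s i) (t i) k l)); last 2 first.
  - by move=> k; rewrite gt_eqF// (price_gt0 B0 hB).
  - by rewrite gt_eqF// (total_gt0 hd B0 hB).
  rewrite -/(total S (s i)) -/(z i) /dlogV.
  have -> : \sum_k phi i k * (mu S (t i) 0 k - mu S (s i) 0 k - (y k i - y k i * z i))
      = \sum_k phi i k * (mu S (t i) 0 k - mu S (s i) 0 k)
        - \sum_k phi i k * (y k i - y k i * z i).
    by rewrite -sumrB; apply: eq_bigr => k _; rewrite mulrBr.
  have -> : \sum_k \sum_l Psi i k l * (Amu S P (s i) (t i) l k - area1 S P l k (s i) (t i))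
      = \sum_k \sum_l Psi i k l * Amu S P (s i) (t i) l k
        - \sum_k \sum_l Psi i k l * area1 S P l k (s i) (t i).
    rewrite -sumrB; apply: eq_bigr => k _; rewrite -sumrB; apply: eq_bigr => l _.
    by rewrite mulrBr.
  have -> : \sum_k \sum_l phi i k * phi i l * (mu_br S P (s i) (t i) k l
       - (y k i * y l i - area1 S P k l (s i) (t i) - area1 S P l k (s i) (t i)))
     = \sum_k \sum_l phi i k * phi i l * mu_br S P (s i) (t i) k l
       - \sum_k \sum_l phi i k * phi i l *
         (y k i * y l i - area1 S P k l (s i) (t i) - area1 S P l k (s i) (t i)).
    rewrite -sumrB; apply: eq_bigr => k _; rewrite -sumrB; apply: eq_bigr => l _.
    by rewrite mulrBr.
  by rewrite -/(dmu1 S s t _ i); ring.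
have E0 i : D i -> 0 <= E (s i) (t i) by move=> _; exact: err_ge0.
have hE3 := O_eta3 hp hr hst.
apply: bO_D; last first.
  apply: bO_Ml; first exact: bO_cst.
  apply: bO_sum => // k; apply: bO_sum => // l; apply: bO_Ml; first exact: bO_Ml.
  exact: (mu_br_expand hd hp hr B0 hB hst).
apply: bO_B; last first.
  apply: bO_sum => // k; apply: bO_sum => // l; apply: bO_Ml => //.
  exact: (Amu_expand hd hp hr B0 hB hst).
apply: bO_B.
  apply: bO_N; apply: bO_trans hE3; exact: (log_total_expand hd hr B0 hB hst).
apply: bO_sum => // k; apply: bO_Ml => //; apply: bO_trans hE3.
exact: (mu_expand hd hr B0 hB hst).
Qed.

(** The limits that define the wealth exist as soon as some path has the local
    increments [log_summand]. *)
Lemma wealth_exp (pi : cpath R d d) (L : R -> R) :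
  (forall i j, bO (@pairs R unit T) (fun z =>
     pi.1 z.2 0 i * pi.1 z.2 0 j / (S z.2 0 i * S z.2 0 j)
     - pi.1 z.1.2 0 i * pi.1 z.1.2 0 j / (S z.1.2 0 i * S z.1.2 0 j))
     (fun z => tau z.1.2 z.2)) ->
  bO (@pairs R unit T) (fun z => L z.2 - L z.1.2 - log_summand pi z.1.2 z.2)
     (fun z => E z.1.2 z.2) ->
  forall t, 0 <= t -> t <= T -> wealth S P pi t = expR (L t - L 0).
Proof.
move=> hk [C C0 hL] t t0 tT.
have cbr i j : psum 0 s (br_summand pi i j) @[s --> mesh_to0 0 t]
    --> mesh_lim 0 t (br_summand pi i j).
  have [|h _ _] := @sewing_family R unit T E (fun _ => br_summand pi i j) hE; last first.
    exact: h tt _ _ _ t0 tT.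
  pose k u := pi.1 u 0 i * pi.1 u 0 j / (S u 0 i * S u 0 j).
  have [C1 C10 hC1] := hk i j.
  apply: (eq_bO (x' := fun z => - ((k z.1.2 - k z.1.1.2) *
     ((S z.2 0 i - S z.1.2 0 i) * (S z.2 0 j - S z.1.2 0 j)
      - A z.1.2 z.2 i j - A z.1.2 z.2 j i)))).
    move=> z _; rewrite -(S_bracketE z.1.2 z.2 i j).
    exact: (left_sum_defect k (fun t => bracket S A t i j)).
  have hsu : spans T (@triples R unit T) (fun z => z.1.1.2) (fun z => z.1.2).
    by move=> z [h1 h2 h3 h4]; split => //; exact: le_trans h4.
  have hut : spans T (@triples R unit T) (fun z => z.1.2) (fun z => z.2).
    by move=> z [h1 h2 h3 h4]; split => //; exact: le_trans h2.
  have hst := spans_st hsu hut.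
  apply: bO_N; apply: bO_trans (O_eta_tau2 hp hr hst).
  have hkt : bO (@triples R unit T) (fun z => k z.1.2 - k z.1.1.2)
      (fun z => tau z.1.1.2 z.2).
    have := bO_comp (E := @triples R unit T) (f := fun z => (tt, z.1.1.2, z.1.2)) _ (hk i j).
    move=> h; apply: bO_leT (h _) _ => z [h1 h2 h3 h4] /=; first by split => //; exact: le_trans h4.
    have p0 : 0 <= p by case/andP: hp => hp2 _; apply: ltW; exact: lt_trans hp2.
    by apply: (tau_mono (driver_control hr)).
  apply: (@bO_leT _ _ _ (fun z => tau z.1.1.2 z.2 * eta z.1.1.2 z.2 ^+ 2)).
    apply: bO_M => //; apply: (bO_sub_r hr hsu hut).
    apply: bO_B; [apply: bO_B|]; try exact: (O_area hr hut).
    by apply: bO_leT (bO_M (O_dS hr hut i) (O_dS hr hut j)) _ => z _; rewrite expr2.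
  move=> z Dz; have /andP[g1 g2] := eta_bounds hr hst Dz.
  rewrite !expr2 -[leRHS]mulrA; apply: ler_wpM2l; first exact: tau_ge0.
  exact: ler_wpM2r.
have cL : psum 0 s (log_summand pi) @[s --> mesh_to0 0 t] --> L t - L 0.
  apply: (approx_cvg hE C0) => // u v u0 uv vT.
  exact: (hL (tt, u, v) (And3 u0 uv vT)).
have cint : psum 0 s (int_summand pi) @[s --> mesh_to0 0 t] -->
    L t - L 0 + 2^-1 * \sum_i \sum_j mesh_lim 0 t (br_summand pi i j).
  have -> : (fun s => psum 0 s (int_summand pi)) = (fun s => psum 0 s (log_summand pi)
      + 2^-1 * \sum_i \sum_j psum 0 s (br_summand pi i j)).
    apply/funext => s; under eq_bigr do rewrite -psum_sum.
    rewrite -psum_sum -psumZ -psumD; apply: eq_bigr => k _.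
    by rewrite /log_summand subrK.
  have FF := mesh_to0_filter t0.
  apply: cvgD => //; apply: cvgM; first exact: cvg_cst.
  by apply: cvg_sumR => i; apply: cvg_sumR => j.
rewrite /wealth; congr expR.
rewrite /rough_int (mesh_limE t0 cint) addrK //.
Qed.

End LogWealth.

(** * Exponentials and uniformly controlled paths *)

Section ControlledCalculus.
Context {R : realType} {d : nat}.
Variables (p T B : R) (S : R -> 'rV[R]_d) (P : nat -> nat -> R).
Variables (c eta : R -> R -> R).
Hypothesis hd : (0 < d)%N.
Hypothesis hp : 2 < p < 3.
Local Notation A := (Defs.lift S P).
Hypothesis hr : rough_driver T p S A c eta.
Hypothesis B0 : 0 < B.
Hypothesis hB : forall t i, 0 <= t -> t <= T -> B^-1 <= S t 0 i <= B.

Local Notation tau := (tau p c).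
Local Notation E := (err p c eta).

Section Expansions.
Context {I : Type}.
Variables (D : set I) (s t : I -> R).
Hypothesis hst : spans T D s t.
Variables (phi : I -> 'I_d -> R) (Psi : I -> 'I_d -> 'I_d -> R).
Hypothesis hphi : forall k, bO D (fun i => phi i k) (fun=> 1).
Hypothesis hPsi : forall k l, bO D (fun i => Psi i k l) (fun=> 1).

Let E0 i : 0 <= E (s i) (t i). Proof. exact: err_ge0. Qed.
Let eta0 i : D i -> 0 <= eta (s i) (t i).
Proof. by move=> /(eta_bounds hr hst)/andP[]. Qed.

Let EE : bO D (fun i => E (s i) (t i)) (fun i => E (s i) (t i)).
Proof. by apply: bO_le => i _; rewrite ger0_norm. Qed.

Lemma O_Amu_eta k l : bO D (fun i => Amu S P (s i) (t i) k l)
  (fun i => eta (s i) (t i) ^+ 2 + E (s i) (t i)).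
Proof.
apply: (eq_bO (x' := fun i => area1 S P k l (s i) (t i) +
  (Amu S P (s i) (t i) k l - area1 S P k l (s i) (t i)))); first by move=> i _; ring.
apply: bO_D.
  by apply: bO_leT (O_area1 hd hr B0 hB hst k l) _ => i _; rewrite lerDl.
apply: bO_leT (Amu_expand hd hp hr B0 hB hst k l) _ => i _.
by rewrite lerDr sqr_ge0.
Qed.

Lemma gauge_cube : bO D (fun i => (eta (s i) (t i) + E (s i) (t i)) ^+ 3)
  (fun i => E (s i) (t i)).
Proof.
have eE := bO_Ml (O_eta hp hr hst) EE; have e2E := bO_Ml (O_eta hp hr hst) eE.
have E2 := bO_Ml (O_E hp hr hst) EE; have E3 := bO_Ml (O_E hp hr hst) E2.
have eE2 := bO_Ml (O_eta hp hr hst) E2.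
have c3 := bO_cst D (3%:R : R).
apply: (eq_bO _ (bO_D (bO_D (bO_D (O_eta3 hp hr hst) (bO_Ml c3 e2E))
  (bO_Ml c3 eE2)) E3)) => i _; ring.
Qed.

Lemma gauge_cross : bO D (fun i => (eta (s i) (t i) ^+ 2 + E (s i) (t i))
    * (eta (s i) (t i) + E (s i) (t i))) (fun i => E (s i) (t i)).
Proof.
have eE := bO_Ml (O_eta hp hr hst) EE; have e2E := bO_Ml (O_eta hp hr hst) eE.
have E2 := bO_Ml (O_E hp hr hst) EE.
apply: (eq_bO _ (bO_D (bO_D (bO_D (O_eta3 hp hr hst) e2E) eE) E2)) => i _; ring.
Qed.

Definition dlin i : R := \sum_k phi i k * (mu S (t i) 0 k - mu S (s i) 0 k).

Lemma O_dlin : bO D dlin (fun i => eta (s i) (t i)).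
Proof.
apply: bO_sum => // k; apply: bO_Ml => //; exact: (O_dmu hd hp hr B0 hB hst).
Qed.

Lemma O_dlin_gauge : bO D dlin (fun i => eta (s i) (t i) + E (s i) (t i)).
Proof. by apply: bO_leT O_dlin _ => i _; rewrite lerDl. Qed.

Lemma gauge_ge0 i : D i -> 0 <= eta (s i) (t i) ^+ 2 + E (s i) (t i).
Proof. by move=> _; rewrite addr_ge0// sqr_ge0. Qed.

Lemma O_area_sum (Ups : I -> 'I_d -> 'I_d -> R) :
  (forall k l, bO D (fun i => Ups i k l) (fun=> 1)) ->
  bO D (fun i => \sum_k \sum_l Ups i k l * Amu S P (s i) (t i) l k)
    (fun i => eta (s i) (t i) ^+ 2 + E (s i) (t i)).
Proof.
move=> h; apply: bO_sum => [|k]; first exact: gauge_ge0.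
apply: bO_sum => [|l]; first exact: gauge_ge0.
by apply: bO_Ml => //; exact: O_Amu_eta.
Qed.

Lemma gauge2_le x : bO D x (fun i => eta (s i) (t i) ^+ 2 + E (s i) (t i)) ->
  bO D x (fun i => eta (s i) (t i) + E (s i) (t i)).
Proof.
move=> h; apply: bO_trans h _; apply: bO_D.
  by apply: bO_leT (O_eta2 hp hr hst) _ => i _; rewrite lerDl.
by apply: bO_leT EE _ => i /eta0; rewrite lerDr.
Qed.

(** The quadratic term of an exponential turns the bracket into the lift. *)
Lemma dlogV_quad i : D i -> dlogV S P (phi i) (Psi i) (s i) (t i)
    + dlin i ^+ 2 / 2 =
  dlin i + \sum_k \sum_l (Psi i k l + phi i k * phi i l) * Amu S P (s i) (t i) l k.
Proof.
move=> /hst[s0 st tT]; rewrite /dlogV -/(dlin i).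
have -> : \sum_k \sum_l (Psi i k l + phi i k * phi i l) * Amu S P (s i) (t i) l k
   = \sum_k \sum_l Psi i k l * Amu S P (s i) (t i) l k
     + \sum_k \sum_l phi i k * phi i l * Amu S P (s i) (t i) l k.
  rewrite -big_split/=; apply: eq_bigr => k _; rewrite -big_split/=.
  by apply: eq_bigr => l _; rewrite mulrDl.
have -> : \sum_k \sum_l phi i k * phi i l * mu_br S P (s i) (t i) k l
   = dlin i ^+ 2 - \sum_k \sum_l phi i k * phi i l * Amu S P (s i) (t i) k l
     - \sum_k \sum_l phi i k * phi i l * Amu S P (s i) (t i) l k.
  rewrite expr2 {1}/dlin mulr_suml -!sumrB; apply: eq_bigr => k _.
  rewrite /dlin mulr_sumr -!sumrB; apply: eq_bigr => l _.
  by rewrite (mu_brE hd hp hr B0 hB _ _ s0 st tT); ring.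
have -> : \sum_k \sum_l phi i k * phi i l * Amu S P (s i) (t i) k l
   = \sum_k \sum_l phi i k * phi i l * Amu S P (s i) (t i) l k.
  rewrite exchange_big/=; apply: eq_bigr => k _; apply: eq_bigr => l _.
  by rewrite [phi i l * _]mulrC.
by field.
Qed.

Lemma O_PsiPhi k l : bO D (fun i => Psi i k l + phi i k * phi i l) (fun=> 1).
Proof. by apply: bO_D => //; apply: bO_Ml. Qed.

Lemma dlogV_gauge : bO D (fun i => dlogV S P (phi i) (Psi i) (s i) (t i) - dlin i)
  (fun i => eta (s i) (t i) ^+ 2 + E (s i) (t i)).
Proof.
apply: (eq_bO (x' := fun i => \sum_k \sum_l (Psi i k l + phi i k * phi i l)
   * Amu S P (s i) (t i) l k - 2^-1 * dlin i ^+ 2)).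
  by move=> i Di; have := dlogV_quad Di; move=> h; apply/eqP; rewrite subr_eq; apply/eqP; lra.
apply: bO_B; first exact: O_area_sum O_PsiPhi.
apply: bO_Ml; first exact: bO_cst.
by apply: bO_leT (bO_X 2 O_dlin) _ => i _; rewrite lerDl.
Qed.

(** Exponentiating the local increments of a logarithmic wealth cancels the
    bracket, see [dlogV_quad]. *)
Lemma exp_expand (L : I -> R) :
  bO D (fun i => L i - dlogV S P (phi i) (Psi i) (s i) (t i)) (fun i => E (s i) (t i)) ->
  bO D (fun i => expR (L i) - 1 - dlin i
      - \sum_k \sum_l (Psi i k l + phi i k * phi i l) * Amu S P (s i) (t i) l k)
    (fun i => E (s i) (t i)).
Proof.
move=> hL.
have Lu : bO D (fun i => L i - dlin i) (fun i => eta (s i) (t i) ^+ 2 + E (s i) (t i)).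
  apply: (eq_bO (x' := fun i => L i - dlogV S P (phi i) (Psi i) (s i) (t i)
     + (dlogV S P (phi i) (Psi i) (s i) (t i) - dlin i))); first by move=> i _; ring.
  apply: bO_D dlogV_gauge.
  by apply: bO_leT hL _ => i _; rewrite lerDr sqr_ge0.
have LG : bO D L (fun i => eta (s i) (t i) + E (s i) (t i)).
  apply: (eq_bO (x' := fun i => L i - dlin i + dlin i)); first by move=> i _; ring.
  by apply: bO_D; [exact: gauge2_le|exact: O_dlin_gauge].
have L1 : bO D L (fun=> 1).
  by apply: bO_trans LG _; apply: bO_D; [exact: (O_eta hp hr hst)|exact: (O_E hp hr hst)].
apply: (eq_bO (x' := fun i => (expR (L i) - 1 - L i - L i ^+ 2 / 2)
    + (L i - dlogV S P (phi i) (Psi i) (s i) (t i))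
    + 2^-1 * ((L i - dlin i) * (L i + dlin i)))).
  by move=> i Di; have := dlogV_quad Di => h; lra.
apply: bO_D; [apply: bO_D => //|].
  apply: bO_trans (bO_exp L1) _; apply: bO_trans gauge_cube.
  exact: bO_X (bO_norm LG).
apply: bO_Ml; first exact: bO_cst.
apply: bO_trans gauge_cross; apply: bO_M => //.
by apply: bO_D => //; exact: O_dlin_gauge.
Qed.

(** This inverts [exp_expand]: the logarithm restores the bracket. *)
Lemma log_expand (z : I -> R) (a b : R) : 0 < a ->
  (forall i, D i -> a <= 1 + z i <= b) ->
  bO D (fun i => z i - dlin i
      - \sum_k \sum_l (Psi i k l + phi i k * phi i l) * Amu S P (s i) (t i) l k)
    (fun i => E (s i) (t i)) ->
  bO D (fun i => ln (1 + z i) - dlogV S P (phi i) (Psi i) (s i) (t i))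
    (fun i => E (s i) (t i)).
Proof.
move=> a0 hz h.
have zu : bO D (fun i => z i - dlin i) (fun i => eta (s i) (t i) ^+ 2 + E (s i) (t i)).
  apply: (eq_bO (x' := fun i => (z i - dlin i
      - \sum_k \sum_l (Psi i k l + phi i k * phi i l) * Amu S P (s i) (t i) l k)
     + \sum_k \sum_l (Psi i k l + phi i k * phi i l) * Amu S P (s i) (t i) l k)).
    by move=> i _; ring.
  apply: bO_D; last exact: O_area_sum O_PsiPhi.
  by apply: bO_leT h _ => i _; rewrite lerDr sqr_ge0.
have zG : bO D z (fun i => eta (s i) (t i) + E (s i) (t i)).
  apply: (eq_bO (x' := fun i => z i - dlin i + dlin i)); first by move=> i _; ring.
  by apply: bO_D; [exact: gauge2_le|exact: O_dlin_gauge].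
apply: (eq_bO (x' := fun i => (ln (1 + z i) - z i + z i ^+ 2 / 2)
    + (z i - dlin i
      - \sum_k \sum_l (Psi i k l + phi i k * phi i l) * Amu S P (s i) (t i) l k)
    - 2^-1 * ((z i - dlin i) * (z i + dlin i)))).
  by move=> i Di; have := dlogV_quad Di => e; lra.
apply: bO_B; [apply: bO_D => //|].
  apply: bO_trans (bO_ln a0 hz) _; apply: bO_trans gauge_cube.
  exact: bO_X (bO_norm zG).
apply: bO_Ml; first exact: bO_cst.
apply: bO_trans gauge_cross; apply: bO_M => //.
by apply: bO_D => //; exact: O_dlin_gauge.
Qed.

End Expansions.

Section Controlled.
Context {J : Type}.

Let D := @pairs R J T.
Let hs : spans T D (fun z => z.1.2) (fun z => z.2) := @pairs_spans _ T J.

(** Scalar paths that are controlled by the prices, uniformly over a family. *)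
Definition ctl (x : J -> R -> R) (x' : J -> R -> 'I_d -> R) : Prop :=
  [/\ bO D (fun z => x z.1.1 z.1.2) (fun=> 1),
      forall k, bO D (fun z => x' z.1.1 z.1.2 k) (fun=> 1),
      forall k, bO D (fun z => x' z.1.1 z.2 k - x' z.1.1 z.1.2 k)
        (fun z => tau z.1.2 z.2) &
      bO D (fun z => x z.1.1 z.2 - x z.1.1 z.1.2
          - \sum_k x' z.1.1 z.1.2 k * (S z.2 0 k - S z.1.2 0 k))
        (fun z => tau z.1.2 z.2 ^+ 2)].

Lemma bO_end (f : J -> R -> R) : bO D (fun z => f z.1.1 z.1.2) (fun=> 1) ->
  bO D (fun z => f z.1.1 z.2) (fun=> 1).
Proof.
move=> h; apply: (bO_comp (f := fun z : J * R * R => (z.1.1, z.2, z.2)) _ h).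
by move=> z [h1 h2 h3]; split => //; exact: le_trans h2.
Qed.

Lemma O_dS_tau k : bO D (fun z => S z.2 0 k - S z.1.2 0 k) (fun z => tau z.1.2 z.2).
Proof. exact: bO_trans (O_dS hr hs k) (O_eta_tau hr hs). Qed.

Lemma ctl_inc x x' : ctl x x' ->
  bO D (fun z => x z.1.1 z.2 - x z.1.1 z.1.2) (fun z => tau z.1.2 z.2).
Proof.
move=> [h1 h2 h3 h4].
apply: (eq_bO (x' := fun z => (x z.1.1 z.2 - x z.1.1 z.1.2
      - \sum_k x' z.1.1 z.1.2 k * (S z.2 0 k - S z.1.2 0 k))
   + \sum_k x' z.1.1 z.1.2 k * (S z.2 0 k - S z.1.2 0 k))); first by move=> z _; ring.
apply: bO_D; first exact: bO_trans h4 (O_tau2_tau hp hr hs).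
apply: bO_sum => [z _|k]; first exact: tau_ge0.
by apply: bO_Ml => //; exact: O_dS_tau.
Qed.

Lemma eq_ctl (x : J -> R -> R) (x' : J -> R -> 'I_d -> R) y y' :
  (forall j t, 0 <= t -> t <= T -> x j t = y j t) ->
  (forall j t k, 0 <= t -> t <= T -> x' j t k = y' j t k) ->
  ctl y y' -> ctl x x'.
Proof.
move=> e e' [h1 h2 h3 h4]; split.
- apply: eq_bO h1 => z [z0 zz zT]; apply: e => //; exact: le_trans zT.
- move=> k; apply: eq_bO (h2 k) => z [z0 zz zT]; apply: e' => //; exact: le_trans zT.
- move=> k; apply: eq_bO (h3 k) => z [z0 zz zT].
  by rewrite !e'//; [exact: le_trans zT|exact: le_trans zz].
- apply: eq_bO h4 => z [z0 zz zT].
  have z2 := le_trans z0 zz; have z1 := le_trans zz zT.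
  by rewrite !e//; congr (_ - _); apply: eq_bigr => k _; rewrite e'.
Qed.

Lemma ctl_cst (k : R) : ctl (fun _ _ => k) (fun _ _ _ => 0).
Proof.
have Z (y : J * R * R -> R) : bO D (fun=> 0) y.
  by exists 0 => // z _; rewrite normr0 mul0r.
split=> [|l|l|]; first exact: bO_cst.
- exact: Z.
- by apply: eq_bO (Z _) => z _; rewrite subrr.
- apply: eq_bO (Z _) => z _; rewrite subrr sub0r big1 ?oppr0// => l _.
  by rewrite mul0r.
Qed.

Lemma ctl_D x x' y y' : ctl x x' -> ctl y y' ->
  ctl (fun j t => x j t + y j t) (fun j t k => x' j t k + y' j t k).
Proof.
move=> [h1 h2 h3 h4] [g1 g2 g3 g4]; split=> [|k|k|].
- exact: bO_D.
- exact: bO_D.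
- by apply: eq_bO (bO_D (h3 k) (g3 k)) => z _; ring.
- apply: eq_bO (bO_D h4 g4) => z _.
  under eq_bigr do rewrite mulrDl; rewrite big_split/=; ring.
Qed.

Lemma ctl_M x x' y y' : ctl x x' -> ctl y y' ->
  ctl (fun j t => x j t * y j t)
    (fun j t k => x' j t k * y j t + x j t * y' j t k).
Proof.
move=> cx cy; have ix := ctl_inc cx; have iy := ctl_inc cy.
move: cx cy => [h1 h2 h3 h4] [g1 g2 g3 g4].
split=> [|k|k|].
- exact: bO_Ml.
- by apply: bO_D; apply: bO_Ml.
- apply: (eq_bO (x' := fun z =>
    (x' z.1.1 z.2 k - x' z.1.1 z.1.2 k) * y z.1.1 z.2
    + x' z.1.1 z.1.2 k * (y z.1.1 z.2 - y z.1.1 z.1.2)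
    + ((x z.1.1 z.2 - x z.1.1 z.1.2) * y' z.1.1 z.2 k
    + x z.1.1 z.1.2 * (y' z.1.1 z.2 k - y' z.1.1 z.1.2 k)))).
    by move=> z _; ring.
  apply: bO_D; apply: bO_D.
  + by apply: bO_Mr => //; exact: bO_end.
  + exact: bO_Ml.
  + by apply: bO_Mr => //; exact: (bO_end (f := fun j t => y' j t k)).
  + exact: bO_Ml.
- apply: (eq_bO (x' := fun z =>
    y z.1.1 z.1.2 * (x z.1.1 z.2 - x z.1.1 z.1.2
      - \sum_k x' z.1.1 z.1.2 k * (S z.2 0 k - S z.1.2 0 k))
    + x z.1.1 z.1.2 * (y z.1.1 z.2 - y z.1.1 z.1.2
      - \sum_k y' z.1.1 z.1.2 k * (S z.2 0 k - S z.1.2 0 k))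
    + (x z.1.1 z.2 - x z.1.1 z.1.2) * (y z.1.1 z.2 - y z.1.1 z.1.2))).
    move=> z _.
    have -> : \sum_k (x' z.1.1 z.1.2 k * y z.1.1 z.1.2 + x z.1.1 z.1.2 * y' z.1.1 z.1.2 k)
         * (S z.2 0 k - S z.1.2 0 k)
      = y z.1.1 z.1.2 * \sum_k x' z.1.1 z.1.2 k * (S z.2 0 k - S z.1.2 0 k)
        + x z.1.1 z.1.2 * \sum_k y' z.1.1 z.1.2 k * (S z.2 0 k - S z.1.2 0 k).
      by rewrite !mulr_sumr -big_split/=; apply: eq_bigr => k _; ring.
    by ring.
  apply: bO_D; first by apply: bO_D; apply: bO_Ml.
  by apply: bO_leT (bO_M ix iy) _ => z _; rewrite expr2.
Qed.

Lemma ctl_N x x' : ctl x x' -> ctl (fun j t => - x j t) (fun j t k => - x' j t k).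
Proof.
move=> h; apply: eq_ctl (ctl_M (ctl_cst (-1)) h) => [j t _ _|j t k _ _]; ring.
Qed.

Lemma ctl_sum (K : Type) (r : seq K) (x : K -> J -> R -> R)
    (x' : K -> J -> R -> 'I_d -> R) : (forall k, ctl (x k) (x' k)) ->
  ctl (fun j t => \sum_(k <- r) x k j t) (fun j t l => \sum_(k <- r) x' k j t l).
Proof.
move=> h; elim: r => [|k r IH].
  by apply: eq_ctl (ctl_cst 0) => [j t _ _|j t l _ _]; rewrite big_nil.
by apply: eq_ctl (ctl_D (h k) IH) => [j t _ _|j t l _ _]; rewrite big_cons.
Qed.

Lemma ctl_V x x' : ctl x x' -> (forall j t, 0 <= t -> t <= T -> x j t != 0) ->
  bO D (fun z => (x z.1.1 z.1.2)^-1) (fun=> 1) ->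
  ctl (fun j t => (x j t)^-1) (fun j t k => - (x j t ^+ 2)^-1 * x' j t k).
Proof.
move=> cx x0 hV; have ix := ctl_inc cx; move: cx => [h1 h2 h3 h4].
have hVe := bO_end (f := fun j t => (x j t)^-1) hV.
have hV2 : bO D (fun z => - (x z.1.1 z.1.2 ^+ 2)^-1) (fun=> 1).
  apply: bO_N; apply: (eq_bO (x' := fun z => (x z.1.1 z.1.2)^-1 * (x z.1.1 z.1.2)^-1)).
    by move=> z _; rewrite expr2 invfM.
  exact: bO_Ml.
have nz (z : J * R * R) : D z -> x z.1.1 z.2 != 0 /\ x z.1.1 z.1.2 != 0.
  move=> [z0 zz zT]; split; apply: x0 => //; [exact: le_trans zz|exact: le_trans zT].
split=> [|k|k|] //.
- exact: bO_Ml.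
- apply: (eq_bO (x' := fun z =>
     - ((x z.1.1 z.2)^-1 * (x z.1.1 z.2)^-1) * (x' z.1.1 z.2 k - x' z.1.1 z.1.2 k)
     + (x' z.1.1 z.1.2 k * ((x z.1.1 z.2)^-1 * (x z.1.1 z.1.2)^-1)
        * ((x z.1.1 z.2)^-1 + (x z.1.1 z.1.2)^-1)) * (x z.1.1 z.2 - x z.1.1 z.1.2))).
    by move=> z /nz[n1 n2]; field; rewrite n1 n2.
  apply: bO_D; apply: bO_Ml => //.
    by apply: bO_N; apply: bO_Ml.
  by apply: bO_Ml; [apply: bO_Ml => //; apply: bO_Ml|apply: bO_D].
- apply: (eq_bO (x' := fun z =>
    - (x z.1.1 z.1.2 ^+ 2)^-1 * (x z.1.1 z.2 - x z.1.1 z.1.2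
      - \sum_k x' z.1.1 z.1.2 k * (S z.2 0 k - S z.1.2 0 k))
    + (- (x z.1.1 z.1.2 ^+ 2)^-1 * - (x z.1.1 z.2)^-1)
      * ((x z.1.1 z.2 - x z.1.1 z.1.2) * (x z.1.1 z.2 - x z.1.1 z.1.2)))).
    move=> z /nz[n1 n2].
    have -> : \sum_k - (x z.1.1 z.1.2 ^+ 2)^-1 * x' z.1.1 z.1.2 k * (S z.2 0 k - S z.1.2 0 k)
      = - (x z.1.1 z.1.2 ^+ 2)^-1 * \sum_k x' z.1.1 z.1.2 k * (S z.2 0 k - S z.1.2 0 k).
      by rewrite mulr_sumr; apply: eq_bigr => k _; ring.
    by field; rewrite n1 n2.
  apply: bO_D; apply: bO_Ml => //.
    by apply: bO_Ml => //; exact: bO_N.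
  by apply: bO_leT (bO_M ix ix) _ => z _; rewrite expr2.
Qed.

Lemma ctl_mu k : ctl (fun _ t => mu S t 0 k) (fun _ t l => dnorm (S t) k l).
Proof.
split=> [|l|l|].
- exact: (O_mu hd B0 hB (spans_l hs)).
- exact: (O_dnorm hd B0 hB (spans_l hs)).
- exact: bO_trans (O_ddnorm hd hp hr B0 hB hs k l) (O_eta_tau hr hs).
- exact: bO_trans (mu_linear hd hp hr B0 hB hs k) (O_eta2_tau2 hr hs).
Qed.

Lemma ctl_S k : ctl (fun _ t => S t 0 k) (fun _ t l => (l == k)%:R).
Proof.
have Z (y : J * R * R -> R) : bO D (fun=> 0) y.
  by exists 0 => // z _; rewrite normr0 mul0r.
split=> [|l|l|].
- exact: (O_S B0 hB (spans_l hs)).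
- exact: bO_cst.
- by apply: eq_bO (Z _) => z _; rewrite subrr.
- apply: eq_bO (Z _) => z _; under eq_bigr do rewrite mulrC.
  by rewrite sum_delta_l subrr.
Qed.

Lemma ctl_Sinv k : ctl (fun _ t => (S t 0 k)^-1)
  (fun _ t l => - (S t 0 k ^+ 2)^-1 * (l == k)%:R).
Proof.
apply: ctl_V (ctl_S k) _ _.
  by move=> j t t0 tT; rewrite gt_eqF// (price_gt0 B0 hB).
exact: (O_Sinv B0 hB (spans_l hs)).
Qed.

End Controlled.
End ControlledCalculus.

(** * Functionally generated portfolios *)

Lemma mul_incr {R : realType} (a b a' b' : R) :
  a' * b' - a * b = (a' - a) * b' + a * (b' - b).
Proof. by ring. Qed.

Lemma dlogV_defect_alg {R : realType} {d : nat} (f g m n : 'I_d -> R)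
    (F G : 'I_d -> 'I_d -> R) (a a' b b' : 'I_d -> 'I_d -> R) :
  (\sum_k f k * (m k + n k) + \sum_k \sum_l F k l * (a l k + a' l k + m l * n k)
     - 2^-1 * \sum_k \sum_l f k * f l * (b k l + b' k l))
  - (\sum_k f k * m k + \sum_k \sum_l F k l * a l k
     - 2^-1 * \sum_k \sum_l f k * f l * b k l)
  - (\sum_k g k * n k + \sum_k \sum_l G k l * a' l k
     - 2^-1 * \sum_k \sum_l g k * g l * b' k l)
  = - \sum_k n k * (g k - f k - \sum_l F k l * m l)
    - \sum_k \sum_l (G k l - F k l) * a' l k
    + 2^-1 * \sum_k \sum_l (g k * g l - f k * f l) * b' k l.
Proof.
have e1 : \sum_k n k * (g k - f k - \sum_l F k l * m l)
   = \sum_k g k * n k - (\sum_k f k * (m k + n k) - \sum_k f k * m k)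
     - \sum_k \sum_l F k l * (m l * n k).
  rewrite -!sumrB; apply: eq_bigr => k _; rewrite mulrBr.
  congr (_ - _); first by ring.
  by rewrite mulr_sumr; apply: eq_bigr => l _; ring.
have e2 : \sum_k \sum_l (G k l - F k l) * a' l k
   = \sum_k \sum_l G k l * a' l k
     - (\sum_k \sum_l F k l * (a l k + a' l k + m l * n k)
        - \sum_k \sum_l F k l * a l k)
     + \sum_k \sum_l F k l * (m l * n k).
  rewrite -!sumrB -big_split/=; apply: eq_bigr => k _.
  rewrite -!sumrB -big_split/=; apply: eq_bigr => l _; ring.
have e3 : \sum_k \sum_l (g k * g l - f k * f l) * b' k l
   = \sum_k \sum_l g k * g l * b' k l
     - (\sum_k \sum_l f k * f l * (b k l + b' k l)
        - \sum_k \sum_l f k * f l * b k l).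
  rewrite -!sumrB; apply: eq_bigr => k _; rewrite -!sumrB; apply: eq_bigr => l _; ring.
by rewrite e1 e2 e3; ring.
Qed.

Section Family.
Context {R : realType} {d : nat}.
Variables (p T B : R) (S : R -> 'rV[R]_d) (P : nat -> nat -> R).
Variables (c eta : R -> R -> R).
Hypothesis hd : (0 < d)%N.
Hypothesis hp : 2 < p < 3.
Hypothesis T0 : 0 <= T.
Local Notation A := (Defs.lift S P).
Hypothesis hr : rough_driver T p S A c eta.
Hypothesis B0 : 0 < B.
Hypothesis hB : forall t i, 0 <= t -> t <= T -> B^-1 <= S t 0 i <= B.

Local Notation tau := (tau p c).
Local Notation E := (err p c eta).
Local Notation ctl := (ctl p T S c).
Let hE : sewing_error T E := err_sewing (driver_control hr) hp (driver_modulus hr).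

Section GeneratedPaths.
Context {J : Type}.
Let hs : spans T (@pairs R J T) (fun z => z.1.2) (fun z => z.2) := @pairs_spans _ T J.

(** The product rule for [gen_pi] is the formula [gen_dpi]. *)
Lemma ctl_gen_pi (phi : J -> R -> 'I_d -> R) (Psi : J -> R -> 'I_d -> 'I_d -> R) :
  (forall k, ctl (fun j t => phi j t k)
     (fun j t l => \sum_i Psi j t k i * dnorm (S t) i l)) ->
  forall k, ctl (fun j t => gen_pi (S t) (phi j t) k)
    (fun j t l => \sum_i gen_dpi (S t) (phi j t) (Psi j t) k i * dnorm (S t) i l).
Proof.
move=> h k.
have hw := ctl_sum (index_enum 'I_d)
  (fun l => ctl_M hp hr (ctl_mu hd hp hr B0 hB (J := J) l) (h l)).
have h1 := ctl_D (ctl_D (h k) (ctl_cst p T S c 1)) (ctl_N hp hr hw).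
apply: eq_ctl (ctl_M hp hr (ctl_mu hd hp hr B0 hB (J := J) k) h1).
  by move=> j t t0 tT.
move=> j t l t0 tT.
pose w := \sum_m mu S t 0 m * phi j t m; rewrite -/w.
transitivity (\sum_i (((i == k)%:R * (phi j t k + 1 - w)) * dnorm (S t) i l
  + mu S t 0 k * (Psi j t k i * dnorm (S t) i l)
  - mu S t 0 k * (phi j t i * dnorm (S t) i l)
  - mu S t 0 k * ((\sum_m mu S t 0 m * Psi j t m i) * dnorm (S t) i l))).
  apply: eq_bigr => i _; rewrite /gen_dpi -/(mu S t) -/w [k == i]eq_sym.
  by move: w => w; ring.
rewrite !sumrB big_split/= -!mulr_sumr.
have -> : \sum_i (i == k)%:R * (phi j t k + 1 - w) * dnorm (S t) i l
    = dnorm (S t) k l * (phi j t k + 1 - w).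
  rewrite -(sum_delta_l (fun i => dnorm (S t) i l * (phi j t k + 1 - w)) k).
  by apply: eq_bigr => i _; ring.
have -> : \sum_m (dnorm (S t) m l * phi j t m
     + mu S t 0 m * \sum_i Psi j t m i * dnorm (S t) i l)
  = \sum_i phi j t i * dnorm (S t) i l
    + \sum_i (\sum_m mu S t 0 m * Psi j t m i) * dnorm (S t) i l.
  rewrite big_split/=; congr (_ + _); first by apply: eq_bigr => m _; ring.
  under [RHS]eq_bigr do rewrite mulr_suml.
  rewrite exchange_big/=; apply: eq_bigr => m _; rewrite mulr_sumr.
  by apply: eq_bigr => i _; ring.
by ring.
Qed.

(** These ratios are the integrands against the bracket of the prices; variation
    of order [tau] is what makes the left-point sums converge. *)
Lemma ctl_ratio (pi : J -> cpath R d d) (pi' : J -> R -> 'I_d -> 'I_d -> R) :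
  (forall k, ctl (fun j t => (pi j).1 t 0 k) (fun j t l => pi' j t k l)) ->
  forall k l, bO (@pairs R J T) (fun z =>
     (pi z.1.1).1 z.2 0 k * (pi z.1.1).1 z.2 0 l / (S z.2 0 k * S z.2 0 l)
     - (pi z.1.1).1 z.1.2 0 k * (pi z.1.1).1 z.1.2 0 l / (S z.1.2 0 k * S z.1.2 0 l))
     (fun z => tau z.1.2 z.2).
Proof.
move=> h k l.
have hk m := ctl_M hp hr (h m) (ctl_Sinv hp hr B0 hB (J := J) m).
apply: eq_bO (ctl_inc hp hr (ctl_M hp hr (hk k) (hk l))) => z _.
by rewrite !invfM; ring.
Qed.

End GeneratedPaths.

Lemma generated_cmu s : 0 <= s -> s <= T ->
  generated S (cmu S) s (fun=> 0) (fun _ _ => 0).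
Proof.
move=> s0 sT; have z (f : 'I_d -> R) : \sum_j f j * 0 = (0 : R).
  by rewrite big1// => j _; rewrite mulr0.
split=> [k|k l].
  by rewrite /gen_pi z subr0 add0r mulr1.
rewrite D_normalize; last by rewrite gt_eqF// (total_gt0 hd B0 hB).
rewrite -(sum_delta_l (fun j => dnorm (S s) j l) k); apply: eq_bigr => j _.
by rewrite /gen_dpi !z !subr0 add0r mulr0 addr0 mulr1 eq_sym mulrC.
Qed.

(** The market portfolio is generated by the zero field, so that its wealth is the
    total of the prices, up to normalisation. *)
Lemma wealth_cmu t : 0 <= t -> t <= T ->
  wealth S P (cmu S) t = expR (ln (total S t) - ln (total S 0)).
Proof.
move=> t0 tT.
have hs : spans T (@pairs R unit T) (fun z => z.1.2) (fun z => z.2) := @pairs_spans _ T unit.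
have Z (y : unit * R * R -> R) : bO (@pairs R unit T) (fun=> 0) y.
  by exists 0 => // z _; rewrite normr0 mul0r.
apply: (wealth_exp hp hr (L := fun t => ln (total S t))) t0 tT => [i j|].
  apply: (@ctl_ratio unit (fun=> cmu S) (fun _ t => fun k l => dnorm (S t) k l)).
  by move=> k; exact: (ctl_mu hd hp hr B0 hB).
have := @ito_local _ _ p T B S P c eta hd hp hr B0 hB _ _ _ _ (fun=> cmu S)
  (fun _ _ => 0) (fun _ _ _ => 0) hs _ _ _.
move=> h; apply: (eq_bO _ (bO_N (h _ _ _))).
- move=> z _; rewrite /dlogV.
  rewrite big1; last by move=> k _; rewrite mul0r.
  rewrite big1; last by move=> k _; rewrite big1// => l _; rewrite mul0r.
  rewrite big1; last by move=> k _; rewrite big1// => l _; rewrite !mul0r.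
  ring.
- by move=> z [z0 zz zT]; apply: generated_cmu => //; exact: le_trans zT.
- by move=> k; exact: Z.
- by move=> k l; exact: Z.
Qed.

Section Functions.
Context {J : Type}.
Variables (F : J -> 'rV[R]_d -> 'rV[R]_d) (K : R).
Hypothesis hF : forall j, twice_diff (F j).
Hypothesis hK : forall j, C2_le K (F j).

Definition phiF j t k : R := F j (mu S t) 0 k.
Definition PsiF j t k l : R := D (F j) (mu S t) k l.
Definition XiF j s t : R := dlogV S P (phiF j s) (PsiF j s) s t.

(** The logarithm of the relative wealth of the portfolio generated by [F j], as
    [rel_wealth_F] shows. *)
Definition logVF j t : R := mesh_lim 0 t (XiF j).

Section Spans.
Context {I : Type}.
Variables (E' : set I) (s t : I -> R) (j : I -> J).
Hypothesis hst : spans T E' s t.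
Let hs := spans_l hst.
Let ht := spans_r hst.

Let K0 : J -> 0 <= K.
Proof.
move=> j0; have [h _ _] := hK j0 (mu_simplex hd B0 hB (lexx 0) T0)
  (Ordinal hd) (Ordinal hd) (Ordinal hd).
exact: le_trans (normr_ge0 _) h.
Qed.

Lemma O_phiF k : bO E' (fun i => phiF (j i) (s i) k) (fun=> 1).
Proof.
exists `|K| => // i Di; have [s0 sT] := hs Di; rewrite mulr1.
have [h _ _] := hK (j i) (mu_simplex hd B0 hB s0 sT) k k k.
exact: le_trans h (ler_norm _).
Qed.

Lemma O_PsiF k l : bO E' (fun i => PsiF (j i) (s i) k l) (fun=> 1).
Proof.
exists `|K| => // i Di; have [s0 sT] := hs Di; rewrite mulr1.
have [_ h _] := hK (j i) (mu_simplex hd B0 hB s0 sT) k l l.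
exact: le_trans h (ler_norm _).
Qed.

Lemma O_dist1 : bO E' (fun i => dist1 (mu S (s i)) (mu S (t i)))
  (fun i => eta (s i) (t i)).
Proof.
apply: bO_sum => [i /(eta_bounds hr hst)/andP[]//|k].
by apply: bO_norm; exact: (O_dmu hd hp hr B0 hB hst).
Qed.

Lemma lipschitz_dist1 (x : I -> R) :
  (forall i, E' i -> `|x i| <= K * dist1 (mu S (s i)) (mu S (t i))) ->
  bO E' x (fun i => eta (s i) (t i)).
Proof.
move=> h; apply: bO_trans O_dist1; exists `|K| => // i Di.
apply: le_trans (h i Di) _; rewrite ler_wpM2r ?dist1_ge0//; exact: ler_norm.
Qed.

Lemma O_dphiF k : bO E' (fun i => phiF (j i) (t i) k - phiF (j i) (s i) k)
  (fun i => eta (s i) (t i)).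
Proof.
apply: lipschitz_dist1 => i Di; have [s0 sT] := hs Di; have [t0 tT] := ht Di.
by apply: C2_lipschitz => //; exact: (mu_simplex hd B0 hB).
Qed.

Lemma O_dPsiF k l : bO E' (fun i => PsiF (j i) (t i) k l - PsiF (j i) (s i) k l)
  (fun i => eta (s i) (t i)).
Proof.
apply: lipschitz_dist1 => i Di; have [s0 sT] := hs Di; have [t0 tT] := ht Di.
by apply: D_lipschitz => //; exact: (mu_simplex hd B0 hB).
Qed.

Lemma O_remF k : bO E' (fun i => phiF (j i) (t i) k - phiF (j i) (s i) k
    - \sum_l PsiF (j i) (s i) k l * (mu S (t i) 0 l - mu S (s i) 0 l))
  (fun i => eta (s i) (t i) ^+ 2).
Proof.
apply: bO_trans (bO_X 2 O_dist1); exists `|K| => // i Di.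
have [s0 sT] := hs Di; have [t0 tT] := ht Di.
apply: (le_trans (@C2_taylor _ _ (F (j i)) K (hF _) (hK _) _ _ k _ _)).
- exact: (mu_simplex hd B0 hB).
- exact: (mu_simplex hd B0 hB).
by rewrite ler_wpM2r ?sqr_ge0// ler_norm.
Qed.

End Spans.

(** By Chen's relation the defect consists of the Taylor remainder of [F], of the
    increment of [D F] against the lift and of that of F F against the bracket,
    all of which are of third order. *)
Lemma XiF_defect : bO (@triples R J T) (fun i => XiF i.1.1.1 i.1.1.2 i.2
    - XiF i.1.1.1 i.1.1.2 i.1.2 - XiF i.1.1.1 i.1.2 i.2) (fun i => E i.1.1.2 i.2).
Proof.
pose Dt := @triples R J T.
pose j (z : J * R * R * R) := z.1.1.1; pose s (z : J * R * R * R) := z.1.1.2.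
pose u (z : J * R * R * R) := z.1.2; pose t (z : J * R * R * R) := z.2.
have hsu : spans T Dt s u by move=> z [h1 h2 h3 h4]; split => //; exact: le_trans h4.
have hut : spans T Dt u t by move=> z [h1 h2 h3 h4]; split => //; exact: le_trans h2.
have hst := spans_st hsu hut.
have E0 z : Dt z -> 0 <= E (s z) (t z) by move=> _; exact: err_ge0.
have p0 : 0 <= p by case/andP: hp => hp2 _; apply: ltW; exact: lt_trans hp2.
have cross x y : bO Dt x (fun z => eta (s z) (u z)) ->
    bO Dt y (fun z => tau (u z) (t z) ^+ 2) ->
    bO Dt (fun z => x z * y z) (fun z => E (s z) (t z)).
  move=> hx hy; apply: bO_trans (O_eta_tau2 hp hr hst).
  apply: bO_leT (bO_M (bO_sub_l1 hr hsu hut hx) hy) _ => z Dz.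
  rewrite mulrC ler_wpM2r//; first by have /andP[] := eta_bounds hr hst Dz.
  rewrite lerXn2r// ?nnegrE ?tau_ge0//.
  have [z0 z1 z2 z3] := Dz.
  exact: (tau_mono (driver_control hr) p0 z0 z1 z2 (lexx _) z3).
pose dm (x y : J * R * R * R -> R) k z := mu S (y z) 0 k - mu S (x z) 0 k.
apply: (eq_bO (x' := fun z =>
   - \sum_k dm u t k z * (phiF (j z) (u z) k - phiF (j z) (s z) k
        - \sum_l PsiF (j z) (s z) k l * dm s u l z)
   - \sum_k \sum_l (PsiF (j z) (u z) k l - PsiF (j z) (s z) k l) * Amu S P (u z) (t z) l k
   + 2^-1 * \sum_k \sum_l (phiF (j z) (u z) k * phiF (j z) (u z) l
       - phiF (j z) (s z) k * phiF (j z) (s z) l) * mu_br S P (u z) (t z) k l)).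
  move=> z [z0 z1 z2 z3].
  rewrite -(@dlogV_defect_alg _ _ (phiF (j z) (s z)) (phiF (j z) (u z))
    (dm s u ^~ z) (dm u t ^~ z) (PsiF (j z) (s z)) (PsiF (j z) (u z))
    (Amu S P (s z) (u z)) (Amu S P (u z) (t z)) (mu_br S P (s z) (u z))
    (mu_br S P (u z) (t z))).
  congr (_ - _ - _); congr (_ + _ - _ * _).
  - by apply: eq_bigr => k _; congr (_ * _); rewrite /dm [RHS]addrC addrA subrK.
  - apply: eq_bigr => k _; apply: eq_bigr => l _; congr (_ * _).
    exact: (Amu_chen hd hp hr B0 hB).
  - apply: eq_bigr => k _; apply: eq_bigr => l _; congr (_ * _).
    exact: mu_br_add.
apply: bO_D; [apply: bO_B; [apply: bO_N|]|].
- apply: bO_sum => // k.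
  apply: (bO_cube12 hp hr hsu hut).
    by apply: (bO_sub_r1 hr hsu hut); exact: (O_dmu hd hp hr B0 hB hut).
  by apply: (bO_sub_l hr hsu hut); exact: O_remF.
- apply: bO_sum => // k; apply: bO_sum => // l.
  by apply: cross; [exact: O_dPsiF|exact: (O_Amu hd hp hr B0 hB hut)].
apply: bO_Ml; first exact: bO_cst.
apply: bO_sum => // k; apply: bO_sum => // l.
apply: cross; last exact: (O_mu_br hd hp hr B0 hB hut).
have hus := spans_l hut.
apply: (eq_bO (x' := fun z => phiF (j z) (u z) k * (phiF (j z) (u z) l - phiF (j z) (s z) l)
   + phiF (j z) (s z) l * (phiF (j z) (u z) k - phiF (j z) (s z) k))).
  by move=> z _; ring.
by apply: bO_D; apply: bO_Ml; do ?[exact: (O_phiF j hut _)|exact: (O_phiF j hsu _)|exact: (O_dphiF j hsu _)].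
Qed.

Lemma logVF_sewing :
  (forall j a b, 0 <= a -> a <= b -> b <= T ->
     psum a s (XiF j) @[s --> mesh_to0 a b] --> logVF j b - logVF j a) /\
  bO (@pairs R J T) (fun z => logVF z.1.1 z.2 - logVF z.1.1 z.1.2 - XiF z.1.1 z.1.2 z.2)
    (fun z => E z.1.2 z.2).
Proof.
have [h1 h2 h3] := sewing_family hE XiF_defect.
have e j a b : 0 <= a -> a <= b -> b <= T ->
    mesh_lim a b (XiF j) = logVF j b - logVF j a.
  move=> a0 ab bT; rewrite /logVF (h2 j 0 a b)// addrAC subrr add0r//.
split=> [j a b a0 ab bT|]; first by rewrite -e//; exact: h1.
by apply: eq_bO h3 => z [z0 zz zT]; rewrite e.
Qed.

Lemma logVF0 j : logVF j 0 = 0.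
Proof.
have [_ h2 _] := sewing_family hE XiF_defect.
have := h2 j 0 0 0 (lexx _) (lexx _) (lexx _) T0; rewrite -/(logVF j 0); lra.
Qed.

Let hs : spans T (@pairs R J T) (fun z => z.1.2) (fun z => z.2) := @pairs_spans _ T J.

Lemma O_XiF : bO (@pairs R J T) (fun z => XiF z.1.1 z.1.2 z.2) (fun=> 1).
Proof.
have h1 : bO (@pairs R J T) (fun z => XiF z.1.1 z.1.2 z.2
      - dlin S (fun z => z.1.2) (fun z => z.2) (fun z => phiF z.1.1 z.1.2) z)
    (fun z => eta z.1.2 z.2 ^+ 2 + E z.1.2 z.2).
  apply: (dlogV_gauge hd hp hr B0 hB hs) => [k|k l].
    exact: (O_phiF (fun z => z.1.1) hs).
  exact: (O_PsiF (fun z => z.1.1) hs).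
have h2 := O_dlin hd hp hr B0 hB hs (fun k => O_phiF (fun z => z.1.1) hs k).
apply: (eq_bO _ (bO_D (bO_trans h1 _) (bO_trans h2 _))) => [z _||].
- by rewrite subrK.
- apply: bO_D; last exact: (O_E hp hr hs).
  exact: bO_trans (O_eta2 hp hr hs) (O_eta hp hr hs).
- exact: (O_eta hp hr hs).
Qed.

Lemma O_logVF : bO (@pairs R J T) (fun z => logVF z.1.1 z.1.2) (fun=> 1).
Proof.
have [_ h] := logVF_sewing.
have h1 : bO (@pairs R J T) (fun z => logVF z.1.1 z.2 - logVF z.1.1 z.1.2) (fun=> 1).
  apply: (eq_bO _ (bO_D (bO_trans h (O_E hp hr hs)) O_XiF)) => z _.
  by rewrite subrK.
have := bO_comp (E := @pairs R J T) (f := fun z => (z.1.1, 0, z.1.2)) _ h1.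
move=> h2; apply: (eq_bO _ (h2 _)) => z; first by rewrite /= logVF0 subr0.
by move=> [z0 zz zT]; split => //; exact: le_trans zT.
Qed.

Definition piF' j : cpath R d d := to_S S (csmooth (portfolio_map (F j)) (mu S)).

Lemma generated_F j s : 0 <= s -> s <= T ->
  generated S (piF' j) s (phiF j s) (PsiF j s).
Proof.
move=> s0 sT; split=> [k|k l]; first by rewrite /= mxE.
rewrite /piF' /to_S /= mxE; apply: eq_bigr => i _; congr (_ * _).
  by apply: D_portfolio_map; case: (hF j).
by apply: D_normalize; rewrite gt_eqF// (total_gt0 hd B0 hB).
Qed.

Lemma ctl_phiF k : ctl (fun j t => phiF j t k)
  (fun j t l => \sum_i PsiF j t k i * dnorm (S t) i l).
Proof.
have et := O_eta_tau hr hs; have et2 := O_eta2_tau2 hr hs.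
have hl := spans_l hs.
split=> [|l|l|].
- exact: (O_phiF (fun z => z.1.1) hs).
- apply: bO_sum => // i; apply: bO_Ml; first exact: (O_PsiF (fun z => z.1.1) hs).
  exact: (O_dnorm hd B0 hB hl).
- apply: bO_trans et.
  apply: (eq_bO (x' := fun z => \sum_i
     ((PsiF z.1.1 z.2 k i - PsiF z.1.1 z.1.2 k i) * dnorm (S z.2) i l
      + PsiF z.1.1 z.1.2 k i * (dnorm (S z.2) i l - dnorm (S z.1.2) i l)))).
    by move=> z _; rewrite -sumrB; apply: eq_bigr => i _; exact: mul_incr.
  apply: bO_sum => [z /(eta_bounds hr hs)/andP[]//|i].
  apply: bO_D.
    apply: bO_Mr; first exact: (O_dPsiF (fun z => z.1.1) hs).
    exact: (O_dnorm hd B0 hB (spans_r hs)).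
  apply: bO_Ml; first exact: (O_PsiF (fun z => z.1.1) hs).
  exact: (O_ddnorm hd hp hr B0 hB hs).
apply: bO_trans et2.
apply: (eq_bO (x' := fun z => (phiF z.1.1 z.2 k - phiF z.1.1 z.1.2 k
    - \sum_l PsiF z.1.1 z.1.2 k l * (mu S z.2 0 l - mu S z.1.2 0 l))
   + \sum_i PsiF z.1.1 z.1.2 k i * (mu S z.2 0 i - mu S z.1.2 0 i
       - dmu1 S (fun z => z.1.2) (fun z => z.2) i z))).
  move=> z _.
  have -> : \sum_l (\sum_i PsiF z.1.1 z.1.2 k i * dnorm (S z.1.2) i l)
       * (S z.2 0 l - S z.1.2 0 l)
     = \sum_i PsiF z.1.1 z.1.2 k i * dmu1 S (fun z => z.1.2) (fun z => z.2) i z.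
    under eq_bigr do rewrite mulr_suml.
    rewrite exchange_big/=; apply: eq_bigr => i _; rewrite /dmu1 mulr_sumr.
    by apply: eq_bigr => l _; ring.
  have -> : \sum_i PsiF z.1.1 z.1.2 k i * (mu S z.2 0 i - mu S z.1.2 0 i
       - dmu1 S (fun z => z.1.2) (fun z => z.2) i z)
     = \sum_l PsiF z.1.1 z.1.2 k l * (mu S z.2 0 l - mu S z.1.2 0 l)
       - \sum_i PsiF z.1.1 z.1.2 k i * dmu1 S (fun z => z.1.2) (fun z => z.2) i z.
    by rewrite -sumrB; apply: eq_bigr => i _; rewrite mulrBr.
  by ring.
apply: bO_D; first exact: (O_remF (fun z => z.1.1) hs).
apply: bO_sum => [z _|i]; first exact: sqr_ge0.
apply: bO_Ml; first exact: (O_PsiF (fun z => z.1.1) hs).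
exact: (mu_linear hd hp hr B0 hB hs).
Qed.

Lemma ctl_piF k : ctl (fun j t => (piF' j).1 t 0 k) (fun j t l => (piF' j).2 t k l).
Proof.
apply: eq_ctl (ctl_gen_pi ctl_phiF k) => [j t t0 tT|j t l t0 tT].
  by have [h _] := generated_F j t0 tT.
by have [_ h] := generated_F j t0 tT.
Qed.

(** Both sides have the same local increments up to errors that vanish in the
    limit, by [ito_local] and [logVF_sewing]. *)
Lemma rel_wealth_F j t : 0 <= t -> t <= T ->
  rel_wealth S P (piF' j) t = expR (logVF j t).
Proof.
move=> t0 tT; rewrite /rel_wealth wealth_cmu//.
have -> : wealth S P (piF' j) t = expR ((logVF j t + ln (total S t))
    - (logVF j 0 + ln (total S 0))).
  apply: (wealth_exp hp hr (L := fun t => logVF j t + ln (total S t))) => //.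
    move=> k l.
    have := ctl_ratio ctl_piF k l.
    move/(bO_comp (E := @pairs R unit T) (f := fun z => (j, z.1.2, z.2))).
    by apply => z [].
  have h1 := @ito_local _ _ p T B S P c eta hd hp hr B0 hB _ (@pairs R J T)
    (fun z => z.1.2) (fun z => z.2) (fun z => piF' z.1.1)
    (fun z => phiF z.1.1 z.1.2) (fun z => PsiF z.1.1 z.1.2) hs _
    (fun k => O_phiF (fun z => z.1.1) hs k) (fun k l => O_PsiF (fun z => z.1.1) hs k l).
  have {}h1 := h1 (fun z Dz => generated_F _ (proj1 (spans_l hs Dz)) (proj2 (spans_l hs Dz))).
  have [_ h2] := logVF_sewing.
  have := bO_B h2 h1.
  move/(bO_comp (E := @pairs R unit T) (f := fun z => (j, z.1.2, z.2))) => h3.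
  apply: (eq_bO _ (h3 _)) => [z _|z []] //=.
  by rewrite /XiF; ring.
by rewrite logVF0 -expRN -expRD; congr expR; ring.
Qed.

Definition VF j t : R := expR (logVF j t).

Lemma O_VF : bO (@pairs R J T) (fun z => VF z.1.1 z.1.2) (fun=> 1).
Proof.
have [C C0 H] := O_logVF; exists (expR C) => [|z /H h]; first exact: expR_ge0.
rewrite mulr1 in h; rewrite mulr1 /VF ger0_norm ?expR_ge0// ler_expR.
exact: le_trans (ler_norm _) h.
Qed.

Lemma VF_lower : exists2 a : R, 0 < a & forall j t, 0 <= t -> t <= T -> a <= VF j t.
Proof.
have [C C0 H] := O_logVF; exists (expR (- C)) => [|j t t0 tT]; first exact: expR_gt0.
have := H (j, t, t) (And3 t0 (lexx t) tT); rewrite /= mulr1 ler_norml => /andP[h _].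
by rewrite /VF ler_expR.
Qed.

Let dlog j s t := logVF j t - logVF j s.

Lemma VF_incr j s t : VF j t - VF j s = VF j s * (expR (dlog j s t) - 1).
Proof. by rewrite /VF mulrBr mulr1 -expRD /dlog (addrC (logVF j s)) subrK. Qed.

(** The relative wealth is the integral of [V F] against the market portfolio,
    without any bracket. *)
Lemma VF_expand : bO (@pairs R J T) (fun z => VF z.1.1 z.2 - VF z.1.1 z.1.2
    - (\sum_k VF z.1.1 z.1.2 * phiF z.1.1 z.1.2 k * (mu S z.2 0 k - mu S z.1.2 0 k)
      + \sum_k \sum_l VF z.1.1 z.1.2 * (PsiF z.1.1 z.1.2 k l
          + phiF z.1.1 z.1.2 k * phiF z.1.1 z.1.2 l) * Amu S P z.1.2 z.2 l k))
  (fun z => E z.1.2 z.2).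
Proof.
have [_ h] := logVF_sewing.
have h1 := exp_expand hd hp hr B0 hB hs (fun k => O_phiF (fun z => z.1.1) hs k)
   (fun k l => O_PsiF (fun z => z.1.1) hs k l) h.
apply: (eq_bO _ (bO_Ml O_VF h1)) => z _.
rewrite VF_incr /dlin /=.
have -> : \sum_k VF z.1.1 z.1.2 * phiF z.1.1 z.1.2 k * (mu S z.2 0 k - mu S z.1.2 0 k)
  = VF z.1.1 z.1.2 * \sum_k phiF z.1.1 z.1.2 k * (mu S z.2 0 k - mu S z.1.2 0 k).
  by rewrite mulr_sumr; apply: eq_bigr => k _; rewrite mulrA.
have -> : \sum_k \sum_l VF z.1.1 z.1.2 * (PsiF z.1.1 z.1.2 k l
     + phiF z.1.1 z.1.2 k * phiF z.1.1 z.1.2 l) * Amu S P z.1.2 z.2 l k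
  = VF z.1.1 z.1.2 * \sum_k \sum_l (PsiF z.1.1 z.1.2 k l
     + phiF z.1.1 z.1.2 k * phiF z.1.1 z.1.2 l) * Amu S P z.1.2 z.2 l k.
  rewrite mulr_sumr; apply: eq_bigr => k _; rewrite mulr_sumr.
  by apply: eq_bigr => l _; rewrite mulrA.
by rewrite /dlog; ring.
Qed.

Lemma ctl_VF : ctl VF
  (fun j t l => \sum_i VF j t * phiF j t i * dnorm (S t) i l).
Proof.
have bd : forall l, bO (@pairs R J T) (fun z => \sum_i VF z.1.1 z.1.2 *
    phiF z.1.1 z.1.2 i * dnorm (S z.1.2) i l) (fun=> 1).
  move=> l; apply: bO_sum => // i; apply: bO_Ml; last exact: (O_dnorm hd B0 hB (spans_l hs)).
  apply: bO_Ml; [exact: O_VF|exact: (O_phiF (fun z => z.1.1) hs)].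
have rem : bO (@pairs R J T) (fun z => VF z.1.1 z.2 - VF z.1.1 z.1.2
     - \sum_l (\sum_i VF z.1.1 z.1.2 * phiF z.1.1 z.1.2 i * dnorm (S z.1.2) i l)
         * (S z.2 0 l - S z.1.2 0 l)) (fun z => tau z.1.2 z.2 ^+ 2).
  apply: (eq_bO _ (bO_D (bO_D (bO_trans VF_expand (O_E_tau2 hp hr hs))
    (bO_sum (index_enum 'I_d) predT (x := fun k z => VF z.1.1 z.1.2 * phiF z.1.1 z.1.2 k *
       (mu S z.2 0 k - mu S z.1.2 0 k - dmu1 S (fun z => z.1.2) (fun z => z.2) k z)) _ _))
    (bO_sum (index_enum 'I_d) predT (x := fun k z => \sum_l VF z.1.1 z.1.2 *
       (PsiF z.1.1 z.1.2 k l + phiF z.1.1 z.1.2 k * phiF z.1.1 z.1.2 l)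
        * Amu S P z.1.2 z.2 l k) _ _))).
  - move=> z _; set q := \sum_k \sum_l _.
    have -> : \sum_l (\sum_i VF z.1.1 z.1.2 * phiF z.1.1 z.1.2 i * dnorm (S z.1.2) i l)
         * (S z.2 0 l - S z.1.2 0 l)
       = \sum_i VF z.1.1 z.1.2 * phiF z.1.1 z.1.2 i
          * dmu1 S (fun z => z.1.2) (fun z => z.2) i z.
      under eq_bigr do rewrite mulr_suml.
      rewrite exchange_big/=; apply: eq_bigr => i _; rewrite /dmu1 mulr_sumr.
      by apply: eq_bigr => l _; ring.
    under [X in _ = _ + X + _]eq_bigr do rewrite mulrBr.
    rewrite sumrB; ring.
  - by move=> z _; exact: sqr_ge0.
  - move=> k; apply: bO_Ml; last exact: bO_trans (mu_linear hd hp hr B0 hB hs k) (O_eta2_tau2 hr hs).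
    by apply: bO_Ml; [exact: O_VF|exact: (O_phiF (fun z => z.1.1) hs)].
  - by move=> z _; exact: sqr_ge0.
  - move=> k; apply: bO_sum => [z _|l]; first exact: sqr_ge0.
    apply: bO_Ml; last exact: (O_Amu hd hp hr B0 hB hs).
    apply: bO_Ml; first exact: O_VF.
    exact: (O_PsiPhi (fun k => O_phiF (fun z => z.1.1) hs k)
      (fun k l => O_PsiF (fun z => z.1.1) hs k l)).
have inc : bO (@pairs R J T) (fun z => VF z.1.1 z.2 - VF z.1.1 z.1.2)
    (fun z => tau z.1.2 z.2).
  apply: (eq_bO (x' := fun z => (VF z.1.1 z.2 - VF z.1.1 z.1.2
     - \sum_l (\sum_i VF z.1.1 z.1.2 * phiF z.1.1 z.1.2 i * dnorm (S z.1.2) i l)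
         * (S z.2 0 l - S z.1.2 0 l))
    + \sum_l (\sum_i VF z.1.1 z.1.2 * phiF z.1.1 z.1.2 i * dnorm (S z.1.2) i l)
         * (S z.2 0 l - S z.1.2 0 l))); first by move=> z _; ring.
  apply: bO_D; first exact: bO_trans rem (O_tau2_tau hp hr hs).
  apply: bO_sum => [z _|l]; first exact: tau_ge0.
  by apply: bO_Ml => //; exact: (O_dS_tau hr).
split=> //; first exact: O_VF.
move=> l.
have et := O_eta_tau hr hs.
apply: (eq_bO (x' := fun z => \sum_i
   ((VF z.1.1 z.2 - VF z.1.1 z.1.2) * (phiF z.1.1 z.2 i * dnorm (S z.2) i l)
    + VF z.1.1 z.1.2 * ((phiF z.1.1 z.2 i - phiF z.1.1 z.1.2 i) * dnorm (S z.2) i l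
    + phiF z.1.1 z.1.2 i * (dnorm (S z.2) i l - dnorm (S z.1.2) i l))))).
  by move=> z _; rewrite -sumrB; apply: eq_bigr => i _; ring.
have dnr i := O_dnorm hd B0 hB (spans_r hs) i l.
apply: bO_sum => [z _|i]; first exact: tau_ge0.
apply: bO_D.
  apply: bO_Mr => //; apply: bO_Ml => //.
  apply: (bO_end (f := fun j t => phiF j t i)).
  exact: (O_phiF (fun z => z.1.1) hs).
apply: bO_Ml; first exact: O_VF.
apply: bO_trans et; apply: bO_D.
  by apply: bO_Mr => //; exact: (O_dphiF (fun z => z.1.1) hs).
apply: bO_Ml; first exact: (O_phiF (fun z => z.1.1) hs).
exact: (O_ddnorm hd hp hr B0 hB hs).
Qed.

End Functions.
End Family.

(** * Expectations over the generating functions *)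

Section BallFunctions.
Context {R : realType} {d : nat}.
Variables (alpha : R) (K : {posnum R}).
Local Notation M := (C2aK_borel d alpha K).
Implicit Types F G : M.

Lemma sup_simplex_ge (f : 'rV[R]_d -> R) (x : 'rV[R]_d) : simplex x ->
  ((f x)%:E <= sup_simplex f)%E.
Proof. by move=> sx; apply: ereal_sup_ubound; exists x. Qed.

Lemma sup_simplex_ge0 (f : 'rV[R]_d -> R) (x : 'rV[R]_d) : simplex x -> (forall x, 0 <= f x) ->
  (0 <= sup_simplex f)%E.
Proof. by move=> sx f0; apply: le_trans (sup_simplex_ge f sx); rewrite lee_fin. Qed.

Lemma C2_norm_le (H : 'rV[R]_d -> 'rV[R]_d) (e : R) :
  (C2_norm H <= e%:E)%E -> C2_le e H.
Proof.
rewrite /C2_norm !ge_max => /and3P[h0 h1 h2] x sx i j k; split.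
- apply: le_trans (enorm_coord (H x) 0 i) _; rewrite -lee_fin.
  exact: le_trans (sup_simplex_ge (fun x => enorm (H x)) sx) h0.
- apply: le_trans (enorm_coord (D H x) i j) _; rewrite -lee_fin.
  exact: le_trans (sup_simplex_ge (fun x => enorm (D H x)) sx) h1.
- apply: le_trans (l2_coord (D2 H x) (i, j, k)) _; rewrite -lee_fin.
  exact: le_trans (sup_simplex_ge (fun x => l2 (D2 H x)) sx) h2.
Qed.

Lemma ball_C2 F : C2 (val F).
Proof. by case: F => F /= /set_mem[]. Qed.

Lemma ball_twice_diff F : twice_diff (val F).
Proof. exact/C2_twice_diff/ball_C2. Qed.

Lemma ball_norms F (x : 'rV[R]_d) : simplex x ->
  (C2_norm (val F) <= K%:num%:E)%E /\ (D2_holder alpha (val F) <= K%:num%:E)%E.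
Proof.
move=> sx; case: F => F /= /set_mem[_]; rewrite /C2a_norm => h.
have n0 : (0 <= C2_norm F)%E.
  by rewrite /C2_norm le_max (sup_simplex_ge0 sx)// => y; exact: enorm_ge0.
have h0 : (0 <= D2_holder alpha F)%E.
  apply: le_ereal_sup_tmp.
  exists ((l2 (D2 F x \- D2 F x) / enorm (x - x) `^ alpha)%:E); first by exists (x, x).
  by rewrite lee_fin divr_ge0 ?l2_ge0// powR_ge0.
by split; apply: le_trans h; [exact: leeDl|exact: leeDr].
Qed.

Lemma ball_C2_le F : C2_le K%:num (val F).
Proof. by move=> x sx; have [/C2_norm_le h _] := ball_norms F sx; exact: h. Qed.

Lemma ball_holder F (x y : 'rV[R]_d) i j k : simplex x -> simplex y ->
  `|D2 (val F) x (i, j, k) - D2 (val F) y (i, j, k)| <= K%:num * enorm (x - y) `^ alpha.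
Proof.
move=> sx sy; have [->|xy] := eqVneq x y.
  by rewrite subrr normr0 mulr_ge0// powR_ge0.
have [_ h] := ball_norms F sx.
have e0 : 0 < enorm (x - y).
  rewrite lt_neqAle enorm_ge0 andbT; apply/eqP => e.
  case/eqP : xy; apply/rowP => l; apply/eqP; rewrite -subr_eq0 -normr_le0 e.
  by have := enorm_coord (x - y) 0 l; rewrite !mxE.
rewrite -ler_pdivrMr ?powR_gt0// -lee_fin; apply: le_trans h.
apply: le_trans (ereal_sup_ubound _); last by exists (x, y).
rewrite lee_fin ler_pM2r ?invr_gt0 ?powR_gt0//.
exact: (l2_coord (D2 (val F) x \- D2 (val F) y) (i, j, k)).
Qed.

Lemma C2_leW (M1 M2 : R) (H : 'rV[R]_d -> 'rV[R]_d) : M1 <= M2 -> C2_le M1 H ->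
  C2_le M2 H.
Proof.
move=> m h x sx i j k; have [h1 h2 h3] := h x sx i j k.
by split; exact: le_trans m.
Qed.

Lemma C2_open_measurable (U : set M) : @C2_open R d alpha K U -> measurable U.
Proof. by move=> oU; apply: sub_sigma_algebra. Qed.

(** The superlevel sets of such a functional are open for the C2-distance. *)
Lemma lipschitz_measurable (h : M -> R) (C : R) : 0 <= C ->
  (forall F G (e : R), 0 < e -> C2_le e (val F - val G) -> `|h F - h G| <= C * e) ->
  measurable_fun setT h.
Proof.
move=> C0 H; apply: (measurability _ (RGenOInfty.measurableE R)).
move=> _ [_ [x ->] <-]; rewrite setTI; apply: C2_open_measurable => F /=.
rewrite in_itv/= andbT => xF.
have e0 : 0 < (h F - x) / (C + 1) by rewrite divr_gt0 ?subr_gt0//; lra.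
exists ((h F - x) / (C + 1)) => // G /ltW/C2_norm_le hG.
rewrite /= in_itv/= andbT; have := H F G _ e0 hG.
rewrite ler_norml => /andP[_ h1].
have : C * ((h F - x) / (C + 1)) < h F - x.
  have C1 : 0 < C + 1 by lra.
  by rewrite -[ltRHS](divfK (lt0r_neq0 C1)) mulrC ltr_pM2l//; lra.
lra.
Qed.

End BallFunctions.

Section BoundedIntegrals.
Context {R : realType} {dd : measure_display} {M : measurableType dd}.
Variable m : probability M R.

Definition bounded_rv (h : M -> R) : Prop :=
  measurable_fun setT h /\ exists C : R, forall F, `|h F| <= C.

Definition mean (h : M -> R) : R := fine (\int[m]_F (h F)%:E).

Lemma bounded_rv_integrable h : bounded_rv h -> m.-integrable setT (EFin \o h).
Proof.
move=> [mh [C hC]]; apply: measurable_bounded_integrable => //.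
  by rewrite (le_lt_trans (probability_le1 _ _)) ?ltry.
exists C; split; first exact: num_real.
by move=> x Cx F _; apply: le_trans (hC F) (ltW Cx).
Qed.

Lemma meanE h : mean h = Rintegral m setT h.
Proof. by []. Qed.

Lemma bounded_rv_cst k : bounded_rv (fun=> k).
Proof. by split; [exact: measurable_cst|exists `|k|]. Qed.

Lemma bounded_rv_D h g : bounded_rv h -> bounded_rv g -> bounded_rv (fun F => h F + g F).
Proof.
move=> [mh [C hC]] [mg [C' hC']]; split; first exact: measurable_funD.
by exists (C + C') => F; apply: le_trans (ler_normD _ _) (lerD _ _).
Qed.

Lemma bounded_rv_M h g : bounded_rv h -> bounded_rv g -> bounded_rv (fun F => h F * g F).
Proof.
move=> [mh [C hC]] [mg [C' hC']]; split; first exact: measurable_funM.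
by exists (C * C') => F; rewrite normrM ler_pM.
Qed.

Lemma bounded_rv_sum (I : Type) (r : seq I) (h : I -> M -> R) :
  (forall i, bounded_rv (h i)) -> bounded_rv (fun F => \sum_(i <- r) h i F).
Proof.
move=> H; elim: r => [|i r IH].
  by under eq_fun do rewrite big_nil; exact: bounded_rv_cst.
by under eq_fun do rewrite big_cons; exact: bounded_rv_D.
Qed.

Lemma bounded_rv_Z k h : bounded_rv h -> bounded_rv (fun F => k * h F).
Proof. by move=> hh; apply: bounded_rv_M => //; exact: bounded_rv_cst. Qed.

Lemma bounded_rv_B h g : bounded_rv h -> bounded_rv g -> bounded_rv (fun F => h F - g F).
Proof.
move=> hh hg; apply: bounded_rv_D => //.
by under eq_fun do rewrite -mulN1r; exact: bounded_rv_Z.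
Qed.

Lemma mean_cst k : mean (fun=> k) = k.
Proof.
have h : fine (m [set: M]) = 1 by rewrite probability_setT.
by transitivity (k * fine (m [set: M])); [exact: Rintegral_cst|rewrite h mulr1].
Qed.

Lemma mean_D h g : bounded_rv h -> bounded_rv g ->
  mean (fun F => h F + g F) = mean h + mean g.
Proof. by move=> hh hg; rewrite !meanE RintegralD//; exact: bounded_rv_integrable. Qed.

Lemma mean_B h g : bounded_rv h -> bounded_rv g ->
  mean (fun F => h F - g F) = mean h - mean g.
Proof. by move=> hh hg; rewrite !meanE RintegralB//; exact: bounded_rv_integrable. Qed.

Lemma mean_Z k h : bounded_rv h -> mean (fun F => k * h F) = k * mean h.
Proof. by move=> hh; rewrite !meanE RintegralZl//; exact: bounded_rv_integrable. Qed.

Lemma mean_Zr k h : bounded_rv h -> mean (fun F => h F * k) = mean h * k.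
Proof. by move=> hh; rewrite !meanE RintegralZr//; exact: bounded_rv_integrable. Qed.

Lemma mean_sum (I : Type) (r : seq I) (h : I -> M -> R) :
  (forall i, bounded_rv (h i)) ->
  mean (fun F => \sum_(i <- r) h i F) = \sum_(i <- r) mean (h i).
Proof.
move=> H; elim: r => [|i r IH].
  by under eq_fun do rewrite big_nil; rewrite mean_cst big_nil.
under eq_fun do rewrite big_cons.
by rewrite mean_D ?IH ?big_cons//; exact: bounded_rv_sum.
Qed.

Lemma mean_le h g : bounded_rv h -> bounded_rv g -> (forall F, h F <= g F) ->
  mean h <= mean g.
Proof.
move=> hh hg H; rewrite !meanE; apply: le_Rintegral => //;
  exact: bounded_rv_integrable.
Qed.

Lemma eq_mean h g : (forall F, h F = g F) -> mean h = mean g.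
Proof. by move=> H; congr mean; exact/funext. Qed.

Lemma mean_norm_le h (C : R) : bounded_rv h -> (forall F, `|h F| <= C) ->
  `|mean h| <= C.
Proof.
move=> hh H; rewrite ler_norml; apply/andP; split.
  rewrite -(mean_cst (- C)); apply: mean_le => //; first exact: bounded_rv_cst.
  by move=> F; have := H F; rewrite ler_norml => /andP[].
rewrite -(mean_cst C); apply: mean_le => //; first exact: bounded_rv_cst.
by move=> F; exact: le_trans (ler_norm _) (H F).
Qed.

Lemma mean_ge_indic h (U : set M) (a : R) : bounded_rv h -> measurable U ->
  0 <= a -> (forall F, 0 <= h F) -> (forall F, U F -> a <= h F) ->
  a * fine (m U) <= mean h.
Proof.
move=> hh mU a0 h0 H.
have hU : bounded_rv (\1_U : M -> R).
  split; first exact: measurable_indic.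
  by exists 1 => F; rewrite indicE; case: (_ \in _); rewrite ?normr1 ?normr0.
have -> : fine (m U) = mean (\1_U : M -> R).
  by rewrite /mean integral_indic// setIT.
rewrite -mean_Z//; apply: mean_le => //; first exact: bounded_rv_Z.
move=> F; rewrite indicE; case: (boolP (F \in U)) => [/set_mem/H|_]; first by rewrite mulr1.
by rewrite mulr0.
Qed.

End BoundedIntegrals.

Section PortfolioIntegrals.
Context {R : realType} {d : nat}.
Variables (S : R -> 'rV[R]_d) (alpha : R) (K : {posnum R}).
Variable m : probability (C2aK_borel d alpha K) R.
Local Notation M := (C2aK_borel d alpha K).
Local Notation piF := (@piF R d S alpha K : M -> portfolios S alpha K).

Lemma image_set_system_measurable (U : set (portfolios S alpha K)) :
  measurable (piF @^-1` U) -> measurable U.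
Proof. by move=> mU; apply: sub_sigma_algebra; rewrite /image_set_system /= setTI. Qed.

Lemma measurable_piF : measurable_fun setT piF.
Proof.
move=> _ U mU; rewrite setTI.
have sA : sigma_algebra setT (image_set_system setT piF (@measurable _ M)).
  apply: sigma_algebra_image; split.
  - exact: measurable0.
  - by move=> A mA; rewrite setTD; exact: measurableC.
  - by move=> A mA; exact: bigcupT_measurable.
have := mU _ (conj sA (fun _ h => h)).
by rewrite /image_set_system /= setTI.
Qed.

(** Change of variables for the push-forward; the largest sigma-algebra that makes
    [piF] measurable also makes [f] measurable when [f \o piF] is. *)
Lemma nu_intE (f : portfolios S alpha K -> R) : bounded_rv (f \o piF) ->
  nu_int m f = mean m (f \o piF).
Proof.
move=> hf; rewrite /nu_int /mean; congr fine.
have cF : piF @^-1` (@calF R d S alpha K) = setT.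
  by apply/seteqP; split=> // F _; exists F.
have mf : measurable_fun setT (EFin \o f).
  apply/measurable_EFinP => _ U mU; rewrite setTI.
  apply: image_set_system_measurable.
  by have [+ _] := hf => /(_ measurableT U mU); rewrite setTI.
rewrite /nu integral_pushforward//.
- by rewrite cF.
- exact: measurable_piF.
- by rewrite cF; exact: bounded_rv_integrable.
- by apply: image_set_system_measurable; rewrite cF.
Qed.

End PortfolioIntegrals.

(** * Dependence of the wealth on the generating function *)

Section Variation.
Context {R : realType} {m n : nat}.
Variables (T a : R) (X : R -> R -> 'M[R]_(m, n)) (c : R -> R -> R) (C : R).
Hypothesis a0 : 0 < a.
Hypothesis hc : control T c.
Hypothesis C0 : 0 <= C.
Hypothesis hX : forall s t, 0 <= s -> s <= t -> t <= T ->
  enorm (X s t) `^ a <= C * c s t.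

(** The a-th power of the a-variation, as a real number: unlike the a-variation
    it is a control. *)
Definition wvar s t : R :=
  sup [set psum s r (fun u v => enorm (X u v) `^ a) | r in itv_partition s t].

Let vs s t := [set psum s r (fun u v => enorm (X u v) `^ a) | r in itv_partition s t].

Let vs_ub s t : 0 <= s -> t <= T -> ubound (vs s t) (C * c s t).
Proof.
move=> s0 tT _ [r pr <-].
apply: (@le_trans _ _ (psum s r (fun u v => C * c u v))).
  apply: (psum_le pr) => u v su uv vt _.
  by apply: hX; [exact: le_trans su|exact: ltW|exact: le_trans vt tT].
by rewrite psumZ ler_wpM2l// (control_psum hc).
Qed.

Let vs_n0 s t : s <= t -> vs s t !=set0.
Proof.
move=> st; have [r [pr _]] := partition_exists st ltr01.
by exists (psum s r (fun u v => enorm (X u v) `^ a)); exists r.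
Qed.

Lemma wvar_ge s t r : 0 <= s -> t <= T -> itv_partition s t r ->
  psum s r (fun u v => enorm (X u v) `^ a) <= wvar s t.
Proof.
move=> s0 tT pr; apply: ub_le_sup; first by exists (C * c s t); exact: vs_ub.
by exists r.
Qed.

(** Partitions of two adjacent intervals concatenate. *)
Lemma wvar_control : control T wvar.
Proof.
split=> [s t /andP[s0 st] tT|s u t /andP[s0 su] /andP[ut tT]].
  have [r [pr _]] := partition_exists st ltr01.
  apply: le_trans (wvar_ge s0 tT pr); apply: (psum_ge0 pr) => *; exact: powR_ge0.
have u0 := le_trans s0 su; have uT := le_trans ut tT.
rewrite -lerBrDr; apply: ge_sup; first exact: vs_n0.
move=> _ [r1 p1 <-]; rewrite lerBrDr addrC -lerBrDr; apply: ge_sup; first exact: vs_n0.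
move=> _ [r2 p2 <-]; rewrite lerBrDr addrC.
have E : last s r1 = u by case: p1 => _ /eqP.
have := wvar_ge s0 tT (itv_partition_cat p1 p2).
by rewrite psum_cat E.
Qed.

Lemma enorm_le_wvar s t : 0 <= s -> s <= t -> t <= T -> enorm (X s t) `^ a <= wvar s t.
Proof.
move=> s0; rewrite le_eqVlt => /predU1P[<- sT|st tT].
  apply: (@le_trans _ _ 0); last by apply: (proj1 wvar_control); rewrite ?s0 ?lexx.
  by apply: le_trans (hX s0 (lexx s) sT) _; rewrite (control_xx hc)// mulr0.
have := wvar_ge s0 tT (itv_partition1 st).
by rewrite psum_cons psum_nil addr0.
Qed.

Lemma pvarE s t : 0 <= s -> s <= t -> t <= T ->
  pvar a X s t = (wvar s t `^ a^-1)%:E.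
Proof.
move=> s0 st tT; have a1 : 0 <= a^-1 by rewrite invr_ge0 ltW.
have w0 := control_ge0 wvar_control s0 st tT.
have ps0 r : itv_partition s t r -> 0 <= psum s r (fun u v => enorm (X u v) `^ a).
  by move=> pr; apply: (psum_ge0 pr) => *; exact: powR_ge0.
have up : (pvar a X s t <= (wvar s t `^ a^-1)%:E)%E.
  apply: ge_ereal_sup => _ [r pr <-]; rewrite lee_fin.
  by apply: ge0_ler_powR => //; rewrite ?nnegrE ?ps0//; exact: wvar_ge.
have lo : (0 <= pvar a X s t)%E.
  have [r [pr _]] := partition_exists st ltr01.
  apply: le_ereal_sup_tmp; exists ((psum s r (fun u v => enorm (X u v) `^ a)) `^ a^-1)%:E.
    by exists r.
  by rewrite lee_fin powR_ge0.
have fn : pvar a X s t \is a fin_num.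
  by rewrite ge0_fin_numE//; apply: le_lt_trans up _; rewrite ltry.
apply/eqP; rewrite eq_le up /= -(fineK fn) lee_fin.
set y := fine _; have y0 : 0 <= y by exact: fine_ge0.
have : wvar s t <= y `^ a.
  apply: ge_sup; first exact: vs_n0.
  move=> _ [r pr <-].
  have h : psum s r (fun u v => enorm (X u v) `^ a) `^ a^-1 <= y.
    by rewrite -lee_fin /y fineK//; apply: ereal_sup_ubound; exists r.
  have := ge0_ler_powR (ltW a0) _ _ h; rewrite !nnegrE powR_ge0 y0 => /(_ isT isT).
  by rewrite -powRrM mulVf ?gt_eqF// powRr1 ?ps0.
move=> /(ge0_ler_powR a1); rewrite !nnegrE w0 powR_ge0 => /(_ isT isT).
by rewrite -powRrM mulfV ?gt_eqF// powRr1.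
Qed.

End Variation.

(** As the control is bounded by its value on the whole interval, a power
    [k * a >= 1] of it is dominated by the control itself. *)
Lemma enorm_powR_control {R : realType} {m n : nat} (T a k C : R)
    (X : R -> R -> 'M[R]_(m, n)) c :
  control T c -> 0 <= C -> 0 < a -> 1 <= k * a ->
  (forall s t i j, 0 <= s -> s <= t -> t <= T -> `|X s t i j| <= C * c s t `^ k) ->
  exists2 C', 0 <= C' & forall s t, 0 <= s -> s <= t -> t <= T ->
    enorm (X s t) `^ a <= C' * c s t.
Proof.
move=> hc C0 a0 ka h.
exists (((m * n)%:R * C) `^ a * c 0 T `^ (k * a - 1)) => [|s t s0 st tT].
  by rewrite mulr_ge0// powR_ge0.
have cst := control_ge0 hc s0 st tT.
have e1 : enorm (X s t) <= (m * n)%:R * C * c s t `^ k.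
  by rewrite -mulrA; apply: enorm_le => [|i j]; [rewrite mulr_ge0// powR_ge0|exact: h].
apply: (@le_trans _ _ (((m * n)%:R * C * c s t `^ k) `^ a)).
  apply: ge0_ler_powR => //; rewrite ?nnegrE ?enorm_ge0//; first exact: ltW.
  by rewrite !mulr_ge0// powR_ge0.
rewrite powRM ?powR_ge0 ?mulr_ge0// -powRrM -mulrA ler_wpM2l ?powR_ge0//.
have ka0 : 0 < k * a by exact: lt_le_trans ka.
rewrite -mulr_powRB1// mulrC ler_wpM2r//.
have cm := control_mono hc (lexx 0) s0 st tT (lexx T).
by apply: ge0_ler_powR => //; rewrite ?nnegrE//; [rewrite subr_ge0|exact: le_trans cm].
Qed.

Lemma powR_inv_mono {R : realType} (a x y : R) : 0 < a -> 0 <= x -> x <= y ->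
  x `^ a^-1 <= y `^ a^-1.
Proof.
move=> a0 x0 xy; apply: ge0_ler_powR => //; first by rewrite invr_ge0 ltW.
by rewrite nnegrE (le_trans x0).
Qed.

Lemma mid_le {R : realType} (x a y b z : R) :
  x = a + y -> y = z + b -> 0 <= a -> 0 <= b -> z <= x.
Proof. by move=> -> -> a0 b0; rewrite addrC -addrA lerDl addr_ge0. Qed.

Lemma linear_defect_alg {R : realType} {d : nat} (f g m n : 'I_d -> R)
    (F G : 'I_d -> 'I_d -> R) (a a' : 'I_d -> 'I_d -> R) :
  (\sum_k f k * (m k + n k) + \sum_k \sum_l F k l * (a l k + a' l k + m l * n k))
  - (\sum_k f k * m k + \sum_k \sum_l F k l * a l k)
  - (\sum_k g k * n k + \sum_k \sum_l G k l * a' l k)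
  = - \sum_k n k * (g k - f k - \sum_l F k l * m l)
    - \sum_k \sum_l (G k l - F k l) * a' l k.
Proof.
have z (p q : 'I_d -> 'I_d -> R) : (forall k l, q k l = 0) ->
    \sum_k \sum_l p k l * q k l = 0.
  by move=> q0; rewrite big1// => k _; rewrite big1// => l _; rewrite q0 mulr0.
have := @dlogV_defect_alg R d f g m n F G a a' (fun _ _ => 0) (fun _ _ => 0).
rewrite !(z _ (fun k l => 0 : R))// (z _ (fun k l => 0 + 0))//; last by move=> *; rewrite addr0.
by rewrite !mulr0 !subr0 addr0.
Qed.

Section TwoControls.
Context {R : realType}.
Variables (p T C1 C2 : R) (w1 w2 nn na gam : R -> R -> R).
Hypotheses (hp : 2 < p < 3) (C10 : 0 <= C1) (C20 : 0 <= C2).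
Hypotheses (c1 : control T w1) (c2 : control T w2).
Hypotheses (n0 : forall u v, 0 <= nn u v) (a0 : forall u v, 0 <= na u v).
Hypothesis hn : forall u v, 0 <= u -> u <= v -> v <= T -> nn u v `^ p <= w1 u v.
Hypothesis ha : forall u v, 0 <= u -> u <= v -> v <= T -> na u v `^ (p / 2) <= w2 u v.
Hypothesis hdef : forall u v w, 0 <= u -> u <= v -> v <= w -> w <= T ->
  `|gam u w - gam u v - gam v w| <= C1 * (nn u v ^+ 2 * nn v w + nn u v * na v w).
Hypothesis hgam : forall u v, 0 <= u -> u <= v -> v <= T ->
  `|gam u v| <= C2 * (nn u v + na u v).

Let p0 : 0 < p. Proof. by case/andP: hp => h _; exact: lt_trans h. Qed.
Let p20 : 0 < p / 2. Proof. by rewrite divr_gt0. Qed.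
Let theta := 3 / p.
Let theta1 : 1 < theta.
Proof. by case/andP: hp => _ p3; rewrite /theta ltr_pdivlMr// mul1r. Qed.

(** A Young bound for germs whose defect is measured by two controls of different
    homogeneity.  Both are divided by their total over [s, t] and added, which
    gives a single control of total at most 2; the totals then come out as
    powers. *)
Lemma two_control_bound s t r : 0 <= s -> s <= t -> t <= T -> itv_partition s t r ->
  `|psum s r gam| <= (C1 * young_cst theta * 2 `^ theta + C2)
     * ((1 + (w1 s t `^ p^-1) ^+ 2) * (w1 s t `^ p^-1 + w2 s t `^ (p / 2)^-1)).
Proof.
move=> s0 st tT pr.
set M1 := w1 s t `^ p^-1; set M2 := w2 s t `^ (p / 2)^-1.
have M10 : 0 <= M1 by exact: powR_ge0.
have M20 : 0 <= M2 by exact: powR_ge0.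
have Y0 := young_cst_ge0 theta1.
have two0 : 0 <= 2 `^ theta :> R by exact: powR_ge0.
case: r pr => [_|x r pr].
  rewrite psum_nil normr0.
  exact: (mulr_ge0 (addr_ge0 (mulr_ge0 (mulr_ge0 C10 Y0) two0) C20)
    (mulr_ge0 (addr_ge0 ler01 (sqr_ge0 _)) (addr_ge0 M10 M20))).
have W1 := control_ge0 c1 s0 st tT; have W2 := control_ge0 c2 s0 st tT.
(* Where a total is 0, so are the values of its control, and the quotients by 0
   are 0. *)
pose w u v := w1 u v / w1 s t + w2 u v / w2 s t.
have wc : control T w.
  have i1 : 0 <= (w1 s t)^-1 by rewrite invr_ge0.
  have i2 : 0 <= (w2 s t)^-1 by rewrite invr_ge0.
  split=> [u v /andP[u0 uv] vT|u v z /andP[u0 uv] /andP[vz zT]].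
    by rewrite addr_ge0// mulr_ge0// ?(control_ge0 c1)// (control_ge0 c2).
  have k1 := ler_wpM2r i1 (control_add c1 u0 uv vz zT).
  have k2 := ler_wpM2r i2 (control_add c2 u0 uv vz zT).
  by rewrite /w; lra.
have wle (f : R -> R -> R) u v : control T f -> s <= u -> u <= v -> v <= t ->
    0 <= f u v /\ f u v <= f s t * (f u v / f s t).
  move=> fc su uv vt; have u0 := le_trans s0 su; have vT := le_trans vt tT.
  have f0 := control_ge0 fc u0 uv vT; split => //.
  have fm := control_mono fc s0 su uv vt tT.
  have [f00|fn] := eqVneq (f s t) 0; first by rewrite f00 mul0r -f00.
  by rewrite mulrC divfK.
have w01 u v : s <= u -> u <= v -> v <= t ->
    0 <= w1 u v / w1 s t /\ 0 <= w2 u v / w2 s t.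
  move=> su uv vt; have [g1 _] := wle _ _ _ c1 su uv vt.
  have [g2 _] := wle _ _ _ c2 su uv vt.
  by rewrite !divr_ge0.
have nnb u v z : s <= u -> u <= v -> v <= z -> z <= t ->
    (nn u v <= M1 * w u z `^ p^-1 /\ nn v z <= M1 * w u z `^ p^-1) /\
    na v z <= M2 * w u z `^ (p / 2)^-1.
  move=> su uv vz zt; have u0 := le_trans s0 su; have zT := le_trans zt tT.
  have uz := le_trans uv vz; have v0 := le_trans u0 uv; have vT := le_trans vz zT.
  have [g1 l1] := wle _ _ _ c1 su uz zt; have [g2 l2] := wle _ _ _ c2 su uz zt.
  have [q1 q2] := w01 _ _ su uz zt.
  have wz : 0 <= w u z by rewrite /w addr_ge0.
  have b1 : w1 u z `^ p^-1 <= M1 * w u z `^ p^-1.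
    rewrite /M1 -powRM//; apply: ge0_ler_powR.
    - by rewrite invr_ge0 ltW.
    - by rewrite nnegrE.
    - by rewrite nnegrE mulr_ge0.
    by apply: le_trans l1 _; rewrite ler_wpM2l// /w lerDl.
  have b2 : w2 u z `^ (p / 2)^-1 <= M2 * w u z `^ (p / 2)^-1.
    rewrite /M2 -powRM//; apply: ge0_ler_powR.
    - by rewrite invr_ge0 ltW.
    - by rewrite nnegrE.
    - by rewrite nnegrE mulr_ge0.
    by apply: le_trans l2 _; rewrite ler_wpM2l// /w lerDr.
  have root (a y y' : R) : 0 < a -> 0 <= y -> 0 <= y' -> y `^ a <= y' -> y <= y' `^ a^-1.
    exact: powR_le_root.
  have n1 : nn u v <= w1 u z `^ p^-1.
    apply: (root _ _ _ p0 (n0 _ _) (control_ge0 c1 u0 uz zT)).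
    apply: le_trans (hn u0 uv vT) _.
    exact: (control_mono c1 u0 (lexx u) uv vz zT).
  have n2 : nn v z <= w1 u z `^ p^-1.
    apply: (root _ _ _ p0 (n0 _ _) (control_ge0 c1 u0 uz zT)).
    apply: le_trans (hn v0 vz zT) _.
    exact: (control_mono c1 u0 uv vz (lexx z) zT).
  have n3 : na v z <= w2 u z `^ (p / 2)^-1.
    apply: (root _ _ _ p20 (a0 _ _) (control_ge0 c2 u0 uz zT)).
    apply: le_trans (ha v0 vz zT) _.
    exact: (control_mono c2 u0 uv vz (lexx z) zT).
  by split; [split|]; [exact: le_trans b1|exact: le_trans b1|exact: le_trans b2].
set M := C1 * (M1 ^+ 3 + M1 * M2).
have M0 : 0 <= M by rewrite /M mulr_ge0// addr_ge0 ?exprn_ge0 ?mulr_ge0.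
have yb : `|psum s (x :: r) gam - gam s t| <= M * young_cst theta * w s t `^ theta.
  apply: (young_bound wc theta1 M0 s0 tT _ pr) => // u v z su uv vz zt.
  have u0 := le_trans s0 su; have zT := le_trans zt tT.
  have [[g1 g2] g3] := nnb _ _ _ su uv vz zt.
  apply: le_trans (hdef u0 uv vz zT) _.
  rewrite /M -[X in _ <= X]mulrA ler_wpM2l ?mulr_ge0 ?exprn_ge0// mulrDl.
  have [q1 q2] := w01 _ _ su (le_trans uv vz) zt.
  have wz : 0 <= w u z by rewrite /w addr_ge0.
  set y := w u z `^ p^-1 in g1 g2.
  have y0 : 0 <= y by exact: powR_ge0.
  have y3 : w u z `^ theta = y ^+ 3.
    rewrite /y -powR_mulrn ?powR_ge0// -powRrM; congr (_ `^ _).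
    by rewrite /theta mulrC.
  have y2 : w u z `^ (p / 2)^-1 = y ^+ 2.
    rewrite /y -powR_mulrn ?powR_ge0// -powRrM; congr (_ `^ _).
    by field; rewrite gt_eqF.
  rewrite y3; rewrite y2 in g3.
  have k1 : nn u v ^+ 2 <= (M1 * y) ^+ 2.
    by rewrite lerXn2r// nnegrE ?n0// mulr_ge0.
  apply: lerD.
    have -> : M1 ^+ 3 * y ^+ 3 = (M1 * y) ^+ 2 * (M1 * y) by ring.
    by apply: ler_pM => //; exact: sqr_ge0.
  have -> : M1 * M2 * y ^+ 3 = M1 * y * (M2 * y ^+ 2) by ring.
  by apply: ler_pM.
have ws : w s t `^ theta <= 2 `^ theta.
  have [q1 q2] := w01 _ _ (lexx s) st (lexx t).
  have le1 (y : R) : 0 <= y -> y / y <= 1.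
    by move=> _; have [->|yn] := eqVneq y 0; rewrite ?mul0r// divff.
  apply: ge0_ler_powR.
  - by apply: ltW; exact: lt_trans theta1.
  - by rewrite nnegrE /w addr_ge0.
  - by rewrite nnegrE.
  by rewrite /w; have := le1 _ W1; have := le1 _ W2; lra.
have gb : `|gam s t| <= C2 * (M1 + M2).
  apply: le_trans (hgam s0 st tT) _; rewrite ler_wpM2l//; apply: lerD.
    by apply: powR_le_root => //; exact: hn.
  by apply: powR_le_root => //; exact: ha.
set Y := young_cst theta in Y0 yb *.
have := ler_normD (psum s (x :: r) gam - gam s t) (gam s t); rewrite subrK => tri.
apply: le_trans tri _; apply: le_trans (lerD yb gb) _.
have MY : M * Y * w s t `^ theta <= M * Y * 2 `^ theta by rewrite ler_wpM2l// mulr_ge0.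
apply: le_trans (lerD MY (lexx _)) _.
set q := 2 `^ theta in two0 *.
have b1 : M1 ^+ 3 + M1 * M2 <= (1 + M1 ^+ 2) * (M1 + M2).
  have := mulr_ge0 M10 M20; have := mulr_ge0 (sqr_ge0 M1) M20.
  have := mulr_ge0 (sqr_ge0 (M1 - 1)) M20; have := exprn_ge0 3 M10.
  by rewrite !exprS !expr0; lra.
have b2 : M1 + M2 <= (1 + M1 ^+ 2) * (M1 + M2).
  by rewrite ler_peMl ?addr_ge0// lerDl sqr_ge0.
have -> : M * Y * q = (C1 * Y * q) * (M1 ^+ 3 + M1 * M2) by rewrite /M; ring.
have CY := mulr_ge0 (mulr_ge0 C10 Y0) two0.
rewrite [X in _ <= X]mulrDl; exact: (lerD (ler_wpM2l CY b1) (ler_wpM2l C20 b2)).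
Qed.

End TwoControls.

Lemma sqr_scale_le {R : realType} (d e x : R) : 1 <= d -> 0 <= e -> 0 <= x ->
  d * (e * x) <= d ^+ 2 * e * x.
Proof.
move=> d1 e0 x0; have d0 : 0 <= d by exact: le_trans d1.
by rewrite expr2 -!mulrA ler_wpM2l// ler_peMl// mulr_ge0.
Qed.

Lemma scale_out {R : realType} (a b e y q z : R) :
  (a * e * y * q + b * e) * z = e * ((a * y * q + b) * z).
Proof. by ring. Qed.

Lemma combine_rate {R : realType} (a b e M x y : R) :
  0 <= a -> 0 <= b -> 0 <= e -> 0 <= x -> 0 <= y ->
  e * (a * ((1 + M ^+ 2) * x)) + b * e * ((1 + M ^+ 2) * y)
    <= (a + b) * e * ((1 + M ^+ 2) * (x + y)).
Proof.
move=> a0 b0 e0 x0 y0; have s1 : 0 <= 1 + M ^+ 2 by rewrite addr_ge0// sqr_ge0.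
have k1 : 0 <= a * e * ((1 + M ^+ 2) * y) by do !apply: mulr_ge0 => //.
have k2 : 0 <= b * e * ((1 + M ^+ 2) * x) by do !apply: mulr_ge0 => //.
lra.
Qed.

Section Difference.
Context {R : realType} {d : nat}.
Variables (p T B : R) (S : R -> 'rV[R]_d) (P : nat -> nat -> R).
Variables (c eta : R -> R -> R).
Hypothesis hd : (0 < d)%N.
Hypothesis hp : 2 < p < 3.
Hypothesis T0 : 0 <= T.
Local Notation A := (Defs.lift S P).
Hypothesis hr : rough_driver T p S A c eta.
Hypothesis B0 : 0 < B.
Hypothesis hB : forall t i, 0 <= t -> t <= T -> B^-1 <= S t 0 i <= B.
Let hc := driver_control hr.
Let p0 : 0 < p. Proof. by case/andP: hp => h _; exact: lt_trans h. Qed.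
Let p20 : 0 < p / 2. Proof. by rewrite divr_gt0. Qed.

Let hs : spans T (@pairs R unit T) (fun z => z.1.2) (fun z => z.2) := @pairs_spans _ T unit.

Lemma mu_variation : exists2 C, 0 <= C & forall s t, 0 <= s -> s <= t -> t <= T ->
  enorm (incr (mu S) s t) `^ p <= C * c s t.
Proof.
have /choice[f Hf] : forall k : 'I_d, exists C, 0 <= C /\
    forall s t, 0 <= s -> s <= t -> t <= T ->
    `|mu S t 0 k - mu S s 0 k| <= C * tau p c s t.
  move=> k; have [C C0 H] := bO_trans (O_dmu hd hp hr B0 hB hs k) (O_eta_tau hr hs).
  by exists C; split=> // s t s0 st tT; exact: (H (tt, s, t) (And3 s0 st tT)).
apply: (@enorm_powR_control _ _ _ T p p^-1 (\sum_k f k)) => //.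
- by apply: sumr_ge0 => k _; case: (Hf k).
- by rewrite mulVf// gt_eqF.
move=> s t i j s0 st tT; rewrite ord1 incr_entry.
have [fj /(_ s t s0 st tT) h] := Hf j; apply: le_trans h _.
rewrite ler_wpM2r ?tau_ge0// (bigD1 j)//= lerDl sumr_ge0// => k _.
by case: (Hf k).
Qed.

Lemma Amu_variation : exists2 C, 0 <= C & forall s t, 0 <= s -> s <= t -> t <= T ->
  enorm (Amu S P s t) `^ (p / 2) <= C * c s t.
Proof.
have /choice[f Hf] : forall kl : 'I_d * 'I_d, exists C, 0 <= C /\
    forall s t, 0 <= s -> s <= t -> t <= T ->
    `|Amu S P s t kl.1 kl.2| <= C * tau p c s t ^+ 2.
  move=> kl; have [C C0 H] := O_Amu hd hp hr B0 hB hs kl.1 kl.2.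
  by exists C; split=> // s t s0 st tT; exact: (H (tt, s, t) (And3 s0 st tT)).
apply: (@enorm_powR_control _ _ _ T (p / 2) (2 / p) (\sum_kl f kl)) => //.
- by apply: sumr_ge0 => k _; case: (Hf k).
- by rewrite le_eqVlt; apply/orP; left; apply/eqP; field; rewrite gt_eqF.
move=> s t i j s0 st tT.
have [fj /(_ s t s0 st tT) h] := Hf (i, j); apply: le_trans h _.
have -> : c s t `^ (2 / p) = tau p c s t ^+ 2.
  by rewrite /tau -powR_mulrn ?powR_ge0// -powRrM mulrC.
rewrite ler_wpM2r ?sqr_ge0// (bigD1 (i, j))//= lerDl sumr_ge0// => k _.
by case: (Hf k).
Qed.

Definition mu_wvar : R -> R -> R := wvar p (incr (mu S)).
Definition Amu_wvar : R -> R -> R := wvar (p / 2) (Amu S P).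

Lemma mu_wvar_control : control T mu_wvar.
Proof. by have [C C0 h] := mu_variation; exact: wvar_control hc C0 h. Qed.

Lemma Amu_wvar_control : control T Amu_wvar.
Proof. by have [C C0 h] := Amu_variation; exact: wvar_control hc C0 h. Qed.

Lemma mu_normE s t : 0 <= s -> s <= t -> t <= T -> mu_norm S p s t = mu_wvar s t `^ p^-1.
Proof.
move=> s0 st tT; have [C C0 h] := mu_variation.
by rewrite /mu_norm (pvarE p0 hc C0 h).
Qed.

Definition A_norm s t : R := fine (pvar (p / 2) (Amu S P) s t).

Lemma A_normE s t : 0 <= s -> s <= t -> t <= T -> A_norm s t = Amu_wvar s t `^ (p / 2)^-1.
Proof.
move=> s0 st tT; have [C C0 h] := Amu_variation.
by rewrite /A_norm (pvarE p20 hc C0 h).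
Qed.

Definition trace s t : R := \sum_i mu_br S P s t i i.

Lemma trace_ge0 s t : 0 <= s -> s <= t -> t <= T -> 0 <= trace s t.
Proof.
by move=> s0 st tT; apply: sumr_ge0 => i _; exact: (mu_br_diag_ge0 hd hp hr B0 hB).
Qed.

Lemma trace_add s u t : trace s t = trace s u + trace u t.
Proof. by rewrite /trace -big_split/=; apply: eq_bigr => i _; exact: mu_br_add. Qed.

Lemma psum_trace s t r : itv_partition s t r -> psum s r trace = trace s t.
Proof.
move=> pr; have E : last s r = t by case: pr => _ /eqP.
rewrite /trace psum_sum; apply: eq_bigr => i _.
rewrite (_ : psum s r _ = psum s r (incr (fun t => mu_bracket S P t i i))).
  by rewrite psum_incr E /mu_br incr_entry.
by apply: eq_bigr => k _; rewrite /mu_br incr_entry.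
Qed.

(** The quantity by which the regret is divided in the theorem. *)
Definition rate s t : R := (1 + mu_norm S p s t ^+ 2) * xi S P p s t.

Lemma xiE s t : xi S P p s t = mu_norm S p s t + A_norm s t + trace s t.
Proof. by []. Qed.

Opaque trace xi mu_wvar Amu_wvar mu_norm A_norm mu Amu mu_bracket mu_br.

Lemma mu_norm_mono s u v t : 0 <= s -> s <= u -> u <= v -> v <= t -> t <= T ->
  mu_norm S p u v <= mu_norm S p s t.
Proof.
move=> s0 su uv vt tT; have u0 := le_trans s0 su; have vT := le_trans vt tT.
have ut := le_trans uv vt; have st := le_trans su ut.
rewrite (mu_normE s0 st tT) (mu_normE u0 uv vT); have hw := mu_wvar_control.
exact: (powR_inv_mono p0 (control_ge0 hw u0 uv vT) (control_mono hw s0 su uv vt tT)).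
Qed.

Lemma A_norm_mono s u v t : 0 <= s -> s <= u -> u <= v -> v <= t -> t <= T ->
  A_norm u v <= A_norm s t.
Proof.
move=> s0 su uv vt tT; have u0 := le_trans s0 su; have vT := le_trans vt tT.
have ut := le_trans uv vt; have st := le_trans su ut.
rewrite (A_normE s0 st tT) (A_normE u0 uv vT); have hw := Amu_wvar_control.
exact: (powR_inv_mono p20 (control_ge0 hw u0 uv vT) (control_mono hw s0 su uv vt tT)).
Qed.

Lemma norms_ge0 s t : 0 <= s -> s <= t -> t <= T ->
  0 <= mu_norm S p s t /\ 0 <= A_norm s t.
Proof.
move=> s0 st tT; rewrite (mu_normE s0 st tT) (A_normE s0 st tT).
by split; exact: powR_ge0.
Qed.

Lemma rate_ge0 s t : 0 <= s -> s <= t -> t <= T -> 0 <= rate s t.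
Proof.
move=> s0 st tT; have [h1 h2] := norms_ge0 s0 st tT; have h3 := trace_ge0 s0 st tT.
exact: (mulr_ge0 (addr_ge0 ler01 (sqr_ge0 _)) (addr_ge0 (addr_ge0 h1 h2) h3)).
Qed.

Lemma rate_mono s u v t : 0 <= s -> s <= u -> u <= v -> v <= t -> t <= T ->
  rate u v <= rate s t.
Proof.
move=> s0 su uv vt tT; have u0 := le_trans s0 su; have vT := le_trans vt tT.
have st := le_trans su (le_trans uv vt).
have [h1 h2] := norms_ge0 u0 uv vT; have h3 := trace_ge0 u0 uv vT.
have m1 := mu_norm_mono s0 su uv vt tT; have m2 := A_norm_mono s0 su uv vt tT.
have m3 : trace u v <= trace s t.
  have g1 := trace_ge0 s0 su (le_trans uv vT).
  have g2 := trace_ge0 (le_trans u0 uv) vt tT.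
  exact: mid_le (trace_add s u t) (trace_add u v t) g1 g2.
have h1' := le_trans h1 m1.
have m4 : 1 + mu_norm S p u v ^+ 2 <= 1 + mu_norm S p s t ^+ 2.
  by rewrite lerD2l; apply: (lerXn2r 2 h1 h1' m1).
exact: (ler_pM (addr_ge0 ler01 (sqr_ge0 _)) (addr_ge0 (addr_ge0 h1 h2) h3) m4
  (lerD (lerD m1 m2) m3)).
Qed.

Section Pair.
Variables (F G : 'rV[R]_d -> 'rV[R]_d) (K e : R).
Hypotheses (hF : twice_diff F) (hG : twice_diff G).
Hypotheses (kF : C2_le K F) (kG : C2_le K G) (he : C2_le e (F - G)).

Let H := F - G.
Let hH : twice_diff H := twice_diff_sub hF hG.
Let h u k := H (mu S u) 0 k.
Let Dh u k l := D H (mu S u) k l.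

Let gam s t : R := \sum_k h s k * (mu S t 0 k - mu S s 0 k)
  + \sum_k \sum_l Dh s k l * Amu S P s t l k.

Let nn s t := enorm (incr (mu S) s t).
Let na s t := enorm (Amu S P s t).

Let nn_coord s t k : `|mu S t 0 k - mu S s 0 k| <= nn s t.
Proof. by rewrite -incr_entry; exact: enorm_coord. Qed.

Let dist_nn s t : dist1 (mu S s) (mu S t) <= d%:R * nn s t.
Proof.
apply: le_trans (ler_norm _) _; apply: sumr_le_const => k.
by rewrite normr_id; exact: nn_coord.
Qed.

Let sx u : 0 <= u -> u <= T -> simplex (mu S u).
Proof. exact: (mu_simplex hd B0 hB). Qed.

Lemma e_ge0 : 0 <= e.
Proof.
have [g _ _] := he (sx (lexx 0) T0) (Ordinal hd) (Ordinal hd) (Ordinal hd).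
exact: le_trans (normr_ge0 _) g.
Qed.

Lemma K_ge0 : 0 <= K.
Proof.
have [g _ _] := kF (sx (lexx 0) T0) (Ordinal hd) (Ordinal hd) (Ordinal hd).
exact: le_trans (normr_ge0 _) g.
Qed.

(** The difference [H] of the two functions has C2 norm at most [e], so that each
    term of the defect carries a factor [e]. *)
Lemma gam_defect u v w : 0 <= u -> u <= v -> v <= w -> w <= T ->
  `|gam u w - gam u v - gam v w| <=
    d%:R ^+ 3 * e * (nn u v ^+ 2 * nn v w + nn u v * na v w).
Proof.
move=> u0 uv vw wT; have uT := le_trans uv (le_trans vw wT).
have v0 := le_trans u0 uv; have vT := le_trans vw wT.
have e0 := e_ge0; have d1 : (1 : R) <= d%:R by rewrite ler1n.
have d0 : (0 : R) <= d%:R by exact: le_trans d1.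
have n0 s t : 0 <= nn s t by exact: enorm_ge0.
have a0 s t : 0 <= na s t by exact: enorm_ge0.
have E : gam u w - gam u v - gam v w =
    - \sum_k (mu S w 0 k - mu S v 0 k) *
        (h v k - h u k - \sum_l Dh u k l * (mu S v 0 l - mu S u 0 l))
    - \sum_k \sum_l (Dh v k l - Dh u k l) * Amu S P v w l k.
  rewrite -(@linear_defect_alg R d (h u) (h v) _ _ (Dh u) (Dh v) (Amu S P u v)).
  congr (_ - _ - _); congr (_ + _).
    by apply: eq_bigr => k _; congr (_ * _); rewrite [RHS]addrC addrA subrK.
  apply: eq_bigr => k _; apply: eq_bigr => l _; congr (_ * _).
  exact: (Amu_chen hd hp hr B0 hB l k u0 uv vw wT).
rewrite E.
apply: le_trans (ler_normB _ _) _; rewrite normrN mulrDr.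
apply: lerD.
  have -> : d%:R ^+ 3 * e * (nn u v ^+ 2 * nn v w)
    = d%:R * (nn v w * (e * (d%:R * nn u v) ^+ 2)) by ring.
  apply: sumr_le_const => k; rewrite normrM; apply: ler_pM => //.
  apply: (le_trans (C2_taylor hH he k (sx u0 uT) (sx v0 vT))).
  rewrite ler_wpM2l// lerXn2r// nnegrE ?dist1_ge0// ?mulr_ge0//.
have -> : d%:R ^+ 3 * e * (nn u v * na v w)
    = d%:R * (d%:R * (e * (d%:R * nn u v) * na v w)) by ring.
apply: sumr_le_const => k; apply: sumr_le_const => l; rewrite normrM; apply: ler_pM => //.
  apply: (le_trans (D_lipschitz hH he k l (sx u0 uT) (sx v0 vT))).
  by rewrite ler_wpM2l.
exact: enorm_coord.
Qed.

Let gam_le u v : 0 <= u -> u <= v -> v <= T ->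
  `|gam u v| <= d%:R ^+ 2 * e * (nn u v + na u v).
Proof.
move=> u0 uv vT; have uT := le_trans uv vT; have e0 := e_ge0.
have d1 : (1 : R) <= d%:R by rewrite ler1n.
apply: le_trans (ler_normD _ _) _; rewrite mulrDr; apply: lerD.
  apply: (@le_trans _ _ (d%:R * (e * nn u v))).
    apply: sumr_le_const => k; rewrite normrM.
    have [g _ _] := he (sx u0 uT) k k k.
    exact: (ler_pM (normr_ge0 _) (normr_ge0 _) g (nn_coord u v k)).
  exact: (sqr_scale_le d1 e0 (enorm_ge0 _)).
have -> : d%:R ^+ 2 * e * na u v = d%:R * (d%:R * (e * na u v)).
  by rewrite expr2 -!mulrA.
apply: sumr_le_const => k; apply: sumr_le_const => l; rewrite normrM.
have [_ g _] := he (sx u0 uT) k l l.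
exact: (ler_pM (normr_ge0 _) (normr_ge0 _) g (enorm_coord _ _ _)).
Qed.

Let theta := 3 / p.

Definition rate_cst : R := d%:R ^+ 3 * young_cst theta * 2 `^ theta + d%:R ^+ 2
  + d%:R ^+ 2 * K.

Lemma gam_bound s t r : 0 <= s -> s <= t -> t <= T -> itv_partition s t r ->
  `|psum s r gam| <= e * ((d%:R ^+ 3 * young_cst theta * 2 `^ theta + d%:R ^+ 2)
     * ((1 + mu_norm S p s t ^+ 2) * (mu_norm S p s t + A_norm s t))).
Proof.
move=> s0 st tT pr; have e0 := e_ge0.
have d0 n : (0 : R) <= d%:R ^+ n by exact: exprn_ge0.
have [C C0 hm] := mu_variation; have [C' C'0 hA] := Amu_variation.
have := @two_control_bound _ p T (d%:R ^+ 3 * e) (d%:R ^+ 2 * e) mu_wvar Amu_wvar nn na gam hp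
  (mulr_ge0 (d0 _) e0) (mulr_ge0 (d0 _) e0) mu_wvar_control Amu_wvar_control
  (fun _ _ => enorm_ge0 _) (fun _ _ => enorm_ge0 _)
  (enorm_le_wvar hc C0 hm) (enorm_le_wvar hc C'0 hA) gam_defect gam_le s t r s0 st tT pr.
move=> g; rewrite (mu_normE s0 st tT) (A_normE s0 st tT).
apply: le_trans g _; rewrite le_eqVlt; apply/orP; left; apply/eqP.
exact: (scale_out _ _ _ _ _ _).
Qed.

(** The difference of the germs is linear in [F - G] up to the bracket term.  The
    linear part is a rough integral, bounded by [two_control_bound]; the bracket
    part is bounded by the trace since the bracket is positive. *)
Lemma log_difference (L L' : R -> R) s t : 0 <= s -> s <= t -> t <= T ->
  psum s r (fun u v => dlogV S P (fun k => F (mu S u) 0 k) (D F (mu S u)) u v)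
    @[r --> mesh_to0 s t] --> L t - L s ->
  psum s r (fun u v => dlogV S P (fun k => G (mu S u) 0 k) (D G (mu S u)) u v)
    @[r --> mesh_to0 s t] --> L' t - L' s ->
  `|(L t - L s) - (L' t - L' s)| <= rate_cst * e * rate s t.
Proof.
move=> s0 st tT cF cG; have FF := mesh_to0_filter st.
have e0 := e_ge0; have K0 := K_ge0.
have d1 : (1 : R) <= d%:R by rewrite ler1n.
have d0 : (0 : R) <= d%:R by exact: le_trans d1.
pose del u v := \sum_k \sum_l (F (mu S u) 0 k * F (mu S u) 0 l
   - G (mu S u) 0 k * G (mu S u) 0 l) * mu_br S P u v k l.
have alg u v : dlogV S P (fun k => F (mu S u) 0 k) (D F (mu S u)) u v
    - dlogV S P (fun k => G (mu S u) 0 k) (D G (mu S u)) u v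
  = gam u v + (- 2^-1) * del u v.
  rewrite /dlogV /gam /del.
  have -> : \sum_k h u k * (mu S v 0 k - mu S u 0 k) =
      \sum_k F (mu S u) 0 k * (mu S v 0 k - mu S u 0 k)
      - \sum_k G (mu S u) 0 k * (mu S v 0 k - mu S u 0 k).
    rewrite -sumrB; apply: eq_bigr => k _; rewrite -mulrBl; congr (_ * _).
    by rewrite /h /H !mxE.
  have -> : \sum_k \sum_l Dh u k l * Amu S P u v l k =
      \sum_k \sum_l D F (mu S u) k l * Amu S P u v l k
      - \sum_k \sum_l D G (mu S u) k l * Amu S P u v l k.
    rewrite -sumrB; apply: eq_bigr => k _; rewrite -sumrB; apply: eq_bigr => l _.
    by rewrite -mulrBl; congr (_ * _); exact: D_sub.
  have -> : \sum_k \sum_l (F (mu S u) 0 k * F (mu S u) 0 l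
     - G (mu S u) 0 k * G (mu S u) 0 l) * mu_br S P u v k l =
     \sum_k \sum_l F (mu S u) 0 k * F (mu S u) 0 l * mu_br S P u v k l
     - \sum_k \sum_l G (mu S u) 0 k * G (mu S u) 0 l * mu_br S P u v k l.
    rewrite -sumrB; apply: eq_bigr => k _; rewrite -sumrB; apply: eq_bigr => l _.
    by rewrite -mulrBl.
  by ring.
apply: (mesh_lim_le (A := fun u v => gam u v + (- 2^-1) * del u v) st).
  apply: cvg_trans (cvgB cF cG); apply: near_eq_cvg; apply: nearW => x.
  by rewrite !fctE -psumN -psumD; apply: eq_bigr => k _; rewrite -alg.
move=> r pr; rewrite psumD psumZ.
apply: le_trans (ler_normD _ _) _.
have g1 := gam_bound s0 st tT pr.
have g2 : `|psum s r del| <= d%:R * (d%:R * (2 * (K * e))) * trace s t.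
  rewrite -(psum_trace pr) -psumZ; apply: (norm_psum_le pr) => u v su uv vt.
  have u0 := le_trans s0 su; have vT := le_trans vt tT; have uT := le_trans (ltW uv) vT.
  rewrite -!mulrA; apply: sumr_le_const => k; apply: sumr_le_const => l.
  rewrite !mulrA normrM; apply: ler_pM => //; last first.
    exact: (mu_br_le_trace hd hp hr B0 hB _ _ u0 (ltW uv) vT).
  have [f1 _ _] := kF (sx u0 uT) l l l; have [f2 _ _] := kG (sx u0 uT) k k k.
  have hk i : `|F (mu S u) 0 i - G (mu S u) 0 i| <= e.
    by have [g _ _] := he (sx u0 uT) i i i; move: g; rewrite !mxE.
  have -> : F (mu S u) 0 k * F (mu S u) 0 l - G (mu S u) 0 k * G (mu S u) 0 l
    = (F (mu S u) 0 k - G (mu S u) 0 k) * F (mu S u) 0 l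
      + G (mu S u) 0 k * (F (mu S u) 0 l - G (mu S u) 0 l) by ring.
  apply: le_trans (ler_normD _ _) _; rewrite !normrM.
  have i1 := ler_pM (normr_ge0 _) (normr_ge0 _) (hk k) f1.
  have i2 := ler_pM (normr_ge0 _) (normr_ge0 _) f2 (hk l).
  lra.
have tr0 := trace_ge0 s0 st tT.
have [M10 M20] := norms_ge0 s0 st tT.
rewrite normrM normrN (ger0_norm (x := 2^-1)) ?invr_ge0//.
have h2 : 2^-1 * `|psum s r del| <= d%:R ^+ 2 * K * e * ((1 + mu_norm S p s t ^+ 2) * trace s t).
  apply: (@le_trans _ _ (d%:R ^+ 2 * K * e * trace s t)); first lra.
  rewrite ler_wpM2l ?mulr_ge0 ?sqr_ge0// ler_peMl// lerDl sqr_ge0//.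
apply: le_trans (lerD g1 h2) _.
rewrite /rate xiE /rate_cst.
have th1 : 1 < theta by case/andP: hp => _ p3; rewrite /theta ltr_pdivlMr// mul1r.
apply: combine_rate => //.
- exact: (addr_ge0 (mulr_ge0 (mulr_ge0 (exprn_ge0 3 d0) (young_cst_ge0 th1))
    (powR_ge0 _ _)) (sqr_ge0 _)).
- exact: (mulr_ge0 (sqr_ge0 _) K0).
exact: (addr_ge0 M10 M20).
Qed.

End Pair.
End Difference.

(** * Total boundedness of the Hölder ball *)

(** Round the values to multiples of [e]. *)
Lemma finite_code {R : realType} {X : Type} (I : finType) (f : I -> X -> R) (B e : R) :
  0 < e -> (forall i x, `|f i x| <= B) ->
  exists (C : finType) (code : X -> C), forall x y, code x = code y ->
    forall i, `|f i x - f i y| <= e.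
Proof.
move=> e0 fB; pose t i x := Num.truncn ((f i x + B) / e).
pose N := Num.truncn ((B + B) / e).
have g0 i x : 0 <= (f i x + B) / e.
  rewrite (divr_ge0 _ (ltW e0))//; have := fB i x; rewrite ler_norml => /andP[+ _].
  lra.
exists {ffun I -> 'I_N.+1}; exists (fun x => [ffun i => inord (t i x)]) => x y /ffunP H i.
have tN z : (t i z < N.+1)%N.
  rewrite ltnS /t /N; apply: le_truncn; rewrite ler_pM2r ?invr_gt0// lerD2r.
  exact: le_trans (ler_norm _) (fB i z).
have := congr1 val (H i); rewrite !ffunE /= !inordK// => txy.
have /andP[x1 x2] := truncn_itv (g0 i x); have /andP[y1 y2] := truncn_itv (g0 i y).
rewrite -/(t i x) txy in x1 x2; rewrite -/(t i y) in y1 y2.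
have -> : f i x - f i y = e * ((f i x + B) / e - (f i y + B) / e).
  by field; rewrite gt_eqF.
rewrite normrM (gtr0_norm e0); apply: (ler_piMr (ltW e0)); rewrite ler_norml.
by move: x2 y2; rewrite -natr1; lra.
Qed.

Lemma positive_lower_bound {R : realType} (C : finType) (f : C -> R) :
  (forall c, 0 < f c) -> exists2 k, 0 < k & forall c, k <= f c.
Proof.
move=> f0; have s0 : 0 <= \sum_c (f c)^-1 by apply: sumr_ge0 => c _; rewrite invr_ge0 ltW.
have s1 : 0 < 1 + \sum_c (f c)^-1 by rewrite ltr_pwDl.
exists (1 + \sum_c (f c)^-1)^-1 => [|c]; first by rewrite invr_gt0.
rewrite -[X in _ <= X]invrK lef_pV2 ?posrE ?invr_gt0//.
rewrite (bigD1 c)//= addrCA lerDl addr_ge0//.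
by apply: sumr_ge0 => i _; rewrite invr_ge0 ltW.
Qed.

Section C2Distance.
Context {R : realType} {d : nat}.

Lemma C2_le_sub (F G : 'rV[R]_d -> 'rV[R]_d) (a : R) : twice_diff F -> twice_diff G ->
  C2_le a (F - G) <-> forall x, simplex x -> forall i j k,
    [/\ `|F x 0 i - G x 0 i| <= a, `|D F x i j - D G x i j| <= a &
        `|D2 F x (i, j, k) - D2 G x (i, j, k)| <= a].
Proof.
move=> hF hG.
have E x i j k : [/\ (F - G) x 0 i = F x 0 i - G x 0 i,
    D (F - G) x i j = D F x i j - D G x i j &
    D2 (F - G) x (i, j, k) = D2 F x (i, j, k) - D2 G x (i, j, k)].
  by split; [rewrite !mxE|exact: D_sub|exact: D2_sub].
by split=> H x sx i j k; have := H x sx i j k; have [-> -> ->] := E x i j k.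
Qed.

Variables (H1 H2 H3 : 'rV[R]_d -> 'rV[R]_d).
Hypotheses (t1 : twice_diff H1) (t2 : twice_diff H2) (t3 : twice_diff H3).

Lemma C2_le_trans (a b : R) : C2_le a (H1 - H2) -> C2_le b (H2 - H3) ->
  C2_le (a + b) (H1 - H3).
Proof.
move=> /(C2_le_sub _ t1 t2) A /(C2_le_sub _ t2 t3) B; apply/(C2_le_sub _ t1 t3).
move=> x sx i j k; have [a1 a2 a3] := A x sx i j k; have [b1 b2 b3] := B x sx i j k.
have tri (u v w : R) : `|u - v| <= a -> `|v - w| <= b -> `|u - w| <= a + b.
  by move=> h h'; rewrite -(subrK v u) -addrA; apply: le_trans (ler_normD _ _) (lerD h h').
by split; [exact: tri b1|exact: tri b2|exact: tri b3].
Qed.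

Lemma C2_le_sym (a : R) : C2_le a (H1 - H2) -> C2_le a (H2 - H1).
Proof.
move=> /(C2_le_sub _ t1 t2) A; apply/(C2_le_sub _ t2 t1) => x sx i j k.
by have [a1 a2 a3] := A x sx i j k; split; rewrite distrC.
Qed.

End C2Distance.

Section TotallyBounded.
Context {R : realType} {d : nat}.
Variables (alpha : R) (K : {posnum R}).
Hypothesis alpha0 : 0 < alpha.
Local Notation M := (C2aK_borel d alpha K).
Implicit Types F G : M.

Lemma simplex_net (e : R) : 0 < e ->
  exists (C : finType) (y : C -> 'rV[R]_d), forall x, simplex x ->
    exists c, simplex (y c) /\ forall i, `|x 0 i - y c 0 i| <= e.
Proof.
move=> e0; pose X := {x : 'rV[R]_d | simplex x}.
have [|C [code Hc]] := @finite_code R X 'I_d (fun i x => sval x 0 i) 1 e e0.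
  move=> i [x [x0 x1]] /=; rewrite ger0_norm// -x1 (bigD1 i)//= lerDl.
  exact: sumr_ge0.
have rep c : exists y : 'rV[R]_d, forall x : X, code x = c ->
    simplex y /\ forall i, `|sval x 0 i - y 0 i| <= e.
  have [[z zc]|nz] := pselect (exists z, code z = c).
    exists (sval z) => x xc; split; first exact: (svalP z).
    by move=> i; apply: (Hc x z); rewrite zc.
  by exists 0 => x xc; case: nz; exists x.
have /choice[y Hy] := rep.
by exists C, y => x sx; exists (code (exist _ x sx)); exact: (Hy _ (exist _ x sx)).
Qed.

(** The code of [F] consists of the rounded values of [F], [D F] and [D^2 F] on a
    finite net of the simplex.  Away from the net, values and first derivatives
    are controlled by the C2 norm, and second derivatives by the Hölder seminorm. *)
Lemma C2_net (e : R) : 0 < e ->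
  exists (C : finType) (code : M -> C), forall F G, code F = code G ->
    C2_le e (val F - val G).
Proof.
move=> e0; have K0 : 0 < K%:num by [].
pose n : R := d%:R + 1.
have n0 : 0 < n by rewrite /n ltr_pwDr.
pose e1 := e / (4 * K%:num).
have e10 : 0 < e1 by rewrite divr_gt0// mulr_gt0.
(* Points at distance [del] in each coordinate have values, derivatives and, by
   the Hölder bound, second derivatives within [e / 4] of each other. *)
pose del := Num.min (e1 / n) (e1 `^ alpha^-1 / n).
have del0 : 0 < del by rewrite lt_min !divr_gt0// powR_gt0.
have [C0 [y Hy]] := simplex_net del0.
pose f (z : C0 * 'I_3 * 'I_d * 'I_d * 'I_d) F : R :=
  if `[< simplex (y z.1.1.1.1) >] then
    let: (c, a, i, j, k) := z in
    if a == 0 then val F (y c) 0 i else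
    if a == 1 then D (val F) (y c) i j else D2 (val F) (y c) (i, j, k)
  else 0.
have e20 : 0 < e / 2 by rewrite divr_gt0.
have [|C [code Hc]] := @finite_code R M _ f K%:num (e / 2) e20.
  move=> [[[[c a] i] j] k] F; rewrite /f /=; case: asboolP => [sy|_]; last first.
    by rewrite normr0 ltW.
  have [h1 h2 h3] := ball_C2_le F sy i j k.
  by case: ifP => // _; case: ifP.
exists C, code => F G FG; have hF := ball_twice_diff F; have hG := ball_twice_diff G.
apply/(C2_le_sub _ hF hG) => x sx i j k.
have [c [sy xy]] := Hy x sx; set z := y c in sy xy.
have cl a : `|f (c, a, i, j, k) F - f (c, a, i, j, k) G| <= e / 2 := Hc F G FG _.
have cl0 := cl 0; have cl1 := cl 1; have cl2 := cl (inord 2).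
rewrite /f /= (asboolT sy) in cl0 cl1 cl2.
rewrite -/z /= ?eqxx in cl0 cl1 cl2.
have two : ((inord 2 == 0 :> 'I_3) = false) * ((inord 2 == 1 :> 'I_3) = false).
  by split; apply/eqP => /(congr1 val); rewrite /= inordK.
rewrite !two in cl2.
have dd : d%:R <= n by rewrite /n lerDl.
have dist : dist1 z x <= n * del.
  apply: le_trans (ler_norm _) _.
  apply: (@le_trans _ _ (d%:R * del)); last exact: (ler_wpM2r (ltW del0)).
  by apply: sumr_le_const => l; rewrite normr_id.
have m1 : del <= e1 / n by rewrite ge_min lexx.
have m2 : del <= e1 `^ alpha^-1 / n by rewrite ge_min lexx orbT.
have d1 : K%:num * dist1 z x <= e / 4.
  apply: (@le_trans _ _ (K%:num * (n * (e1 / n)))).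
    apply: (ler_wpM2l (ltW K0)); apply: (le_trans dist).
    exact: (ler_wpM2l (ltW n0)).
  by rewrite /e1 le_eqVlt; apply/orP; left; apply/eqP; field; rewrite !gt_eqF.
have d2 : K%:num * enorm (x - z) `^ alpha <= e / 4.
  have en : enorm (x - z) <= e1 `^ alpha^-1.
    apply: (@le_trans _ _ ((1 * d)%:R * del)).
      by apply: enorm_le => [|l l']; [exact: ltW|rewrite ord1 !mxE; exact: xy].
    rewrite mul1n; apply: (@le_trans _ _ (n * (e1 `^ alpha^-1 / n))).
      exact: (ler_pM (ler0n _ _) (ltW del0) dd m2).
    by rewrite mulrC divfK// gt_eqF.
  have := ge0_ler_powR (ltW alpha0) _ _ en; rewrite !nnegrE enorm_ge0 powR_ge0.
  move=> /(_ isT isT); rewrite -powRrM mulVf ?gt_eqF// (powRr1 (ltW e10)) => en'.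
  apply: (@le_trans _ _ (K%:num * e1)); first exact: (ler_wpM2l (ltW K0)).
  by rewrite /e1 le_eqVlt; apply/orP; left; apply/eqP; field; rewrite !gt_eqF.
have tri (a b a' b' : R) : `|a - b| <= e / 4 -> `|a' - b'| <= e / 4 ->
    `|b - b'| <= e / 2 -> `|a - a'| <= e.
  move=> h1 h2 h3; have -> : a - a' = a - b + (b - b') - (a' - b') by ring.
  apply: le_trans (ler_normB _ _) _; apply: le_trans (lerD (ler_normD _ _) (lexx _)) _.
  by apply: le_trans (lerD (lerD h1 h3) h2) _; lra.
split.
- by apply: tri cl0; apply: le_trans d1; apply: C2_lipschitz => //; exact: ball_C2_le.
- by apply: tri cl1; apply: le_trans d1; apply: D_lipschitz => //; exact: ball_C2_le.
by apply: tri cl2; apply: le_trans d2; exact: ball_holder.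
Qed.

Variable m : probability M R.
Hypothesis hm : full_support m.

(** By [C2_net] finitely many balls of small radius suffice; each has positive
    mass by full support, so that their masses are bounded below. *)
Lemma ball_mass (e : R) : 0 < e -> exists2 k : R, 0 < k & forall F, exists U : set M,
  [/\ measurable U, k <= fine (m U) & forall G, U G -> C2_le e (val F - val G)].
Proof.
move=> e0; have e30 : 0 < e / 4 by rewrite divr_gt0.
have [C [code Hc]] := C2_net e30.
have td := @ball_twice_diff R d alpha K.
pose near F := [set G : M | exists2 h : R, h < e / 2 & C2_le h (val G - val F)].
have near_open F : @C2_open R d alpha K (near F).
  move=> G [h he hG]; exists ((e / 2 - h) / 2); first by rewrite divr_gt0// subr_gt0.
  move=> G' /ltW /C2_norm_le GG'; exists ((e / 2 - h) / 2 + h); first by lra.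
  exact: (C2_le_trans (td G') (td G) (td F) (C2_le_sym (td G) (td G') GG') hG).
have near_refl F : near F F.
  exists (e / 4); first by lra.
  exact: (Hc F F erefl).
have near_meas F : measurable (near F) := C2_open_measurable (near_open F).
have near_pos (F : M) : 0 < fine (m (near F)).
  have h1 : (0 < m (near F))%E := hm (near_open F) (ex_intro _ F (near_refl F)).
  have h2 : (m (near F) < +oo)%E := le_lt_trans (probability_le1 m (near_meas F)) (ltry 1).
  by rewrite fine_gt0// h1 h2.
have rep c : exists F0 : M, forall F, code F = c -> code F0 = c.
  have [[z zc]|nz] := pselect (exists z, code z = c); first by exists z.
  by exists point => F Fc; case: nz; exists F.
have /choice[F0 HF0] := rep.
have [k k0 Hk] := positive_lower_bound (fun c => near_pos (F0 c)).
exists k => // F; exists (near (F0 (code F))); split.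
- exact: near_meas.
- exact: Hk.
move=> G [h he hG]; apply: (@C2_leW _ _ (e / 4 + h)); first by lra.
have h1 : C2_le (e / 4) (val F - val (F0 (code F))).
  by apply: Hc; rewrite (HF0 (code F) F erefl).
exact: (C2_le_trans (td F) (td (F0 (code F))) (td G) h1
  (C2_le_sym (td G) (td (F0 (code F))) hG)).
Qed.

End TotallyBounded.

(** * Mixtures of generating fields *)

Section WeightedMean.
Context {R : realType} {dd : measure_display} {M : measurableType dd}.
Variable m : probability M R.
Variable v : M -> R.
Hypothesis hv : bounded_rv v.
Hypothesis v0 : mean m v != 0.

(** The expectation under the probability of density proportional to [v]. *)
Definition wmean (h : M -> R) : R := mean m (fun F => v F * h F) / mean m v.

Let hvm h : bounded_rv h -> bounded_rv (fun F => v F * h F).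
Proof. exact: bounded_rv_M. Qed.

Lemma wmeanE h : mean m (fun F => v F * h F) = mean m v * wmean h.
Proof. by rewrite /wmean mulrC divfK. Qed.

Lemma eq_wmean h g : (forall F, h F = g F) -> wmean h = wmean g.
Proof. by move=> e; rewrite /wmean; congr (_ / _); apply: eq_mean => F; rewrite e. Qed.

Lemma wmean_D h g : bounded_rv h -> bounded_rv g ->
  wmean (fun F => h F + g F) = wmean h + wmean g.
Proof.
move=> hh hg; rewrite /wmean -mulrDl -mean_D; [|exact: hvm..].
by congr (_ / _); apply: eq_mean => F; rewrite mulrDr.
Qed.

Lemma wmean_B h g : bounded_rv h -> bounded_rv g ->
  wmean (fun F => h F - g F) = wmean h - wmean g.
Proof.
move=> hh hg; rewrite /wmean -mulrBl -mean_B; [|exact: hvm..].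
by congr (_ / _); apply: eq_mean => F; rewrite mulrBr.
Qed.

Lemma wmean_Z k h : bounded_rv h -> wmean (fun F => k * h F) = k * wmean h.
Proof.
move=> hh; rewrite /wmean mulrA -mean_Z; last exact: hvm.
by congr (_ / _); apply: eq_mean => F; rewrite mulrCA.
Qed.

Lemma wmean_cst k : wmean (fun=> k) = k.
Proof. by rewrite /wmean mean_Zr// mulrAC divff// mul1r. Qed.

Lemma wmean_sum (I : Type) (r : seq I) (h : I -> M -> R) :
  (forall i, bounded_rv (h i)) ->
  wmean (fun F => \sum_(i <- r) h i F) = \sum_(i <- r) wmean (h i).
Proof.
move=> H; elim: r => [|i r IH].
  by under eq_wmean do rewrite big_nil; rewrite wmean_cst big_nil.
under eq_wmean do rewrite big_cons.
by rewrite wmean_D// ?IH ?big_cons//; exact: bounded_rv_sum.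
Qed.

Variables (d : nat) (x : 'rV[R]_d).
Variables (phi : M -> 'I_d -> R) (Psi : M -> 'I_d -> 'I_d -> R).
Hypothesis hphi : forall k, bounded_rv (fun F => phi F k).
Hypothesis hPsi : forall k l, bounded_rv (fun F => Psi F k l).

(** The mixture of the generating fields, and its derivative: the covariance of
    [phi] accounts for the change of the weights along the market. *)
Definition mix_phi k : R := wmean (fun F => phi F k).

Definition mix_Psi k l : R :=
  wmean (fun F => Psi F k l + phi F k * phi F l) - mix_phi k * mix_phi l.

Let n k : R := normalize x 0 k.

Lemma bounded_rv_avg (h : M -> 'I_d -> R) : (forall k, bounded_rv (fun F => h F k)) ->
  bounded_rv (fun F => \sum_j n j * h F j).
Proof. by move=> H; apply: bounded_rv_sum => j; exact: bounded_rv_Z. Qed.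

Lemma wmean_avg (h : M -> 'I_d -> R) : (forall k, bounded_rv (fun F => h F k)) ->
  wmean (fun F => \sum_j n j * h F j) = \sum_j n j * wmean (fun F => h F j).
Proof.
move=> H; rewrite wmean_sum; last by move=> j; exact: bounded_rv_Z.
by apply: eq_bigr => j _; rewrite wmean_Z.
Qed.

Lemma bounded_rv_gen_pi k : bounded_rv (fun F => gen_pi x (phi F) k).
Proof.
apply: bounded_rv_Z; apply: bounded_rv_B; last exact: bounded_rv_avg.
by apply: bounded_rv_D => //; exact: bounded_rv_cst.
Qed.

Lemma bounded_rv_gen_dpi k l : bounded_rv (fun F => gen_dpi x (phi F) (Psi F) k l).
Proof.
apply: bounded_rv_D; apply: bounded_rv_Z.
  apply: bounded_rv_B; last exact: bounded_rv_avg.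
  by apply: bounded_rv_D => //; exact: bounded_rv_cst.
apply: bounded_rv_B; first exact: bounded_rv_B.
exact: (bounded_rv_avg (h := fun F j => Psi F j l)).
Qed.

Lemma wmean_gen_pi k : wmean (fun F => gen_pi x (phi F) k) = gen_pi x mix_phi k.
Proof.
rewrite /gen_pi wmean_Z; last first.
  apply: bounded_rv_B; last exact: bounded_rv_avg.
  by apply: bounded_rv_D => //; exact: bounded_rv_cst.
rewrite wmean_B; last 2 first.
- by apply: bounded_rv_D => //; exact: bounded_rv_cst.
- exact: bounded_rv_avg.
by rewrite wmean_D ?wmean_cst ?wmean_avg//; exact: bounded_rv_cst.
Qed.

Lemma gen_pi_mulr (f : 'I_d -> R) k y : gen_pi x f k * y =
  n k * (f k * y + y - \sum_j n j * (f j * y)).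
Proof.
rewrite /gen_pi -mulrA; congr (_ * _); rewrite mulrBl mulrDl mul1r; congr (_ - _).
by rewrite mulr_suml; apply: eq_bigr => j _; rewrite mulrA.
Qed.

(** The left-hand side is the quotient rule for the weighted average of the
    portfolios [gen_pi].  The product term on the left supplies the second
    moment of [phi], and the subtracted one turns it into a covariance. *)
Lemma wmean_gen_dpi k l :
  wmean (fun F => gen_dpi x (phi F) (Psi F) k l + gen_pi x (phi F) k * phi F l)
    - gen_pi x mix_phi k * mix_phi l = gen_dpi x mix_phi mix_Psi k l.
Proof.
pose Q F j i := Psi F j i + phi F j * phi F i.
have hpp j i : bounded_rv (fun F => phi F j * phi F i) by exact: bounded_rv_M.
have hQ j i : bounded_rv (fun F => Q F j i) by exact: bounded_rv_D.
have E F : gen_dpi x (phi F) (Psi F) k l + gen_pi x (phi F) k * phi F l =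
    (k == l)%:R * (phi F k + 1 - \sum_j n j * phi F j)
    + n k * (Q F k l - \sum_j n j * Q F j l).
  rewrite gen_pi_mulr /gen_dpi -/(n k) -addrA; congr (_ + _); rewrite -mulrDr.
  congr (_ * _); rewrite /Q.
  under [\sum_j n j * (Psi F j l + _)]eq_bigr do rewrite mulrDr.
  by rewrite big_split/=; ring.
rewrite (eq_wmean E) wmean_D; last 2 first.
- apply: bounded_rv_Z; apply: bounded_rv_B; last exact: bounded_rv_avg.
  by apply: bounded_rv_D => //; exact: bounded_rv_cst.
- apply: bounded_rv_Z; apply: bounded_rv_B => //.
  exact: (bounded_rv_avg (h := fun F j => Q F j l)).
rewrite wmean_Z; last first.
  apply: bounded_rv_B; last exact: bounded_rv_avg.
  by apply: bounded_rv_D => //; exact: bounded_rv_cst.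
rewrite wmean_B; last 2 first.
- by apply: bounded_rv_D => //; exact: bounded_rv_cst.
- exact: bounded_rv_avg.
rewrite wmean_D//; last exact: bounded_rv_cst.
rewrite wmean_cst wmean_avg// wmean_Z; last first.
  by apply: bounded_rv_B => //; exact: (bounded_rv_avg (h := fun F j => Q F j l)).
rewrite wmean_B//; last exact: (bounded_rv_avg (h := fun F j => Q F j l)).
rewrite (wmean_avg (h := fun F j => Q F j l))//.
rewrite gen_pi_mulr /gen_dpi -/(n k) -addrA; congr (_ + _); rewrite -mulrBr.
congr (_ * _); rewrite /mix_Psi -/(n _).
under [\sum_j n j * (_ - _)]eq_bigr do rewrite mulrBr.
by rewrite sumrB /Q; ring.
Qed.

End WeightedMean.

(** * Averages of controlled paths *)

Section Regular.
Context {R : realType} {d : nat}.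
Variables (p T : R) (S : R -> 'rV[R]_d) (P : nat -> nat -> R) (c eta : R -> R -> R).
Hypothesis hp : 2 < p < 3.
Local Notation A := (Defs.lift S P).
Hypothesis hr : rough_driver T p S A c eta.
Local Notation tau := (tau p c).
Local Notation E := (err p c eta).

(** Unlike the control, this gauge is small on all short intervals. *)
Definition gauge s t : R := eta s t + E s t.

Lemma gauge_small (k : R) : 0 < k -> exists2 delta, 0 < delta & forall s t,
  0 <= s -> s <= t -> t <= T -> t - s < delta -> gauge s t <= k.
Proof.
move=> k0; have hc := driver_control hr; have [h1 h2 h3] := driver_modulus hr.
case/andP: (hp) => p2 p3; have p0 : 0 < p by exact: lt_trans p2.
have [T0|T0] := lerP 0 T; last first.
  exists 1 => // s t s0 st tT; move: (le_trans s0 (le_trans st tT)).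
  by rewrite leNgt T0.
pose a := (3 - p) / 2; pose C := c 0 T `^ ((3 + p) / (2 * p)) + 1.
have a0 : 0 < a by rewrite divr_gt0// subr_gt0.
have C0 : 0 < C by rewrite ltr_pwDr// powR_ge0.
pose k1 := Num.min (k / 2) ((k / (2 * C)) `^ a^-1).
have k2C : 0 < k / (2 * C) by rewrite divr_gt0// mulr_gt0.
have k10 : 0 < k1 by rewrite lt_min powR_gt0// andbT divr_gt0.
have [delta d0 H] := h3 k1 k10; exists delta => // s t s0 st tT ts.
have := H s t s0 st tT ts; rewrite le_min => /andP[e1 e2].
have /andP[e0 _] := h1 s t s0 st tT.
have cm := control_mono hc (lexx 0) s0 st tT (lexx T).
have c0 := control_ge0 hc s0 st tT.
have g1 : eta s t `^ a <= k / (2 * C).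
  have := ge0_ler_powR (ltW a0) _ _ e2; rewrite !nnegrE e0 powR_ge0 => /(_ isT isT).
  by rewrite -powRrM mulVf ?gt_eqF// powRr1// ltW.
have g2 : c s t `^ ((3 + p) / (2 * p)) <= C.
  apply: (@le_trans _ _ (c 0 T `^ ((3 + p) / (2 * p)))); last by rewrite lerDl.
  apply: ge0_ler_powR => //; last by rewrite nnegrE (le_trans c0).
  by rewrite divr_ge0// ?mulr_ge0// ?addr_ge0// ltW.
have g3 : E s t <= k / (2 * C) * C by apply: ler_pM => //; exact: powR_ge0.
have -> : k = k / 2 + k / (2 * C) * C by field; rewrite gt_eqF.
exact: lerD.
Qed.

Section Family.
Context {J : Type}.
Let D := @pairs R J T.
Let hs : spans T D (fun z => z.1.2) (fun z => z.2) := @pairs_spans _ T J.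

Let g0 (z : J * R * R) : D z -> 0 <= gauge z.1.2 z.2.
Proof.
by move=> Dz; have /andP[h _] := eta_bounds hr hs Dz; rewrite addr_ge0// err_ge0.
Qed.

(** Scalar paths that are bounded and equicontinuous over a family. *)
Definition reg (x : J -> R -> R) : Prop :=
  bO D (fun z => x z.1.1 z.1.2) (fun=> 1) /\
  bO D (fun z => x z.1.1 z.2 - x z.1.1 z.1.2) (fun z => gauge z.1.2 z.2).

Lemma bO_eta_gauge f : bO D f (fun z => eta z.1.2 z.2) ->
  bO D f (fun z => gauge z.1.2 z.2).
Proof. by move=> h; apply: bO_leT h _ => z _; rewrite lerDl err_ge0. Qed.

Lemma bO_err_gauge f : bO D f (fun z => E z.1.2 z.2) ->
  bO D f (fun z => gauge z.1.2 z.2).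
Proof.
move=> h; apply: bO_leT h _ => z Dz.
by have /andP[h _] := eta_bounds hr hs Dz; rewrite lerDr.
Qed.

Lemma eq_reg x y : (forall j t, 0 <= t -> t <= T -> x j t = y j t) -> reg y -> reg x.
Proof.
move=> e [h1 h2]; split.
  by apply: eq_bO h1 => z [z0 zz zT]; apply: e => //; exact: le_trans zT.
apply: eq_bO h2 => z [z0 zz zT].
by rewrite !e//; [exact: le_trans zT|exact: le_trans zz].
Qed.

Lemma reg_cst k : reg (fun _ _ => k).
Proof.
split; first exact: bO_cst.
by exists 0 => // z Dz; rewrite subrr normr0 mul0r.
Qed.

Lemma reg_D x y : reg x -> reg y -> reg (fun j t => x j t + y j t).
Proof.
move=> [h1 h2] [k1 k2]; split; first exact: bO_D.
by apply: eq_bO (bO_D h2 k2) => z _; ring.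
Qed.

Lemma reg_M x y : reg x -> reg y -> reg (fun j t => x j t * y j t).
Proof.
move=> [h1 h2] [k1 k2]; split; first exact: bO_Ml.
apply: (eq_bO (x' := fun z => (x z.1.1 z.2 - x z.1.1 z.1.2) * y z.1.1 z.2
  + x z.1.1 z.1.2 * (y z.1.1 z.2 - y z.1.1 z.1.2))); first by move=> z _; ring.
by apply: bO_D; [apply: bO_Mr => //; exact: bO_end|exact: bO_Ml].
Qed.

Lemma reg_N x : reg x -> reg (fun j t => - x j t).
Proof. by move=> h; apply: eq_reg (reg_M (reg_cst (-1)) h) => j t _ _; ring. Qed.

Lemma reg_sum (I : Type) (r : seq I) (x : I -> J -> R -> R) :
  (forall i, reg (x i)) -> reg (fun j t => \sum_(i <- r) x i j t).
Proof.
move=> h; elim: r => [|i r IH].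
  by apply: eq_reg (reg_cst 0) => j t _ _; rewrite big_nil.
by apply: eq_reg (reg_D (h i) IH) => j t _ _; rewrite big_cons.
Qed.

Lemma reg_V x : reg x -> (forall j t, 0 <= t -> t <= T -> x j t != 0) ->
  bO D (fun z => (x z.1.1 z.1.2)^-1) (fun=> 1) -> reg (fun j t => (x j t)^-1).
Proof.
move=> [h1 h2] x0 hV; split => //.
apply: (eq_bO (x' := fun z => - ((x z.1.1 z.1.2)^-1 *
   ((x z.1.1 z.2)^-1 * (x z.1.1 z.2 - x z.1.1 z.1.2))))).
  move=> z [z0 zz zT]; field.
  by rewrite !x0//; [exact: le_trans zT|exact: le_trans zz].
apply: bO_N; apply: bO_Ml => //; apply: bO_Ml => //.
exact: (bO_end (f := fun j t => (x j t)^-1)).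
Qed.

End Family.

Lemma reg_continuous {n k : nat} (X : R -> 'M[R]_(n, k)) :
  (forall i j, reg (fun (_ : unit) t => X t i j)) -> {within `[0, T], continuous X}.
Proof.
move=> h.
have /choice[f Hf] : forall ij : 'I_n * 'I_k, exists C, 0 <= C /\
    forall s t, 0 <= s -> s <= t -> t <= T ->
    `|X t ij.1 ij.2 - X s ij.1 ij.2| <= C * gauge s t.
  move=> ij; have [_ [C C0 H]] := h ij.1 ij.2.
  by exists C; split=> // s t s0 st tT; exact: (H (tt, s, t) (And3 s0 st tT)).
pose C := 1 + \sum_ij f ij.
have f0 ij : 0 <= f ij by case: (Hf ij).
have C0 : 0 < C by rewrite ltr_pwDl// sumr_ge0.
have fC ij : f ij <= C.
  by rewrite /C (bigD1 ij)//= addrCA lerDl addr_ge0// sumr_ge0.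
apply/within_itv_continuousP => x x0 xT e e0.
have eC : 0 < e / C by rewrite divr_gt0.
have [delta d0 H] := gauge_small eC; exists delta => // y y0 yT yx.
have key s t : 0 <= s -> s <= t -> t <= T -> t - s < delta -> `|X t - X s| <= e.
  move=> s0 st tT ts; apply: mx_norm_le => [|i j]; first exact: ltW.
  rewrite !mxE; have [_ /(_ s t s0 st tT) g] := Hf (i, j); apply: le_trans g _.
  have g1 := H s t s0 st tT ts.
  apply: (@le_trans _ _ (f (i, j) * (e / C))); first by rewrite ler_wpM2l.
  rewrite mulrA ler_pdivrMr// mulrC; apply: ler_wpM2l => //; exact: ltW.
have [xy|/ltW xy] := leP x y.
  by apply: key => //; rewrite -(ger0_norm (x := y - x))// subr_ge0.
by rewrite distrC; apply: key => //; rewrite -(ger0_norm (x := x - y)) ?subr_ge0// distrC.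
Qed.

Section Averages.
Context {dd : measure_display} {M : measurableType dd}.
Variable m : probability M R.

Lemma bO_mean (f : M * R * R -> R) (g : R -> R -> R) :
  bO (@pairs R M T) f (fun z => g z.1.2 z.2) ->
  (forall s t, 0 <= s -> s <= t -> t <= T -> bounded_rv (fun j => f (j, s, t))) ->
  bO (@pairs R unit T) (fun z => mean m (fun j => f (j, z.1.2, z.2)))
    (fun z => g z.1.2 z.2).
Proof.
move=> [C C0 H] hf; exists C => // z [z0 zz zT]; apply: mean_norm_le; first exact: hf.
by move=> j; exact: (H (j, z.1.2, z.2) (And3 z0 zz zT)).
Qed.

Lemma reg_mean (x : M -> R -> R) : reg x ->
  (forall t, 0 <= t -> t <= T -> bounded_rv (x ^~ t)) ->
  reg (fun (_ : unit) t => mean m (x ^~ t)).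
Proof.
move=> [h1 h2] hx; split.
  apply: (bO_mean (g := fun _ _ => 1) h1) => s t s0 st tT /=.
  by apply: hx => //; exact: le_trans tT.
apply: (eq_bO _ (bO_mean h2 _)) => [z [z0 zz zT]|s t s0 st tT] /=.
  by rewrite mean_B//; apply: hx => //; [exact: le_trans zz|exact: le_trans zT].
by apply: bounded_rv_B; apply: hx => //; [exact: le_trans st|exact: le_trans tT].
Qed.

Lemma ctl_mean (x : M -> R -> R) (x' : M -> R -> 'I_d -> R) : ctl p T S c x x' ->
  (forall t, 0 <= t -> t <= T -> bounded_rv (x ^~ t)) ->
  (forall t k, 0 <= t -> t <= T -> bounded_rv (fun j => x' j t k)) ->
  ctl p T S c (fun (_ : unit) t => mean m (x ^~ t))
    (fun _ t k => mean m (fun j => x' j t k)).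
Proof.
move=> [h1 h2 h3 h4] hx hx'; split.
- apply: (bO_mean (g := fun _ _ => 1) h1) => s t s0 st tT /=.
  by apply: hx => //; exact: le_trans tT.
- move=> k; apply: (bO_mean (g := fun _ _ => 1) (h2 k)) => s t s0 st tT /=.
  by apply: hx' => //; exact: le_trans tT.
- move=> k; apply: (eq_bO _ (bO_mean (h3 k) _)) => [z [z0 zz zT]|s t s0 st tT] /=.
    by rewrite mean_B//; apply: hx' => //; [exact: le_trans zz|exact: le_trans zT].
  by apply: bounded_rv_B; apply: hx' => //; [exact: le_trans st|exact: le_trans tT].
have hi s t : 0 <= s -> s <= t -> t <= T -> bounded_rv (fun j => x j t - x j s).
  move=> s0 st tT.
  by apply: bounded_rv_B; apply: hx => //; [exact: le_trans st|exact: le_trans tT].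
have hl s t k : 0 <= s -> s <= t -> t <= T ->
    bounded_rv (fun j => x' j s k * (S t 0 k - S s 0 k)).
  move=> s0 st tT; apply: bounded_rv_M; last exact: bounded_rv_cst.
  by apply: hx' => //; exact: le_trans tT.
apply: (eq_bO _ (bO_mean (g := fun s t => tau s t ^+ 2) h4 _)) => [z [z0 zz zT]|s t s0 st tT] /=.
  rewrite mean_B; last 2 first.
  - exact: hi.
  - by apply: bounded_rv_sum => k; exact: hl.
  rewrite mean_B; last 2 first.
  - by apply: hx => //; exact: le_trans zz.
  - by apply: hx => //; exact: le_trans zT.
  congr (_ - _); rewrite mean_sum; last by move=> k; exact: hl.
  by apply: eq_bigr => k _; rewrite mean_Zr//; apply: hx' => //; exact: le_trans zT.
by apply: bounded_rv_B; [exact: hi|apply: bounded_rv_sum => k; exact: hl].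
Qed.

End Averages.
End Regular.

(** Increments of order [tau] have finite p-variation and remainders of order
    [tau ^+ 2] finite p/2-variation; continuity does not follow from bounds by
    the control and is asked for separately. *)
Lemma ctl_controlled {R : realType} {d : nat} (p q r T : R) (S : R -> 'rV[R]_d)
    (P : nat -> nat -> R) (c eta : R -> R -> R) (pi : cpath R d d) :
  2 < p < 3 -> 0 < q -> 0 < r -> p <= q -> p / 2 <= r -> 0 <= T ->
  rough_driver T p S (Defs.lift S P) c eta ->
  (forall k, ctl p T S c (fun (_ : unit) t => pi.1 t 0 k) (fun _ t l => pi.2 t k l)) ->
  (forall k, reg p T c eta (fun (_ : unit) t => pi.1 t 0 k)) ->
  (forall k l, reg p T c eta (fun (_ : unit) t => pi.2 t k l)) ->
  controlled q r T S pi.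
Proof.
move=> hp q0 r0 pq pr T0 hr hc hg1 hg2.
have p0 : 0 < p by case/andP: hp => h _; exact: lt_trans h.
have ctrl := driver_control hr.
split.
- by apply: (reg_continuous hp hr) => i j; rewrite ord1; exact: hg1.
- exact: (reg_continuous hp hr).
- have /choice[f Hf] : forall kl : 'I_d * 'I_d, exists C, 0 <= C /\
      forall s t, 0 <= s -> s <= t -> t <= T ->
      `|pi.2 t kl.1 kl.2 - pi.2 s kl.1 kl.2| <= C * tau p c s t.
    move=> kl; have [_ _ /(_ kl.2)[C C0 H] _] := hc kl.1.
    by exists C; split=> // s t s0 st tT; exact: (H (tt, s, t) (And3 s0 st tT)).
  have [||||C C0 H] := @enorm_powR_control _ _ _ T q p^-1 (\sum_k f k) (incr pi.2) c ctrl.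
  - by apply: sumr_ge0 => k _; case: (Hf k).
  - exact: q0.
  - by rewrite mulrC ler_pdivlMr// mul1r.
  - move=> s t i j s0 st tT; rewrite incr_entry.
    have [fj /(_ s t s0 st tT) h] := Hf (i, j); apply: le_trans h _.
    rewrite ler_wpM2r ?tau_ge0// (bigD1 (i, j))//= lerDl sumr_ge0// => k _.
    by case: (Hf k).
  by rewrite (pvarE q0 ctrl C0 H (lexx 0) T0 (lexx T)) ltry.
have /choice[f Hf] : forall k : 'I_d, exists C, 0 <= C /\
    forall s t, 0 <= s -> s <= t -> t <= T ->
    `|pi.1 t 0 k - pi.1 s 0 k - \sum_l pi.2 s k l * (S t 0 l - S s 0 l)|
      <= C * tau p c s t ^+ 2.
  move=> k; have [_ _ _ [C C0 H]] := hc k.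
  by exists C; split=> // s t s0 st tT; exact: (H (tt, s, t) (And3 s0 st tT)).
have [||||C C0 H] := @enorm_powR_control _ _ _ T r (2 / p) (\sum_k f k) (remainder S pi) c ctrl.
- by apply: sumr_ge0 => k _; case: (Hf k).
- exact: r0.
- by rewrite mulrAC ler_pdivlMr// mul1r; move: pr; rewrite ler_pdivrMr//; lra.
- move=> s t i j s0 st tT; rewrite ord1.
  have [fj /(_ s t s0 st tT) h] := Hf j.
  have -> : remainder S pi s t 0 j =
      pi.1 t 0 j - pi.1 s 0 j - \sum_l pi.2 s j l * (S t 0 l - S s 0 l).
    rewrite /remainder mxE incr_entry; congr (_ + _); rewrite mxE mxE; congr (- _).
    by apply: eq_bigr => l _; rewrite mulrC; congr (_ * _); rewrite mxE /incr ?mxE.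
  apply: le_trans h _.
  have -> : c s t `^ (2 / p) = tau p c s t ^+ 2.
    by rewrite /tau -powR_mulrn ?powR_ge0// -powRrM mulrC.
  rewrite ler_wpM2r ?sqr_ge0// (bigD1 j)//= lerDl sumr_ge0// => k _.
  by case: (Hf k).
by rewrite (pvarE r0 ctrl C0 H (lexx 0) T0 (lexx T)) ltry.
Qed.

(** * The mixed portfolio *)

(** This is the Gubinelli derivative, with respect to the prices, of the
    logarithm of the relative wealth of the portfolio generated by [f]. *)
Lemma gen_pi_drift {R : realType} {d : nat} (x : 'rV[R]_d) (f : 'I_d -> R) l :
  x 0 l != 0 -> \sum_k x 0 k != 0 ->
  (gen_pi x f l - normalize x 0 l) / x 0 l = \sum_b f b * dnorm x b l.
Proof.
move=> xl s0.
have -> : \sum_b f b * dnorm x b l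
   = (f l - \sum_b normalize x 0 b * f b) / \sum_k x 0 k.
  rewrite -(sum_delta_l f l) -sumrB mulr_suml; apply: eq_bigr => b _.
  by rewrite /dnorm eq_sym; ring.
by rewrite /gen_pi {1 2}normalizeE; field; rewrite s0 xl.
Qed.

Lemma quotient_rule_alg {R : realType} {d : nat} (z g : R) (a b n : 'I_d -> R) : z != 0 ->
  z^-1 * (z * \sum_i a i * n i) - (z ^+ 2)^-1 * (z * g * (z * \sum_i b i * n i))
  = \sum_i (a i - g * b i) * n i.
Proof.
move=> z0; rewrite mulKf//.
have -> : (z ^+ 2)^-1 * (z * g * (z * \sum_i b i * n i)) = g * \sum_i b i * n i.
  by field.
by rewrite mulr_sumr -sumrB; apply: eq_bigr => i _; rewrite mulrBl mulrA.
Qed.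

Lemma eq_bounded_rv {R : realType} {dd : measure_display} {M : measurableType dd}
  (f g : M -> R) : (forall j, f j = g j) -> bounded_rv g -> bounded_rv f.
Proof. by move=> e; rewrite (_ : f = g)//; exact/funext. Qed.

Lemma ratio_bounds {R : realType} (a b x y : R) : 0 < a -> a <= x -> x <= b ->
  a <= y -> y <= b -> a / b <= 1 + (y / x - 1) <= b / a.
Proof.
move=> a0 ax xb ay yb; have x0 := lt_le_trans a0 ax; have b0 := lt_le_trans x0 xb.
rewrite (addrC 1) subrK; apply/andP; split.
  by apply: ler_pM => //; rewrite ?invr_ge0 ?lef_pV2//; exact: ltW.
apply: ler_pM => //; rewrite ?invr_ge0 ?lef_pV2//; apply: ltW => //.
exact: lt_le_trans ay.
Qed.

Lemma log_split {R : realType} (a b c e l x : R) :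
  (a + b) - (c + e) - l = (a - c - x) - (l - (b - e) - x).
Proof. by ring. Qed.

Lemma ln_ratio {R : realType} (x y : R) : 0 < x -> 0 < y ->
  ln y - ln x = ln (1 + (y / x - 1)).
Proof. by move=> x0 y0; rewrite (addrC 1) subrK ln_div. Qed.

Section Mixture.
Context {R : realType} {d : nat}.
Variables (p T B : R) (S : R -> 'rV[R]_d) (P : nat -> nat -> R).
Variables (c eta : R -> R -> R).
Hypothesis hd : (0 < d)%N.
Hypothesis hp : 2 < p < 3.
Hypothesis T0 : 0 <= T.
Local Notation A := (Defs.lift S P).
Hypothesis hr : rough_driver T p S A c eta.
Hypothesis B0 : 0 < B.
Hypothesis hB : forall t i, 0 <= t -> t <= T -> B^-1 <= S t 0 i <= B.
Variables (alpha : R) (K : {posnum R}).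
Local Notation M := (C2aK_borel d alpha K).
Variable m : probability M R.

Local Notation tau := (tau p c).
Local Notation E := (err p c eta).

Let F (j : M) : 'rV[R]_d -> 'rV[R]_d := val j.
Let hF j : twice_diff (F j) := ball_twice_diff j.
Let hK j : C2_le K%:num (F j) := ball_C2_le j.
Let sx t : 0 <= t -> t <= T -> simplex (mu S t).
Proof. exact: (mu_simplex hd B0 hB). Qed.

Definition phi_at t (j : M) k : R := phiF S F j t k.
Definition Psi_at t (j : M) k l : R := PsiF S F j t k l.
Definition V_at t (j : M) : R := VF S P F j t.

Lemma C2_le_coord (G : 'rV[R]_d -> 'rV[R]_d) e x i j : C2_le e G -> simplex x ->
  `|G x 0 i| <= e /\ `|D G x i j| <= e.
Proof. by move=> h sx'; have [h1 h2 _] := h x sx' i j j. Qed.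

Lemma rv_phi t k : 0 <= t -> t <= T -> bounded_rv (fun j => phi_at t j k).
Proof.
move=> t0 tT; split; last first.
  by exists K%:num => j; have [h _] := C2_le_coord k k (hK j) (sx t0 tT).
apply: (lipschitz_measurable ler01) => j j' e e0 h.
have [+ _] := C2_le_coord k k h (sx t0 tT).
by rewrite mul1r !mxE.
Qed.

Lemma rv_Psi t k l : 0 <= t -> t <= T -> bounded_rv (fun j => Psi_at t j k l).
Proof.
move=> t0 tT; split; last first.
  by exists K%:num => j; have [_ h] := C2_le_coord k l (hK j) (sx t0 tT).
apply: (lipschitz_measurable ler01) => j j' e e0 h.
have [_ +] := C2_le_coord k l h (sx t0 tT).
by rewrite mul1r (D_sub _ _ _ (hF j) (hF j')).
Qed.

Lemma log_wealth_lipschitz j j' e s t : C2_le e (F j - F j') ->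
  0 <= s -> s <= t -> t <= T ->
  `|(logVF S P F j t - logVF S P F j s) - (logVF S P F j' t - logVF S P F j' s)|
    <= @rate_cst R d p K%:num * e * rate p S P s t.
Proof.
move=> h s0 st tT; have [cv _] := logVF_sewing hd hp hr B0 hB hF hK.
exact: (log_difference hd hp T0 hr B0 hB (hF j) (hF j') (hK j) (hK j') h s0 st tT
  (cv j s t s0 st tT) (cv j' s t s0 st tT)).
Qed.

Opaque logVF.

Lemma rv_W t : 0 <= t -> t <= T -> bounded_rv (V_at t).
Proof.
move=> t0 tT; split; last first.
  have [C C0 H] := O_VF hd hp T0 hr B0 hB hF hK; exists C => j.
  by have := H (j, t, t) (And3 t0 (lexx t) tT); rewrite mulr1.
apply: (measurableT_comp (f := expR)) => //.
apply: (@lipschitz_measurable _ _ _ _ _ (`|@rate_cst R d p K%:num * rate p S P 0 t|)) => //.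
move=> j j' e e0 h; have g := log_wealth_lipschitz h (lexx 0) t0 tT.
have z := logVF0 hd hp T0 hr B0 hB hF hK.
have aux (a b a0 b0 x : R) : a0 = 0 -> b0 = 0 -> `|(a - a0) - (b - b0)| <= x ->
    `|a - b| <= x by move=> -> ->; rewrite !subr0.
apply: (aux _ _ _ _ _ (z j) (z j')); apply: (le_trans g).
rewrite mulrAC; apply: ler_wpM2r (ler_norm _); exact: ltW.
Qed.

Local Notation piF := (@piF R d S alpha K : M -> portfolios S alpha K).

Lemma nu_int_mean (f : portfolios S alpha K -> R) (g : M -> R) :
  (forall j, f (piF j) = g j) -> bounded_rv g -> nu_int m f = mean m g.
Proof.
move=> e hg; rewrite nu_intE; first by apply: eq_mean.
exact: eq_bounded_rv hg.
Qed.

Lemma V_piF t j : 0 <= t -> t <= T -> V P (piF j) t = V_at t j.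
Proof. exact: (rel_wealth_F hd hp T0 hr B0 hB hF hK j). Qed.

Lemma piF_value t j k : 0 <= t -> t <= T ->
  (piF j).1 t 0 k = gen_pi (S t) (phi_at t j) k.
Proof. by move=> t0 tT; have [h _] := generated_F hd B0 hB hF j t0 tT; exact: h. Qed.

Lemma piF_derivative t j k l : 0 <= t -> t <= T ->
  (to_S S (piF j)).2 t k l =
  \sum_i gen_dpi (S t) (phi_at t j) (Psi_at t j) k i * dnorm (S t) i l.
Proof. by move=> t0 tT; have [_ h] := generated_F hd B0 hB hF j t0 tT; exact: h. Qed.

Definition V_mean t : R := mean m (V_at t).

Lemma Z_lower : exists2 a, 0 < a & forall t, 0 <= t -> t <= T -> a <= V_mean t.
Proof.
have [a a0 H] := VF_lower hd hp T0 hr B0 hB hF hK; exists a => // t t0 tT.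
rewrite -(mean_cst m a); apply: mean_le; first exact: bounded_rv_cst.
  exact: rv_W.
by move=> j; exact: H.
Qed.

Lemma Z_neq0 t : 0 <= t -> t <= T -> V_mean t != 0.
Proof.
move=> t0 tT; have [a a0 H] := Z_lower; rewrite gt_eqF//.
exact: lt_le_trans a0 (H t t0 tT).
Qed.

Definition phi_mean t k : R := mix_phi m (V_at t) (phi_at t) k.
Definition Psi_mean t k l : R := mix_Psi m (V_at t) (phi_at t) (Psi_at t) k l.

Lemma V_at0 j : V_at 0 j = 1.
Proof. by rewrite /V_at /VF (logVF0 hd hp T0 hr B0 hB hF hK) expR0. Qed.

Lemma V_at_exp t j : V_at t j = expR (logVF S P F j t).
Proof. by []. Qed.

Lemma V_mean0 : V_mean 0 = 1.
Proof. by rewrite /V_mean (eq_mean m V_at0) mean_cst. Qed.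

Opaque phi_at Psi_at V_at.

Section AtTime.
Variable t : R.
Hypotheses (t0 : 0 <= t) (tT : t <= T).

Let hW := rv_W t0 tT.
Let hphi k := rv_phi k t0 tT.
Let hPsi k l := rv_Psi k l t0 tT.
Let Zn0 : mean m (V_at t) != 0 := Z_neq0 t0 tT.

Lemma pinu_denE : pinu_den S P m t = V_mean t.
Proof. by apply: nu_int_mean => // j; exact: V_piF. Qed.

Lemma pinu_numE k : pinu_num S P m t 0 k = V_mean t * gen_pi (S t) (phi_mean t) k.
Proof.
rewrite mxE -(wmean_gen_pi hW Zn0 (S t) hphi) -(wmeanE Zn0).
apply: nu_int_mean => [j|]; last by apply: bounded_rv_M => //; exact: bounded_rv_gen_pi.
by rewrite (V_piF j t0 tT) (piF_value j k t0 tT) mulrC.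
Qed.

Lemma V'_piF j l : V' P (piF j) t 0 l = V_at t j * \sum_b phi_at t j b * dnorm (S t) b l.
Proof.
have x0 : S t 0 l != 0 by rewrite gt_eqF// (price_gt0 B0 hB).
have s0 : \sum_k S t 0 k != 0 by rewrite gt_eqF// (total_gt0 hd B0 hB).
rewrite -(gen_pi_drift _ x0 s0) -(piF_value j l t0 tT) -(V_piF j t0 tT).
by rewrite /V' /rel_wealth' mxE.
Qed.

Lemma pinu_den'E l : pinu_den' S P m t 0 l =
  V_mean t * \sum_b phi_mean t b * dnorm (S t) b l.
Proof.
have hb b : bounded_rv (fun j => phi_at t j b * dnorm (S t) b l).
  by apply: bounded_rv_M => //; exact: bounded_rv_cst.
have -> : \sum_b phi_mean t b * dnorm (S t) b l =
    wmean m (V_at t) (fun j => \sum_b phi_at t j b * dnorm (S t) b l).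
  rewrite (wmean_sum hW Zn0)//; apply: eq_bigr => b _.
  rewrite mulrC /phi_mean /mix_phi -(wmean_Z m hW)//; apply: eq_wmean => j.
  by rewrite mulrC.
rewrite mxE -(wmeanE Zn0); apply: nu_int_mean => [j|]; first exact: V'_piF.
by apply: bounded_rv_M => //; exact: bounded_rv_sum.
Qed.

Let dpi k b j := gen_dpi (S t) (phi_at t j) (Psi_at t j) k b
  + gen_pi (S t) (phi_at t j) k * phi_at t j b.

Let hdpi k b : bounded_rv (dpi k b).
Proof.
apply: bounded_rv_D; first exact: bounded_rv_gen_dpi.
by apply: bounded_rv_M => //; exact: bounded_rv_gen_pi.
Qed.

Lemma pinu_num'E k l : pinu_num' S P m t k l =
  V_mean t * \sum_b wmean m (V_at t) (dpi k b) * dnorm (S t) b l.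
Proof.
have hb b : bounded_rv (fun j => dpi k b j * dnorm (S t) b l).
  by apply: bounded_rv_M => //; exact: bounded_rv_cst.
have -> : \sum_b wmean m (V_at t) (dpi k b) * dnorm (S t) b l =
    wmean m (V_at t) (fun j => \sum_b dpi k b j * dnorm (S t) b l).
  rewrite (wmean_sum hW Zn0)//; apply: eq_bigr => b _.
  rewrite mulrC -(wmean_Z m hW)//; apply: eq_wmean => j.
  by rewrite mulrC.
rewrite mxE -(wmeanE Zn0); apply: nu_int_mean => [j|]; last first.
  by apply: bounded_rv_M => //; exact: bounded_rv_sum.
rewrite (V'_piF j l) (V_piF j t0 tT) (piF_value j k t0 tT) (piF_derivative j k l t0 tT).
rewrite mulrC mulrCA -mulrDr; congr (_ * _); rewrite mulr_sumr -big_split/=.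
by apply: eq_bigr => b _; rewrite (mulrA (gen_pi _ _ _)) -mulrDl.
Qed.

(** The mixed portfolio is an average of portfolios with weights proportional to
    their wealths.  As [gen_pi] is affine in the field, the weighted average of
    the portfolios is the portfolio of the averaged field. *)
Lemma generated_pinu : generated S (pinu S P m) t (phi_mean t) (Psi_mean t).
Proof.
split=> [k|k l].
  by rewrite mxE pinu_denE pinu_numE mulKf.
have -> : (pinu S P m).2 t k l = (pinu_den S P m t)^-1 * pinu_num' S P m t k l
    - (pinu_den S P m t ^+ 2)^-1 * (pinu_num S P m t 0 k * pinu_den' S P m t 0 l).
  rewrite /pinu /= mxE; congr (_ + _); first by rewrite mxE.
  by rewrite mxE; congr (- _); rewrite mxE tensorE.
rewrite pinu_denE pinu_numE pinu_den'E pinu_num'E quotient_rule_alg//.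
by apply: eq_bigr => b _; rewrite -(wmean_gen_dpi hW Zn0 (S t) hphi hPsi).
Qed.

End AtTime.

Definition moment_mean t k l : R :=
  wmean m (V_at t) (fun j => Psi_at t j k l + phi_at t j k * phi_at t j l).

Lemma Psi_meanE t k l : Psi_mean t k l = moment_mean t k l - phi_mean t k * phi_mean t l.
Proof. by []. Qed.

Opaque V_mean phi_mean Psi_mean moment_mean.

Let hs : spans T (@pairs R unit T) (fun z => z.1.2) (fun z => z.2) := @pairs_spans _ T unit.
Let hsM : spans T (@pairs R M T) (fun z => z.1.2) (fun z => z.2) := @pairs_spans _ T M.

Let rv_Wphi t k : 0 <= t -> t <= T -> bounded_rv (fun j => V_at t j * phi_at t j k).
Proof. by move=> t0 tT; apply: bounded_rv_M; [exact: rv_W|exact: rv_phi]. Qed.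

Let rv_Q t k l : 0 <= t -> t <= T ->
  bounded_rv (fun j => Psi_at t j k l + phi_at t j k * phi_at t j l).
Proof.
move=> t0 tT; apply: bounded_rv_D; first exact: rv_Psi.
by apply: bounded_rv_M; exact: rv_phi.
Qed.

Let rv_WQ t k l : 0 <= t -> t <= T ->
  bounded_rv (fun j => V_at t j * (Psi_at t j k l + phi_at t j k * phi_at t j l)).
Proof. by move=> t0 tT; apply: bounded_rv_M; [exact: rv_W|exact: rv_Q]. Qed.

Lemma mean_Wphi t k : 0 <= t -> t <= T ->
  mean m (fun j => V_at t j * phi_at t j k) = V_mean t * phi_mean t k.
Proof. by move=> t0 tT; exact: (wmeanE (Z_neq0 t0 tT)). Qed.

Lemma mean_WQ t k l : 0 <= t -> t <= T ->
  mean m (fun j => V_at t j * (Psi_at t j k l + phi_at t j k * phi_at t j l)) = V_mean t * moment_mean t k l.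
Proof. by move=> t0 tT; exact: (wmeanE (Z_neq0 t0 tT)). Qed.

Lemma ctl_W : ctl p T S c (fun j t => V_at t j)
  (fun j t l => \sum_i V_at t j * phi_at t j i * dnorm (S t) i l).
Proof. exact: (ctl_VF hd hp T0 hr B0 hB hF hK). Qed.

Lemma ctl_phi k : ctl p T S c (fun j t => phi_at t j k)
  (fun j t l => \sum_i Psi_at t j k i * dnorm (S t) i l).
Proof. exact: (ctl_phiF hd hp hr B0 hB hF hK). Qed.

Lemma ctl_Z : ctl p T S c (fun (_ : unit) t => V_mean t)
  (fun _ t l => \sum_i V_mean t * phi_mean t i * dnorm (S t) i l).
Proof.
have rv t i l : 0 <= t -> t <= T ->
    bounded_rv (fun j => V_at t j * phi_at t j i * dnorm (S t) i l).
  by move=> t0 tT; apply: bounded_rv_M; [exact: rv_Wphi|exact: bounded_rv_cst].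
apply: eq_ctl (ctl_mean m ctl_W _ _) => [_ t _ _|_ t l t0 tT|t|t l t0 tT].
- by [].
- rewrite mean_sum; last by move=> i; exact: rv.
  apply: eq_bigr => i _; rewrite mean_Zr; last exact: rv_Wphi.
  by rewrite mean_Wphi.
- exact: rv_W.
by apply: bounded_rv_sum => i; exact: rv.
Qed.

Lemma ctl_ZPhi k : ctl p T S c (fun (_ : unit) t => V_mean t * phi_mean t k)
  (fun _ t l => \sum_i V_mean t * moment_mean t k i * dnorm (S t) i l).
Proof.
have E t j l : (\sum_i V_at t j * phi_at t j i * dnorm (S t) i l) * phi_at t j k
    + V_at t j * \sum_i Psi_at t j k i * dnorm (S t) i l =
    \sum_i V_at t j * (Psi_at t j k i + phi_at t j k * phi_at t j i) * dnorm (S t) i l.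
  by rewrite mulr_suml mulr_sumr -big_split/=; apply: eq_bigr => i _; ring.
have rv t i l : 0 <= t -> t <= T ->
    bounded_rv (fun j => V_at t j * (Psi_at t j k i + phi_at t j k * phi_at t j i) * dnorm (S t) i l).
  by move=> t0 tT; apply: bounded_rv_M; [exact: rv_WQ|exact: bounded_rv_cst].
apply: eq_ctl (ctl_mean m (ctl_M hp hr ctl_W (ctl_phi k)) _ _)
    => [_ t t0 tT|_ t l t0 tT|t t0 tT|t l t0 tT].
- by rewrite -mean_Wphi.
- rewrite (eq_mean m (fun j => E t j l)) mean_sum; last by move=> i; exact: rv.
  apply: eq_bigr => i _; rewrite mean_Zr; last exact: rv_WQ.
  by rewrite mean_WQ.
- exact: rv_Wphi.
apply: (eq_bounded_rv (fun j => E t j l)).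
by apply: bounded_rv_sum => i; exact: rv.
Qed.

Let O_Zinv : bO (@pairs R unit T) (fun z => (V_mean z.1.2)^-1) (fun=> 1).
Proof.
have [a a0 H] := Z_lower; exists a^-1 => [|z [z0 zz zT]]; first by rewrite invr_ge0 ltW.
have Za := H _ z0 (le_trans zz zT).
have V_mean0 := lt_le_trans a0 Za.
by rewrite mulr1 ger0_norm ?invr_ge0 ?(ltW V_mean0)// lef_pV2.
Qed.

Lemma ctl_Phi k : ctl p T S c (fun (_ : unit) t => phi_mean t k)
  (fun _ t l => \sum_i Psi_mean t k i * dnorm (S t) i l).
Proof.
have iv := ctl_V hp hr ctl_Z (fun _ => @Z_neq0) O_Zinv.
apply: eq_ctl (ctl_M hp hr (ctl_ZPhi k) iv) => [_ t t0 tT|_ t l t0 tT].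
  by have := Z_neq0 t0 tT => z0; field.
have z0 := Z_neq0 t0 tT.
rewrite mulr_suml !mulr_sumr -big_split/=; apply: eq_bigr => i _.
by rewrite Psi_meanE; field.
Qed.

Let O_Phi k : bO (@pairs R unit T) (fun z => phi_mean z.1.2 k) (fun=> 1).
Proof. by have [h _ _ _] := ctl_Phi k. Qed.

Let reg_W : reg p T c eta (fun (j : M) t => V_at t j).
Proof.
have [h _ _ _] := ctl_W; split => //.
have O1 := O_VF hd hp T0 hr B0 hB hF hK.
have gk k : bO (@pairs R M T) (fun z => V_at z.1.2 z.1.1 * phi_at z.1.2 z.1.1 k) (fun=> 1).
  by apply: bO_Ml => //; exact: (O_phiF hd B0 hB hK (fun z => z.1.1) hsM).
have gq k l : bO (@pairs R M T) (fun z => V_at z.1.2 z.1.1 * (Psi_at z.1.2 z.1.1 k l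
    + phi_at z.1.2 z.1.1 k * phi_at z.1.2 z.1.1 l)) (fun=> 1).
  apply: bO_Ml => //; apply: bO_D.
    exact: (O_PsiF hd B0 hB hK (fun z => z.1.1) hsM).
  by apply: bO_Ml; exact: (O_phiF hd B0 hB hK (fun z => z.1.1) hsM).
have h1 := bO_err_gauge hr (VF_expand hd hp T0 hr B0 hB hF hK).
have h2 := bO_eta_gauge p c (O_dlin hd hp hr B0 hB hsM gk).
have h3 := gauge2_le hp hr hsM (O_area_sum hd hp hr B0 hB hsM gq).
by apply: (eq_bO _ (bO_D h1 (bO_D h2 h3))) => z _; rewrite /dlin subrK.
Qed.

Local Notation reg := (reg p T c eta).

Let reg_phi k : reg (fun (j : M) t => phi_at t j k).
Proof.
split; first by have [h _ _ _] := ctl_phi k.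
by apply: bO_eta_gauge; exact: (O_dphiF hd hp hr B0 hB hF hK (fun z => z.1.1) hsM).
Qed.

Let reg_Psi k l : reg (fun (j : M) t => Psi_at t j k l).
Proof.
split; first exact: (O_PsiF hd B0 hB hK (fun z => z.1.1) hsM).
by apply: bO_eta_gauge; exact: (O_dPsiF hd hp hr B0 hB hF hK (fun z => z.1.1) hsM).
Qed.

Let reg_mu k : reg (fun (_ : unit) t => mu S t 0 k).
Proof.
split; first exact: (O_mu hd B0 hB (spans_l hs)).
by apply: bO_eta_gauge; exact: (O_dmu hd hp hr B0 hB hs).
Qed.

Let reg_dnorm k l : reg (fun (_ : unit) t => dnorm (S t) k l).
Proof.
split; first exact: (O_dnorm hd B0 hB (spans_l hs)).
by apply: bO_eta_gauge; exact: (O_ddnorm hd hp hr B0 hB hs).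
Qed.

Let reg_Zinv : reg (fun (_ : unit) t => (V_mean t)^-1).
Proof.
have h : reg (fun (_ : unit) t => V_mean t) := reg_mean m reg_W rv_W.
exact: (reg_V h (fun _ => @Z_neq0) O_Zinv).
Qed.

Let reg_Phi k : reg (fun (_ : unit) t => phi_mean t k).
Proof.
have h := reg_mean m (reg_M reg_W (reg_phi k)) (fun t => @rv_Wphi t k).
apply: eq_reg (reg_M h reg_Zinv) => _ t t0 tT.
have z0 := Z_neq0 t0 tT; rewrite (mean_Wphi k t0 tT).
by rewrite mulrC mulKf.
Qed.

Let reg_PsiM k l : reg (fun (_ : unit) t => Psi_mean t k l).
Proof.
have h1 := reg_M reg_W (reg_D (reg_Psi k l) (reg_M (reg_phi k) (reg_phi l))).
have h2 := reg_M (reg_mean m h1 (fun t => @rv_WQ t k l)) reg_Zinv.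
apply: eq_reg (reg_D h2 (reg_N (reg_M (reg_Phi k) (reg_Phi l)))) => _ t t0 tT.
have z0 := Z_neq0 t0 tT; rewrite Psi_meanE (mean_WQ k l t0 tT).
by rewrite (mulrC (V_mean t)) mulfK.
Qed.

Let reg_avg (f : R -> 'I_d -> R) : (forall k, reg (fun (_ : unit) t => f t k)) ->
  reg (fun (_ : unit) t => \sum_k normalize (S t) 0 k * f t k).
Proof. by move=> h; apply: (reg_sum) => k; exact: (reg_M (reg_mu k) (h k)). Qed.

Let reg_B (x y : unit -> R -> R) : reg x -> reg y -> reg (fun j t => x j t - y j t).
Proof. by move=> hx hy; exact: (reg_D hx (reg_N hy)). Qed.

Let reg_pinu1 k : reg (fun (_ : unit) t => (pinu S P m).1 t 0 k).
Proof.
apply: (eq_reg (y := fun _ t => gen_pi (S t) (phi_mean t) k)) => [_ t t0 tT|].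
  by have [h _] := generated_pinu t0 tT; exact: h.
apply: (reg_M (reg_mu k)); apply: reg_B; last exact: reg_avg.
exact: (reg_D (reg_Phi k) (reg_cst p T c eta 1)).
Qed.

Let reg_pinu2 k l : reg (fun (_ : unit) t => (pinu S P m).2 t k l).
Proof.
apply: (eq_reg (y := fun _ t =>
    \sum_i gen_dpi (S t) (phi_mean t) (Psi_mean t) k i * dnorm (S t) i l)) => [_ t t0 tT|].
  by have [_ h] := generated_pinu t0 tT; exact: h.
apply: (reg_sum) => i; apply: reg_M (reg_dnorm i l); apply: reg_D.
  apply: (reg_M (reg_cst p T c eta _)); apply: reg_B; last exact: reg_avg.
  exact: (reg_D (reg_Phi k) (reg_cst p T c eta 1)).
apply: (reg_M (reg_mu k)); apply: reg_B; first exact: reg_B.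
exact: (reg_avg (f := fun t j => Psi_mean t j i)).
Qed.

Lemma ctl_pinu k : ctl p T S c (fun (_ : unit) t => (pinu S P m).1 t 0 k)
  (fun _ t l => (pinu S P m).2 t k l).
Proof.
apply: eq_ctl (ctl_gen_pi hd hp hr B0 hB ctl_Phi k) => [_ t t0 tT|_ t l t0 tT].
  by have [h _] := generated_pinu t0 tT; exact: h.
by have [_ h] := generated_pinu t0 tT; exact: h.
Qed.

Lemma controlled_pinu q r : p <= q -> p / 2 <= r -> controlled q r T S (pinu S P m).
Proof.
move=> pq pr; have p0 : 0 < p by case/andP: hp => h _; exact: lt_trans h.
apply: (ctl_controlled hp _ _ pq pr T0 hr) => //.
- exact: lt_le_trans pq.
- by apply: lt_le_trans pr; rewrite divr_gt0.
- exact: ctl_pinu.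
Qed.

Lemma pinu_total t : 0 <= t -> t <= T -> \sum_i (pinu S P m).1 t 0 i = 1.
Proof.
move=> t0 tT; have [h _] := generated_pinu t0 tT.
have [_ s1] := sx t0 tT; have {}s1 : \sum_i normalize (S t) 0 i = 1 by exact: s1.
under eq_bigr do rewrite h /gen_pi mulrBr mulrDr mulr1.
rewrite sumrB big_split/= s1 -mulr_suml s1 mul1r.
by rewrite addrAC subrr add0r.
Qed.

(** Averaging the increments of the individual wealths gives those of their
    average, in which only the mixtures [phi_mean] and [moment_mean] appear. *)
Lemma Z_expand : bO (@pairs R unit T) (fun z => V_mean z.2 - V_mean z.1.2
    - (\sum_k V_mean z.1.2 * phi_mean z.1.2 k * (mu S z.2 0 k - mu S z.1.2 0 k)
      + \sum_k \sum_l V_mean z.1.2 * moment_mean z.1.2 k l * Amu S P z.1.2 z.2 l k))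
  (fun z => E z.1.2 z.2).
Proof.
have rv1 s t k : 0 <= s -> s <= t -> t <= T ->
    bounded_rv (fun j => V_at s j * phi_at s j k * (mu S t 0 k - mu S s 0 k)).
  move=> s0 st tT; apply: bounded_rv_M; last exact: bounded_rv_cst.
  by apply: rv_Wphi => //; exact: le_trans tT.
have rv2 s t k l : 0 <= s -> s <= t -> t <= T ->
    bounded_rv (fun j => V_at s j * (Psi_at s j k l + phi_at s j k * phi_at s j l) * Amu S P s t l k).
  move=> s0 st tT; apply: bounded_rv_M; last exact: bounded_rv_cst.
  by apply: rv_WQ => //; exact: le_trans tT.
have rvS1 s t : 0 <= s -> s <= t -> t <= T ->
    bounded_rv (fun j => \sum_k V_at s j * phi_at s j k * (mu S t 0 k - mu S s 0 k)).
  by move=> s0 st tT; apply: bounded_rv_sum => k; exact: rv1.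
have rvS2 s t : 0 <= s -> s <= t -> t <= T ->
    bounded_rv (fun j => \sum_k \sum_l
      V_at s j * (Psi_at s j k l + phi_at s j k * phi_at s j l) * Amu S P s t l k).
  by move=> s0 st tT; apply: bounded_rv_sum => k; apply: bounded_rv_sum => l; exact: rv2.
have rvW s t : 0 <= s -> s <= t -> t <= T -> bounded_rv (fun j => V_at t j - V_at s j).
  move=> s0 st tT.
  by apply: bounded_rv_B; apply: rv_W => //; [exact: le_trans st|exact: le_trans tT].
apply: (eq_bO _ (bO_mean m (g := E) (VF_expand hd hp T0 hr B0 hB hF hK) _))
    => [z [z0 zz zT]|s t s0 st tT] /=; last first.
  apply: bounded_rv_B; first exact: rvW.
  by apply: bounded_rv_D; [exact: rvS1|exact: rvS2].
have zT' := le_trans zz zT; have z0' := le_trans z0 zz.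
rewrite mean_B; last 2 first.
- exact: rvW.
- by apply: bounded_rv_D; [exact: rvS1|exact: rvS2].
rewrite mean_B; last 2 first.
- exact: rv_W.
- exact: rv_W.
congr (_ - _ - _); rewrite mean_D; last 2 first.
- exact: rvS1.
- exact: rvS2.
congr (_ + _).
  rewrite mean_sum; last by move=> k; exact: rv1.
  apply: eq_bigr => k _; rewrite mean_Zr; last exact: rv_Wphi.
  by congr (_ * _); rewrite -mean_Wphi.
rewrite mean_sum; last by move=> k; apply: bounded_rv_sum => l; exact: rv2.
apply: eq_bigr => k _; rewrite mean_sum; last by move=> l; exact: rv2.
apply: eq_bigr => l _; rewrite mean_Zr; last exact: rv_WQ.
by congr (_ * _); rewrite -mean_WQ.
Qed.

(** Dividing [Z_expand] by the current average turns the averages into weighted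
    ones, and taking logarithms subtracts the bracket of the averaged field. *)
Lemma log_Z_expand : bO (@pairs R unit T) (fun z => ln (V_mean z.2) - ln (V_mean z.1.2)
    - dlogV S P (phi_mean z.1.2) (Psi_mean z.1.2) z.1.2 z.2) (fun z => E z.1.2 z.2).
Proof.
have [a a0 Za] := Z_lower.
have [[C C0 ZC] _ _ _] := ctl_Z.
have Cb t : 0 <= t -> t <= T -> V_mean t <= C.
  move=> t0 tT; have := ZC (tt, t, t) (And3 t0 (lexx t) tT); rewrite mulr1.
  exact: le_trans (ler_norm _).
have O_PsiM k l : bO (@pairs R unit T) (fun z => Psi_mean z.1.2 k l) (fun=> 1).
  by have [h _] := reg_PsiM k l.
have h : bO (@pairs R unit T) (fun z => (V_mean z.2 / V_mean z.1.2 - 1)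
    - dlin S (fun z => z.1.2) (fun z => z.2) (fun z => phi_mean z.1.2) z
    - \sum_k \sum_l (Psi_mean z.1.2 k l + phi_mean z.1.2 k * phi_mean z.1.2 l)
        * Amu S P z.1.2 z.2 l k) (fun z => E z.1.2 z.2).
  apply: (eq_bO _ (bO_Ml O_Zinv Z_expand)) => z [z0 zz zT].
  have zn := Z_neq0 z0 (le_trans zz zT).
  rewrite /dlin.
  have -> : \sum_k \sum_l (Psi_mean z.1.2 k l + phi_mean z.1.2 k * phi_mean z.1.2 l) * Amu S P z.1.2 z.2 l k
      = (V_mean z.1.2)^-1 * \sum_k \sum_l V_mean z.1.2 * moment_mean z.1.2 k l * Amu S P z.1.2 z.2 l k.
    rewrite mulr_sumr; apply: eq_bigr => k _; rewrite mulr_sumr; apply: eq_bigr => l _.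
    by rewrite Psi_meanE subrK -mulrA mulKf.
  have -> : \sum_k phi_mean z.1.2 k * (mu S z.2 0 k - mu S z.1.2 0 k)
      = (V_mean z.1.2)^-1 * \sum_k V_mean z.1.2 * phi_mean z.1.2 k * (mu S z.2 0 k - mu S z.1.2 0 k).
    by rewrite mulr_sumr; apply: eq_bigr => k _; rewrite -mulrA mulKf.
  set x := \sum_k _; set y := \sum_k _.
  by move: (V_mean z.2) (V_mean z.1.2) zn x y => u v vn x y; field.
have := log_expand hd hp hr B0 hB hs O_Phi O_PsiM (a := a / C) (b := C / a) _ _ h.
move=> g; apply: (eq_bO _ (g _ _)) => [z [z0 zz zT]||z [z0 zz zT]].
- congr (_ - _); apply: ln_ratio; [have h1 := Za _ z0 (le_trans zz zT)|
    have h1 := Za _ (le_trans z0 zz) zT]; exact: lt_le_trans a0 h1.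
- exact: (divr_gt0 a0 (lt_le_trans a0 (le_trans (Za 0 (lexx 0) T0) (Cb 0 (lexx 0) T0)))).
exact: (ratio_bounds a0 (Za _ z0 (le_trans zz zT)) (Cb _ z0 (le_trans zz zT))
  (Za _ (le_trans z0 zz) zT) (Cb _ (le_trans z0 zz) zT)).
Qed.

(** By [generated_pinu] and [ito_local] the logarithmic wealth of the mixed
    portfolio has the local increments [dlogV] of the averaged field, and by
    [log_Z_expand] so has the logarithm of the average wealth. *)
Lemma rel_wealth_pinu t : 0 <= t -> t <= T -> rel_wealth S P (pinu S P m) t = V_mean t.
Proof.
move=> t0 tT; rewrite /rel_wealth (wealth_cmu hd hp hr B0 hB t0 tT).
have Zpos u : 0 <= u -> u <= T -> 0 < V_mean u.
  by move=> u0 uT; have [a a0 H] := Z_lower; exact: lt_le_trans a0 (H u u0 uT).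
have O_PsiM k l : bO (@pairs R unit T) (fun z => Psi_mean z.1.2 k l) (fun=> 1).
  by have [h _] := reg_PsiM k l.
have hL : bO (@pairs R unit T) (fun z => (ln (V_mean z.2) + ln (total S z.2))
    - (ln (V_mean z.1.2) + ln (total S z.1.2)) - log_summand S P (pinu S P m) z.1.2 z.2)
    (fun z => E z.1.2 z.2).
  have h1 := @ito_local _ _ p T B S P c eta hd hp hr B0 hB _ (@pairs R unit T)
    (fun z => z.1.2) (fun z => z.2) (fun=> pinu S P m)
    (fun z => phi_mean z.1.2) (fun z => Psi_mean z.1.2) hs _ O_Phi O_PsiM.
  have {}h1 := h1 (fun z Dz => generated_pinu (proj1 (spans_l hs Dz)) (proj2 (spans_l hs Dz))).
  by apply: (eq_bO _ (bO_B log_Z_expand h1)) => z _; exact: log_split.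
have hk := ctl_ratio hp hr B0 hB (pi := fun (_ : unit) => pinu S P m) ctl_pinu.
have w : wealth S P (pinu S P m) t = expR ((ln (V_mean t) + ln (total S t))
    - (ln (V_mean 0) + ln (total S 0))).
  exact: (wealth_exp hp hr (L := fun t => ln (V_mean t) + ln (total S t)) hk hL t0 tT).
rewrite w.
rewrite V_mean0 ln1 add0r -expRN -expRD opprB addrA subrK addrK.
exact: (lnK (Zpos t t0 tT)).
Qed.

End Mixture.

(** * Regret *)

(** The average wealth is at least the contribution of the set [U j] around a
    nearly optimal [j], on which the wealth is within a factor [expR x] of the
    optimum. *)
Lemma regret_bounds {R : realType} {dd : measure_display} {M : measurableType dd}
    (m : probability M R) (w : M -> R) (k x : R) (U : M -> set M) (F0 : M) :
  bounded_rv w -> (forall j, 0 < w j) -> 0 < k ->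
  (forall j, measurable (U j)) -> (forall j, k <= fine (m (U j))) ->
  (forall j i, U j i -> ln (w j) - ln (w i) <= x) ->
  0 <= ln (sup (range w)) - ln (mean m w) <= x - ln k.
Proof.
move=> hw w0 k0 mU kU hx; have [_ [C hC]] := hw.
have key j : w j * expR (- x) * k <= mean m w.
  apply: (@le_trans _ _ (w j * expR (- x) * fine (m (U j)))).
    by rewrite ler_wpM2l// mulr_ge0 ?expR_ge0// ltW.
  apply: mean_ge_indic => //.
  - by rewrite mulr_ge0 ?expR_ge0// ltW.
  - by move=> i; exact: ltW.
  move=> i /hx h; rewrite -{1}(lnK (x := w j)) ?posrE// -expRD.
  by rewrite -(lnK (x := w i)) ?posrE// ler_expR; move: h; lra.
have V_mean0 : 0 < mean m w.
  by apply: lt_le_trans (key F0); rewrite !mulr_gt0// expR_gt0.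
have ub : has_ubound (range w).
  by exists C => _ [j _ <-]; exact: le_trans (ler_norm _) (hC j).
have n0 : range w !=set0 by exists (w F0); exists F0.
have ws j : w j <= sup (range w) by apply: ub_le_sup => //; exists j.
have s0 : 0 < sup (range w) := lt_le_trans (w0 F0) (ws F0).
apply/andP; split.
  rewrite subr_ge0 ler_ln ?posrE// -(mean_cst m (sup _)).
  by apply: mean_le => //; exact: bounded_rv_cst.
have e0 := expR_gt0 (- x).
have sle : sup (range w) <= mean m w / (expR (- x) * k).
  apply: ge_sup => // _ [j _ <-]; rewrite ler_pdivlMr ?mulr_gt0//.
  by rewrite mulrA; exact: key.
move: sle; rewrite -ler_ln ?posrE ?divr_gt0 ?mulr_gt0//.
rewrite ln_div ?posrE ?mulr_gt0// lnM ?posrE// expRK; lra.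
Qed.

(** The constant [k] depends on [e] but not on [t], so that it is negligible
    against [a t]; [e] is then arbitrary. *)
Lemma sublinear_limit {R : realType} (f a : R -> R) (C : R) : 0 <= C ->
  (forall e, 0 < e -> exists k : R, forall t, 0 < t -> 0 <= f t <= C * e * a t + k) ->
  a t @[t --> +oo] --> +oo -> (a t)^-1 * f t @[t --> +oo] --> 0.
Proof.
move=> C0 H ha; apply/cvgrPdist_le => e e0.
have C1 : 0 < C + 1 by rewrite ltr_pwDr.
(* One half of [e] is for the rate and the other for the constant; [C] may
   vanish. *)
pose e1 := e / 2 / (C + 1).
have e10 : 0 < e1 by rewrite !divr_gt0.
have [k Hk] := H e1 e10.
near=> t.
have t0 : 0 < t by near: t; exact: nbhs_pinfty_gt.
have a1 : 1 <= a t by near: t; move/cvgryPge: ha; exact.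
have ak : 2 * `|k| / e <= a t by near: t; move/cvgryPge: ha; exact.
have a0 : 0 < a t by exact: lt_le_trans a1.
have /andP[f0 f1] := Hk t t0.
have g0 : 0 <= (a t)^-1 * f t by rewrite mulr_ge0// invr_ge0 ltW.
rewrite sub0r normrN (ger0_norm g0) mulrC ler_pdivrMr//.
apply: le_trans f1 _.
have h1 : C * e1 * a t <= e / 2 * a t.
  apply: ler_wpM2r; first exact: ltW.
  rewrite /e1 mulrA ler_pdivrMr// [leRHS]mulrC; apply: ler_wpM2r.
    by rewrite divr_ge0// ltW.
  by rewrite lerDl.
have h2 : k <= e / 2 * a t.
  apply: le_trans (ler_norm k) _; move: ak; rewrite ler_pdivrMr//; lra.
have -> : e * a t = e / 2 * a t + e / 2 * a t by lra.
exact: lerD.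
Unshelve. all: by end_near. Qed.

Lemma start_at_zero {R : realType} (x a y b z : R) : a = 0 -> b = 0 ->
  (x - a) - (y - b) <= z -> x - y <= z.
Proof. by move=> -> ->; rewrite !subr0. Qed.

Lemma chain_base {R : realType} (x y c u : R) : x = 0 -> y = 0 -> u = 0 ->
  x - y <= c * u.
Proof. by move=> -> -> ->; rewrite subr0 mulr0. Qed.

Lemma chain_le {R : realType} (x x' y y' c u v w : R) : x - x' <= c * u ->
  (y - x) - (y' - x') <= v -> v <= c * w -> y - y' <= c * (u + w).
Proof. by rewrite mulrDr; lra. Qed.

Lemma rate_cst_ge0 {R : realType} (d : nat) (p K : R) : 2 < p < 3 -> 0 <= K ->
  0 <= @rate_cst R d p K.
Proof.
case/andP=> p2 p3 K0; have p0 : 0 < p by exact: lt_trans p2.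
have th : 1 < 3 / p by rewrite ltr_pdivlMr// mul1r.
have d0 n : (0 : R) <= d%:R ^+ n by exact: exprn_ge0.
exact: (addr_ge0 (addr_ge0 (mulr_ge0 (mulr_ge0 (d0 3) (young_cst_ge0 th))
  (powR_ge0 _ _)) (d0 2)) (mulr_ge0 (d0 2) K0)).
Qed.

Section Regret.
Context {R : realType} {d : nat}.
Variables (p : R) (S : R -> 'rV[R]_d) (P : nat -> nat -> R).
Hypothesis hd : (0 < d)%N.
Hypothesis hp : 2 < p < 3.
Hypothesis hS : price_path p S P.
Variables (alpha : R) (K : {posnum R}).
Local Notation M := (C2aK_borel d alpha K).
Variable m : probability M R.
Hypothesis alpha0 : 0 < alpha.
Hypothesis hm : full_support m.

Local Notation rate := (rate p S P).
Local Notation C := (@rate_cst R d p K%:num).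
Local Notation L t j := (ln (V_at S P t j)).

Let horizon T : 0 < T -> exists B c eta,
  [/\ rough_driver T p S (Defs.lift S P) c eta, 0 < B &
      forall t i, 0 <= t -> t <= T -> B^-1 <= S t 0 i <= B].
Proof.
move=> T0; have [B B0 hB] := price_bounds hS (ltW T0).
by have [c [eta hr]] := price_rough_driver hp hS hd T0; exists B, c, eta.
Qed.

Let rate_mono s u v t : 0 <= s -> s <= u -> u <= v -> v <= t -> 0 < t ->
  0 <= rate u v /\ rate u v <= rate s t.
Proof.
move=> s0 su uv vt t0; have [B [c [eta [hr B0 hB]]]] := horizon t0; split.
  exact: (rate_ge0 hd hp hr B0 hB (le_trans s0 su) uv vt).
exact: (rate_mono hd hp hr B0 hB s0 su uv vt (lexx t)).
Qed.

Let ln_W t (j : M) : L t j = logVF S P (fun j : M => val j) j t.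
Proof. by rewrite V_at_exp expRK. Qed.

Let L_lipschitz (j j' : M) e s t : C2_le e (val j - val j') ->
  0 <= s -> s <= t -> 0 < t ->
  (L t j - L s j) - (L t j' - L s j') <= C * e * rate s t.
Proof.
move=> h s0 st t0; have [B [c [eta [hr B0 hB]]]] := horizon t0.
have aux (a b u v a' b' u' v' x : R) : a = a' -> b = b' -> u = u' -> v = v' ->
    `|(a' - b') - (u' - v')| <= x -> (a - b) - (u - v) <= x.
  by move=> -> -> -> ->; exact: le_trans (ler_norm _).
exact: (aux _ _ _ _ _ _ _ _ _ (ln_W t j) (ln_W s j) (ln_W t j') (ln_W s j')
  (log_wealth_lipschitz hd hp (ltW t0) hr B0 hB h s0 st (lexx t))).
Qed.

Let L0 (j : M) : L 0 j = 0.
Proof.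
have [B [c [eta [hr B0 hB]]]] := horizon ltr01.
by rewrite (V_at0 hd hp ler01 hr B0 hB) ln1.
Qed.

Definition regret T : R := ln (Vstar S P alpha K T) - ln (rel_wealth S P (pinu S P m) T).

Lemma regret_le (rho : R -> R) :
  (forall (j j' : M) e T, 0 < e -> C2_le e (val j - val j') -> 0 < T ->
     L T j - L T j' <= C * e * rho T) ->
  forall e, 0 < e -> exists k, forall T, 0 < T -> 0 <= regret T <= C * e * rho T + k.
Proof.
move=> H e e0; have [k k0 HU] := ball_mass alpha0 hm e0.
have /choice[U {}HU] := HU.
exists (- ln k) => T T0; have [B [c [eta [hr B0 hB]]]] := horizon T0.
have T0' := ltW T0.
rewrite /regret (rel_wealth_pinu hd hp T0' hr B0 hB m T0' (lexx T)).
rewrite /Vstar (_ : (fun F => _) = V_at S P T); last first.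
  by apply/funext => j; exact: (V_piF hd hp T0' hr B0 hB j T0' (lexx T)).
apply: (@regret_bounds _ _ _ m (V_at S P T) k (C * e * rho T) U point) => //.
- exact: (rv_W hd hp T0' hr B0 hB).
- by move=> j; rewrite V_at_exp expR_gt0.
- by move=> j; have [h _ _] := HU j.
- by move=> j; have [_ h _] := HU j.
by move=> j i Uji; apply: H => //; have [_ _ h] := HU j; exact: h.
Qed.

Lemma regret_rate e : 0 < e ->
  exists k, forall T, 0 < T -> 0 <= regret T <= C * e * rate 0 T + k.
Proof.
apply: (regret_le (rho := rate 0)) => j j' e' T e0 h T0.
exact: (start_at_zero (L0 j) (L0 j') (L_lipschitz h (lexx 0) (ltW T0) T0)).
Qed.

Definition unit_rate (T : R) : R := \sum_(0 <= k < `|Num.ceil T|%N) rate k%:R k.+1%:R.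

(** On each unit interval the logarithmic wealths differ by at most [C * e] times
    the rate of that interval; the incomplete last one is completed by
    monotonicity of the rate. *)
Lemma regret_unit_rate e : 0 < e ->
  exists k, forall T, 0 < T -> 0 <= regret T <= C * e * unit_rate T + k.
Proof.
apply: regret_le => j j' e' T e0 h T0.
have K0 : 0 <= K%:num by [].
have Ce : 0 <= C * e' := mulr_ge0 (rate_cst_ge0 d hp K0) (ltW e0).
have step (n : nat) : L n%:R j - L n%:R j' <=
    C * e' * \sum_(0 <= k < n) rate k%:R k.+1%:R.
  elim: n => [|n IH].
    by apply: (chain_base _ (L0 j) (L0 j')); exact: big_geq.
  have n1 : (n%:R : R) <= n.+1%:R by rewrite ler_nat.
  have n0 : (0 : R) < n.+1%:R by rewrite ltr0n.
  rewrite big_nat_recr//=.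
  exact: (chain_le IH (L_lipschitz h (ler0n R n) n1 n0) (lexx _)).
have c0 : (0 <= Num.ceil T)%R by rewrite ceil_ge0; apply: lt_trans T0; rewrite ltrN10.
have cE : Num.ceil T = `|Num.ceil T|%N%:Z by rewrite gez0_abs.
(* [n] is the beginning of the last, possibly incomplete, unit interval. *)
rewrite /unit_rate; case nE : `|Num.ceil T|%N cE => [|n] cE.
  have := ceil_ge T; rewrite cE => h0.
  by move: T0; rewrite ltNge h0.
have Tn : T <= n.+1%:R by have := ceil_ge T; rewrite cE.
have nT : n%:R <= T.
  apply: ltW; have := ceil_itv T; rewrite cE => /andP[+ _].
  by rewrite (_ : n.+1%:Z - 1 = n%:Z)// -addn1 PoszD addrK.
have n0 : (0 : R) < n.+1%:R by rewrite ltr0n.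
have [_ rm] := rate_mono (ler0n R n) (lexx _) nT Tn n0.
rewrite big_nat_recr//=.
exact: (chain_le (step n) (L_lipschitz h (ler0n R n) nT T0) (ler_wpM2l Ce rm)).
Qed.

Lemma portfolio_pinu q r : p <= q -> p / 2 <= r -> portfolio S q r (pinu S P m).
Proof.
move=> pq pr; split=> [T T0|t t0].
  have [B [c [eta [hr B0 hB]]]] := horizon T0.
  exact: (controlled_pinu hd hp (ltW T0) hr B0 hB m pq pr).
have T0 : 0 < t + 1 by rewrite ltr_pwDr.
have [B [c [eta [hr B0 hB]]]] := horizon T0.
have tT : t <= t + 1 by rewrite lerDl.
exact: (pinu_total hd hp (ltW T0) hr B0 hB m t0 tT).
Qed.

End Regret.

Theorem theorem4p12 (R : realType) (d : nat) (p q r : R)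
  (S : R -> 'rV[R]_d) (P : nat -> nat -> R)
  (alpha : R) (K : {posnum R}) (m : probability (C2aK_borel d alpha K) R)
  (hd : (0 < d)%N)
  (hp : 2 < p < 3) (hq : p <= q) (hr : 1 < r)
  (hpq : 1 < 2 / p + 1 / q) (hpqr : 1 / r = 1 / p + 1 / q)
  (hS : price_path p S P)
  (halpha : 0 < alpha <= 1)
  (hm : full_support m) :
  let pi_nu := pinu S P m in
  let regret (T : R) := ln (Vstar S P alpha K T) - ln (rel_wealth S P pi_nu T) in
  let a s t := (1 + mu_norm S p s t ^+ 2) * xi S P p s t in
  let b (T : R) := \sum_(0 <= k < `|Num.ceil T|%N) a k%:R k.+1%:R in
  [/\ portfolio S q r pi_nu,
      a 0 T @[T --> +oo] --> +oo ->
        (a 0 T)^-1 * regret T @[T --> +oo] --> 0 &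
      b T @[T --> +oo] --> +oo ->
        (b T)^-1 * regret T @[T --> +oo] --> 0].
Proof.
move=> pi_nu reg a b; case/andP: (halpha) => alpha0 _.
have p0 : 0 < p by case/andP: hp => p2 _; exact: lt_trans p2.
have q0 : 0 < q by exact: lt_le_trans hq.
have r0 : 0 < r by exact: lt_trans hr.
have K0 : 0 <= K%:num by [].
have C0 := rate_cst_ge0 d hp K0.
split.
- apply: (portfolio_pinu hd hp hS m) => //.
  have h : 1 / r <= 2 / p.
    rewrite hpqr (_ : 2 / p = 1 / p + 1 / p); last by field; rewrite gt_eqF.
    by rewrite lerD2l !div1r lef_pV2.
  move: h; rewrite ler_pdivrMr// mulrAC ler_pdivlMr// mul1r ler_pdivrMr// mulrC.
  by rewrite (mulrC r).
- exact: (sublinear_limit C0 (regret_rate hd hp hS alpha0 hm)).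
exact: (sublinear_limit C0 (regret_unit_rate hd hp hS alpha0 hm)).
Qed.
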